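(* Suppose that $\kappa>\kappa_c$, where $\kappa_c:=2\beta\sigma^2+4\sigma^4$. Then there is a curve $\mathcal{C}\subset D=\mathbb{R}\times[-1,1]$ that connects all three stationary points $(-\bar a,-\bar q)$, $(0,0)$, $(\bar a,\bar q)$ of the dynamical system $$\dot a=(\beta+2\sigma^2)a+\tfrac12\,\mathrm{sign}(a)\,a^2-\kappa q,\qquad \dot q=a-(2\sigma^2+|a|)q \qquad ( * )$$ and hits the boundary $\{q=\pm1\}$. It is given by the stable manifolds of the non-trivial stationary points $(\bar a,\bar q)$ and $(-\bar a,-\bar q)$ joining the origin. All discounted Nash equilibria (NE) are included in $\mathcal{C}$, so that for any $q\in[-1,1]$ there is at least one NE starting from $q$. Moreover: (A) If $\kappa<\kappa_c+\beta^2/4$, then $\mathcal{C}$ is a strictly monotone curve, so that there is a unique discounted NE starting from $q$, and when $q\neq0$ it converges to $\mathrm{sign}(q)\,\bar q$. (B) If $\kappa>\kappa_c+\beta^2/4$, then $\mathcal{C}$ spirals around the origin. In particular, for initial data $q$ close to the origin there exist many NE that spiral around the origin before converging to one of the self-organizing stationary Nash equilibria. However, for $|q|$ sufficiently large, there is a unique NE starting from $q$.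
   Context: Fix $\beta>0$ (discount factor), $\sigma^2>0$ (thermal noise) and $\kappa>0$ (interaction strength). Let $\mathcal{X}=\{0,1\}$, with running cost $\ell(0,p)=p$, $\ell(1,p)=1-p$ for $p\in[0,1]$. A probability measure on $\mathcal{X}$ is identified with the mass $p$ it gives to $1$, and we use the variable $q=2p-1\in[-1,1]$; a flow $q(\cdot)$ is called a Nash equilibrium if the flow $p(\cdot)=(q(\cdot)+1)/2$ is one, and it starts from $q$ if $q(0)=q$. $\mathcal{A}$ is the set of functions $\alpha:[0,\infty)\times\mathcal{X}\to[0,\infty)$ with $\alpha(\cdot,x)$ locally integrable. For $\alpha\in\mathcal{A}$, $X^{\alpha}$ is the continuous-time Markov chain on $\mathcal{X}$ with jump rate $\sigma^2+\alpha(t,0)$ from $0$ to $1$, jump rate $\sigma^2+\alpha(t,1)$ from $1$ to $0$, and $\mathbb{P}(X^{\alpha}_0=1)=p(0)$. A flow $t\mapsto p(t)\in[0,1]$ is a discounted (mean-field game) Nash equilibrium if there is $\alpha^*\in\mathcal{A}$ that minimizes $$J_\beta(\alpha)=\mathbb{E}\int_0^\infty e^{-\beta t}\Big(\tfrac12\alpha(t,X^{\alpha}_t)^2+\kappa\,\ell(X^{\alpha}_t,p(t))\Big)\,dt$$ over $\alpha\in\mathcal{A}$ and satisfies $p(t)=\mathbb{P}(X^{\alpha^*}_t=1)$ for all $t\ge0$. The discounted NE are exactly the $q$-components of the bounded solutions $(a(t),q(t))_{t\ge0}$ of $( * )$ in $D$; a NE is said to be included in $\mathcal{C}$, or to spiral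 around the origin, in terms of this solution $(a,q)$ in the phase space $D$. A stationary Nash equilibrium is one that is constant in time. For $\kappa>\kappa_c$ these are $q=0$ (the uniform distribution) and the two self-organizing ones $q=\pm\bar q$, where $$\bar a=-(\beta+3\sigma^2)+\sqrt{(\beta+3\sigma^2)^2+2(\kappa-\kappa_c)}>0,\qquad \bar q=\frac{\bar a}{\bar a+2\sigma^2}.$$ The stable manifold of a stationary point of $( * )$ is the set of points of $D$ whose forward trajectory converges to that point. *)

(* Defs.v *)
From HB Require Import structures.
From mathcomp Require Import all_boot all_order all_algebra.
From mathcomp Require Import all_classical all_reals all_analysis.
Set Implicit Arguments.
Unset Strict Implicit.
Unset Printing Implicit Defensive.
Import Order.TTheory GRing.Theory Num.Theory.
Import numFieldNormedType.Exports.
Local Open Scope classical_set_scope.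
Local Open Scope ring_scope.

(* Functions of time t >= 0 are total functions on R of
   which only the restriction to [0, +oo[ is meaningful.  The state space
   {0, 1} is bool, with true standing for 1. *)

Section Game.
Context {R : realType}.
Implicit Types (beta sigma kappa : R) (p q : R -> R) (alpha : R -> bool -> R).

Definition running_cost (x : bool) (m : R) : R := if x then 1 - m else m.

Definition admissible alpha : Prop :=
  forall x : bool,
    (forall t, 0 <= t -> 0 <= alpha t x) /\
    (forall T, 0 <= T ->
      (@lebesgue_measure R).-integrable `[0, T] (fun t => (alpha t x)%:E)).

(* The rate at which a chain controlled by alpha leaves x at time t. *)
Definition jump_rate sigma alpha (t : R) (x : bool) : R :=
  sigma ^+ 2 + alpha t x.

(* tr s t x y is the probability of being in y at time t when in x at time s.
   The rates are only locally integrable, so Kolmogorov's forward equation is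
   written in integral form; continuity in t makes the integrand measurable. *)
Definition transition_function (rate : R -> bool -> R)
    (tr : R -> R -> bool -> bool -> R) : Prop :=
  forall (s : R) (x : bool), 0 <= s ->
  [/\ forall t y, s <= t -> 0 <= tr s t x y,
      forall t, s <= t -> tr s t x false + tr s t x true = 1,
      forall y, {within `[s, +oo[, continuous (fun t => tr s t x y)} &
      forall t y, s <= t ->
        tr s t x y = (x == y)%:R +
          \int[@lebesgue_measure R]_(u in `[s, t])
            (rate u (~~ y) * tr s u x (~~ y) - rate u y * tr s u x y)].

(* The last clause is the Markov property: h lists finitely many pairs
   (time, state), with times in [0, s], describing the past of the chain. *)
Definition markov_chain (rate : R -> bool -> R) (m0 : R)
    (d : measure_display) (Omega : measurableType d)
    (P : probability Omega R) (X : R -> Omega -> bool) : Prop :=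
  [/\ forall t, 0 <= t -> measurable_fun [set: Omega] (X t),
      forall w t, 0 <= t -> \forall s \near t^'+, X s w = X t w,
      P [set w | X 0 w] = m0%:E &
      exists2 tr, transition_function rate tr &
        forall (h : seq (R * bool)) (s t : R) (x y : bool),
          0 <= s -> s <= t -> all (fun e => 0 <= e.1 <= s) h ->
          P [set w | [&& all (fun e => X e.1 w == e.2) h,
                         X s w == x & X t w == y]] =
          (P [set w | all (fun e => X e.1 w == e.2) h && (X s w == x)] *
           (tr s t x y)%:E)%E].

Definition cost beta kappa p alpha (d : measure_display)
    (Omega : measurableType d) (P : probability Omega R)
    (X : R -> Omega -> bool) : \bar R :=
  (\int[P]_w \int[@lebesgue_measure R]_(t in `[0%R, +oo[)
     (expR (- beta * t) *
       (2^-1 * alpha t (X t w) ^+ 2 + kappa * running_cost (X t w) (p t)))%:E)%E.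

(* The chain X^alpha is only determined in law, hence the quantification over
   all of its realizations. *)
Definition nash_p beta sigma kappa p : Prop :=
  (forall t, 0 <= t -> 0 <= p t <= 1) /\
  exists alpha, admissible alpha /\
  exists (d : measure_display) (Omega : measurableType d)
         (P : probability Omega R) (X : R -> Omega -> bool),
  [/\ markov_chain (jump_rate sigma alpha) (p 0) P X,
      forall t, 0 <= t -> P [set w | X t w] = (p t)%:E &
      forall alpha', admissible alpha' ->
      forall (d' : measure_display) (Omega' : measurableType d')
             (P' : probability Omega' R) (X' : R -> Omega' -> bool),
        markov_chain (jump_rate sigma alpha') (p 0) P' X' ->
        (cost beta kappa p alpha P X <= cost beta kappa p alpha' P' X')%E].

Definition nash beta sigma kappa q : Prop :=
  nash_p beta sigma kappa (fun t => (q t + 1) / 2).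

Definition nash_from beta sigma kappa (q0 : R) q : Prop :=
  nash beta sigma kappa q /\ q 0 = q0.

Definition unique_nash_from beta sigma kappa (q0 : R) : Prop :=
  (exists q, nash_from beta sigma kappa q0 q) /\
  (forall q1 q2, nash_from beta sigma kappa q0 q1 ->
     nash_from beta sigma kappa q0 q2 -> forall t, 0 <= t -> q1 t = q2 t).

End Game.

Section Dynamics.
Context {R : realType}.
Implicit Types (beta sigma kappa : R) (a q : R -> R) (z : R * R).

Definition kappa_c beta sigma : R := 2 * beta * sigma ^+ 2 + 4 * sigma ^+ 4.

Definition abar beta sigma kappa : R :=
  - (beta + 3 * sigma ^+ 2) +
  Num.sqrt ((beta + 3 * sigma ^+ 2) ^+ 2 + 2 * (kappa - kappa_c beta sigma)).

Definition qbar beta sigma kappa : R :=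
  abar beta sigma kappa / (abar beta sigma kappa + 2 * sigma ^+ 2).

(* Points of the phase space are pairs (a, q). *)
Definition phase_space : set (R * R) := [set z | -1 <= z.2 <= 1].

Definition field_a beta sigma kappa z : R :=
  (beta + 2 * sigma ^+ 2) * z.1 + 2^-1 * Num.sg z.1 * z.1 ^+ 2 - kappa * z.2.

Definition field_q sigma z : R := z.1 - (2 * sigma ^+ 2 + `|z.1|) * z.2.

Definition stationary_point beta sigma kappa z : Prop :=
  field_a beta sigma kappa z = 0 /\ field_q sigma z = 0.

(* The vector field is continuous, so imposing the equation for t > 0 and
   continuity up to t = 0 also gives the one-sided equation at t = 0. *)
Definition trajectory beta sigma kappa a q : Prop :=
  [/\ {within `[0, +oo[, continuous a},
      {within `[0, +oo[, continuous q},
      forall t : R, 0 < t ->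
        is_derive t 1 a (field_a beta sigma kappa (a t, q t)),
      forall t : R, 0 < t -> is_derive t 1 q (field_q sigma (a t, q t)) &
      forall t, 0 <= t -> phase_space (a t, q t)].

(* q being confined to [-1, 1], only a has to be bounded explicitly. *)
Definition bounded_trajectory beta sigma kappa a q : Prop :=
  trajectory beta sigma kappa a q /\
  exists M : R, forall t, 0 <= t -> `|a t| <= M.

Definition stable_manifold beta sigma kappa z : set (R * R) :=
  [set x | exists a q : R -> R,
    [/\ trajectory beta sigma kappa a q, (a 0, q 0) = x,
        a t @[t --> +oo] --> z.1 & q t @[t --> +oo] --> z.2]].

(* Continuous polar coordinates (r, th) along t |-> (a t, q t), t in S. *)
Definition polar_lift (S : set R) a q (r th : R -> R) : Prop :=
  [/\ {within S, continuous r}, {within S, continuous th} &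
      forall t, S t ->
        [/\ 0 < r t, a t = r t * cos (th t) & q t = r t * sin (th t)]].

(* The forward trajectory makes at least n full turns around the origin. *)
Definition winds_around (n : nat) a q : Prop :=
  exists r th : R -> R,
    polar_lift `[0, +oo[ a q r th /\
    exists2 T, 0 <= T & n%:R * (2 * pi) <= `|th T - th 0|.

(* Both branches of a curve g with g 0 = (0, 0) turn infinitely often around
   the origin when approaching it. *)
Definition spirals (g : R -> R * R) : Prop :=
  (exists r th : R -> R,
     polar_lift `]0, 1] (fun t => (g t).1) (fun t => (g t).2) r th /\
     `|th t| @[t --> 0^'+] --> +oo) /\
  (exists r th : R -> R,
     polar_lift `[-1, 0[ (fun t => (g t).1) (fun t => (g t).2) r th /\
     `|th t| @[t --> 0^'-] --> +oo).

(* C is the graph of a strictly increasing function of either coordinate. *)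
Definition strictly_monotone (C : set (R * R)) : Prop :=
  forall x y, C x -> C y -> (x.1 < y.1 <-> x.2 < y.2).

End Dynamics.

(* Main.v *)
From HB Require Import structures.
Require Import Defs.
From mathcomp Require Import all_boot all_order all_algebra.
From mathcomp Require Import all_classical all_reals all_analysis.
From mathcomp Require Import measurable_realfun.
From mathcomp Require Import ring lra.
Import Order.TTheory GRing.Theory Num.Theory.
Import numFieldNormedType.Exports.
Local Open Scope classical_set_scope.
Local Open Scope ring_scope.
Set Implicit Arguments.
Unset Strict Implicit.
Unset Printing Implicit Defensive.

(** Nash equilibria are trajectories. Fix a flow q. The difference a of the two
    values of the representative player solves the scalar equation for a in
    the system, and among its solutions the bounded one is found by shooting
    (bounded_value_difference). For that a the cost of every admissible control
    is a constant plus the integral of a nonnegative excess, which vanishes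
    for the feedback that jumps at the extra rates a^+ from 0 and a^- from 1
    (cost_identity). Hence the optimal controls are those whose excess vanishes
    almost everywhere, and the law of the chain that they control satisfies the
    equation for q: this gives nash_trajectory and trajectory_nash. Both directions
    compare costs of actual chains, so a chain with prescribed continuous rates
    is constructed (chain_exists): its finite-dimensional laws at dyadic times
    are realized by nested partitions of [0, 1[, and since its expected number of
    jumps on the grids is bounded, its values at dyadic times have limits from
    the right almost surely.

    Bounded trajectories converge. They are orbits of a globally defined flow,
    that of the field truncated outside a box. For zero discount the system
    is Hamiltonian; in general its energy W, corrected by a primitive of the
    curve on which q is at rest, is nondecreasing along bounded orbits, with a
    rate of increase at least of the order of the square of q'. So q' tends to 0 and
    bounded orbits converge to a stationary point (orbit_converges); since W
    is positive near the origin except at the origin itself, where it vanishes, only the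
    stationary orbit tends to the origin (stays_cases). Therefore the points of
    bounded forward orbits are the origin and the stable manifolds of the
    two other stationary points, which are opposite to each other.

    The stable manifold of (abar, qbar) is a curve. The nullclines of the two
    components bound a wedge on each side of this point. An orbit that converges to
    the point ends up in one of the wedges (converging_in_wedge); on every
    horizontal line each wedge contains a point whose orbit remains in it, by
    shooting (wedge_point), and only one, because on a horizontal line the slope
    of the field is monotone and two orbits would drift apart
    (wedge_unique). So there are two branches. The right one comes from the
    boundary q = 1 and q is monotone on it, which makes the equilibrium unique for
    |q| > qbar. The left one, followed backwards, cannot cross |q| = qbar since
    W is below its value there, so it exists for all negative times and tends to
    the origin. Gluing both branches at their common limit and adding the
    opposite branches gives the curve, a continuous injective image of [-1, 1].

    Weak and strong interaction. With s = sigma^2, the linear part of the field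
    at the origin has real or complex eigenvalues according to the sign of
    (beta + 4 s)^2 - 4 kappa, that is of kappa_c + beta^2 / 4 - kappa. In the first case the field
    crosses a ray of the half plane a > 0 in one direction only, the left branch
    stays on one side of it, hence in its wedge, and both coordinates increase along
    the curve (curve_mono). In the second case the angular velocity is bounded
    below near the origin, so the angle of the left branch tends to -oo
    backwards in time (left_angle). Each turn meets all the lines
    q = q0 with |q0| small, which yields arbitrarily many equilibria (left_meets). *)

(** * Derivatives and primitives on the line *)

Section Calculus.
Context {R : realType}.
Implicit Types (f g : R -> R) (s t : R).

Lemma is_derive_cont f t l : is_derive t (1:R) f l -> {for t, continuous f}.
Proof.
by move=> [h _]; apply/differentiable_continuous/derivable1_diffP.
Qed.

Lemma is_derive_within f (df : R -> R) s t :
  (forall u, is_derive u (1:R) f (df u)) -> {within `[s, t], continuous f}.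
Proof.
by move=> h; apply: continuous_subspaceT => u; apply: is_derive_cont (h u).
Qed.

Lemma is_derive_nondecr f (df : R -> R) s t : s <= t ->
  (forall u, s < u < t -> is_derive u (1:R) f (df u)) ->
  {within `[s, t], continuous f} ->
  (forall u, s < u < t -> 0 <= df u) -> f s <= f t.
Proof.
rewrite le_eqVlt => /orP[/eqP-> //|st] d c p.
have d' u : u \in `]s, t[ -> is_derive u (1:R) f (df u).
  by rewrite in_itv /= => uI; apply: d.
have [u uI e] := MVT st d' c.
rewrite -subr_ge0 e mulr_ge0 ?subr_ge0 ?(ltW st)//.
by apply: p; rewrite in_itv /= in uI.
Qed.

Lemma is_derive_incr f (df : R -> R) s t : s < t ->
  (forall u, s < u < t -> is_derive u (1:R) f (df u)) ->
  {within `[s, t], continuous f} ->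
  (forall u, s < u < t -> 0 < df u) -> f s < f t.
Proof.
move=> st d c p.
have d' u : u \in `]s, t[ -> is_derive u (1:R) f (df u).
  by rewrite in_itv /= => uI; apply: d.
have [u uI e] := MVT st d' c.
rewrite -subr_gt0 e mulr_gt0 ?subr_gt0//.
by apply: p; rewrite in_itv /= in uI.
Qed.

Lemma ndecrT f (df : R -> R) : (forall u, is_derive u (1:R) f (df u)) ->
  (forall u, 0 <= df u) -> {homo f : x y / x <= y}.
Proof.
move=> d p x y xy; apply: (@is_derive_nondecr f df) => //.
exact: is_derive_within d.
Qed.

(** The fundamental theorem of calculus gives the derivative only to the right of
    the base point, so near each t the base point is moved to the left. *)
Lemma primitive f : continuous f ->
  exists2 F : R -> R, F 0 = 0 & forall t, is_derive t (1:R) F (f t).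
Proof.
move=> cf.
have ii a b : (@lebesgue_measure R).-integrable `[a, b] (EFin \o f).
  apply: continuous_compact_integrable; first exact: segment_compact.
  exact: continuous_subspaceT.
pose G a x := (\int[lebesgue_measure]_(u in `[a, x]) f u)%R.
have dG (a x : R) : a < x -> is_derive x (1:R) (G a) (f x).
  move=> ax; have [|//|d1 d2] := @continuous_FTC1_closed R f a x (x + 1) _ (ii _ _) ax.
  - by rewrite ltrDl.
  - exact: cf.
  - by rewrite -d2 derive1E; exact: derivableP.
(* shift the base point to the left of t so as to stay inside the interval *)
have eqG (a c x y : R) : a < c -> c < x -> c < y -> G a x - G a y = G c x - G c y.
  move=> ac.
  suff aux (u v : R) : c < u -> u <= v -> G a v - G a u = G c v - G c u.
    move=> cx cy; case: (leP x y) => h; last by apply: aux => //; exact: ltW.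
    by apply: oppr_inj; rewrite !opprB; exact: aux.
  move=> cu uv.
  pose H z := G a z - G c z.
  have dH (z : R) : c < z -> is_derive z (1:R) H (f z - f z).
    by move=> cz; apply: is_deriveB; apply: dG => //; exact: lt_trans cz.
  suff: H v = H u by rewrite /H; lra.
  case: (eqVneq u v) => [-> //|nuv].
  have ltuv : u < v by rewrite lt_neqAle nuv.
  have dH' (z : R) : z \in `]u, v[ -> is_derive z (1:R) H (f z - f z).
    by rewrite in_itv /= => /andP[h _]; apply: dH; exact: lt_trans h.
  have [|w _] := MVT ltuv dH'.
    apply: continuous_in_subspaceT => z; rewrite inE /= in_itv /= => /andP[h _].
    by apply: is_derive_cont (dH z _); exact: lt_le_trans h.
  by rewrite subrr mul0r => /eqP; rewrite subr_eq0 => /eqP.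
pose F t := G (Num.min t 0 - 1) t - G (Num.min t 0 - 1) 0.
exists F; first by rewrite /F subrr.
move=> t; set a := Num.min t 0 - 2.
have [at_ a0] : a + 1 < t /\ a + 1 < 0.
  by split; rewrite /a; case: (leP t 0) => h; lra.
have := dG (a) t; have -> : a < t by lra.
move=> /(_ isT) d.
have {}d : is_derive t (1:R) (fun u => G a u - G a 0) (f t).
  by rewrite -[f t]subr0; apply: is_deriveB.
apply: near_eq_is_derive d => //.
near=> u.
have au : a + 1 < u by near: u; apply: lt_nbhsr.
rewrite /F; case: (leP a (Num.min u 0 - 1)) => h.
  move: h; rewrite le_eqVlt => /orP[/eqP<- //|h].
  by apply: eqG => //; case: (leP u 0) => ?; lra.
move: h; case: (leP u 0) => ? ?; lra.
Unshelve. all: by end_near.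
Qed.

End Calculus.

(** * Global solutions of Lipschitz systems *)

Section Picard.
Context {R : realType}.

(** The intervals of radius 2 C 2^-n around the u n are nested. *)
Lemma geometric_limit (u : nat -> R) (C : R) :
  (forall n, `|u n.+1 - u n| <= C * 2^-1 ^+ n) ->
  exists l : R, forall n, `|l - u n| <= 2 * C * 2^-1 ^+ n.
Proof.
move=> h; pose e n : R := 2 * C * 2^-1 ^+ n.
have C0 : 0 <= C by have := h 0%N; rewrite expr0 mulr1; exact: le_trans.
have e0 n : 0 <= e n by rewrite /e mulr_ge0 ?exprn_ge0 ?mulr_ge0 ?invr_ge0.
have eS n : C * 2^-1 ^+ n = e n - e n.+1.
  by rewrite /e exprS; field.
have incr : {homo (fun n => u n - e n) : m n / (m <= n)%N >-> m <= n}.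
  apply: homo_leq => [x||n]; [exact: lexx|exact: le_trans|].
  by have := h n; rewrite eS ler_norml => /andP[]; lra.
have decr : {homo (fun n => u n + e n) : m n / (m <= n)%N >-> n <= m}.
  apply: (@homo_leq _ _ (fun x y => y <= x)) => [x|y x z xy yz|n]; first exact: lexx.
    exact: le_trans yz xy.
  by have := h n; rewrite eS ler_norml => /andP[]; lra.
have ab m n : u m - e m <= u n + e n.
  apply: (@le_trans _ _ (u (maxn m n) - e (maxn m n))); first exact: incr (leq_maxl _ _).
  apply: (@le_trans _ _ (u (maxn m n) + e (maxn m n))); last exact: decr (leq_maxr _ _).
  by have := e0 (maxn m n); lra.
pose A := range (fun n => u n - e n).
have uA n : ubound A (u n + e n) by move=> _ [m _ <-].
exists (sup A) => n; rewrite ler_norml -/(e n); apply/andP; split.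
  have : u n - e n <= sup A by apply: ub_le_sup; [exists (u 0%N + e 0%N)|exists n].
  by lra.
have : sup A <= u n + e n by apply: ge_sup => //; exists (u 0%N - e 0%N), 0%N.
by lra.
Qed.

Lemma lipschitz_continuous (x : R -> R) (M : R) :
  (forall s t, `|x s - x t| <= M * `|s - t|) -> continuous x.
Proof.
move=> h t; apply/cvgrPdist_lt => e e0; near=> u.
apply: le_lt_trans (h _ _) _.
apply: (@le_lt_trans _ _ ((`|M| + 1) * `|t - u|)).
  by rewrite ler_wpM2r// (le_trans (ler_norm M))// lerDl.
have M1 : 0 < `|M| + 1 by rewrite ltr_wpDl.
rewrite mulrC -ltr_pdivlMr//; near: u.
by apply: (@cvgr_dist_lt _ _ _ _ _ _ _ cvg_id); rewrite divr_gt0.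
Unshelve. all: by end_near. Qed.

Lemma derive_bound_lipschitz (x dx : R -> R) (M : R) :
  (forall t, is_derive t (1:R) x (dx t)) -> (forall t, `|dx t| <= M) ->
  forall s t, `|x s - x t| <= M * `|s - t|.
Proof.
move=> d b s t; wlog st : s t / s <= t => [H|].
  case: (leP s t) => [|/ltW ts]; first exact: H.
  by rewrite distrC (distrC s); exact: H.
have [c _ e] := MVT_segment st (fun u _ => d u) (is_derive_within d).
by rewrite distrC e normrM distrC ler_wpM2r.
Qed.

(** A total function of f, so that iterating the integral operator does not carry
    proofs of continuity. *)
Definition prim (f : R -> R) : R -> R :=
  if pselect (continuous f) is left c then projT1 (cid2 (primitive c)) else f.

Lemma prim0 f : continuous f -> prim f 0 = 0.
Proof. by rewrite /prim; case: pselect => // c _; case: cid2. Qed.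

Lemma is_derive_prim f t : continuous f -> is_derive t (1:R) (prim f) (f t).
Proof. by rewrite /prim; case: pselect => // c _; case: cid2 => F _ /=. Qed.

Lemma is_derive_expRM (K t : R) :
  is_derive t (1:R) (fun u => expR (K * u)) (K * expR (K * t)).
Proof.
have h := @is_derive1_comp R expR ( *%R K) t _ _ (is_derive_expR _) _.
have d : is_derive t (1:R) ( *%R K) K.
  by have := @is_deriveZ R _ _ id K t 1 1 (is_derive_id _ _); rewrite /GRing.scale /= mulr1.
by have := h _ d; rewrite mulrC.
Qed.

Variables (K : R).
Hypothesis K_gt0 : 0 < K.
(** Both exponentials are present in order to bound past and future times at once. *)
Definition weight (t : R) : R := expR (K * t) + expR (- K * t).

Lemma weight_ge0 t : 0 <= weight t.
Proof. by rewrite addr_ge0// expR_ge0. Qed.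

Lemma weight_ge1 t : 1 <= weight t.
Proof.
rewrite /weight; case: (leP 0 t) => h.
  by rewrite ler_wpDr ?expR_ge0// -expR0 ler_expR mulr_ge0// ltW.
by rewrite ler_wpDl ?expR_ge0// -expR0 ler_expR mulNr -mulrN mulr_ge0 ?ltW// oppr_gt0.
Qed.

(** Up to the factor K the weight dominates its own primitive, so that integrating
    a bound by the weight gains a factor 1/K. *)
Lemma weight_bound (F dF : R -> R) (c : R) : F 0 = 0 ->
  (forall t, is_derive t (1:R) F (dF t)) -> (forall t, `|dF t| <= c * weight t) ->
  forall t, `|F t| <= c / K * weight t.
Proof.
move=> F0 d b t.
pose H t := c / K * (expR (K * t) - expR (- K * t)).
have c0 : 0 <= c.
  have := le_trans (normr_ge0 _) (b 0).
  by rewrite pmulr_lge0// (lt_le_trans ltr01) ?weight_ge1.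
have dH u : is_derive u (1:R) H (c * weight u).
  rewrite (_ : c * weight u =
     (c / K) *: (K * expR (K * u) - (- K * expR (- K * u)))); last first.
    by rewrite /weight /GRing.scale /=; field; rewrite gt_eqF.
  by apply: is_deriveZ; apply: is_deriveB; apply: is_derive_expRM.
have H0 : H 0 = 0 by rewrite /H !mulr0 subrr mulr0.
have m1 : {homo (fun u => H u - F u) : x y / x <= y}.
  apply: (@ndecrT _ _ (fun u => c * weight u - dF u)) => u.
  by have := b u; rewrite ler_norml => /andP[]; lra.
have m2 : {homo (fun u => H u + F u) : x y / x <= y}.
  apply: (@ndecrT _ _ (fun u => c * weight u + dF u)) => u.
  by have := b u; rewrite ler_norml => /andP[]; lra.
have HW : `|H t| <= c / K * weight t.
  rewrite /H normrM ger0_norm ?divr_ge0 ?(ltW K_gt0)// ler_wpM2l ?divr_ge0 ?(ltW K_gt0)//.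
  apply: le_trans (ler_normB _ _) _.
  by rewrite !ger0_norm ?expR_ge0.
apply: le_trans HW; case: (leP 0 t) => h.
  have := m1 _ _ h; have := m2 _ _ h; rewrite F0 H0 subrr addr0 => h2 h1.
  by apply: le_trans (ler_norm _); rewrite ler_norml; apply/andP; split; lra.
have := m1 _ _ (ltW h); have := m2 _ _ (ltW h); rewrite F0 H0 subrr addr0 => h2 h1.
by rewrite -(normrN (H t)); apply: le_trans (ler_norm _); rewrite ler_norml; apply/andP; split; lra.
Qed.

End Picard.

Section Existence.
Context {R : realType}.
Variables (f g : R -> R -> R -> R) (L M : R).
Hypothesis L_gt0 : 0 < L.
Hypothesis lf : forall t x y x' y', `|f t x y - f t x' y'| <= L * (`|x - x'| + `|y - y'|).
Hypothesis lg : forall t x y x' y', `|g t x y - g t x' y'| <= L * (`|x - x'| + `|y - y'|).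
Hypothesis bf : forall t x y, `|f t x y| <= M.
Hypothesis bg : forall t x y, `|g t x y| <= M.
Hypothesis cf : forall x y : R -> R, continuous x -> continuous y ->
  continuous (fun t => f t (x t) (y t)).
Hypothesis cg : forall x y : R -> R, continuous x -> continuous y ->
  continuous (fun t => g t (x t) (y t)).

(** Picard iteration contracts by the factor 1/2 for the norm weighted with
    K = 4 L, on the whole time axis at once. *)
Theorem picard (x0 y0 : R) : exists x y : R -> R,
  [/\ x 0 = x0, y 0 = y0, forall t, is_derive t (1:R) x (f t (x t) (y t)) &
      forall t, is_derive t (1:R) y (g t (x t) (y t))].
Proof.
pose K : R := 4 * L; have K0 : 0 < K by rewrite mulr_gt0.
pose w := @weight R K.
pose step (z : (R -> R) * (R -> R)) :=
  (fun t => x0 + prim (fun u => f u (z.1 u) (z.2 u)) t,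
   fun t => y0 + prim (fun u => g u (z.1 u) (z.2 u)) t).
pose z n := iter n step (fun=> x0, fun=> y0).
have derD (h : R -> R) (c l t : R) : is_derive t (1:R) h l ->
    is_derive t (1:R) (fun u => c + h u) l.
  move=> dh; rewrite -[l]add0r; apply: is_deriveD.
have cz n : continuous (z n).1 /\ continuous (z n).2.
  elim: n => [|n [c1 c2]]; first by split=> t; exact: cvg_cst.
  split=> t; apply: is_derive_cont; apply: derD; apply: is_derive_prim.
    exact: cf.
  exact: cg.
have dx n t : is_derive t (1:R) (z n.+1).1 (f t ((z n).1 t) ((z n).2 t)).
  by apply: derD; apply: is_derive_prim; case: (cz n) => *; exact: cf.
have dy n t : is_derive t (1:R) (z n.+1).2 (g t ((z n).1 t) ((z n).2 t)).
  by apply: derD; apply: is_derive_prim; case: (cz n) => *; exact: cg.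
have zx0 n : (z n).1 0 = x0.
  by case: n => //= n; rewrite prim0 ?addr0//; case: (cz n) => *; exact: cf.
have zy0 n : (z n).2 0 = y0.
  by case: n => //= n; rewrite prim0 ?addr0//; case: (cz n) => *; exact: cg.
have M0 : 0 <= M by exact: le_trans (normr_ge0 _) (bf 0 0 0).
have w1 t : 1 <= w t by exact: weight_ge1.
have w0 t : 0 <= w t by exact: weight_ge0.
pose c n := M / K * 2^-1 ^+ n.
have c0 n : 0 <= c n by rewrite mulr_ge0 ?exprn_ge0 ?divr_ge0 ?invr_ge0// ltW.
have cS n : (L * (c n + c n)) / K = c n.+1.
  by rewrite /c exprS /K; field; rewrite gt_eqF.
have diff n t : `|(z n.+1).1 t - (z n).1 t| <= c n * w t /\
                `|(z n.+1).2 t - (z n).2 t| <= c n * w t.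
  elim: n t => [|n IH] t.
    rewrite /c expr0 mulr1; split.
    - apply: (@weight_bound R K K0 (fun u => (z 1%N).1 u - x0) (fun u => f u x0 y0 - 0)).
      + by rewrite zx0 subrr.
      + by move=> u; rewrite subr0; apply: le_trans (bf _ _ _) _; rewrite ler_peMr.
    - apply: (@weight_bound R K K0 (fun u => (z 1%N).2 u - y0) (fun u => g u x0 y0 - 0)).
      + by rewrite zy0 subrr.
      + by move=> u; rewrite subr0; apply: le_trans (bg _ _ _) _; rewrite ler_peMr.
  rewrite -cS; split.
  - apply: (@weight_bound R K K0 (fun u => (z n.+2).1 u - (z n.+1).1 u)
      (fun u => f u ((z n.+1).1 u) ((z n.+1).2 u) - f u ((z n).1 u) ((z n).2 u))).
    + by rewrite !zx0 subrr.
    + move=> u; apply: le_trans (lf _ _ _ _ _) _; rewrite -mulrA ler_wpM2l ?(ltW L_gt0)//.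
      by rewrite mulrDl lerD//; case: (IH u).
  - apply: (@weight_bound R K K0 (fun u => (z n.+2).2 u - (z n.+1).2 u)
      (fun u => g u ((z n.+1).1 u) ((z n.+1).2 u) - g u ((z n).1 u) ((z n).2 u))).
    + by rewrite !zy0 subrr.
    + move=> u; apply: le_trans (lg _ _ _ _ _) _; rewrite -mulrA ler_wpM2l ?(ltW L_gt0)//.
      by rewrite mulrDl lerD//; case: (IH u).
have cE n t : c n * w t = (M / K * w t) * 2^-1 ^+ n by rewrite /c; ring.
have limx t : exists l : R, forall n, `|l - (z n).1 t| <= 2 * (M / K * w t) * 2^-1 ^+ n.
  by apply: geometric_limit => n; rewrite -cE; case: (diff n t).
have limy t : exists l : R, forall n, `|l - (z n).2 t| <= 2 * (M / K * w t) * 2^-1 ^+ n.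
  by apply: geometric_limit => n; rewrite -cE; case: (diff n t).
have [x xP] := choice limx; have [y yP] := choice limy.
have small (a C : R) : (forall n, `|a| <= C * 2^-1 ^+ n) -> a = 0.
  move=> h; apply/eqP; rewrite -normr_eq0 eq_le normr_ge0 andbT.
  have H : C * 2^-1 ^+ n @[n --> \oo] --> (0 : R).
    rewrite -[X in _ --> X](mulr0 C); apply: cvgM; first exact: cvg_cst.
    by apply: cvg_expr; rewrite ger0_norm ?invr_ge0// invf_lt1 ?ltr1n.
  rewrite -(cvg_lim _ H)//; apply: limr_ge; first exact: cvgP H.
  by near=> n; exact: h.
have lip (v : R -> R) (u : nat -> R -> R) (D : R -> R) :
    (forall t n, `|v t - u n t| <= D t * 2^-1 ^+ n) ->
    (forall n s t, `|u n.+1 s - u n.+1 t| <= M * `|s - t|) -> continuous v.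
  move=> h1 h2; apply: (@lipschitz_continuous R v M) => s t.
  rewrite -subr_le0; case: (leP (`|v s - v t| - M * `|s - t|) 0) => // hp.
  have := @small (`|v s - v t| - M * `|s - t|) (D s + D t).
  rewrite gtr0_norm// => H; move: hp; rewrite H ?ltxx// => n.
  have p : 2^-1 ^+ n.+1 <= 2^-1 ^+ n :> R.
    by rewrite exprS ler_piMl ?exprn_ge0 ?invr_ge0// invf_le1 ?ler1n.
  have D0 r : 0 <= D r by have := h1 r 0%N; rewrite expr0 mulr1; exact: le_trans.
  apply: (@le_trans _ _ ((D s + D t) * 2^-1 ^+ n.+1)); last first.
    by rewrite ler_wpM2l// addr_ge0.
  rewrite lerBlDr mulrDl.
  have -> : v s - v t = (v s - u n.+1 s) - (v t - u n.+1 t) + (u n.+1 s - u n.+1 t) by ring.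
  apply: le_trans (ler_normD _ _) _; apply: lerD => //.
  by apply: le_trans (ler_normB _ _) _; apply: lerD.
have cx : continuous x.
  apply: (@lip x (fun n => (z n).1) (fun t => 2 * (M / K * w t))) => [t n|n s t].
    exact: xP.
  exact: derive_bound_lipschitz (dx n) (fun u => bf _ _ _) s t.
have cy : continuous y.
  apply: (@lip y (fun n => (z n).2) (fun t => 2 * (M / K * w t))) => [t n|n s t].
    exact: yP.
  exact: derive_bound_lipschitz (dy n) (fun u => bg _ _ _) s t.
have xE (X : R -> R) : X 0 = x0 ->
    (forall t, is_derive t (1:R) X (f t (x t) (y t))) -> X = x.
  move=> X0 dX; apply/funext => t; apply/esym/eqP; rewrite -subr_eq0; apply/eqP.
  apply: (@small _ (2 * (M / K * w t))) => n.
  have -> : x t - X t = (x t - (z n.+1).1 t) - (X t - (z n.+1).1 t) by ring.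
  apply: le_trans (ler_normB _ _) _.
  have h1 := xP t n.+1.
  have h0 : X 0 - (z n.+1).1 0 = 0 by rewrite X0 zx0 subrr.
  have hd u : is_derive u (1:R) (fun u => X u - (z n.+1).1 u)
      (f u (x u) (y u) - f u ((z n).1 u) ((z n).2 u)).
    exact: is_deriveB (dX u) (dx n u).
  have hb u : `|f u (x u) (y u) - f u ((z n).1 u) ((z n).2 u)| <=
      (L * (2 * (M / K) * 2^-1 ^+ n + 2 * (M / K) * 2^-1 ^+ n)) * weight K u.
    apply: le_trans (lf _ _ _ _ _) _; rewrite -mulrA ler_wpM2l ?(ltW L_gt0)//.
    by rewrite mulrDl lerD//; [apply: le_trans (xP u n) _|apply: le_trans (yP u n) _];
      rewrite le_eqVlt; apply/orP; left; apply/eqP; rewrite /w; ring.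
  have h2 := @weight_bound R K K0 _ _ _ h0 hd hb t.
  apply: le_trans (lerD h1 h2) _; rewrite le_eqVlt; apply/orP; left; apply/eqP.
  by rewrite exprS /K /w; field; rewrite gt_eqF.
have yE (X : R -> R) : X 0 = y0 ->
    (forall t, is_derive t (1:R) X (g t (x t) (y t))) -> X = y.
  move=> X0 dX; apply/funext => t; apply/esym/eqP; rewrite -subr_eq0; apply/eqP.
  apply: (@small _ (2 * (M / K * w t))) => n.
  have -> : y t - X t = (y t - (z n.+1).2 t) - (X t - (z n.+1).2 t) by ring.
  apply: le_trans (ler_normB _ _) _.
  have h1 := yP t n.+1.
  have h0 : X 0 - (z n.+1).2 0 = 0 by rewrite X0 zy0 subrr.
  have hd u : is_derive u (1:R) (fun u => X u - (z n.+1).2 u)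
      (g u (x u) (y u) - g u ((z n).1 u) ((z n).2 u)).
    exact: is_deriveB (dX u) (dy n u).
  have hb u : `|g u (x u) (y u) - g u ((z n).1 u) ((z n).2 u)| <=
      (L * (2 * (M / K) * 2^-1 ^+ n + 2 * (M / K) * 2^-1 ^+ n)) * weight K u.
    apply: le_trans (lg _ _ _ _ _) _; rewrite -mulrA ler_wpM2l ?(ltW L_gt0)//.
    by rewrite mulrDl lerD//; [apply: le_trans (xP u n) _|apply: le_trans (yP u n) _];
      rewrite le_eqVlt; apply/orP; left; apply/eqP; rewrite /w; ring.
  have h2 := @weight_bound R K K0 _ _ _ h0 hd hb t.
  apply: le_trans (lerD h1 h2) _; rewrite le_eqVlt; apply/orP; left; apply/eqP.
  by rewrite exprS /K /w; field; rewrite gt_eqF.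
have cfx : continuous (fun u => f u (x u) (y u)) by exact: cf.
have cgy : continuous (fun u => g u (x u) (y u)) by exact: cg.
have dX t : is_derive t (1:R) (fun u => x0 + prim (fun u => f u (x u) (y u)) u) (f t (x t) (y t)).
  by apply: derD; exact: (is_derive_prim t cfx).
have dY t : is_derive t (1:R) (fun u => y0 + prim (fun u => g u (x u) (y u)) u) (g t (x t) (y t)).
  by apply: derD; exact: (is_derive_prim t cgy).
have X0 : x0 + prim (fun u => f u (x u) (y u)) 0 = x0 by rewrite prim0 ?addr0.
have Y0 : y0 + prim (fun u => g u (x u) (y u)) 0 = y0 by rewrite prim0 ?addr0.
have EX := xE _ X0 dX; have EY := yE _ Y0 dY.
exists x, y; split.
- by rewrite -EX.
- by rewrite -EY.
- by move=> t; have := dX t; rewrite EX.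
- by move=> t; have := dY t; rewrite EY.
Unshelve. all: by end_near. Qed.

End Existence.

(** * Gronwall estimates and the truncated vector field *)

Section Within.
Context {R : realType} (A : set R).
Implicit Types f g : R -> R.

Lemma wcontD f g : {within A, continuous f} -> {within A, continuous g} ->
  {within A, continuous (fun u => f u + g u)}.
Proof. by move=> cf cg u; apply: continuousD; [exact: cf|exact: cg]. Qed.

Lemma wcontN f : {within A, continuous f} -> {within A, continuous (fun u => - f u)}.
Proof. by move=> cf u; apply: continuousN; exact: cf. Qed.

Lemma wcontB f g : {within A, continuous f} -> {within A, continuous g} ->
  {within A, continuous (fun u => f u - g u)}.
Proof. by move=> cf cg u; apply: continuousB; [exact: cf|exact: cg]. Qed.

Lemma wcontM f g : {within A, continuous f} -> {within A, continuous g} ->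
  {within A, continuous (fun u => f u * g u)}.
Proof. by move=> cf cg u; apply: continuousM; [exact: cf|exact: cg]. Qed.

End Within.

Section Cont.
Context {T : topologicalType} {R : realType}.
Implicit Types f g : T -> R.

Lemma contD f g : continuous f -> continuous g -> continuous (fun u => f u + g u).
Proof. by move=> cf cg u; apply: continuousD; [exact: cf|exact: cg]. Qed.

Lemma contN f : continuous f -> continuous (fun u => - f u).
Proof. by move=> cf u; apply: continuousN; exact: cf. Qed.

Lemma contB f g : continuous f -> continuous g -> continuous (fun u => f u - g u).
Proof. by move=> cf cg u; apply: continuousB; [exact: cf|exact: cg]. Qed.

Lemma contM f g : continuous f -> continuous g -> continuous (fun u => f u * g u).
Proof. by move=> cf cg u; apply: continuousM; [exact: cf|exact: cg]. Qed.

Lemma contC (c : R) : continuous (fun _ : T => c).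
Proof. by move=> u; exact: cvg_cst. Qed.

Lemma cont_norm f : continuous f -> continuous (fun u => `|f u|).
Proof. by move=> cf u; apply: cvg_norm; exact: cf. Qed.

End Cont.

Lemma ler_by_sub (R : realDomainType) (x y z : R) : 0 <= z -> y - x = z -> x <= y.
Proof. by move=> z0 e; rewrite -subr_ge0 e. Qed.

Section Gronwall.
Context {R : realType}.
Implicit Types (D : R -> R).

(** D exp (- c t) is nonincreasing. *)
Lemma gronwall_upper D (dD : R -> R) (c s t : R) : s <= t ->
  (forall u, s < u < t -> is_derive u (1:R) D (dD u)) ->
  {within `[s, t], continuous D} ->
  (forall u, s < u < t -> dD u <= c * D u) -> D t <= D s * expR (c * (t - s)).
Proof.
move=> st d cD h.
pose E u := - (D u * expR (- c * u)).
have : E s <= E t.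
  apply: (@is_derive_nondecr R E (fun u => (c * D u - dD u) * expR (- c * u))) => //.
  - move=> u uI; have du := d u uI; have de := @is_derive_expRM R (- c) u.
    by rewrite /E; apply: is_derive_eq; rewrite /GRing.scale /=; ring.
  - apply: wcontN; apply: wcontM => //.
    exact: is_derive_within (is_derive_expRM (- c)).
  - by move=> u uI; rewrite mulr_ge0 ?expR_ge0 ?subr_ge0 ?h.
rewrite /E lerN2 -ler_pdivlMr ?expR_gt0// -mulrA -expRN -expRD.
by congr (_ <= _ * expR _); ring.
Qed.

(** D exp (c t) is nondecreasing. *)
Lemma gronwall_lower D (dD : R -> R) (c s t : R) : s <= t ->
  (forall u, s < u < t -> is_derive u (1:R) D (dD u)) ->
  {within `[s, t], continuous D} ->
  (forall u, s < u < t -> - (c * D u) <= dD u) -> D s <= D t * expR (c * (t - s)).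
Proof.
move=> st d cD h.
pose E u := D u * expR (c * u).
have : E s <= E t.
  apply: (@is_derive_nondecr R E (fun u => (c * D u + dD u) * expR (c * u))) => //.
  - move=> u uI; have du := d u uI; have de := @is_derive_expRM R c u.
    by rewrite /E; apply: is_derive_eq; rewrite /GRing.scale /=; ring.
  - by apply: wcontM => //; exact: is_derive_within (is_derive_expRM c).
  - by move=> u uI; rewrite mulr_ge0 ?expR_ge0//; have := h u uI; lra.
rewrite /E -ler_pdivlMr ?expR_gt0// -mulrA -expRN -expRD.
by congr (_ <= _ * expR _); ring.
Qed.

Section Distance.
Variables (f g : R -> R -> R -> R) (L : R).
Hypothesis L_ge0 : 0 <= L.
Hypothesis lf : forall t x y x' y', `|f t x y - f t x' y'| <= L * (`|x - x'| + `|y - y'|).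
Hypothesis lg : forall t x y x' y', `|g t x y - g t x' y'| <= L * (`|x - x'| + `|y - y'|).

Definition solves (s t : R) (x y : R -> R) : Prop :=
  [/\ {within `[s, t], continuous x}, {within `[s, t], continuous y} &
      forall u, s < u < t -> is_derive u (1:R) x (f u (x u) (y u)) /\
                             is_derive u (1:R) y (g u (x u) (y u))].

Definition sqdist (x y x' y' : R) : R := (x - x') * (x - x') + (y - y') * (y - y').

Lemma sqdist_ge0 (x y x' y' : R) : 0 <= sqdist x y x' y'.
Proof. by rewrite addr_ge0// -expr2 sqr_ge0. Qed.

Lemma sqdist_eq0 (x y x' y' : R) : sqdist x y x' y' <= 0 -> x = x' /\ y = y'.
Proof.
rewrite /sqdist -!expr2 => h.
have hx : (x - x') ^+ 2 = 0 by apply/eqP; rewrite eq_le sqr_ge0 andbT; have := sqr_ge0 (y - y'); lra.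
have hy : (y - y') ^+ 2 = 0 by apply/eqP; rewrite eq_le sqr_ge0 andbT; have := sqr_ge0 (x - x'); lra.
by move: hx hy => /eqP; rewrite sqrf_eq0 subr_eq0 => /eqP -> /eqP; rewrite sqrf_eq0 subr_eq0 => /eqP ->.
Qed.

(** The derivative of the squared distance D is between - 4 L D and 4 L D. The lower
    bound is what makes solutions unique backwards in time as well. *)
Lemma dist_growth (s t : R) (x y x' y' : R -> R) : s <= t ->
  solves s t x y -> solves s t x' y' ->
  let D u := sqdist (x u) (y u) (x' u) (y' u) in
  D t <= D s * expR (4 * L * (t - s)) /\ D s <= D t * expR (4 * L * (t - s)).
Proof.
move=> st [cx cy dxy] [cx' cy' dxy'] D.
pose dD u := 2 * ((x u - x' u) * (f u (x u) (y u) - f u (x' u) (y' u)) +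
                  (y u - y' u) * (g u (x u) (y u) - g u (x' u) (y' u))).
have d u : s < u < t -> is_derive u (1:R) D (dD u).
  move=> uI; have [dx dy] := dxy u uI; have [dx' dy'] := dxy' u uI.
  by rewrite /D /sqdist; apply: is_derive_eq; rewrite /dD /GRing.scale /=; ring.
have cD : {within `[s, t], continuous D}.
  by apply: wcontD; apply: wcontM; apply: wcontB.
have bD u : `|dD u| <= 4 * L * D u.
  rewrite /dD normrM ger0_norm//.
  set X := x u - x' u; set Y := y u - y' u.
  have h1 := lf u (x u) (y u) (x' u) (y' u); have h2 := lg u (x u) (y u) (x' u) (y' u).
  have -> : D u = `|X| ^+ 2 + `|Y| ^+ 2 by rewrite /D /sqdist -!expr2 -/X -/Y !real_normK ?num_real.
  rewrite -/X -/Y in h1 h2.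
  apply: (@le_trans _ _ (2 * (`|X| * (L * (`|X| + `|Y|)) + `|Y| * (L * (`|X| + `|Y|))))).
    by rewrite ler_wpM2l// (le_trans (ler_normD _ _))// lerD// normrM ler_wpM2l.
  apply: (@ler_by_sub _ _ _ (2 * (L * (`|X| - `|Y|) ^+ 2))); last by ring.
  by rewrite mulr_ge0// mulr_ge0// sqr_ge0.
split; [apply: gronwall_upper st d cD _|apply: gronwall_lower st d cD _] => u _.
  exact: le_trans (ler_norm _) (bD u).
by rewrite lerNl; apply: le_trans (bD u); rewrite -normrN ler_norm.
Qed.

Lemma solves_unique (s t : R) (x y x' y' : R -> R) : solves s t x y -> solves s t x' y' ->
  forall u v, s <= u <= t -> s <= v <= t -> x u = x' u -> y u = y' u -> x v = x' v /\ y v = y' v.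
Proof.
move=> h h' u v uI vI eu ev.
have sub a b : s <= a -> b <= t -> forall z w, solves s t z w -> solves a b z w.
  move=> sa bt z w [c1 c2 d].
  have ss : `[a, b] `<=` `[s, t].
    by move=> r /=; rewrite !in_itv /= => /andP[? ?]; rewrite (le_trans sa)//= (le_trans _ bt).
  split; [exact: continuous_subspaceW c1|exact: continuous_subspaceW c2|].
  move=> r /andP[r1 r2]; apply: d.
  by rewrite (le_lt_trans sa r1) (lt_le_trans r2 bt).
have D0 : sqdist (x u) (y u) (x' u) (y' u) = 0 by rewrite /sqdist eu ev !subrr mul0r addr0.
apply: sqdist_eq0; move/andP: uI => [su ut]; move/andP: vI => [sv vt].
case: (leP u v) => uv.
  by have [+ _] := dist_growth uv (sub _ _ su vt _ _ h) (sub _ _ su vt _ _ h'); rewrite /= D0 mul0r.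
by have [_ +] := dist_growth (ltW uv) (sub _ _ sv ut _ _ h) (sub _ _ sv ut _ _ h'); rewrite /= D0 mul0r.
Qed.

Lemma solves_global (x y : R -> R) (s t : R) : (forall u, is_derive u (1:R) x (f u (x u) (y u))) ->
  (forall u, is_derive u (1:R) y (g u (x u) (y u))) -> solves s t x y.
Proof.
move=> dx dy; split; [exact: is_derive_within dx|exact: is_derive_within dy|].
by move=> u _; split.
Qed.

End Distance.
End Gronwall.

Section Clamp.
Context {R : realType}.
(** Outside the box |a| <= bnd, |q| <= 1 the field is replaced by its value at the
    nearest point of the box; it becomes bounded and Lipschitz, hence complete. *)
Definition clamp (M x : R) : R := Num.max (- M) (Num.min x M).

Lemma clamp_cases (M x : R) : 0 <= M ->
  [\/ x <= - M /\ clamp M x = - M, - M <= x <= M /\ clamp M x = x |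
      M <= x /\ clamp M x = M].
Proof.
move=> M0; have NM : - M <= M by lra.
rewrite /clamp; case: (leP x M) => h1; last first.
  by rewrite (max_idPr NM); constructor 3; split; [exact: ltW|].
case: (leP (- M) x) => h2; first by constructor 2; split; rewrite ?h2// (max_idPr h2).
by constructor 1; split; first exact: ltW.
Qed.

Lemma clamp_id (M x : R) : `|x| <= M -> clamp M x = x.
Proof.
by rewrite ler_norml /clamp => /andP[h1 h2]; rewrite (min_idPl h2) (max_idPr h1).
Qed.

Lemma clamp_bound (M x : R) : 0 <= M -> `|clamp M x| <= M.
Proof.
move=> M0; rewrite ler_norml.
by case: (clamp_cases x M0) => -[h ->]; rewrite ?h//; apply/andP; split; lra.
Qed.

Lemma clamp_lip (M x y : R) : 0 <= M -> `|clamp M x - clamp M y| <= `|x - y|.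
Proof.
move=> M0; have := ler_norm (x - y); have := ler_norm (- (x - y)); rewrite normrN.
rewrite ler_norml => h1 h2.
by case: (clamp_cases x M0) => -[h ->]; case: (clamp_cases y M0) => -[h' ->];
  apply/andP; split; lra.
Qed.

Lemma clamp_continuous M : 0 <= M -> continuous (clamp M).
Proof.
move=> M0; apply: (@lipschitz_continuous R _ 1) => s t; rewrite mul1r; exact: clamp_lip.
Qed.

End Clamp.

Section Field.
Context {R : realType}.
Variables (beta s kappa : R).
Hypotheses (beta_gt0 : 0 < beta) (s_gt0 : 0 < s) (kappa_gt0 : 0 < kappa).

Definition fa (a q : R) : R := (beta + 2 * s) * a + 2^-1 * (`|a| * a) - kappa * q.
Definition fq (a q : R) : R := a - (2 * s + `|a|) * q.
(** A bound for a in bounded trajectories: when |q| <= 1 and |a| > bnd, the linear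
    term of fa dominates kappa q. *)
Definition bnd : R := kappa / (beta + 2 * s).

Lemma b_gt0 : 0 < beta + 2 * s. Proof. by rewrite addr_gt0// mulr_gt0. Qed.
Lemma bnd_gt0 : 0 < bnd. Proof. by rewrite divr_gt0// b_gt0. Qed.

Lemma fa_odd a q : fa (- a) (- q) = - fa a q.
Proof. by rewrite /fa normrN; ring. Qed.
Lemma fq_odd a q : fq (- a) (- q) = - fq a q.
Proof. by rewrite /fq normrN; ring. Qed.

Definition lipc : R := beta + 4 * s + 2 + kappa + 2 * bnd.

Lemma lipc_gt0 : 0 < lipc.
Proof. by rewrite /lipc; have := bnd_gt0; move: beta_gt0 s_gt0 kappa_gt0; lra. Qed.

Definition fat (t a q : R) : R := fa (clamp bnd a) (clamp 1 q).
Definition fqt (t a q : R) : R := fq (clamp bnd a) (clamp 1 q).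

Lemma fa_lip a q a' q' : `|a| <= bnd -> `|a'| <= bnd ->
  `|fa a q - fa a' q'| <= lipc * (`|a - a'| + `|q - q'|).
Proof.
move=> ha ha'.
have h1 : `| `|a| * a - `|a'| * a'| <= 2 * bnd * `|a - a'|.
  have -> : `|a| * a - `|a'| * a' = `|a| * (a - a') + (`|a| - `|a'|) * a' by ring.
  rewrite (le_trans (ler_normD _ _))// !normrM normr_id mulrAC mulr_natl mulr2n mulrDl lerD//.
    by rewrite mulrC ler_wpM2l.
  rewrite ler_pM//; exact: ler_dist_dist.
have -> : fa a q - fa a' q' = (beta + 2 * s) * (a - a') + 2^-1 * (`|a| * a - `|a'| * a') - kappa * (q - q').
  by rewrite /fa; ring.
apply: le_trans (ler_normB _ _) _; rewrite !normrM (gtr0_norm kappa_gt0).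
apply: (@le_trans _ _ ((beta + 2 * s) * `|a - a'| + bnd * `|a - a'| + kappa * `|q - q'|)).
  rewrite lerD2r (le_trans (ler_normD _ _))// !normrM (gtr0_norm b_gt0) lerD2l ger0_norm ?invr_ge0//.
  by rewrite -ler_pdivlMl ?invr_gt0// invrK mulrA.
rewrite /lipc; have := bnd_gt0; have := normr_ge0 (a - a'); have := normr_ge0 (q - q').
move: beta_gt0 s_gt0 kappa_gt0 => *.
have p1 : 0 <= (2 * s + 2 + kappa + bnd) * `|a - a'| by rewrite mulr_ge0//; lra.
have p2 : 0 <= (beta + 4 * s + 2 + 2 * bnd) * `|q - q'| by rewrite mulr_ge0//; lra.
by apply: (ler_by_sub (addr_ge0 p1 p2)); ring.
Qed.

Lemma fq_lip a q a' q' : `|a| <= bnd -> `|q'| <= 1 ->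
  `|fq a q - fq a' q'| <= lipc * (`|a - a'| + `|q - q'|).
Proof.
move=> ha hq.
have -> : fq a q - fq a' q' = (a - a') - (2 * s + `|a|) * (q - q') - (`|a| - `|a'|) * q'.
  by rewrite /fq; ring.
apply: (@le_trans _ _ (`|a - a'| + (2 * s + bnd) * `|q - q'| + `|a - a'|)).
  apply: le_trans (ler_normB _ _) _; apply: lerD.
    apply: le_trans (ler_normB _ _) _; rewrite lerD2l normrM ler_wpM2r//.
    by rewrite ger0_norm ?lerD2l// addr_ge0// mulr_ge0// ltW.
  rewrite normrM -[leRHS]mulr1 ler_pM//; exact: ler_dist_dist.
rewrite /lipc; have := bnd_gt0; have := normr_ge0 (a - a'); have := normr_ge0 (q - q').
move: beta_gt0 s_gt0 kappa_gt0 => *.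
have p1 : 0 <= (beta + 4 * s + kappa + 2 * bnd) * `|a - a'| by rewrite mulr_ge0//; lra.
have p2 : 0 <= (beta + 2 * s + 2 + kappa + bnd) * `|q - q'| by rewrite mulr_ge0//; lra.
by apply: (ler_by_sub (addr_ge0 p1 p2)); ring.
Qed.

Lemma fat_lip t a q a' q' : `|fat t a q - fat t a' q'| <= lipc * (`|a - a'| + `|q - q'|).
Proof.
have M0 := ltW bnd_gt0.
apply: le_trans (fa_lip _ _ (clamp_bound _ M0) (clamp_bound _ M0)) _.
by rewrite ler_wpM2l ?(ltW lipc_gt0)// lerD// clamp_lip.
Qed.

Lemma fqt_lip t a q a' q' : `|fqt t a q - fqt t a' q'| <= lipc * (`|a - a'| + `|q - q'|).
Proof.
have M0 := ltW bnd_gt0.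
apply: le_trans (fq_lip _ _ (clamp_bound _ M0) (clamp_bound _ ler01)) _.
by rewrite ler_wpM2l ?(ltW lipc_gt0)// lerD// clamp_lip.
Qed.

Lemma fat_bound t a q : `|fat t a q| <= lipc * (bnd + 1).
Proof.
have M0 := ltW bnd_gt0.
have n0 : `|0 : R| <= bnd by rewrite normr0.
have := fa_lip (clamp 1 q) 0 (clamp_bound a M0) n0.
have -> : fa 0 0 = 0 by rewrite /fa normr0; ring.
rewrite !subr0 => h.
apply: le_trans h _; rewrite ler_wpM2l ?(ltW lipc_gt0)// lerD// clamp_bound//.
Qed.

Lemma fqt_bound t a q : `|fqt t a q| <= lipc * (bnd + 1).
Proof.
have M0 := ltW bnd_gt0.
have n0 : `|0 : R| <= 1 by rewrite normr0.
have := @fq_lip (clamp bnd a) (clamp 1 q) 0 0 (clamp_bound a M0) n0.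
have -> : fq 0 0 = 0 by rewrite /fq normr0; ring.
rewrite !subr0 => h.
apply: le_trans h _; rewrite ler_wpM2l ?(ltW lipc_gt0)// lerD// clamp_bound//.
Qed.

Lemma fa_continuous (x y : R -> R) : continuous x -> continuous y ->
  continuous (fun t => fa (x t) (y t)).
Proof.
move=> cx cy.
have h := contB (contD (contM (@contC _ R (beta + 2 * s)) cx)
  (contM (@contC _ R 2^-1) (contM (cont_norm cx) cx))) (contM (@contC _ R kappa) cy).
exact: h.
Qed.

Lemma fq_continuous (x y : R -> R) : continuous x -> continuous y ->
  continuous (fun t => fq (x t) (y t)).
Proof.
move=> cx cy; have h := contB cx (contM (contD (@contC _ R (2 * s)) (cont_norm cx)) cy).
exact: h.
Qed.

Lemma clamp_comp_continuous (M : R) (x : R -> R) : 0 <= M -> continuous x ->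
  continuous (fun t => clamp M (x t)).
Proof.
by move=> M0 cx t; apply: continuous_comp; [exact: cx|exact: clamp_continuous].
Qed.

Lemma flow_exists (z : R * R) : exists xy : (R -> R) * (R -> R),
  [/\ xy.1 0 = z.1, xy.2 0 = z.2,
   forall t, is_derive t (1:R) xy.1 (fat t (xy.1 t) (xy.2 t)) &
   forall t, is_derive t (1:R) xy.2 (fqt t (xy.1 t) (xy.2 t))].
Proof.
have [x [y [*]]] := @picard R fat fqt lipc _ lipc_gt0 fat_lip fqt_lip fat_bound fqt_bound
  (fun x y cx cy => fa_continuous (clamp_comp_continuous (ltW bnd_gt0) cx) (clamp_comp_continuous ler01 cy))
  (fun x y cx cy => fq_continuous (clamp_comp_continuous (ltW bnd_gt0) cx) (clamp_comp_continuous ler01 cy))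
  z.1 z.2.
by exists (x, y); split.
Qed.

End Field.

(** * The flow of the truncated field *)

Section RealLine.
Context {R : realType}.
Implicit Types (f g x y : R -> R).

Lemma cont_gt f (c t : R) : {for t, continuous f} -> c < f t ->
  exists2 e : R, 0 < e & forall u, `|u - t| < e -> c < f u.
Proof.
move=> /cvgrPdist_lt cf ct; have := cf (f t - c); rewrite subr_gt0 => /(_ ct).
move=> /nbhs_ballP[e /= e0 he]; exists e => // u ut.
have : `|f t - f u| < f t - c by apply: he; rewrite /ball /= distrC.
by rewrite ltr_norml => /andP[]; lra.
Qed.

(** The hitting time is the supremum of the times up to which f exceeds c. *)
Lemma first_hit f (c t0 t1 : R) : continuous f -> t0 <= t1 -> c < f t0 -> f t1 <= c ->
  exists2 t, t0 < t <= t1 & f t = c /\ forall u, t0 <= u < t -> c < f u.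
Proof.
move=> cf t01 f0 f1.
pose A := [set u | t0 <= u <= t1 /\ f u <= c].
have A1 : A t1 by split; rewrite ?lexx ?t01.
have Al : lbound A t0 by move=> u [/andP[]].
have hA : has_inf A by split; [exists t1|exists t0].
pose t := inf A.
have t0t : t0 <= t by apply: lb_le_inf => //; exists t1.
have tt1 : t <= t1 by apply: ge_inf => //; exists t0.
have below u : t0 <= u < t -> c < f u.
  move=> /andP[u0 ut]; rewrite ltNge; apply/negP => fu.
  have : A u by split=> //; rewrite u0 (le_trans (ltW ut)).
  by move=> /(ge_inf (ex_intro _ t0 Al)); rewrite leNgt ut.
have ft : f t <= c.
  rewrite leNgt; apply/negP => fc.
  have [e e0 he] := cont_gt (cf t) fc.
  have [u Au ut] := inf_adherent e0 hA.
  have : c < f u.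
    apply: he; rewrite ltr_norml; have := ge_inf (ex_intro _ t0 Al) Au.
    by rewrite -/t in ut * => ?; apply/andP; split; lra.
  by case: Au => _; rewrite leNgt => /negP.
exists t; last split => //.
- rewrite tt1 andbT lt_neqAle t0t andbT; apply/eqP => e.
  by move: ft; rewrite -e leNgt f0.
- apply/eqP; rewrite eq_le ft /= leNgt; apply/negP => ftc.
  have hc : Num.min (f t0) (f t) <= c <= Num.max (f t0) (f t).
    by rewrite ge_min (ltW ftc) orbT le_max (ltW f0).
  have [u uI fu] := IVT t0t (continuous_subspaceT cf) hc.
  move: uI; rewrite in_itv /= => /andP[u0 ut].
  have [e|ne] := eqVneq u t; first by move: ftc; rewrite -e fu ltxx.
  have := below u; rewrite u0 lt_neqAle ne ut => /(_ isT).
  by rewrite fu ltxx.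
Qed.

(** At the first return to the level c, f would have grown since t0, where it exceeds c. *)
Lemma barrier f (df : R -> R) (c t0 t1 : R) : continuous f -> t0 <= t1 -> c < f t0 ->
  (forall u, t0 < u < t1 -> is_derive u (1:R) f (df u)) ->
  (forall u, t0 < u < t1 -> c < f u -> 0 <= df u) ->
  f t0 <= f t1.
Proof.
move=> cf t01 f0 d h.
have pos u : t0 <= u <= t1 -> c < f u.
  move=> /andP[u0 u1]; rewrite ltNge; apply/negP => fu.
  have [t /andP[tt0 tt1] [ft hb]] := first_hit cf u0 f0 fu.
  suff : f t0 <= f t by rewrite ft leNgt f0.
  have t1t : t <= t1 := le_trans tt1 u1.
  apply: (@is_derive_nondecr R f df _ _ (ltW tt0)).
  - by move=> v /andP[v0 v1]; apply: d; rewrite v0 (lt_le_trans v1).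
  - exact: continuous_subspaceT.
  - move=> v /andP[v0 v1]; apply: h; first by rewrite v0 (lt_le_trans v1).
    by apply: hb; rewrite (ltW v0).
apply: (@is_derive_nondecr R f df) => //; first exact: continuous_subspaceT.
by move=> u uI; apply: h => //; apply: pos; case/andP: uI => /ltW -> /ltW.
Qed.

(** Extending a function on the half line by its value at 0 turns one-sided
    continuity into continuity on the line. *)
Lemma max0_continuous x : {within `[0, +oo[, continuous x} ->
  continuous (fun t : R => x (Num.max 0 t)).
Proof.
move=> /continuous_within_itvcyP [cx c0] t.
apply/cvgrPdist_lt => e e0.
have pos r : 0 < r -> exists2 d : R, 0 < d & forall u, `|r - u| < d -> `|x r - x u| < e.
  move=> r0; have := cx r; rewrite in_itv /= r0 => /(_ isT)/cvgrPdist_lt/(_ e e0).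
  by move=> /nbhs_ballP[d /= d0 hd]; exists d.
have zero : exists2 d : R, 0 < d & forall u, 0 <= u < d -> `|x 0 - x u| < e.
  move/cvgrPdist_lt: c0 => /(_ e e0) /nbhs_ballP[d /= d0 hd]; exists d => // u /andP[u0 ud].
  have [->|ne] := eqVneq u 0; first by rewrite subrr normr0.
  have {}u0 : 0 < u by rewrite lt_neqAle eq_sym ne.
  by apply: hd => //; rewrite /ball /= sub0r normrN gtr0_norm.
apply/nbhs_ballP; case: (ltgtP t 0) => t0.
- exists (- t) => /=; first by rewrite oppr_gt0.
  move=> u; rewrite /ball /= ltr_norml => /andP[h1 h2].
  have u0 : u < 0 by lra.
  by rewrite (max_idPl (ltW u0)) subrr normr0.
- have [d d0 hd] := pos t t0; exists (Num.min d t) => /=; first by rewrite lt_min d0.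
  move=> u; rewrite /ball /= lt_min ltr_norml => /andP[/andP[h1 h2] h3].
  have u0 : 0 < u by move: h3; rewrite ltr_norml => /andP[]; lra.
  rewrite (max_idPr (ltW u0)); apply: hd.
  by rewrite ltr_norml h1.
- have [d d0 hd] := zero; exists d => //= u; rewrite /ball /= t0 sub0r normrN ltr_norml.
  move=> /andP[h1 h2]; apply: hd.
  by rewrite le_max lexx /= gt_max d0.
Qed.

Lemma is_derive_quotient f (t l : R) : is_derive t (1:R) f l ->
  forall e : R, 0 < e -> exists2 d : R, 0 < d &
    forall u, `|u - t| < d -> `|f u - f t - l * (u - t)| <= e * `|u - t|.
Proof.
move=> [dv dl] e e0.
move: dv; rewrite /derivable => /cvg_ex[l' hl].
have ll' : l = l' by rewrite -dl /derive; exact/cvg_lim.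
move: hl => /cvgrPdist_le /(_ e e0) /nbhs_ballP[d /= d0 hd].
exists d => // u ut; have [->|ne] := eqVneq u t; first by rewrite !subrr mulr0 subr0 normr0 mulr0.
have := hd (u - t); rewrite /ball /= sub0r normrN => /(_ ut); rewrite subr_eq0 => /(_ ne).
rewrite /= /GRing.scale /= mulr1 subrK -ll' => h.
have nz : u - t != 0 by rewrite subr_eq0.
have -> : f u - f t - l * (u - t) = - ((l - (u - t)^-1 * (f u - f t)) * (u - t)).
  by rewrite mulrBl mulrAC mulVf// mul1r; ring.
by rewrite normrN normrM ler_wpM2r.
Qed.

Lemma deriv_gt0 f (t l : R) : is_derive t (1:R) f l -> 0 < l ->
  exists2 d : R, 0 < d & forall u, `|u - t| < d ->
    (t < u -> f t < f u) /\ (u < t -> f u < f t).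
Proof.
move=> df l0; have l2 : 0 < l / 2 by rewrite divr_gt0.
have [d d0 hd] := is_derive_quotient df l2; exists d => // u /hd; rewrite ler_norml => /andP[h1 h2].
split=> h.
- have p : 0 < l * (u - t) by rewrite mulr_gt0// subr_gt0.
  by move: h1; rewrite gtr0_norm ?subr_gt0//; lra.
- have p : 0 < l * (t - u) by rewrite mulr_gt0// subr_gt0.
  by move: h2; rewrite ltr0_norm ?subr_lt0//; lra.
Qed.

Lemma is_derive_translate f (r t l : R) : is_derive (r + t) (1:R) f l ->
  is_derive t (1:R) (fun u => f (r + u)) l.
Proof.
move=> d; have d1 : is_derive t (1:R) (fun u => r + u) 1.
  by rewrite -[X in is_derive _ _ _ X]add0r; apply: is_deriveD.
have := @is_derive1_comp R f (fun u => r + u) t _ _ d d1.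
by rewrite mulr1.
Qed.

Lemma is_derive_scale_arg f (r t l : R) : is_derive (r * t) (1:R) f l ->
  is_derive t (1:R) (fun u => f (r * u)) (r * l).
Proof.
move=> d; have d1 : is_derive t (1:R) (fun u => r * u) r.
  by have := @is_deriveZ R _ _ id r t 1 1 (is_derive_id _ _); rewrite /GRing.scale /= mulr1.
have := @is_derive1_comp R f (fun u => r * u) t _ _ d d1.
by rewrite mulrC.
Qed.

Lemma is_derive_cmul (e t : R) : is_derive t (1:R) (fun v => e * v) e.
Proof.
by have := @is_deriveZ R _ _ id e t 1 1 (is_derive_id _ _); rewrite /GRing.scale /= mulr1.
Qed.

Lemma is_derive_ext_near f g (t l d : R) : 0 < d -> (forall u, `|u - t| < d -> f u = g u) ->
  is_derive t (1:R) f l -> is_derive t (1:R) g l.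
Proof.
move=> d0 h; apply: near_eq_is_derive => //.
by apply/nbhs_ballP; exists d => //= u; rewrite /ball /= distrC => /h.
Qed.

(** The nonlinear term a|a| of the field is of class C^1 although |a| is not. *)
Lemma is_derive_normM (x : R) : is_derive x (1:R) (fun u : R => `|u| * u) (2 * `|x|).
Proof.
have sq (y : R) : is_derive y (1:R) (fun u : R => u * u) (2 * y).
  by apply: is_derive_eq; rewrite /GRing.scale /=; ring.
case: (ltgtP x 0) => x0.
- apply: (@is_derive_ext_near (fun u => - (u * u)) _ _ _ (- x)); first by rewrite oppr_gt0.
    move=> u; rewrite ltr_norml => /andP[h1 h2].
    by rewrite ltr0_norm ?mulNr//; lra.
  by rewrite ltr0_norm// mulrN; apply: is_deriveN; exact: sq.
- apply: (@is_derive_ext_near (fun u => u * u) _ _ _ x) => //.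
    move=> u; rewrite ltr_norml => /andP[h1 h2].
    by rewrite gtr0_norm//; lra.
  by rewrite gtr0_norm//; exact: sq.
- rewrite x0 normr0 mulr0.
  have h : (fun h : R => h^-1 *: (`|h *: (1:R) + 0| * (h *: (1:R) + 0) - `|0 : R| * 0)) @ 0^' --> (0 : R).
    apply/cvgrPdist_lt => e e0; apply/nbhs_ballP; exists e => //= u.
    rewrite /ball /= sub0r normrN => ue u0.
    rewrite /GRing.scale /= mulr1 addr0 mulr0 subr0 sub0r normrN mulrCA mulVf// mulr1.
    by rewrite normr_id.
  split; first by apply/cvg_ex; exists 0.
  by apply/cvg_lim.
Qed.

End RealLine.

Section Flow.
Context {R : realType}.
Variables (beta s kappa : R).
Hypotheses (beta_gt0 : 0 < beta) (s_gt0 : 0 < s) (kappa_gt0 : 0 < kappa).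
Local Notation fa := (fa beta s kappa).
Local Notation fq := (fq s).
Local Notation bnd := (bnd beta s kappa).
Local Notation fat := (fat beta s kappa).
Local Notation fqt := (fqt beta s kappa).
Local Notation lipc := (lipc beta s kappa).
Let bnd0 : 0 < bnd := bnd_gt0 beta_gt0 s_gt0 kappa_gt0.
Let lip0 : 0 < lipc := lipc_gt0 beta_gt0 s_gt0 kappa_gt0.
Let latlip := fat_lip beta_gt0 s_gt0 kappa_gt0.
Let lqtlip := fqt_lip beta_gt0 s_gt0 kappa_gt0.

Definition flow_spec (z : R * R) (xy : (R -> R) * (R -> R)) : Prop :=
  [/\ xy.1 0 = z.1, xy.2 0 = z.2,
   forall t, is_derive t (1:R) xy.1 (fat t (xy.1 t) (xy.2 t)) &
   forall t, is_derive t (1:R) xy.2 (fqt t (xy.1 t) (xy.2 t))].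

Definition flow (z : R * R) : (R -> R) * (R -> R) :=
  if pselect (exists xy, flow_spec z xy) is left h then projT1 (cid h)
  else (fun=> 0, fun=> 0).
Definition pa z := (flow z).1.
Definition pq z := (flow z).2.

Lemma flowP z : flow_spec z (flow z).
Proof.
rewrite /flow; case: pselect => [h|[]]; first by case: cid.
exact: flow_exists.
Qed.

Lemma pa0 z : pa z 0 = z.1. Proof. by case: (flowP z). Qed.
Lemma pq0 z : pq z 0 = z.2. Proof. by case: (flowP z). Qed.
Lemma pa_derive z t : is_derive t (1:R) (pa z) (fat t (pa z t) (pq z t)).
Proof. by case: (flowP z). Qed.
Lemma pq_derive z t : is_derive t (1:R) (pq z) (fqt t (pa z t) (pq z t)).
Proof. by case: (flowP z). Qed.
Lemma pa_continuous z : continuous (pa z).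
Proof. by move=> t; apply: is_derive_cont (pa_derive z t). Qed.
Lemma pq_continuous z : continuous (pq z).
Proof. by move=> t; apply: is_derive_cont (pq_derive z t). Qed.

Lemma flow_solves z t0 t1 : solves fat fqt t0 t1 (pa z) (pq z).
Proof. by apply: solves_global => u; [exact: pa_derive|exact: pq_derive]. Qed.

(** Any solution on an interval around 0 that the truncated field sees is the orbit
    of its initial point. *)
Lemma flow_unique z (x y : R -> R) (t0 t1 : R) : t0 <= 0 <= t1 ->
  x 0 = z.1 -> y 0 = z.2 -> solves fat fqt t0 t1 x y ->
  forall t, t0 <= t <= t1 -> x t = pa z t /\ y t = pq z t.
Proof.
move=> t01 x0 y0 h t tI.
apply: (solves_unique (ltW lip0) latlip lqtlip h (@flow_solves z t0 t1) t01 tI).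
  by rewrite pa0.
by rewrite pq0.
Qed.

Lemma flow_shift z r t : pa (pa z r, pq z r) t = pa z (r + t) /\
  pq (pa z r, pq z r) t = pq z (r + t).
Proof.
have h : solves fat fqt (- `|t|) `|t| (fun u => pa z (r + u)) (fun u => pq z (r + u)).
  by apply: solves_global => u; apply: is_derive_translate; [exact: pa_derive|exact: pq_derive].
have tt : - `|t| <= t <= `|t| by rewrite -ler_norml.
have t0 : - `|t| <= 0 <= `|t| by rewrite oppr_le0 normr_ge0.
have ea : pa z (r + 0) = (pa z r, pq z r).1 by rewrite addr0.
have eq : pq z (r + 0) = (pa z r, pq z r).2 by rewrite addr0.
by have [-> ->] := flow_unique t0 ea eq h tt.
Qed.

Lemma clampN (M x : R) : 0 <= M -> clamp M (- x) = - clamp M x.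
Proof.
move=> M0; case: (clamp_cases x M0) => -[h ->]; case: (clamp_cases (- x) M0) => -[h' ->] //;
  lra.
Qed.

Lemma flow_opp z t : pa (- z.1, - z.2) t = - pa z t /\ pq (- z.1, - z.2) t = - pq z t.
Proof.
have h : solves fat fqt (- `|t|) `|t| (fun u => - pa z u) (fun u => - pq z u).
  apply: solves_global => u.
  - rewrite /fat !clampN ?ler01 ?(ltW bnd0)// fa_odd.
    by apply: is_deriveN; exact: pa_derive.
  - rewrite /fqt !clampN ?ler01 ?(ltW bnd0)// fq_odd.
    by apply: is_deriveN; exact: pq_derive.
have tt : - `|t| <= t <= `|t| by rewrite -ler_norml.
have t0 : - `|t| <= 0 <= `|t| by rewrite oppr_le0 normr_ge0.
have ea : - pa z 0 = (- z.1, - z.2).1 by rewrite pa0.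
have eq : - pq z 0 = (- z.1, - z.2).2 by rewrite pq0.
by have [-> ->] := flow_unique t0 ea eq h tt.
Qed.

Lemma flow_inj z z' t : pa z t = pa z' t -> pq z t = pq z' t -> z = z'.
Proof.
move=> ea eq.
have tt : - `|t| <= t <= `|t| by rewrite -ler_norml.
have t0 : - `|t| <= 0 <= `|t| by rewrite oppr_le0 normr_ge0.
have := solves_unique (ltW lip0) latlip lqtlip (@flow_solves z _ _) (@flow_solves z' _ _) tt t0 ea eq.
by rewrite !pa0 !pq0; case: z z' {ea eq} => ? ? [? ?] /= [-> ->].
Qed.

Lemma flow_dist z z' t : 0 <= t ->
  sqdist (pa z t) (pq z t) (pa z' t) (pq z' t) <=
  sqdist z.1 z.2 z'.1 z'.2 * expR (4 * lipc * t).
Proof.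
move=> t0.
have [h _] := dist_growth (ltW lip0) latlip lqtlip t0 (@flow_solves z _ _) (@flow_solves z' _ _).
by move: h; rewrite !pa0 !pq0 subr0.
Qed.

Lemma flow_close z (t d : R) : 0 <= t -> 0 < d ->
  exists2 r : R, 0 < r & forall z', `|z'.1 - z.1| < r -> `|z'.2 - z.2| < r ->
    forall u : R, 0 <= u <= t -> `|pa z' u - pa z u| < d /\ `|pq z' u - pq z u| < d.
Proof.
move=> t0 d0.
set E := expR (4 * lipc * t); have E0 : 0 < E by exact: expR_gt0.
have E1 : 1 <= E by rewrite -expR0 ler_expR !mulr_ge0// ltW.
pose r := d / (2 * E); have r0 : 0 < r by rewrite divr_gt0// mulr_gt0.
exists r => // z' h1 h2 u /andP[u0 ut].
have sq (x y : R) : 0 < y -> `|x| < y -> x * x <= y * y.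
  by move=> y0 xy; rewrite -expr2 -real_normK ?num_real// -expr2 ler_pXn2r ?nnegrE ?(ltW y0)// ltW.
have sq' (x y : R) : 0 < y -> x * x < y * y -> `|x| < y.
  move=> y0; rewrite -expr2 -real_normK ?num_real// -expr2.
  by rewrite ltr_pXn2r// nnegrE ltW.
have D : sqdist (pa z' u) (pq z' u) (pa z u) (pq z u) < d * d.
  apply: le_lt_trans (flow_dist z' z u0) _.
  have D0 : sqdist z'.1 z'.2 z.1 z.2 <= r * r + r * r by rewrite /sqdist lerD// sq.
  have uE : expR (4 * lipc * u) <= E by rewrite ler_expR ler_wpM2l// mulr_ge0// ltW.
  apply: (@le_lt_trans _ _ ((r * r + r * r) * (E * E))).
    apply: (@le_trans _ _ ((r * r + r * r) * E)).
      by apply: ler_pM; rewrite ?expR_ge0// sqdist_ge0.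
    by rewrite ler_wpM2l ?(ler_peMl (ltW E0))// addr_ge0// mulr_ge0// ltW.
  have -> : (r * r + r * r) * (E * E) = d * d / 2 by rewrite /r; field; rewrite gt_eqF.
  by rewrite ltr_pdivrMr// ltr_pMr ?mulr_gt0// ltr1n.
have p1 := sqr_ge0 (pa z' u - pa z u); have p2 := sqr_ge0 (pq z' u - pq z u).
rewrite !expr2 in p1 p2.
by split; apply: sq' => //; move: D; rewrite /sqdist; lra.
Qed.

(** By compactness the inequality holds with a margin, which continuous dependence
    on the initial point does not consume. *)
Lemma flow_open (h : R -> R -> R) (K : R) z (t1 t c : R) : 0 <= t1 -> t1 <= t -> 0 < K ->
  (forall x y x' y' : R, `|h x y - h x' y'| <= K * (`|x - x'| + `|y - y'|)) ->
  (forall u : R, t1 <= u <= t -> c < h (pa z u) (pq z u)) ->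
  exists2 r : R, 0 < r & forall z', `|z'.1 - z.1| < r -> `|z'.2 - z.2| < r ->
    forall u : R, t1 <= u <= t -> c < h (pa z' u) (pq z' u).
Proof.
move=> t10 t1t K0 hK hc; have t0 := le_trans t10 t1t.
have ch : continuous (fun u => h (pa z u) (pq z u)).
  move=> u; apply/cvgrPdist_lt => e e0; have e1 : 0 < e / (2 * K) by rewrite divr_gt0// mulr_gt0.
  have ca : {for u, continuous (pa z)} by exact: pa_continuous.
  have cq : {for u, continuous (pq z)} by exact: pq_continuous.
  move/cvgrPdist_lt : ca => /(_ _ e1) na; move/cvgrPdist_lt : cq => /(_ _ e1) nq.
  near=> v.
  apply: le_lt_trans (hK _ _ _ _) _.
  have h1 : `|pa z u - pa z v| < e / (2 * K) by near: v.
  have h2 : `|pq z u - pq z v| < e / (2 * K) by near: v.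
  have -> : e = K * (e / (2 * K) + e / (2 * K)) by field; rewrite gt_eqF.
  by rewrite ltr_pM2l// ltrD.
have [m mI hm] := EVT_min t1t (continuous_subspaceT ch).
have cm : c < h (pa z m) (pq z m) by apply: hc; rewrite in_itv /= in mI.
pose d := (h (pa z m) (pq z m) - c) / (2 * K).
have d0 : 0 < d by rewrite divr_gt0 ?subr_gt0// mulr_gt0.
have [r r0 hr] := flow_close z t0 d0; exists r => // z' h1 h2 u uI.
have [k1 k2] : `|pa z' u - pa z u| < d /\ `|pq z' u - pq z u| < d.
  by apply: hr => //; case/andP: uI => t1u ->; rewrite (le_trans t10).
have := hm u; rewrite in_itv /= uI => /(_ isT) hmu.
have := hK (pa z' u) (pq z' u) (pa z u) (pq z u).
have : K * (`|pa z' u - pa z u| + `|pq z' u - pq z u|) < K * (d + d).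
  by rewrite ltr_pM2l// ltrD.
have -> : K * (d + d) = h (pa z m) (pq z m) - c by rewrite /d; field; rewrite gt_eqF.
by move=> k3 k4; have := le_lt_trans k4 k3; rewrite ltr_norml => /andP[]; lra.
Unshelve. all: by end_near. Qed.

Definition inbox z t : Prop := `|pa z t| <= bnd /\ `|pq z t| <= 1.

Lemma inbox_pa z t : inbox z t -> is_derive t (1:R) (pa z) (fa (pa z t) (pq z t)).
Proof. by move=> [h1 h2]; have := pa_derive z t; rewrite /fat !clamp_id. Qed.
Lemma inbox_pq z t : inbox z t -> is_derive t (1:R) (pq z) (fq (pa z t) (pq z t)).
Proof. by move=> [h1 h2]; have := pq_derive z t; rewrite /fqt !clamp_id. Qed.

(** These are the initial points of bounded trajectories: in the box the
    truncation is not felt. *)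
Definition stays z : Prop := forall t, 0 <= t -> inbox z t.

Lemma stays_shift z r : stays z -> 0 <= r -> stays (pa z r, pq z r).
Proof. by move=> h r0 t t0; rewrite /inbox; have [-> ->] := flow_shift z r t; apply: h; rewrite addr_ge0. Qed.

Lemma stays_opp z : stays z -> stays (- z.1, - z.2).
Proof. by move=> h t t0; rewrite /inbox; have [-> ->] := flow_opp z t; rewrite !normrN; exact: h. Qed.

(** Above the level bnd the equation for a pushes up linearly, whatever q is, so that a
    solution exceeding this level is unbounded. *)
Lemma bounded_le_bnd (a q : R -> R) (M : R) : continuous a ->
  (forall t : R, 0 < t -> is_derive t (1:R) a (fa (a t) (q t))) ->
  (forall t, 0 <= t -> `|q t| <= 1) -> (forall t, 0 <= t -> `|a t| <= M) ->
  forall t, 0 <= t -> a t <= bnd.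
Proof.
move=> ca da hq hM t t0; rewrite leNgt; apply/negP => at_.
have b0 := b_gt0 beta_gt0 s_gt0.
have grow u : 0 <= u -> bnd < a u -> (beta + 2 * s) * (a u - bnd) <= fa (a u) (q u).
  move=> u0 au; rewrite /fa.
  have : kappa * q u <= kappa.
    by rewrite -[leRHS]mulr1 ler_wpM2l ?(ltW kappa_gt0)//; apply: le_trans (ler_norm _) (hq u u0).
  have -> : (beta + 2 * s) * (a u - bnd) = (beta + 2 * s) * a u - kappa.
    by rewrite mulrBr /bnd mulrCA mulfV ?mulr1// gt_eqF.
  have : 0 <= 2^-1 * (`|a u| * a u).
    by rewrite mulr_ge0// mulr_ge0//; move: bnd0; lra.
  by lra.
have up u : t <= u -> a t <= a u.
  move=> tu; apply: (@barrier R a (fun u => fa (a u) (q u)) bnd) => //.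
    by move=> v /andP[tv _]; apply: da; lra.
  move=> v /andP[tv _] av; apply: le_trans (grow v _ av); last by lra.
  by rewrite mulr_ge0// ?(ltW b0)//; lra.
pose e := (beta + 2 * s) * (a t - bnd).
have e0 : 0 < e by rewrite mulr_gt0// subr_gt0.
have lin u : t <= u -> a t + e * (u - t) <= a u.
  move=> tu; rewrite addrC -lerBrDr.
  have : a t - e * t <= a u - e * u.
    apply: (@is_derive_nondecr R (fun v => a v - e * v) (fun v => fa (a v) (q v) - e)) => //.
    - move=> v /andP[tv _]; have d1 := da v (le_lt_trans t0 tv).
      have d2 := is_derive_cmul e v.
      exact: is_deriveB.
    - apply: wcontB; first exact: continuous_subspaceT.
      exact: is_derive_within (is_derive_cmul e).
    - move=> v /andP[tv _]; have tv' := ltW tv; have := up v tv' => h.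
      have := grow v (le_trans t0 tv') (lt_le_trans at_ h).
      have : e <= (beta + 2 * s) * (a v - bnd) by rewrite /e ler_wpM2l ?(ltW b0)// lerB.
      by lra.
  by lra.
pose u := t + (`|M| + 1) / e.
have tu : t <= u by rewrite lerDl divr_ge0// ?(ltW e0)// addr_ge0.
have := lin u tu; rewrite /u addrAC subrr add0r mulrC divfK ?gt_eqF// => h.
have := hM u (le_trans t0 tu); have := ler_norm (a u); have := ler_norm M.
by rewrite -/u in h; move: at_ bnd0; lra.
Qed.

(** The bound on a is improved to bnd, after which the solution lies in the box and
    is recognized by uniqueness for the truncated field. *)
Lemma bounded_flow (a q : R -> R) (M : R) : continuous a -> continuous q ->
  (forall t : R, 0 < t -> is_derive t (1:R) a (fa (a t) (q t))) ->
  (forall t : R, 0 < t -> is_derive t (1:R) q (fq (a t) (q t))) ->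
  (forall t, 0 <= t -> `|q t| <= 1) -> (forall t, 0 <= t -> `|a t| <= M) ->
  stays (a 0, q 0) /\ forall t, 0 <= t -> a t = pa (a 0, q 0) t /\ q t = pq (a 0, q 0) t.
Proof.
move=> ca cq da dq hq hM.
have ub := bounded_le_bnd ca da hq hM.
have lb : forall t, 0 <= t -> - a t <= bnd.
  apply: (@bounded_le_bnd (fun t => - a t) (fun t => - q t) M).
  - exact: contN.
  - by move=> t t0; rewrite fa_odd; apply: is_deriveN; exact: da.
  - by move=> t t0; rewrite normrN; exact: hq.
  - by move=> t t0; rewrite normrN; exact: hM.
have box t : 0 <= t -> `|a t| <= bnd.
  by move=> t0; rewrite ler_norml ub// andbT lerNl lb.
have e t : 0 <= t -> a t = pa (a 0, q 0) t /\ q t = pq (a 0, q 0) t.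
  move=> t0; have tI : 0 <= t <= t by rewrite t0 lexx.
  apply: (@flow_unique (a 0, q 0) a q 0 t _ _ _ _ t tI) => //; first by rewrite lexx.
  split; [exact: continuous_subspaceT|exact: continuous_subspaceT|].
  move=> u /andP[u0 _]; rewrite /fat /fqt !clamp_id; first split.
  - exact: da.
  - exact: dq.
  - exact/hq/ltW.
  - exact/box/ltW.
split=> // t t0; rewrite /inbox; have [<- <-] := e t t0.
by split; [exact: box|exact: hq].
Qed.

End Flow.

Section Link.
Context {R : realType}.
Variables (beta sigma kappa : R).
Hypotheses (beta_gt0 : 0 < beta) (s_gt0 : 0 < sigma ^+ 2) (kappa_gt0 : 0 < kappa).
Local Notation s := (sigma ^+ 2).

Lemma field_aE (a q : R) : field_a beta sigma kappa (a, q) = fa beta s kappa a q.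
Proof.
rewrite /field_a /fa /=; congr (_ + _ - _); rewrite -mulrA; congr (_ * _).
by rewrite expr2 mulrA; congr (_ * _); rewrite [in RHS]normrEsg.
Qed.

Lemma field_qE (a q : R) : field_q sigma (a, q) = fq s a q.
Proof. by []. Qed.

Lemma bounded_trajectory_flow (a q : R -> R) : bounded_trajectory beta sigma kappa a q ->
  stays beta s kappa (a 0, q 0) /\
  forall t, 0 <= t -> a t = pa beta s kappa (a 0, q 0) t /\ q t = pq beta s kappa (a 0, q 0) t.
Proof.
move=> [[ca cq da dq ph] [M hM]].
pose a' t := a (Num.max 0 t); pose q' t := q (Num.max 0 t).
have e t : 0 <= t -> a' t = a t /\ q' t = q t.
  by move=> t0; rewrite /a' /q' (max_idPr t0).
have ext (x : R -> R) (t l : R) : 0 < t -> is_derive t (1:R) x l ->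
    is_derive t (1:R) (fun u => x (Num.max 0 u)) l.
  move=> t0; apply: (@is_derive_ext_near R x (fun u => x (Num.max 0 u)) t l t t0).
  move=> u; rewrite ltr_norml => /andP[h _].
  by rewrite max_r//; lra.
have da' (t : R) : 0 < t -> is_derive t (1:R) a' (fa beta s kappa (a' t) (q' t)).
  by move=> t0; have [-> ->] := e t (ltW t0); rewrite -field_aE; apply: ext => //; exact: da.
have dq' (t : R) : 0 < t -> is_derive t (1:R) q' (fq s (a' t) (q' t)).
  by move=> t0; have [-> ->] := e t (ltW t0); rewrite -field_qE; apply: ext => //; exact: dq.
have hq' (t : R) : 0 <= t -> `|q' t| <= 1.
  by move=> t0; have [_ ->] := e t t0; rewrite ler_norml; exact: ph.
have hM' (t : R) : 0 <= t -> `|a' t| <= M.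
  by move=> t0; have [-> _] := e t t0; exact: hM.
have [h1 h2] := bounded_flow beta_gt0 s_gt0 kappa_gt0
  (max0_continuous ca) (max0_continuous cq) da' dq' hq' hM'.
move: h1 h2; rewrite maxxx => h1 h2; split=> // t t0.
by have := h2 t t0; rewrite (max_idPr t0).
Qed.

Lemma flow_bounded_trajectory z : stays beta s kappa z ->
  bounded_trajectory beta sigma kappa (pa beta s kappa z) (pq beta s kappa z).
Proof.
move=> h; split; last by exists (bnd beta s kappa) => t /h[].
split.
- exact/continuous_subspaceT/pa_continuous.
- exact/continuous_subspaceT/pq_continuous.
- by move=> t t0; rewrite field_aE; apply: inbox_pa => //; exact/h/ltW.
- by move=> t t0; rewrite field_qE; apply: inbox_pq => //; exact/h/ltW.
- by move=> t /h[_]; rewrite ler_norml.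
Qed.

(** From some time on a is close to its limit, and before that it is bounded by
    compactness. *)
Lemma convergent_bounded (a q : R -> R) (l : R) : trajectory beta sigma kappa a q ->
  a t @[t --> +oo] --> l -> bounded_trajectory beta sigma kappa a q.
Proof.
move=> h al; split=> //.
have /cvgrPdist_lt /(_ 1 ltr01) [T [_ hT]] := al.
pose a' t := a (Num.max 0 t).
have ca : continuous a' by apply: max0_continuous; case: h.
pose T' := Num.max 0 (T + 1).
have T'0 : 0 <= T' by rewrite le_max lexx.
have cn : {within `[0, T'], continuous (fun t => `|a' t|)}.
  by apply: continuous_subspaceT; exact: cont_norm.
have [c _ hc] := EVT_max T'0 cn.
exists (`|a' c| + (`|l| + 1)) => t t0.
case: (leP t T') => tT.
  have := hc t; rewrite in_itv /= t0 tT => /(_ isT); rewrite /a' (max_idPr t0) => h1.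
  by apply: le_trans h1 _; rewrite lerDl addr_ge0.
have : `|l - a t| < 1.
  by apply: hT; apply: le_lt_trans tT; rewrite /T' le_max; apply/orP; right; lra.
have := ler_normB l (l - a t); rewrite subKr => h1 h2; have := normr_ge0 (a' c); lra.
Qed.

End Link.

(** * A Lyapunov function and the convergence of bounded orbits *)

Section Limits.
Context {R : realType}.
Implicit Types f : R -> R.

Lemma cvgyP f (l : R) :
  (forall e : R, 0 < e -> exists T : R, forall t, T <= t -> `|f t - l| <= e) <->
  f t @[t --> +oo] --> l.
Proof.
split=> h.
  apply/cvgrPdist_le => e e0; have [T hT] := h e e0.
  exists T; split=> [|t Tt]; first exact: num_real.
  by rewrite distrC; apply/hT/ltW.
move=> e e0; move/cvgrPdist_le : h => /(_ e e0)[T [_ hT]].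
exists (T + 1) => t Tt; rewrite distrC; apply: hT.
by apply: lt_le_trans Tt; rewrite ltrDl.
Qed.

Lemma ndecr_bounded_limit f (M : R) : (forall x y : R, 0 <= x -> x <= y -> f x <= f y) ->
  (forall t : R, 0 <= t -> f t <= M) ->
  exists l : R, (forall t : R, 0 <= t -> f t <= l) /\
    forall e : R, 0 < e -> exists2 T : R, 0 <= T & forall t : R, T <= t -> l - e <= f t.
Proof.
move=> h hM; pose A := [set f t | t in [set t : R | 0 <= t]].
have hA : has_sup A.
  by split; [exists (f 0), 0 => //=|exists M => _ [t t0 <-]; exact: hM].
exists (sup A); split.
  by move=> t t0; apply: ub_le_sup; [case: hA|exists t].
move=> e e0; have [_ [T T0 <-] hT] := sup_adherent e0 hA.
by exists T => // t Tt; apply: le_trans (ltW hT) _; exact: h.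
Qed.

Lemma lipschitz_of_derive f (df : R -> R) (M : R) (x y : R) : continuous f -> x <= y ->
  (forall u : R, x < u < y -> is_derive u (1:R) f (df u)) ->
  (forall u : R, x < u < y -> `|df u| <= M) -> `|f y - f x| <= M * (y - x).
Proof.
move=> cf xy d b; rewrite ler_norml.
have cM : {within `[x, y], continuous (fun u => M * u)}.
  exact: is_derive_within (is_derive_cmul M).
have h1 : M * x - f x <= M * y - f y.
  apply: (@is_derive_nondecr R (fun u => M * u - f u) (fun u => M - df u)) => //.
  - by move=> u uI; have d1 := d u uI; have d2 := is_derive_cmul M u; apply: is_deriveB.
  - by apply: wcontB => //; exact: continuous_subspaceT.
  - by move=> u uI; have := b u uI; rewrite ler_norml => /andP[]; lra.
have h2 : M * x + f x <= M * y + f y.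
  apply: (@is_derive_nondecr R (fun u => M * u + f u) (fun u => M + df u)) => //.
  - by move=> u uI; have d1 := d u uI; have d2 := is_derive_cmul M u; apply: is_deriveD.
  - by apply: wcontD => //; exact: continuous_subspaceT.
  - by move=> u uI; have := b u uI; rewrite ler_norml => /andP[]; lra.
by apply/andP; split; lra.
Qed.

Lemma unbounded_of_drift f (df : R -> R) (c T M : R) : continuous f -> 0 < c ->
  (forall t : R, T < t -> is_derive t (1:R) f (df t)) ->
  (forall t : R, T < t -> c <= df t) -> (forall t : R, T <= t -> f t <= M) -> False.
Proof.
move=> cf c0 d h hM.
have lin u : T <= u -> f T - c * T <= f u - c * u.
  move=> Tu; apply: (@is_derive_nondecr R (fun u => f u - c * u) (fun u => df u - c)) => //.
  - move=> v /andP[Tv _]; have d1 := d v Tv; have d2 := is_derive_cmul c v.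
    exact: is_deriveB.
  - apply: wcontB; first exact: continuous_subspaceT.
    exact: is_derive_within (is_derive_cmul c).
  - by move=> v /andP[Tv _]; have := h v Tv; lra.
pose u := T + (`|M - f T| + 1) / c.
have Tu : T <= u by rewrite lerDl divr_ge0// ?(ltW c0)// addr_ge0.
have := lin u Tu; have := hM u Tu; have := ler_norm (M - f T).
have -> : c * u = c * T + (`|M - f T| + 1) by rewrite /u mulrDr; congr (_ + _); field; rewrite gt_eqF.
by lra.
Qed.

End Limits.

Section Lyapunov.
Context {R : realType}.
Variables (beta s kappa ab qb : R).
Hypotheses (beta_gt0 : 0 < beta) (s_gt0 : 0 < s) (kappa_gt0 : 0 < kappa).
Hypotheses (ab_gt0 : 0 < ab) (qbE : qb = ab / (ab + 2 * s)).
Hypothesis abE : 2^-1 * ab * ab + (beta + 3 * s) * ab + 2 * beta * s + 4 * s * s = kappa.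
Local Notation fa := (fa beta s kappa).
Local Notation fq := (fq s).
Local Notation bnd := (bnd beta s kappa).

Lemma qb_gt0 : 0 < qb. Proof. by rewrite qbE divr_gt0// addr_gt0// mulr_gt0. Qed.
Lemma qb_lt1 : qb < 1.
Proof. by rewrite qbE ltr_pdivrMr ?mul1r ?ltrDl ?mulr_gt0// addr_gt0// mulr_gt0. Qed.
Lemma oneBqb : 1 - qb = 2 * s / (ab + 2 * s).
Proof. by rewrite qbE; field; rewrite gt_eqF// addr_gt0// mulr_gt0. Qed.

(** The curve on which q is momentarily at rest. *)
Definition a0 (q : R) : R := 2 * s * q / (1 - `|q|).

Lemma fq_a0 (q : R) : `|q| < 1 -> fq (a0 q) q = 0.
Proof.
move=> q1; have p : 0 < 1 - `|q| by rewrite subr_gt0.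
have e : `|a0 q| * q = a0 q * `|q|.
  rewrite /a0 !normrM normfV (gtr0_norm p) (@gtr0_norm _ 2)// (gtr0_norm s_gt0).
  by field; rewrite gt_eqF.
rewrite /fq mulrDl e /a0; field; rewrite gt_eqF//.
Qed.

Lemma fq_diffE (a q : R) : `|q| < 1 -> fq a q = (a - a0 q) - (`|a| - `|a0 q|) * q.
Proof. by move=> q1; rewrite -[LHS]subr0 -(fq_a0 q1) /fq; ring. Qed.

(** q' vanishes only on the curve a = a0 q, and controls the distance to it. *)
Lemma fq_ge (a q : R) : `|q| < 1 -> (1 - `|q|) * `|a - a0 q| <= `|fq a q|.
Proof.
move=> q1; rewrite fq_diffE//; apply: le_trans (lerB_dist _ _).
have := ler_wpM2r (normr_ge0 q) (ler_dist_dist a (a0 q)).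
move=> h; apply: (@ler_by_sub _ _ _ (`|a - a0 q| * `|q| - `| `|a| - `|a0 q| | * `|q|)).
  by rewrite subr_ge0.
by rewrite normrM; ring.
Qed.

(** q' has the sign of a - a0 q, and this product is the rate of increase of W. *)
Lemma fq_diss (a q : R) : `|q| < 1 -> 2^-1 * (fq a q * fq a q) <= fq a q * (a - a0 q).
Proof.
move=> q1; rewrite fq_diffE//; set d := a - a0 q; set e := `|a| - `|a0 q|.
have ed : e * e <= d * d.
  by rewrite -!expr2 -(@real_normK _ e) ?num_real// -(@real_normK _ d) ?num_real// ler_pXn2r ?nnegrE//; exact: ler_dist_dist.
have qq : q * q <= 1.
  by rewrite -expr2 -real_normK ?num_real// -[leRHS](expr1n _ 2%N) ler_pXn2r ?nnegrE// ltW.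
have e0 : 0 <= e * e by rewrite -expr2 sqr_ge0.
apply: (@ler_by_sub _ _ _ (2^-1 * ((d * d - e * e) + e * e * (1 - q * q)))); last by field.
by rewrite mulr_ge0// addr_ge0 ?subr_ge0// mulr_ge0// subr_ge0.
Qed.

Variable r : R.
Hypotheses (r_ge0 : 0 <= r) (r_lt1 : r < 1).

(** a0 is singular at |q| = 1; clamping at r < 1 makes its primitive total. *)
Definition a0c (q : R) : R := a0 (clamp r q).

Lemma clamp_r (q : R) : `|clamp r q| < 1.
Proof. exact: le_lt_trans (clamp_bound _ r_ge0) r_lt1. Qed.

Lemma a0c_continuous : continuous a0c.
Proof.
move=> q; rewrite /a0c /a0; apply: cvgM.
  by apply: cvgM; [exact: cvg_cst|exact: clamp_continuous].
apply: cvgV; first by rewrite gt_eqF// subr_gt0 clamp_r.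
by apply: cvgB; [exact: cvg_cst|apply: cvg_norm; exact: clamp_continuous].
Qed.

Lemma a0c_id (q : R) : `|q| <= r -> a0c q = a0 q.
Proof. by move=> h; rewrite /a0c clamp_id. Qed.

Lemma a0c_bound (q : R) : `|a0c q| <= 2 * s / (1 - r).
Proof.
rewrite /a0c /a0; have h := clamp_bound q r_ge0; have h1 := clamp_r q.
have p : 0 < 1 - `|clamp r q| by rewrite subr_gt0.
rewrite normrM normfV (gtr0_norm p) normrM gtr0_norm ?mulr_gt0// -!mulrA !ler_wpM2l ?(ltW s_gt0)//.
apply: (@le_trans _ _ (1 / (1 - `|clamp r q|))); first by rewrite ler_pM2r ?invr_gt0// ltW.
by rewrite mul1r lef_pV2 ?posrE ?subr_gt0// lerB.
Qed.

Definition A0 : R -> R := prim a0c.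

Lemma A0_derive (q : R) : is_derive q (1:R) A0 (a0c q).
Proof. exact: is_derive_prim a0c_continuous. Qed.

Lemma A0_0 : A0 0 = 0. Proof. exact: prim0 a0c_continuous. Qed.

Lemma a0N (q : R) : a0 (- q) = - a0 q.
Proof. by rewrite /a0 normrN; ring. Qed.

Lemma A0N (q : R) : A0 (- q) = A0 q.
Proof.
suff : forall u v : R, u <= v -> A0 (- u) - A0 u <= A0 (- v) - A0 v /\
    A0 u - A0 (- u) <= A0 v - A0 (- v).
  move=> h; case: (leP 0 q) => q0.
    by have := h _ _ q0; rewrite oppr0 subrr => -[]; lra.
  by have := h _ _ (ltW q0); rewrite oppr0 subrr => -[]; lra.
move=> u v uv.
have dN x : is_derive x (1:R) (fun x => A0 (- x)) (a0c x).
  have := @is_derive_scale_arg R A0 (-1) x (a0c (- 1 * x)) (A0_derive _).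
  rewrite (_ : (fun u0 => A0 (-1 * u0)) = (fun x => A0 (- x))); last by apply/funext => y; rewrite mulN1r.
  by rewrite !mulN1r {1}/a0c clampN// a0N opprK.
split.
- apply: (@ndecrT R (fun x => A0 (- x) - A0 x) (fun x => a0c x - a0c x)) => // x.
  + exact: is_deriveB (dN x) (A0_derive x).
  + by rewrite subrr.
- apply: (@ndecrT R (fun x => A0 x - A0 (- x)) (fun x => a0c x - a0c x)) => // x.
  + exact: is_deriveB (A0_derive x) (dN x).
  + by rewrite subrr.
Qed.

Lemma A0_bound (q : R) : `|A0 q| <= 2 * s / (1 - r) * `|q|.
Proof.
by have := derive_bound_lipschitz A0_derive a0c_bound q 0; rewrite A0_0 !subr0.
Qed.

(** For beta = 0 the system is Hamiltonian with energy W. Discounting adds beta a to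
    a', which contributes beta a q' to W'; the primitive of a0 replaces this term by
    beta (a - a0 q) q', which is nonnegative. *)
Definition W (a q : R) : R :=
  2^-1 * (a * a) - 2 * s * (a * q) - 2^-1 * (`|a| * a * q) + 2^-1 * kappa * (q * q) - beta * A0 q.
Definition w (q : R) : R := W (a0 q) q.

Lemma WN (a q : R) : W (- a) (- q) = W a q.
Proof. by rewrite /W normrN A0N; ring. Qed.

Lemma wN (q : R) : w (- q) = w q.
Proof. by rewrite /w a0N WN. Qed.

Lemma W00 : W 0 0 = 0.
Proof. by rewrite /W A0_0; ring. Qed.

Lemma W_derive (x y : R -> R) (t dx dy : R) :
  is_derive t (1:R) x dx -> is_derive t (1:R) y dy ->
  is_derive t (1:R) (fun t => W (x t) (y t))
    (fq (x t) (y t) * dx + (beta * (x t - a0c (y t)) - fa (x t) (y t)) * dy).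
Proof.
move=> hx hy.
have hn := @is_derive1_comp R (fun u : R => `|u| * u) x t _ _ (is_derive_normM (x t)) hx.
have hA := @is_derive1_comp R A0 y t _ _ (A0_derive (y t)) hy.
have h1 : is_derive t (1:R) (fun t => x t * x t) (2 * x t * dx).
  by apply: is_derive_eq; rewrite /GRing.scale /=; ring.
have h2 : is_derive t (1:R) (fun t => x t * y t) (x t * dy + y t * dx).
  by apply: is_derive_eq; rewrite /GRing.scale /=; ring.
have h3 : is_derive t (1:R) (fun t => y t * y t) (2 * y t * dy).
  by apply: is_derive_eq; rewrite /GRing.scale /=; ring.
have h4 : is_derive t (1:R) (fun t => `|x t| * x t * y t) (`|x t| * x t * dy + y t * (2 * `|x t| * dx)).
  have H := @is_deriveM R _ ((fun u : R => `|u| * u) \o x) y t 1 _ _ hn hy.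
  by apply: (is_derive_eq H); rewrite /GRing.scale /=; ring.
have H := is_deriveB (is_deriveD (is_deriveB (is_deriveB (is_deriveZ 2^-1 h1)
  (is_deriveZ (2 * s) h2)) (is_deriveZ 2^-1 h4)) (is_deriveZ (2^-1 * kappa) h3)) (is_deriveZ beta hA).
by apply: (is_derive_eq H); rewrite /fa /fq /GRing.scale /=; field.
Qed.

(** For given q, W is minimal at a = a0 q and grows quadratically from there. *)
Lemma W_sub_w (a q : R) : `|q| < 1 ->
  2^-1 * (1 - `|q|) * ((a - a0 q) * (a - a0 q)) <= W a q - w q /\
  W a q - w q <= 2^-1 * (1 + `|q|) * ((a - a0 q) * (a - a0 q)).
Proof.
move=> q1; have e := fq_a0 q1; set c := a0 q in e *.
pose B := 2^-1 * (`|a| * a - `|c| * c) - `|c| * (a - c).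
have E : W a q - w q = 2^-1 * ((a - c) * (a - c)) - q * B.
  rewrite /w -/c /W /B.
  have e' : 2 * s * q = c - `|c| * q by move: e; rewrite /fq; lra.
  have -> : 2 * s * (a * q) = a * (2 * s * q) by ring.
  have -> : 2 * s * (c * q) = c * (2 * s * q) by ring.
  by rewrite e'; field.
have B1 : `|B| <= 2^-1 * ((a - c) * (a - c)).
  have s1 := sqr_ge0 a; have s2 := sqr_ge0 c; have s3 := sqr_ge0 (a - c); rewrite !expr2 in s1 s2 s3.
  rewrite /B ler_norml; case: (leP 0 a) => ha; case: (leP 0 c) => hc.
  - by rewrite !ger0_norm//; apply/andP; split; lra.
  - rewrite (ger0_norm ha) (ltr0_norm hc).
    have m : a * c <= 0 by rewrite mulr_ge0_le0// ltW.
    by apply/andP; split; lra.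
  - rewrite (ger0_norm hc) (ltr0_norm ha).
    have m : a * c <= 0 by rewrite mulr_le0_ge0// ltW.
    by apply/andP; split; lra.
  - by rewrite !ltr0_norm//; apply/andP; split; lra.
have qB : `|q * B| <= `|q| * (2^-1 * ((a - c) * (a - c))) by rewrite normrM ler_wpM2l.
by move: qB; rewrite ler_norml E => /andP[]; split; lra.
Qed.

Lemma W_ge_w (a q : R) : `|q| < 1 -> w q <= W a q.
Proof.
move=> q1; have [h _] := W_sub_w a q1; rewrite -subr_ge0; apply: le_trans h.
apply: mulr_ge0; last by rewrite -expr2 sqr_ge0.
by rewrite mulr_ge0 ?subr_ge0 ?(ltW q1).
Qed.

Definition y_of (q : R) : R := (1 - q)^-1.

(** w without absolute values. Its derivative factors in terms of 1 / (1 - q), which is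
    increasing, so that w has a single critical point qb in ]0, 1[. *)
Definition wpos (q : R) : R :=
  2^-1 * kappa * (q * q) - 2 * s * s * (q * q * (1 - q)^-1) - beta * A0 q.

Lemma w_wpos (q : R) : 0 <= q < 1 -> w q = wpos q.
Proof.
move=> /andP[q0 q1]; have p : 1 - q != 0 by rewrite gt_eqF// subr_gt0.
have a0u : 0 <= a0 q by rewrite /a0 (ger0_norm q0) divr_ge0 ?mulr_ge0 ?(ltW s_gt0) ?subr_ge0 ?(ltW q1).
by rewrite /w /W (ger0_norm a0u) /a0 (ger0_norm q0) /wpos; field.
Qed.

Lemma wpos_derive (q : R) : q < 1 -> is_derive q (1:R) wpos
  (kappa * q - 2 * s * s * (q * q * (1 - q) ^- 2 + 2 * q * (1 - q)^-1) - beta * a0c q).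
Proof.
move=> q1; have p : 1 - q != 0 by rewrite gt_eqF// subr_gt0.
have d1 : is_derive q (1:R) (fun q : R => q * q) (2 * q).
  by apply: is_derive_eq; rewrite /GRing.scale /=; ring.
have d2 : is_derive q (1:R) (fun q : R => 1 - q) (- 1).
  have H := is_deriveB (is_derive_cst (1:R) q (1:R)) (is_derive_id q (1:R)).
  by apply: (is_derive_eq H); rewrite sub0r.
have d3 := @is_deriveV R (fun q : R => 1 - q) q _ 1 p d2.
have H := is_deriveB (is_deriveB (is_deriveZ (2^-1 * kappa) d1)
  (is_deriveZ (2 * s * s) (is_deriveM d1 d3))) (is_deriveZ beta (A0_derive q)).
by apply: (is_derive_eq H); rewrite /GRing.scale /=; field.
Qed.

Lemma wpos_derive_factor (q : R) : 0 <= q <= r ->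
  kappa * q - 2 * s * s * (q * q * (1 - q) ^- 2 + 2 * q * (1 - q)^-1) - beta * a0c q =
  q * ((y_of qb - y_of q) * (2 * s * s * (y_of qb + y_of q + 1) + 2 * beta * s)).
Proof.
move=> /andP[q0 qr]; have p : 1 - q != 0 by rewrite gt_eqF// subr_gt0 (le_lt_trans qr).
rewrite a0c_id ?ger0_norm// /a0 (ger0_norm q0) /y_of oneBqb -abE.
have abs0 : ab + 2 * s != 0 by rewrite gt_eqF// addr_gt0// mulr_gt0.
have s0 : s != 0 by rewrite gt_eqF.
by field; rewrite abs0 p s0.
Qed.

Lemma y_of_lt (x y : R) : x < y -> y < 1 -> y_of x < y_of y.
Proof.
move=> xy y1; rewrite /y_of ltf_pV2 ?posrE ?subr_gt0// ?(lt_trans xy)//.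
by rewrite ltrD2l ltrN2.
Qed.

Lemma y_of_gt0 (x : R) : x < 1 -> 0 < y_of x.
Proof. by move=> x1; rewrite /y_of invr_gt0 subr_gt0. Qed.

Lemma wpos_within (x y : R) : y < 1 -> {within `[x, y], continuous wpos}.
Proof.
move=> y1; apply: continuous_in_subspaceT => u; rewrite inE /= in_itv /= => /andP[_ uy].
by apply: is_derive_cont (wpos_derive _); exact: le_lt_trans y1.
Qed.

Lemma w_incr (x y : R) : 0 <= x -> x < y -> y <= r -> y <= qb -> w x < w y.
Proof.
move=> x0 xy yr yq.
have y1 : y < 1 := le_lt_trans yr r_lt1.
rewrite !w_wpos ?x0 ?(lt_trans xy) ?y1 ?(le_trans x0 (ltW xy))//.
have d u : x < u < y -> is_derive u (1:R) wpos
  (kappa * u - 2 * s * s * (u * u * (1 - u) ^- 2 + 2 * u * (1 - u)^-1) - beta * a0c u).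
  by move=> /andP[xu uy]; apply: wpos_derive; exact: lt_trans y1.
apply: (is_derive_incr xy d (wpos_within y1)) => u /andP[xu uy].
have u0 : 0 < u := le_lt_trans x0 xu.
rewrite wpos_derive_factor ?(ltW u0) ?(le_trans (ltW uy))//.
have u1 := lt_trans uy y1.
rewrite !mulr_gt0// ?subr_gt0 ?y_of_lt ?(lt_le_trans uy) ?qb_lt1//.
by rewrite !addr_gt0 ?mulr_gt0 ?addr_gt0 ?y_of_gt0 ?qb_lt1.
Qed.

Lemma w_decr (x y : R) : qb <= x -> x < y -> y <= r -> w y < w x.
Proof.
move=> qx xy yr.
have x0 : 0 <= x := le_trans (ltW qb_gt0) qx.
have y1 : y < 1 := le_lt_trans yr r_lt1.
rewrite !w_wpos ?x0 ?(lt_trans xy) ?y1 ?(le_trans x0 (ltW xy))//.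
rewrite -ltrN2.
have d u : x < u < y -> is_derive u (1:R) (fun u => - wpos u)
  (- (kappa * u - 2 * s * s * (u * u * (1 - u) ^- 2 + 2 * u * (1 - u)^-1) - beta * a0c u)).
  by move=> /andP[xu uy]; apply: is_deriveN; apply: wpos_derive; exact: lt_trans y1.
have c : {within `[x, y], continuous (fun u : R => - wpos u : R)} 
  by apply: wcontN; exact: wpos_within.
apply: (is_derive_incr xy d c) => u /andP[xu uy].
have u0 : 0 < u := le_lt_trans x0 xu.
rewrite wpos_derive_factor ?(ltW u0) ?(le_trans (ltW uy))//.
have u1 := lt_trans uy y1.
rewrite -mulrN -mulNr !mulr_gt0// ?opprB ?subr_gt0 ?y_of_lt ?(le_lt_trans qx)//.
by rewrite !addr_gt0 ?mulr_gt0 ?addr_gt0 ?y_of_gt0 ?qb_lt1.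
Qed.

Lemma w0 : w 0 = 0.
Proof. by rewrite /w /a0 mulr0 mul0r W00. Qed.

Lemma w_gt0 (q : R) : q != 0 -> `|q| <= r -> `|q| <= qb -> 0 < w q.
Proof.
move=> q0 qr qq; rewrite -w0 (_ : w q = w `|q|); last first.
  by case: (leP 0 q) => h; [rewrite ger0_norm|rewrite ltr0_norm// wN].
by apply: w_incr => //; rewrite normr_gt0.
Qed.

(** w is strictly monotone between the points -qb, 0 and qb and beyond them. This
    forbids q to oscillate between two limit points. *)
Lemma w_not_constant (l l' c0 : R) : l < l' ->
  exists2 c, l < c < l' & r < `|c| \/ w c <> c0.
Proof.
move=> ll'.
suff H (x y : R) : l < x -> x < y -> y < l' ->
    (`|x| <= r -> `|y| <= r -> w x <> w y) -> exists2 c, l < c < l' & r < `|c| \/ w c <> c0.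
  have q0 := qb_gt0.
  have piece (m : R) : l < m -> m <= l' ->
      (forall x y : R, l < x -> x < y -> y < m -> `|x| <= r -> `|y| <= r -> w x <> w y) ->
      exists2 c, l < c < l' & r < `|c| \/ w c <> c0.
    move=> lm ml' hw; pose x := l + (m - l) / 3; pose y := l + 2 * (m - l) / 3.
    have [lx xy ym] : [/\ l < x, x < y & y < m] by rewrite /x /y; split; lra.
    apply: (H x y lx xy (lt_le_trans ym ml')) => hx hy; exact: hw.
  have ne (a b : R) : a < b -> a <> b by move=> h e; move: h; rewrite e ltxx.
  have neg (x y : R) : w (- y) <> w (- x) -> w x <> w y by rewrite !wN => h /esym.
  case: (leP qb l) => h1.
    apply: (piece l') => // x y lx xy _ _; rewrite ler_norml => /andP[_ yr].
    by apply/nesym/ne/w_decr => //; lra.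
  case: (leP 0 l) => h2.
    apply: (piece (Num.min l' qb)); rewrite ?lt_min ?ll'// ?ge_min ?lexx//.
    move=> x y lx xy; rewrite lt_min => /andP[yl yq] _; rewrite ler_norml => /andP[_ yr].
    by apply/ne/w_incr => //; lra.
  case: (leP (- qb) l) => h3.
    apply: (piece (Num.min l' 0)); rewrite ?lt_min ?ll'// ?ge_min ?lexx//.
    move=> x y lx xy; rewrite lt_min => /andP[yl yq]; rewrite ler_norml => /andP[xr _] _.
    by apply/neg/ne/w_incr; lra.
  apply: (piece (Num.min l' (- qb))); rewrite ?lt_min ?ll'// ?ge_min ?lexx//.
  move=> x y lx xy; rewrite lt_min => /andP[yl yq]; rewrite ler_norml => /andP[xr _] _.
  by apply/neg/nesym/ne/w_decr; lra.
move=> lx xy yl' hw.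
case: (leP `|x| r) => xr; last by exists x; [rewrite lx (lt_trans xy)|left].
case: (leP `|y| r) => yr; last by exists y; [rewrite yl' (lt_trans lx)|left].
have [e|ne] := eqVneq (w x) c0; last by exists x; [rewrite lx (lt_trans xy)|right; apply/eqP].
exists y; first by rewrite yl' (lt_trans lx).
by right=> e'; apply: hw => //; rewrite e e'.
Qed.

Lemma W_bound (a q : R) : `|a| <= bnd -> `|q| <= 1 ->
  `|W a q| <= bnd * bnd + 2 * s * bnd + bnd * bnd + kappa + beta * (2 * s / (1 - r)).
Proof.
move=> ha hq; have b0 : 0 <= bnd := le_trans (normr_ge0 _) ha.
have h1 : `|a| * `|a| <= bnd * bnd by rewrite ler_pM.
have h2 : `|a| * `|q| <= bnd by rewrite -[leRHS]mulr1 ler_pM.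
have h3 : `|a| * `|a| * `|q| <= bnd * bnd by rewrite -[leRHS]mulr1 ler_pM// mulr_ge0.
have h4 : `|q| * `|q| <= 1 by rewrite -[leRHS]mulr1 ler_pM.
have h5 : `|A0 q| <= 2 * s / (1 - r).
  apply: le_trans (A0_bound q) _; rewrite ler_piMr// divr_ge0 ?mulr_ge0 ?(ltW s_gt0)// subr_ge0 ltW//.
have tri (x y z t v : R) : `|x - y - z + t - v| <= `|x| + `|y| + `|z| + `|t| + `|v|.
  apply: le_trans (ler_normB _ _) _; rewrite lerD2r.
  apply: le_trans (ler_normD _ _) _; rewrite lerD2r.
  apply: le_trans (ler_normB _ _) _; rewrite lerD2r.
  exact: ler_normB.
apply: le_trans (tri _ _ _ _ _) _.
rewrite !normrM !normr_id !(@ger0_norm _ 2^-1)// (@ger0_norm _ 2)// (gtr0_norm s_gt0) (gtr0_norm kappa_gt0) (gtr0_norm beta_gt0).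
have bb : 0 <= bnd * bnd by rewrite mulr_ge0.
have e1 : 2 * s * (`|a| * `|q|) <= 2 * s * bnd by rewrite ler_wpM2l// mulr_ge0// ltW.
have e2 : 2^-1 * kappa * (`|q| * `|q|) <= kappa.
  apply: (@le_trans _ _ (kappa * 1)); last by rewrite mulr1.
  rewrite -mulrA mulrCA ler_wpM2l ?(ltW kappa_gt0)//; move: h4; have := normr_ge0 q; lra.
have e3 : beta * `|A0 q| <= beta * (2 * s / (1 - r)) by rewrite ler_wpM2l// ltW.
by rewrite !lerD//; lra.
Qed.

Section Convergence.
Variables (a q : R -> R) (sg : R).
Hypothesis sg1 : sg * sg = 1.
Hypotheses (ca : continuous a) (cq : continuous q).
Hypothesis da : forall t : R, 0 < t -> is_derive t (1:R) a (sg * fa (a t) (q t)).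
Hypothesis dq : forall t : R, 0 < t -> is_derive t (1:R) q (sg * fq (a t) (q t)).
Hypothesis ba : forall t : R, 0 <= t -> `|a t| <= bnd.
Hypothesis bq : forall t : R, 0 <= t -> `|q t| <= r.

Let bq1 (t : R) : 0 <= t -> `|q t| < 1. Proof. by move=> /bq h; exact: le_lt_trans r_lt1. Qed.

Lemma W_orbit_derive (t : R) : 0 < t ->
  is_derive t (1:R) (fun t => sg * W (a t) (q t)) (beta * (fq (a t) (q t) * (a t - a0 (q t)))).
Proof.
move=> t0; have H := is_deriveZ sg (W_derive (da t0) (dq t0)).
apply: (is_derive_eq H); rewrite /GRing.scale /= a0c_id ?bq ?(ltW t0)//.
rewrite -[RHS]mul1r -sg1; ring.
Qed.

Lemma WAq_continuous : continuous (fun t => W (a t) (q t)).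
Proof.
move=> t; have cA : continuous A0 by move=> u; apply: is_derive_cont (A0_derive u).
rewrite /W; apply: cvgB; last by apply: cvgM; [exact: cvg_cst|apply: continuous_comp; [exact: cq|exact: cA]].
apply: cvgD; last by apply: cvgM; [exact: cvg_cst|apply: cvgM; exact: cq].
apply: cvgB; last by apply: cvgM; [exact: cvg_cst|apply: cvgM; [apply: cvgM; [apply: cvg_norm; exact: ca|exact: ca]|exact: cq]].
apply: cvgB; last by apply: cvgM; [exact: cvg_cst|apply: cvgM; [exact: ca|exact: cq]].
by apply: cvgM; [exact: cvg_cst|apply: cvgM; exact: ca].
Qed.

Lemma WAq_ndecr (x y : R) : 0 <= x -> x <= y -> sg * W (a x) (q x) <= sg * W (a y) (q y).
Proof.
move=> x0 xy.
have d u : x < u < y -> is_derive u (1:R) (fun t => sg * W (a t) (q t))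
    (beta * (fq (a u) (q u) * (a u - a0 (q u)))).
  by case/andP => h _; apply: W_orbit_derive; exact: le_lt_trans h.
apply: (is_derive_nondecr xy d).
- by apply: continuous_subspaceT; apply: contM; [exact: contC|exact: WAq_continuous].
- move=> u /andP[xu _]; have u0 : 0 <= u := le_trans x0 (ltW xu).
  rewrite mulr_ge0 ?(ltW beta_gt0)//; apply: le_trans (fq_diss _ (bq1 u0)).
  by rewrite mulr_ge0// -expr2 sqr_ge0.
Qed.

Let B : R := lipc beta s kappa * (bnd + 1).
Let K : R := lipc beta s kappa * (2 * B) + 1.
Let lip0 : 0 < lipc beta s kappa := lipc_gt0 beta_gt0 s_gt0 kappa_gt0.
Let bnd0 : 0 < bnd := bnd_gt0 beta_gt0 s_gt0 kappa_gt0.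

Let B_ge0 : 0 <= B.
Proof. by rewrite mulr_ge0 ?(ltW lip0)// addr_ge0 ?(ltW bnd0). Qed.
Let K_gt0 : 0 < K.
Proof. by rewrite /K ltr_wpDl// mulr_ge0 ?(ltW lip0)// mulr_ge0. Qed.

Let sg_norm : `|sg| = 1.
Proof.
have : `|sg| * `|sg| = 1 by rewrite -normrM sg1 normr1.
move=> h; apply/eqP; rewrite -(@eqrXn2 _ 2)// expr2 h expr1n //.
Qed.

Let box (t : R) : 0 <= t -> clamp bnd (a t) = a t /\ clamp 1 (q t) = q t.
Proof.
by move=> t0; rewrite !clamp_id ?ba//; apply/ltW/bq1.
Qed.

Let fab (t : R) : 0 <= t -> `|sg * fa (a t) (q t)| <= B.
Proof.
move=> t0; rewrite normrM sg_norm mul1r.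
have := fat_bound beta_gt0 s_gt0 kappa_gt0 0 (a t) (q t).
by rewrite /fat; have [-> ->] := box t0.
Qed.

Let fqb (t : R) : 0 <= t -> `|sg * fq (a t) (q t)| <= B.
Proof.
move=> t0; rewrite normrM sg_norm mul1r.
have := fqt_bound beta_gt0 s_gt0 kappa_gt0 0 (a t) (q t).
by rewrite /fqt; have [-> ->] := box t0.
Qed.

Let g_lip (x y : R) : 0 <= x -> x <= y ->
  `|fq (a y) (q y) - fq (a x) (q x)| <= K * (y - x).
Proof.
move=> x0 xy; have y0 := le_trans x0 xy.
apply: le_trans (fq_lip beta_gt0 s_gt0 kappa_gt0 _ _ (ba y0) (ltW (bq1 x0))) _.
have la : `|a y - a x| <= B * (y - x).
  apply: (lipschitz_of_derive ca xy (df := fun t => sg * fa (a t) (q t))) => u /andP[xu _].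
    by apply: da; exact: le_lt_trans xu.
  by apply: fab; exact: le_trans (ltW xu).
have lq : `|q y - q x| <= B * (y - x).
  apply: (lipschitz_of_derive cq xy (df := fun t => sg * fq (a t) (q t))) => u /andP[xu _].
    by apply: dq; exact: le_lt_trans xu.
  by apply: fqb; exact: le_trans (ltW xu).
apply: (@le_trans _ _ (lipc beta s kappa * (B * (y - x) + B * (y - x)))).
  by rewrite ler_wpM2l ?(ltW lip0)// lerD.
apply: (@ler_by_sub _ _ _ (y - x)); first by rewrite subr_ge0.
by rewrite /K; ring.
Qed.

Let V (t : R) : R := sg * W (a t) (q t).

Let V_limit : exists l : R, (forall t : R, 0 <= t -> V t <= l) /\
    forall e : R, 0 < e -> exists2 T : R, 0 <= T & forall t : R, T <= t -> l - e <= V t.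
Proof.
apply: (@ndecr_bounded_limit R V _ WAq_ndecr) => t t0.
apply: le_trans (ler_norm _) _; rewrite normrM sg_norm mul1r.
by apply: W_bound; [exact: ba|exact/ltW/bq1].
Qed.

(** Barbalat: a rate of change that is Lipschitz in time cannot stay away from
    0 without making W increase by a fixed amount infinitely often. *)
Let g_small (e : R) : 0 < e ->
  exists2 T : R, 0 <= T & forall t : R, T <= t -> `|fq (a t) (q t)| <= e.
Proof.
move=> e0; have [l [lub lim]] := V_limit.
pose h := e / (2 * K); pose c := beta * (2^-1 * ((e / 2) * (e / 2))).
have h0 : 0 < h by rewrite divr_gt0// mulr_gt0.
have c0 : 0 < c by rewrite !mulr_gt0// invr_gt0.
have ch : 0 < c * h / 2 by rewrite divr_gt0// mulr_gt0.
have [T T0 hT] := lim _ ch.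
exists T => // t Tt; have t0 := le_trans T0 Tt.
rewrite leNgt; apply/negP => ge.
have gu (u : R) : t <= u <= t + h -> e / 2 <= `|fq (a u) (q u)|.
  move=> /andP[tu uh]; have := g_lip t0 tu.
  have : K * (u - t) <= e / 2.
    apply: (@le_trans _ _ (K * h)); first by rewrite ler_wpM2l ?(ltW K_gt0)//; lra.
    by rewrite /h [X in X <= _](_ : _ = e / 2)//; field; rewrite gt_eqF.
  have := lerB_dist (fq (a t) (q t)) (fq (a t) (q t) - fq (a u) (q u)).
  rewrite subKr (distrC (fq (a t) (q t))) => h1 h2 h3; lra.
have th : t <= t + h by rewrite lerDl ltW.
have d u : t < u < t + h -> is_derive u (1:R) (fun u => V u - c * u)
    (beta * (fq (a u) (q u) * (a u - a0 (q u))) - c).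
  move=> /andP[tu _]; have d1 := W_orbit_derive (le_lt_trans t0 tu).
  have d2 := is_derive_cmul c u; exact: is_deriveB d1 d2.
have cV : {within `[t, t + h], continuous (fun u => V u - c * u)}.
  apply: wcontB; last exact: is_derive_within (is_derive_cmul c).
  by apply: continuous_subspaceT; apply: contM; [exact: contC|exact: WAq_continuous].
have : V t - c * t <= V (t + h) - c * (t + h).
  apply: (is_derive_nondecr th d cV) => u /andP[tu uh].
  have u0 : 0 <= u := le_trans t0 (ltW tu).
  rewrite subr_ge0 ler_wpM2l ?(ltW beta_gt0)//; apply: le_trans (fq_diss _ (bq1 u0)).
  rewrite ler_wpM2l ?invr_ge0//.
  have hg := gu u; rewrite (ltW tu) (ltW uh) in hg; have {}hg := hg isT.
  have e2 : 0 <= e / 2 by rewrite divr_ge0// ltW.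
  have -> : fq (a u) (q u) * fq (a u) (q u) = `|fq (a u) (q u)| * `|fq (a u) (q u)|.
    by rewrite -normrM ger0_norm// -expr2 sqr_ge0.
  by rewrite ler_pM.
have := lub (t + h) (le_trans t0 th); have := hT t Tt.
by lra.
Qed.

Let r1 : 0 < 1 - r. Proof. by rewrite subr_gt0. Qed.

Let d_small (e : R) : 0 < e ->
  exists2 T : R, 0 <= T & forall t : R, T <= t -> `|a t - a0 (q t)| <= e.
Proof.
move=> e0; have er : 0 < e * (1 - r) by rewrite mulr_gt0.
have [T T0 hT] := g_small er; exists T => // t Tt.
have t0 := le_trans T0 Tt.
have h1 := fq_ge (a t) (bq1 t0); have h2 := hT t Tt.
rewrite -(ler_pM2l r1) mulrC (mulrC _ e); apply: le_trans h2; apply: le_trans h1.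
by rewrite mulrC ler_wpM2r// lerD2l lerN2 bq.
Qed.

Let w_limit : exists l : R, forall e : R, 0 < e ->
  exists2 T : R, 0 <= T & forall t : R, T <= t -> `|w (q t) - l| <= e.
Proof.
have [l [lub lim]] := V_limit; exists (sg * l) => e e0.
have e2 : 0 < e / 2 by rewrite divr_gt0.
have em : 0 < Num.min 1 (e / 2) by rewrite lt_min ltr01.
have [T T0 hT] := lim _ e2; have [T' T'0 hT'] := d_small em.
exists (Num.max T T'); first by rewrite le_max T0.
move=> t; rewrite ge_max => /andP[Tt T't]; have t0 := le_trans T0 Tt.
have h1 := hT t Tt; have h2 := lub t t0; have h3 := hT' t T't.
have [h4 h5] := W_sub_w (a t) (bq1 t0).
set D := (a t - a0 (q t)) * (a t - a0 (q t)) in h4 h5.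
have D0 : 0 <= D by rewrite /D -expr2 sqr_ge0.
have De : D <= e / 2.
  have -> : D = `|a t - a0 (q t)| * `|a t - a0 (q t)| by rewrite -normrM ger0_norm.
  move: h3; rewrite le_min => /andP[h31 h32].
  by rewrite -[leRHS]mul1r ler_pM.
have h6 : 0 <= W (a t) (q t) - w (q t).
  by apply: le_trans h4; rewrite mulr_ge0// mulr_ge0 ?invr_ge0// subr_ge0 ltW// bq1.
have h7 : W (a t) (q t) - w (q t) <= e / 2.
  apply: le_trans h5 _; apply: le_trans De; rewrite ler_piMl//.
  by have := bq1 t0; lra.
have -> : w (q t) - sg * l = - (W (a t) (q t) - w (q t)) + sg * (V t - l).
  by rewrite /V mulrBr mulrA sg1 mul1r; ring.
apply: le_trans (ler_normD _ _) _; rewrite normrN normrM sg_norm mul1r.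
by rewrite (ger0_norm h6) ler0_norm ?subr_le0//; lra.
Qed.

Let q_limit : exists l : R, forall e : R, 0 < e ->
  exists2 T : R, 0 <= T & forall t : R, T <= t -> `|q t - l| <= e.
Proof.
have [wl hwl] := w_limit.
have avoid (c : R) : r < `|c| \/ w c <> wl ->
    exists2 T : R, 0 <= T & forall t : R, T <= t -> q t <> c.
  move=> [rc|/eqP wc].
    by exists 0 => // t t0 e; move: rc; rewrite -e ltNge bq.
  have e0 : 0 < `|w c - wl| / 2 by rewrite divr_gt0// normr_gt0 subr_eq0.
  have [T T0 hT] := hwl _ e0; exists T => // t Tt e.
  by have := hT t Tt; rewrite e; have := e0; lra.
have side (c : R) : r < `|c| \/ w c <> wl ->
    exists2 T : R, 0 <= T & (forall t : R, T <= t -> c < q t) \/ (forall t : R, T <= t -> q t < c).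
  move=> /avoid[T T0 hT]; exists T => //.
  case: (ltgtP c (q T)) => [cq'|qc|e]; last by case: (hT T (lexx T)).
  - left=> t Tt; rewrite ltNge; apply/negP => qt.
    have [u /andP[Tu _] [e _]] := first_hit cq Tt cq' qt.
    by have := hT u (ltW Tu).
  - right=> t Tt; rewrite ltNge; apply/negP => qt.
    have cN : continuous (fun t => - q t) by exact: contN.
    have [||u /andP[Tu _] [e _]] := @first_hit R (fun t => - q t) (- c) T t cN Tt.
    + by rewrite ltrN2.
    + by rewrite lerN2.
    + by have := hT u (ltW Tu); move/oppr_inj : e.
pose A := [set c : R | exists2 T : R, 0 <= T & forall t : R, T <= t -> c < q t].
have Aub : ubound A r.
  move=> c [T T0 hT]; have := hT T (lexx T); have := bq T0.
  by rewrite ler_norml => /andP[_ h1] h2; exact: le_trans (ltW h2) h1.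
have A0' : A (- r - 1).
  by exists 0 => // t t0; have := bq t0; rewrite ler_norml => /andP[]; lra.
have hA : has_sup A by split; [exists (- r - 1)|exists r].
exists (sup A) => e e0.
have [c1 [T1 T10 hT1] hc1] := sup_adherent e0 hA.
have [|c2 /andP[lc2 c2e] hc2] := @w_not_constant (sup A) (sup A + e) wl.
  by rewrite ltrDl.
have [T2 T20 hT2] := side _ hc2.
exists (Num.max T1 T2); first by rewrite le_max T10.
move=> t; rewrite ge_max => /andP[T1t T2t].
case: hT2 => hT2.
  have : A c2 by exists T2.
  by move=> /(ub_le_sup (proj2 hA)); rewrite leNgt lc2.
rewrite ler_norml; apply/andP; split; last by have := hT2 t T2t; lra.
by have := hT1 t T1t; lra.
Qed.

Lemma a0_zero (l : R) : `|l| < 1 -> fa (a0 l) l = 0 -> [\/ l = 0, l = qb | l = - qb].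
Proof.
have pos (m : R) : 0 <= m -> m < 1 -> fa (a0 m) m = 0 -> m = 0 \/ m = qb.
  move=> m0 m1; have p : 1 - m != 0 by rewrite gt_eqF// subr_gt0.
  have a0m : 0 <= a0 m by rewrite /a0 (ger0_norm m0) divr_ge0 ?mulr_ge0 ?(ltW s_gt0) ?subr_ge0 ?(ltW m1).
  have abs0 : ab + 2 * s != 0 by rewrite gt_eqF// addr_gt0// mulr_gt0.
  have sn0 : s != 0 by rewrite gt_eqF.
  have -> : fa (a0 m) m = - (m * ((y_of qb - y_of m) * (2 * s * s * (y_of qb + y_of m + 1) + 2 * beta * s))).
    rewrite /fa (ger0_norm a0m) /a0 (ger0_norm m0) /y_of oneBqb -abE.
    by field; rewrite abs0 p sn0.
  have Y : 0 < 2 * s * s * (y_of qb + y_of m + 1) + 2 * beta * s.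
    by rewrite !addr_gt0 ?mulr_gt0 ?addr_gt0 ?y_of_gt0 ?qb_lt1.
  move/eqP; rewrite oppr_eq0 !mulf_eq0 (gt_eqF Y) orbF => /orP[/eqP|]; first by left.
  by rewrite subr_eq0 => /eqP /invr_inj h; right; move: h; lra.
move=> l1; case: (leP 0 l) => l0.
  move=> h; have lt1 : l < 1 by exact: le_lt_trans (ler_norm _) l1.
  by case: (pos l l0 lt1 h) => ->; [constructor 1|constructor 2].
move=> h; have := pos (- l); rewrite oppr_ge0 (ltW l0) -(ltr0_norm l0) l1 (ltr0_norm l0) a0N fa_odd h oppr0.
move=> /(_ isT isT erefl) [e|e]; first by constructor 1; apply: oppr_inj; rewrite e oppr0.
by constructor 3; rewrite -e opprK.
Qed.

(** W is bounded and monotone along the orbit, and its rate of change dominates q'^2: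
    so q' tends to 0, then a - a0 q does, then w (q t) converges, and q with it. The sign
    sg allows to follow orbits backwards in time as well. *)
Lemma orbit_converges : exists l : R,
  [/\ `|l| <= r, q t @[t --> +oo] --> l, a t @[t --> +oo] --> a0 l,
      [\/ l = 0, l = qb | l = - qb] &
      forall t : R, 0 <= t -> sg * W (a t) (q t) <= sg * w l].
Proof.
have [l hl] := q_limit; exists l.
have lr : `|l| <= r.
  apply/ler_addgt0Pr => e e0; have [T T0 hT] := hl e e0.
  have := ler_normD (q T) (l - q T); rewrite addrC subrK => h.
  by apply: le_trans h _; rewrite lerD ?bq// distrC hT.
have l1 : `|l| < 1 := le_lt_trans lr r_lt1.
have ql : q t @[t --> +oo] --> l by apply/cvgyP => e /hl[T _ hT]; exists T.
have a0l : a0c (q t) @[t --> +oo] --> a0c l.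
  by apply: continuous_cvg => //; exact: a0c_continuous.
have al : a t @[t --> +oo] --> a0 l.
  rewrite -(a0c_id lr).
  have : a t - a0c (q t) @[t --> +oo] --> (0 : R).
    apply/cvgyP => e /d_small[T T0 hT]; exists T => t Tt.
    by rewrite subr0 a0c_id ?bq ?(le_trans T0)// hT.
  move=> h; have -> : a = (fun t => (a t - a0c (q t)) + a0c (q t)).
    by apply/funext => u; rewrite subrK.
  by rewrite -[X in _ --> X]add0r; exact: cvgD.
have fal : sg * fa (a t) (q t) @[t --> +oo] --> sg * fa (a0 l) l.
  apply: cvgM; first exact: cvg_cst.
  apply: cvgB; last by apply: cvgM => //; exact: cvg_cst.
  apply: cvgD; first by apply: cvgM => //; exact: cvg_cst.
  by apply: cvgM; [exact: cvg_cst|apply: cvgM => //; exact: cvg_norm].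
have fa0 : fa (a0 l) l = 0.
  set c := sg * fa (a0 l) l in fal.
  suff : c = 0 by move=> /eqP; rewrite mulf_eq0 -normr_eq0 sg_norm oner_eq0 /= => /eqP.
  apply/eqP; case: (ltgtP c 0) => // c0; exfalso.
  - have c2 : 0 < - c / 2 by rewrite divr_gt0// oppr_gt0.
    have [T hT] := (proj2 (cvgyP _ _) fal) _ c2.
    have T0 : 0 <= Num.max 0 T by rewrite le_max lexx.
    have cN : continuous (fun t => - a t) by exact: contN.
    apply: (@unbounded_of_drift R _ (fun t => - (sg * fa (a t) (q t))) (- c / 2) (Num.max 0 T) bnd cN c2).
    + by move=> t Tt; apply: is_deriveN; apply: da; exact: le_lt_trans Tt.
    + move=> t; rewrite gt_max => /andP[_ Tt]; have := hT t (ltW Tt).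
      by rewrite ler_norml => /andP[]; lra.
    + by move=> t Tt; have := ba (le_trans T0 Tt); rewrite ler_norml => /andP[]; lra.
  - have c2 : 0 < c / 2 by rewrite divr_gt0.
    have [T hT] := (proj2 (cvgyP _ _) fal) _ c2.
    have T0 : 0 <= Num.max 0 T by rewrite le_max lexx.
    apply: (@unbounded_of_drift R _ (fun t => (sg * fa (a t) (q t))) (c / 2) (Num.max 0 T) bnd ca c2).
    + by move=> t Tt; apply: da; exact: le_lt_trans Tt.
    + move=> t; rewrite gt_max => /andP[_ Tt]; have := hT t (ltW Tt).
      by rewrite ler_norml => /andP[]; lra.
    + by move=> t Tt; have := ba (le_trans T0 Tt); rewrite ler_norml => /andP[]; lra.
split=> //; first exact: a0_zero.
have Wl : sg * W (a t) (q t) @[t --> +oo] --> sg * w l.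
  have cA : continuous A0 by move=> u; apply: is_derive_cont (A0_derive u).
  rewrite /w /W; apply: cvgM; first exact: cvg_cst.
  apply: cvgB; last by apply: cvgM; [exact: cvg_cst|apply: continuous_cvg => //; exact: cA].
  apply: cvgD; last by apply: cvgM; [exact: cvg_cst|apply: cvgM].
  apply: cvgB; last by apply: cvgM; [exact: cvg_cst|apply: cvgM => //; apply: cvgM => //; exact: cvg_norm].
  apply: cvgB; last by apply: cvgM; [exact: cvg_cst|apply: cvgM].
  by apply: cvgM; [exact: cvg_cst|apply: cvgM].
move=> t t0; apply/ler_addgt0Pr => e e0.
have [T hT] := (proj2 (cvgyP _ _) Wl) _ e0.
have := hT (Num.max t T); rewrite le_max lexx orbT => /(_ isT).
have := @WAq_ndecr t (Num.max t T) t0; rewrite le_max lexx => /(_ isT).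
by rewrite ler_norml => h /andP[_]; lra.
Qed.

(** W stops increasing only at rest. *)
Lemma W_constant (l : R) (t0 : R) : 0 <= t0 ->
  (forall t : R, 0 <= t -> sg * W (a t) (q t) <= sg * w l) ->
  sg * w l <= sg * W (a t0) (q t0) -> forall t : R, t0 < t -> fq (a t) (q t) = 0.
Proof.
move=> t00 h h0 t tt0; have t0' : 0 < t := le_lt_trans t00 tt0.
have d := W_orbit_derive t0'; set D := _ * _ in d.
have eqV (u : R) : t0 <= u -> sg * W (a u) (q u) = sg * w l.
  move=> u0; apply/eqP; rewrite eq_le h ?(le_trans t00)//=.
  by apply: le_trans h0 _; exact: WAq_ndecr.
have D0 : D <= 0.
  rewrite leNgt; apply/negP => D0; have [e e0 he] := deriv_gt0 d D0.
  have [|+ _] := he (t + e / 2).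
    by rewrite addrAC subrr add0r gtr0_norm ?divr_gt0//; lra.
  have h1 : t0 <= t by exact: ltW.
  have h2 : t0 <= t + e / 2 by lra.
  rewrite (eqV t h1) (eqV _ h2) ltxx => H.
  by have := H; rewrite ltrDl divr_gt0// => /(_ isT).
have := fq_diss (a t) (bq1 (ltW t0')).
move: D0; rewrite /D pmulr_rle0// => D0 h1.
have : fq (a t) (q t) * fq (a t) (q t) <= 0 by lra.
by rewrite -expr2 => h2; apply/eqP; rewrite -sqrf_eq0 eq_le h2 sqr_ge0.
Qed.

End Convergence.

End Lyapunov.

(** * The wedges at the self-organized point *)

Section Shooting.
Context {R : realType}.

(** An interval is not the union of two disjoint nonempty open sets. *)
Lemma shooting (O1 O2 : R -> Prop) (lo hi : R) : lo <= hi -> O1 hi -> O2 lo ->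
  (forall c, lo <= c <= hi -> O1 c -> exists2 d : R, 0 < d & forall c', `|c' - c| < d -> O1 c') ->
  (forall c, lo <= c <= hi -> O2 c -> exists2 d : R, 0 < d & forall c', `|c' - c| < d -> O2 c') ->
  (forall c, O1 c -> O2 c -> False) ->
  exists2 c : R, lo <= c <= hi & ~ O1 c /\ ~ O2 c.
Proof.
move=> lh h1 h2 op1 op2 dis.
pose S := [set c | lo <= c <= hi /\ O2 c].
have hS : has_sup S.
  by split; [exists lo; split=> //; rewrite lexx lh|exists hi => c [/andP[]]].
have cI : lo <= sup S <= hi.
  apply/andP; split; first by apply: ub_le_sup; [case: hS|split=> //; rewrite lexx lh].
  by apply: ge_sup; [case: hS|move=> c [/andP[]]].
exists (sup S) => //; split=> hO.
- have [d d0 hd] := op1 _ cI hO; have [c [cI' c2] hc] := sup_adherent d0 hS.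
  apply: (dis c) => //; apply: hd; have := ub_le_sup (proj2 hS) (conj cI' c2).
  by move=> h; rewrite ltr_norml; apply/andP; split; lra.
- have [d d0 hd] := op2 _ cI hO; case: (eqVneq (sup S) hi) => e.
    by apply: (dis hi) => //; rewrite -e.
  have lt : sup S < hi by rewrite lt_neqAle e; case/andP: cI.
  pose c := Num.min hi (sup S + d / 2).
  have c1 : sup S < c by rewrite lt_min lt ltrDl divr_gt0.
  have c2 : c <= sup S + d / 2 by rewrite ge_min lexx orbT.
  have c3 : c <= hi by rewrite ge_min lexx.
  have : S c.
    split; first by rewrite c3 andbT (le_trans _ (ltW c1))//; case/andP: cI.
    by apply: hd; rewrite ltr_norml; apply/andP; split; lra.
  by move=> /(ub_le_sup (proj2 hS)); rewrite leNgt c1.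
Qed.

(** At the first zero the slope would not be positive. *)
Lemma stay_pos (f : R -> R) (t0 t1 : R) : continuous f -> t0 <= t1 -> 0 < f t0 ->
  (forall t : R, t0 < t <= t1 -> f t = 0 -> (forall u : R, t0 <= u < t -> 0 < f u) ->
     exists2 l : R, 0 < l & is_derive t (1:R) f l) ->
  forall t : R, t0 <= t <= t1 -> 0 < f t.
Proof.
move=> cf t01 f0 h t /andP[tt0 tt1]; rewrite ltNge; apply/negP => ft.
have [u /andP[u0 ut] [fu hu]] := first_hit cf tt0 f0 ft.
have [|l l0 dl] := h u _ fu hu; first by rewrite u0 (le_trans ut).
have [d d0 hd] := deriv_gt0 dl l0.
pose v := Num.max t0 (u - d / 2).
have vu : v < u by rewrite gt_max u0 ltrBlDr ltrDl divr_gt0.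
have tv : t0 <= v by rewrite le_max lexx.
have dv : u - d / 2 <= v by rewrite le_max lexx orbT.
have [|_ /(_ vu)] := hd v; first by rewrite ltr_norml; apply/andP; split; lra.
by rewrite fu ltNge ltW// hu// tv vu.
Qed.

Lemma minl_le (x y : R) : Num.min x y <= x. Proof. by rewrite ge_min lexx. Qed.
Lemma minr_le (x y : R) : Num.min x y <= y. Proof. by rewrite ge_min lexx orbT. Qed.

Lemma cont_min (f g : R -> R) : continuous f -> continuous g ->
  continuous (fun u : R => Num.min (f u) (g u)).
Proof. by move=> cf cg u; exact: (@continuous_min R R f g u (cf u) (cg u)). Qed.

Lemma cont_sub_arg (f : R -> R) (t : R) : continuous f -> continuous (fun u : R => f (t - u)).
Proof.
move=> cf u; apply: (@continuous_comp _ _ _ (fun u : R => t - u) f); last exact: cf.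
by apply: cvgB; [exact: cvg_cst|exact: cvg_id].
Qed.

Lemma cont_add_arg (f : R -> R) (t : R) : continuous f -> continuous (fun u : R => f (t + u)).
Proof.
move=> cf u; apply: (@continuous_comp _ _ _ (fun u : R => t + u) f); last exact: cf.
by apply: cvgD; [exact: cvg_cst|exact: cvg_id].
Qed.

End Shooting.

Section PhasePlane.
Context {R : realType}.
Variables (beta s kappa ab qb : R).
Hypotheses (beta_gt0 : 0 < beta) (s_gt0 : 0 < s) (kappa_gt0 : 0 < kappa).
Hypotheses (ab_gt0 : 0 < ab) (qbE : qb = ab / (ab + 2 * s)).
Hypothesis abE : 2^-1 * ab * ab + (beta + 3 * s) * ab + 2 * beta * s + 4 * s * s = kappa.
Local Notation fa := (fa beta s kappa).
Local Notation fq := (fq s).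
Local Notation bnd := (bnd beta s kappa).
Local Notation fat := (fat beta s kappa).
Local Notation fqt := (fqt beta s kappa).
Local Notation lipc := (lipc beta s kappa).
Local Notation pa := (pa beta s kappa).
Local Notation pq := (pq beta s kappa).
Local Notation inbox := (inbox beta s kappa).
Local Notation stays := (stays beta s kappa).
Local Notation a0 := (a0 s).

Let bnd0 : 0 < bnd := bnd_gt0 beta_gt0 s_gt0 kappa_gt0.
Let b0 : 0 < beta + 2 * s := b_gt0 beta_gt0 s_gt0.
Let lip0 : 0 < lipc := lipc_gt0 beta_gt0 s_gt0 kappa_gt0.
Let qb0 : 0 < qb := qb_gt0 s_gt0 ab_gt0 qbE.
Let qb1 : qb < 1 := qb_lt1 s_gt0 ab_gt0 qbE.
Let ab2s : 0 < ab + 2 * s. Proof. by rewrite addr_gt0// mulr_gt0. Qed.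
Let dpa := pa_derive beta_gt0 s_gt0 kappa_gt0.
Let dpq := pq_derive beta_gt0 s_gt0 kappa_gt0.
Let cpa z : continuous (pa z). Proof. exact: pa_continuous. Qed.
Let cpq z : continuous (pq z). Proof. exact: pq_continuous. Qed.

Lemma bndE : (beta + 2 * s) * bnd = kappa.
Proof. by rewrite /bnd mulrCA mulfV ?mulr1// gt_eqF. Qed.

Lemma fa_stat : fa ab qb = 0.
Proof.
by rewrite /fa (gtr0_norm ab_gt0) qbE -abE; field; rewrite gt_eqF.
Qed.

Lemma fq_stat : fq ab qb = 0.
Proof. by rewrite /fq (gtr0_norm ab_gt0) qbE; field; rewrite gt_eqF. Qed.

Lemma ab_le_bnd : ab < bnd.
Proof.
rewrite -(ltr_pM2l b0) bndE; have := fa_stat; rewrite /fa (gtr0_norm ab_gt0).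
have h1 : kappa * qb < kappa by rewrite -[ltRHS]mulr1 ltr_pM2l.
have h2 : 0 < 2^-1 * (ab * ab) by rewrite !mulr_gt0// invr_gt0.
lra.
Qed.

(** On the boundary q = 1 of the strip q' = a - 2 s - |a| is negative. *)
Lemma strip_le1 z (t : R) : z.2 <= 1 -> 0 <= t -> pq z t <= 1.
Proof.
move=> z1 t0; rewrite leNgt; apply/negP => h.
have cg : continuous (fun u : R => pq z (t - u)) by apply: cont_sub_arg; exact: cpq.
have dg (u : R) : 0 < u < t -> is_derive u (1:R) (fun u => pq z (t - u)) (- fqt (t - u) (pa z (t - u)) (pq z (t - u))).
  move=> _; have d1 : is_derive u (1:R) (fun u : R => t - u) (- 1).
    have H := is_deriveB (is_derive_cst t u (1:R)) (is_derive_id u (1:R)).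
    by apply: (is_derive_eq H); rewrite sub0r.
  have H := @is_derive1_comp R (pq z) (fun u => t - u) u _ _ (dpq z (t - u)) d1.
  by apply: (is_derive_eq H); rewrite mulrN1.
have h0 : 1 < pq z (t - 0) by rewrite subr0.
have := barrier cg t0 h0 dg; rewrite subr0 subrr pq0// => H.
suff : pq z t <= z.2 by move=> h'; move: h; rewrite ltNge (le_trans h').
apply: H => u _ hu; rewrite oppr_ge0 /fqt /fq.
have -> : clamp 1 (pq z (t - u)) = 1.
  by case: (clamp_cases (pq z (t - u)) (@ler01 R)) => -[k1 k2] //; lra.
have := ler_norm (clamp bnd (pa z (t - u))); move: s_gt0; lra.
Qed.

Lemma strip z (t : R) : `|z.2| <= 1 -> 0 <= t -> `|pq z t| <= 1.
Proof.
rewrite !ler_norml => /andP[h1 h2] t0; rewrite strip_le1// andbT.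
have [_ e] := flow_opp beta_gt0 s_gt0 kappa_gt0 z t.
by rewrite lerNl -e strip_le1//= lerNl.
Qed.

Lemma strip_gap_upper z (t : R) : `|z.2| <= 1 -> 0 <= t ->
  2 * s / (2 * s + bnd) * (1 - expR (- (2 * s + bnd) * t)) <= 1 - pq z t.
Proof.
move=> z1 t0; set C := 2 * s + bnd.
have C0 : 0 < C by rewrite /C addr_gt0// mulr_gt0.
pose D (u : R) := 1 - 2 * s / C - pq z u.
have dD (u : R) : 0 < u < t -> is_derive u (1:R) D (0 - fqt u (pa z u) (pq z u)).
  move=> _; exact: is_deriveB (is_derive_cst (1 - 2 * s / C) u (1:R)) (dpq z u).
have cD : {within `[0, t], continuous D}.
  by apply: continuous_subspaceT; apply: contB; [exact: contC|exact: cpq].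
have := gronwall_lower (c := C) t0 dD cD.
have h (u : R) : 0 < u < t -> - (C * D u) <= 0 - fqt u (pa z u) (pq z u).
  move=> /andP[u0 _]; have qu := strip z1 (ltW u0).
  rewrite sub0r lerN2 /fqt /fq (clamp_id qu) /D.
  have ha := clamp_bound (pa z u) (ltW bnd0); set A := clamp bnd _ in ha *.
  have -> : C * (1 - 2 * s / C - pq z u) = C * (1 - pq z u) - 2 * s by field; rewrite gt_eqF.
  have := ler_norm A; have q1 : 0 <= 1 - pq z u by move: qu; rewrite ler_norml => /andP[_]; lra.
  have := ler_wpM2r q1 ha; rewrite /C; lra.
move=> /(_ h); rewrite subr0 /D pq0// => H.
have E0 := expR_gt0 (C * t).
have z2 : z.2 <= 1 by move: z1; rewrite ler_norml => /andP[].
have e : expR (- C * t) * expR (C * t) = 1 by rewrite -expRD mulNr addNr expR0.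
rewrite -(ler_pM2r E0) mulrBr mulr1 mulrBl -[X in _ - X]mulrA e mulr1.
have : - (2 * s / C) <= 1 - 2 * s / C - z.2 by lra.
by move=> h1; have := le_trans h1 H; rewrite !mulrBl; lra.
Qed.

(** The orbit leaves the boundary of the strip at once and remains at a distance from
    it, as required by the definition of W. *)
Lemma strip_gap z (t : R) : `|z.2| <= 1 -> 0 <= t ->
  2 * s / (2 * s + bnd) * (1 - expR (- (2 * s + bnd) * t)) <= 1 - `|pq z t|.
Proof.
move=> z1 t0; case: (leP 0 (pq z t)) => h; first by rewrite ger0_norm//; exact: strip_gap_upper.
rewrite ltr0_norm//.
have [_ e] := flow_opp beta_gt0 s_gt0 kappa_gt0 z t.
have := @strip_gap_upper (- z.1, - z.2) t; rewrite e /= normrN.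
by move=> /(_ z1 t0).
Qed.

Lemma strip_lt1 z (t : R) : `|z.2| <= 1 -> 0 < t -> `|pq z t| < 1.
Proof.
move=> z1 t0; rewrite -subr_gt0; apply: lt_le_trans (strip_gap z1 (ltW t0)).
have C0 : 0 < 2 * s + bnd by rewrite addr_gt0// mulr_gt0.
by rewrite mulr_gt0 ?divr_gt0 ?mulr_gt0// subr_gt0 expR_lt1 mulNr oppr_lt0 mulr_gt0.
Qed.

(** After time 1 the orbit is in a strip |q| <= r with r < 1, where W is available. *)
Lemma stays_converges z : stays z ->
  exists l : R, [/\ pq z t @[t --> +oo] --> l, pa z t @[t --> +oo] --> a0 l &
    [\/ l = 0, l = qb | l = - qb]].
Proof.
move=> hz; have z1 : `|z.2| <= 1 by have [_] := hz 0 (lexx 0); rewrite pq0.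
have C0 : 0 < 2 * s + bnd by rewrite addr_gt0// mulr_gt0.
pose g := 2 * s / (2 * s + bnd) * (1 - expR (- (2 * s + bnd) * 1)).
have g0 : 0 < g.
  by rewrite mulr_gt0 ?divr_gt0 ?mulr_gt0// subr_gt0 expR_lt1 mulr1 oppr_lt0.
have qg (t : R) : 0 <= t -> `|pq z (1 + t)| <= 1 - g.
  move=> t0; have t1 : 0 <= 1 + t by rewrite addr_ge0.
  have := strip_gap z1 t1.
  have : g <= 2 * s / (2 * s + bnd) * (1 - expR (- (2 * s + bnd) * (1 + t))).
    rewrite /g ler_wpM2l ?divr_ge0 ?mulr_ge0 ?(ltW s_gt0) ?(ltW C0)// lerD2l lerN2 ler_expR.
    by rewrite !mulNr lerN2 ler_wpM2l ?(ltW C0)// lerDl.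
  by lra.
have r0 : 0 <= 1 - g by apply: le_trans (qg 0 (lexx 0)).
have r1 : 1 - g < 1 by rewrite ltrBlDr ltrDl.
have ca : continuous (fun t : R => pa z (1 + t)) by apply: cont_add_arg; exact: cpa.
have cq : continuous (fun t : R => pq z (1 + t)) by apply: cont_add_arg; exact: cpq.
have t1 (t : R) : 0 < t -> 0 <= 1 + t by move=> t0; rewrite addr_ge0// ltW.
have da (t : R) : 0 < t -> is_derive t (1:R) (fun t => pa z (1 + t)) (1 * fa (pa z (1 + t)) (pq z (1 + t))).
  move=> t0; have H := is_derive_translate (inbox_pa beta_gt0 s_gt0 kappa_gt0 (hz _ (t1 t t0))).
  by apply: (is_derive_eq H); rewrite mul1r.
have dq (t : R) : 0 < t -> is_derive t (1:R) (fun t => pq z (1 + t)) (1 * fq (pa z (1 + t)) (pq z (1 + t))).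
  move=> t0; have H := is_derive_translate (inbox_pq beta_gt0 s_gt0 kappa_gt0 (hz _ (t1 t t0))).
  by apply: (is_derive_eq H); rewrite mul1r.
have ba (t : R) : 0 <= t -> `|pa z (1 + t)| <= bnd.
  by move=> t0; case: (hz (1 + t) (addr_ge0 ler01 t0)).
have [l [_ ql al hl _]] := orbit_converges beta_gt0 s_gt0 kappa_gt0 ab_gt0 qbE abE r0 r1 (mul1r 1)
  ca cq da dq ba qg.
exists l; split=> //.
- apply/cvgyP => e e0; have [T hT] := (proj2 (cvgyP _ _) ql) e e0.
  by exists (1 + T) => t Tt; have := hT (t - 1); rewrite subrKC; apply; rewrite lerBrDl.
- apply/cvgyP => e e0; have [T hT] := (proj2 (cvgyP _ _) al) e e0.
  by exists (1 + T) => t Tt; have := hT (t - 1); rewrite subrKC; apply; rewrite lerBrDl.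
Qed.

Lemma a0_qb : a0 qb = ab.
Proof.
rewrite /a0 (gtr0_norm qb0) (oneBqb s_gt0 ab_gt0 qbE) qbE; field.
by rewrite !gt_eqF.
Qed.

Lemma a0_0 : a0 0 = 0. Proof. by rewrite /a0 mulr0 mul0r. Qed.

Lemma fa_derive z (t : R) : is_derive t (1:R) (fun t => fa (pa z t) (pq z t))
  ((beta + 2 * s + `|pa z t|) * fat t (pa z t) (pq z t) - kappa * fqt t (pa z t) (pq z t)).
Proof.
have hn := @is_derive1_comp R (fun u : R => `|u| * u) (pa z) t _ _ (is_derive_normM (pa z t)) (dpa z t).
have H := is_deriveB (is_deriveD (is_deriveZ (beta + 2 * s) (dpa z t)) (is_deriveZ 2^-1 hn))
  (is_deriveZ kappa (dpq z t)).
by apply: (is_derive_eq H); rewrite /GRing.scale /=; field.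
Qed.

Lemma fa_orbit_continuous z : continuous (fun t => fa (pa z t) (pq z t)).
Proof. by move=> t; apply: is_derive_cont (fa_derive z t). Qed.

Lemma inboxE z t : inbox z t -> fat t (pa z t) (pq z t) = fa (pa z t) (pq z t) /\
  fqt t (pa z t) (pq z t) = fq (pa z t) (pq z t).
Proof. by move=> [h1 h2]; rewrite /fat /fqt !clamp_id. Qed.

(** Left and right of (ab, qb) are treated together through a sign sg. *)
Section Wedge.
Variable sg : R.
Hypothesis sgP : sg = 1 \/ sg = -1.

Let sg1 : sg * sg = 1. Proof. by case: sgP => ->; rewrite ?mulr1 ?mulrNN ?mulr1. Qed.

Let sgabs (x : R) : `|sg * x| = `|x|.
Proof. by case: sgP => ->; rewrite ?mul1r ?mulN1r ?normrN. Qed.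

(** At the vertex (ab, qb) both nullclines meet. In the closed region between the
    line a = ab and the nullcline of a, the nullcline of q is not met again. *)
Lemma wedge_fq (a q : R) : 0 < a -> 0 <= sg * (a - ab) -> sg * fa a q <= 0 ->
  (a, q) <> (ab, qb) -> sg * fq a q < 0.
Proof.
move=> a_gt0 ha hfa ne.
have a2s : 0 < 2 * s + a by rewrite addr_gt0// mulr_gt0.
(* eliminate q between the two components of the field *)
have e : kappa * fq a q = (2 * s + a) * fa a q - 2^-1 * (a * (a - ab) * (a + ab + 2 * beta + 6 * s)).
  by rewrite /fq /fa (gtr0_norm a_gt0) -abE; field.
have p1 : (2 * s + a) * (sg * fa a q) <= 0 by rewrite pmulr_rle0.
have p2 : 0 <= a * (sg * (a - ab)) * (a + ab + 2 * beta + 6 * s).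
  apply: mulr_ge0; first by apply: mulr_ge0 => //; exact: ltW.
  by move: a_gt0 ab_gt0 beta_gt0 s_gt0; lra.
have ke : kappa * (sg * fq a q) = (2 * s + a) * (sg * fa a q) - 2^-1 * (a * (sg * (a - ab)) * (a + ab + 2 * beta + 6 * s)).
  by rewrite mulrCA e; field.
rewrite -(pmulr_rlt0 _ kappa_gt0) ke lt_neqAle; apply/andP; split; last by lra.
apply/eqP => e0.
have q1 : (2 * s + a) * (sg * fa a q) = 0 by lra.
have q2 : a * (sg * (a - ab)) * (a + ab + 2 * beta + 6 * s) = 0 by lra.
have sn : sg != 0 by case: sgP => ->; rewrite ?oppr_eq0 oner_eq0.
have Sn : a + ab + 2 * beta + 6 * s != 0 by rewrite gt_eqF// !addr_gt0 ?mulr_gt0.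
have ea : a = ab.
  move/eqP: q2; rewrite !mulf_eq0 (negbTE sn) (negbTE Sn) (gt_eqF a_gt0) !orbF /=.
  by rewrite subr_eq0 => /eqP.
apply: ne; congr (_, _) => //.
move/eqP: q1; rewrite !mulf_eq0 (negbTE sn) (gt_eqF a2s) /= => /eqP.
rewrite ea => fa0; have := fa_stat; rewrite -fa0 /fa => H.
by apply: (mulfI (lt0r_neq0 kappa_gt0)); lra.
Qed.

(** Where the a-component points away from ab it keeps doing so: on the nullcline of a
    the derivative of fa is - kappa fq, whose sign is known from wedge_fq. *)
Lemma escape z (t0 : R) : stays z -> 0 <= t0 -> (forall t : R, t0 <= t -> 0 < pa z t) ->
  0 < sg * (pa z t0 - ab) -> 0 < sg * fa (pa z t0) (pq z t0) ->
  forall t : R, t0 <= t -> 0 < sg * fa (pa z t) (pq z t) /\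
    sg * (pa z t0 - ab) <= sg * (pa z t - ab).
Proof.
move=> hz t00 apos h1 h2.
have box (t : R) : t0 <= t -> inbox z t by move=> h; apply: hz; exact: le_trans h.
have mono (t : R) : t0 <= t -> (forall u : R, t0 <= u < t -> 0 < sg * fa (pa z u) (pq z u)) ->
    sg * (pa z t0 - ab) <= sg * (pa z t - ab).
  move=> tt0 hu; rewrite !mulrBr lerD2r.
  have d u : t0 < u < t -> is_derive u (1:R) (fun u => sg * pa z u) (sg * fa (pa z u) (pq z u)).
    move=> /andP[u0 _]; have h := inbox_pa beta_gt0 s_gt0 kappa_gt0 (box u (ltW u0)).
    have H := is_deriveZ sg h; exact: (is_derive_eq H).
  have c : {within `[t0, t], continuous (fun u => sg * pa z u)}.
    by apply: continuous_subspaceT; apply: contM; [exact: contC|exact: cpa].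
  apply: (is_derive_nondecr tt0 d c) => u /andP[u0 ut].
  by apply/ltW/hu; rewrite (ltW u0).
have cf : continuous (fun t => sg * fa (pa z t) (pq z t)).
  by apply: contM; [exact: contC|exact: fa_orbit_continuous].
have pos (t : R) : t0 <= t -> 0 < sg * fa (pa z t) (pq z t).
  move=> tt0; have tI : t0 <= t <= t by rewrite tt0 lexx.
  apply: (stay_pos cf tt0 h2 _ tI) => u /andP[u0 ut] fu hu.
  exists (- (kappa * (sg * fq (pa z u) (pq z u)))); last first.
    have H := is_deriveZ sg (fa_derive z u); apply: (is_derive_eq H).
    have [-> ->] := inboxE (box u (ltW u0)); rewrite /GRing.scale /= mulrBr mulrCA fu mulr0 sub0r.
    by congr (- _); rewrite mulrCA.
  rewrite oppr_gt0 pmulr_rlt0//.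
  have m := mono u (ltW u0) hu.
  apply: wedge_fq; first exact/apos/ltW.
  - exact: ltW (lt_le_trans h1 m).
  - by rewrite fu.
  - by move=> [e _]; move: (lt_le_trans h1 m); rewrite e subrr mulr0 ltxx.
move=> t tt0; split; first exact: pos.
by apply: mono => // u /andP[u0 _]; exact: pos.
Qed.

Let cfat z : continuous (fun t : R => fat t (pa z t) (pq z t)).
Proof.
have h := @fa_continuous R beta s kappa _ _ (clamp_comp_continuous (ltW bnd0) (@cpa z))
  (clamp_comp_continuous ler01 (@cpq z)).
exact: h.
Qed.

Lemma limit_ge0 (f : R -> R) (t0 t1 : R) : continuous f -> t0 < t1 ->
  (forall u : R, t0 <= u < t1 -> 0 <= f u) -> 0 <= f t1.
Proof.
move=> cf t01 h; rewrite leNgt; apply/negP => f0.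
have cN : {for t1, continuous (fun u => - f u)} by apply: contN.
have [|e e0 he] := @cont_gt R (fun u => - f u) 0 t1 cN; first by rewrite oppr_gt0.
pose u := Num.max t0 (t1 - e / 2).
have ut : u < t1 by rewrite gt_max t01 ltrBlDr ltrDl divr_gt0.
have tu : t0 <= u by rewrite le_max lexx.
have eu : t1 - e / 2 <= u by rewrite le_max lexx orbT.
have : 0 < - f u by apply: he; rewrite ltr_norml; apply/andP; split; lra.
by rewrite oppr_gt0 ltNge h// tu.
Qed.

Lemma wedge_box z (tau : R) : `|z.2| <= 1 -> 0 < z.1 -> z.1 <= bnd -> 0 <= sg * (z.1 - ab) ->
  (forall u : R, 0 <= u < tau ->
     0 < sg * (pa z u - ab) /\ sg * fat u (pa z u) (pq z u) < 0) ->
  forall u : R, 0 <= u <= tau ->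
  [/\ 0 < pa z u, inbox z u, 0 <= sg * (pa z u - ab) & sg * pa z u <= sg * z.1].
Proof.
move=> z2 z10 z1b zab h u /andP[u0 ut].
have h1 : 0 <= sg * (pa z u - ab).
  have [->|ne] := eqVneq u 0; first by rewrite pa0.
  have {}ne : 0 < u by rewrite lt_neqAle eq_sym ne.
  apply: (@limit_ge0 (fun u => sg * (pa z u - ab)) 0) => //.
    by apply: contM; [exact: contC|apply: contB; [exact: cpa|exact: contC]].
  by move=> v /andP[v0 vu]; case: (h v); rewrite ?v0 ?(lt_le_trans vu)// => /ltW.
have h2 : sg * pa z u <= sg * z.1.
  rewrite -(pa0 beta_gt0 s_gt0 kappa_gt0 z) -lerN2.
  have d (v : R) : 0 < v < u -> is_derive v (1:R) (fun v => - (sg * pa z v)) (- (sg * fat v (pa z v) (pq z v))).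
    move=> _; have H := is_deriveN (is_deriveZ sg (dpa z v)); exact: (is_derive_eq H).
  have c : {within `[0, u], continuous (fun v : R => - (sg * pa z v))}.
    by apply: continuous_subspaceT; apply: contN; apply: contM; [exact: contC|exact: cpa].
  apply: (is_derive_nondecr u0 d c) => v /andP[v0 vu].
  by rewrite oppr_ge0; case: (h v); rewrite ?(ltW v0) ?(lt_le_trans vu)// => _ /ltW.
have [p1 p2] : 0 < pa z u /\ pa z u <= bnd.
  move: h1 h2 zab; have := ab_le_bnd; case: sgP => ->; rewrite ?mul1r ?mulN1r; move: ab_gt0; split; lra.
by split=> //; split; [rewrite ger0_norm// ltW|exact: strip].
Qed.

Definition exits_first (z : R * R) : Prop := exists2 t : R, 0 <= t &
  0 < sg * fat t (pa z t) (pq z t) /\ forall u : R, 0 <= u <= t -> 0 < sg * (pa z u - ab).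
Definition exits_second (z : R * R) : Prop := exists2 t : R, 0 <= t &
  sg * (pa z t - ab) < 0 /\ forall u : R, 0 <= u <= t -> sg * fat u (pa z u) (pq z u) < 0.

(** An orbit leaving the wedge through one of its sides cannot have left it before
    through the other one. *)
Lemma exits_disjoint z : exits_first z -> exits_second z -> False.
Proof.
move=> [t t0 [h1 h2]] [t' t'0 [h1' h2']]; case: (leP t t') => tt.
  by have := h2' t; rewrite t0 tt => /(_ isT); lra.
by have := h2 t'; rewrite t'0 (ltW tt) => /(_ isT); lra.
Qed.

Let sg_norm : `|sg| = 1. Proof. by case: sgP => ->; rewrite ?normrN normr1. Qed.

Let lipA (x y x' y' : R) : `|sg * (x - ab) - sg * (x' - ab)| <= (lipc + 1) * (`|x - x'| + `|y - y'|).
Proof.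
have -> : sg * (x - ab) - sg * (x' - ab) = sg * (x - x') by ring.
rewrite normrM sg_norm mul1r.
have := normr_ge0 (x - x'); have := normr_ge0 (y - y') => h1 h2.
apply: (@ler_by_sub _ _ _ (lipc * (`|x - x'| + `|y - y'|) + `|y - y'|)); last by ring.
by rewrite addr_ge0// mulr_ge0 ?(ltW lip0)// addr_ge0.
Qed.

Let lipF (t x y x' y' : R) : `|sg * fat t x y - sg * fat t x' y'| <= (lipc + 1) * (`|x - x'| + `|y - y'|).
Proof.
rewrite -mulrBr normrM sg_norm mul1r.
apply: le_trans (fat_lip beta_gt0 s_gt0 kappa_gt0 _ _ _ _ _) _.
by rewrite ler_wpM2r ?addr_ge0// lerDl.
Qed.

Let lip1 : 0 < lipc + 1. Proof. by rewrite addr_gt0. Qed.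

Lemma exits_first_open z : exits_first z -> exists2 d : R, 0 < d & forall z',
  `|z'.1 - z.1| < d -> `|z'.2 - z.2| < d -> exits_first z'.
Proof.
move=> [t t0 [h1 h2]].
have [|r1 r10 hr1] := flow_open (h := fun x y => sg * fat 0 x y) (z := z) (c := 0) beta_gt0 s_gt0 kappa_gt0 t0 (lexx t) lip1 (@lipF 0).
  by move=> u /le_anti <-.
have [//|r2 r20 hr2] := flow_open (h := fun x y => sg * (x - ab)) (z := z) (c := 0) beta_gt0 s_gt0 kappa_gt0 (lexx 0) t0 lip1 lipA.
exists (Num.min r1 r2); first by rewrite lt_min r10.
move=> z'; rewrite !lt_min => /andP[k1 k2] /andP[k3 k4]; exists t => //; split.
  by apply: hr1 => //; rewrite lexx.
exact: hr2.
Qed.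

Lemma exits_second_open z : exits_second z -> exists2 d : R, 0 < d & forall z',
  `|z'.1 - z.1| < d -> `|z'.2 - z.2| < d -> exits_second z'.
Proof.
move=> [t t0 [h1 h2]].
have lipA' (x y x' y' : R) : `|- (sg * (x - ab)) - - (sg * (x' - ab))| <= (lipc + 1) * (`|x - x'| + `|y - y'|).
  by rewrite -opprD normrN; exact: lipA.
have lipF' (x y x' y' : R) : `|- (sg * fat 0 x y) - - (sg * fat 0 x' y')| <= (lipc + 1) * (`|x - x'| + `|y - y'|).
  by rewrite -opprD normrN; exact: lipF.
have [|r1 r10 hr1] := flow_open (h := fun x y => - (sg * (x - ab))) (z := z) (c := 0) beta_gt0 s_gt0 kappa_gt0 t0 (lexx t) lip1 lipA'.
  by move=> u /le_anti <-; rewrite oppr_gt0.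
have [|r2 r20 hr2] := flow_open (h := fun x y => - (sg * fat 0 x y)) (z := z) (c := 0) beta_gt0 s_gt0 kappa_gt0 (lexx 0) t0 lip1 lipF'.
  by move=> u uI; rewrite oppr_gt0; exact: h2.
exists (Num.min r1 r2); first by rewrite lt_min r10.
move=> z'; rewrite !lt_min => /andP[k1 k2] /andP[k3 k4]; exists t => //; split.
  by rewrite -oppr_gt0; apply: hr1 => //; rewrite lexx.
by move=> u uI; rewrite -oppr_gt0; exact: hr2.
Qed.

(** Crossing either side of the wedge is transversal: reaching a = ab below, or
    the nullcline of a, one is on the other side immediately afterwards. *)
Lemma cross_second z (t0 : R) : 0 <= t0 -> sg * (pa z t0 - ab) <= 0 ->
  (forall u : R, 0 <= u <= t0 -> sg * fat u (pa z u) (pq z u) < 0) -> exits_second z.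
Proof.
move=> t00 h1 h2.
have f0 : 0 < - (sg * fat t0 (pa z t0) (pq z t0)) by rewrite oppr_gt0; apply: h2; rewrite t00 lexx.
have dN : is_derive t0 (1:R) (fun v => - (sg * pa z v)) (- (sg * fat t0 (pa z t0) (pq z t0))).
  have H := is_deriveN (is_deriveZ sg (dpa z t0)); exact: (is_derive_eq H).
have [d d0 hd] := deriv_gt0 dN f0.
have cF : continuous (fun u => - (sg * fat u (pa z u) (pq z u))).
  by apply: contN; apply: contM; [exact: contC|exact: cfat].
have [e e0 he] := cont_gt (cF t0) f0.
pose h := Num.min d e / 2; have h0 : 0 < h by rewrite divr_gt0// lt_min d0.
have [hd' he'] : h < d /\ h < e.
  by move: h0; rewrite /h; have := minl_le d e; have := minr_le d e; split; lra.
exists (t0 + h); first by rewrite addr_ge0// ltW.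
split.
  have [|+ _] := hd (t0 + h); first by rewrite addrAC subrr add0r gtr0_norm.
  by rewrite ltrDl => /(_ h0); move: h1; rewrite !mulrBr; lra.
move=> u /andP[u0 ut]; case: (leP u t0) => tu; first by apply: h2; rewrite u0.
by rewrite -oppr_gt0; apply: he; rewrite gtr0_norm ?subr_gt0//; lra.
Qed.

Lemma cross_first z (t0 : R) : 0 <= t0 -> `|z.2| <= 1 -> inbox z t0 -> 0 < pa z t0 ->
  fa (pa z t0) (pq z t0) = 0 ->
  (forall u : R, 0 <= u <= t0 -> 0 < sg * (pa z u - ab)) -> exits_first z.
Proof.
move=> t00 z2 box apos fa0 h2.
have a0' : 0 < sg * (pa z t0 - ab) by apply: h2; rewrite t00 lexx.
have [ef eq] := inboxE box.
have qneg : sg * fq (pa z t0) (pq z t0) < 0.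
  apply: wedge_fq => //; first exact: ltW.
    by rewrite fa0 mulr0.
  by move=> [e _]; move: a0'; rewrite e subrr mulr0 ltxx.
have l0 : 0 < - (kappa * (sg * fq (pa z t0) (pq z t0))) by rewrite oppr_gt0 pmulr_rlt0.
have dF : is_derive t0 (1:R) (fun t => sg * fa (pa z t) (pq z t)) (- (kappa * (sg * fq (pa z t0) (pq z t0)))).
  have H := is_deriveZ sg (fa_derive z t0); apply: (is_derive_eq H).
  by rewrite ef eq fa0 /GRing.scale /=; ring.
have [d d0 hd] := deriv_gt0 dF l0.
have cA : continuous (fun u => sg * (pa z u - ab)).
  by apply: contM; [exact: contC|apply: contB; [exact: cpa|exact: contC]].
have [e e0 he] := cont_gt (cA t0) a0'.
have ab_lt : 0 < bnd - pa z t0.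
  rewrite subr_gt0 -(ltr_pM2l b0) bndE; move: fa0; rewrite /fa (gtr0_norm apos).
  have : kappa * pq z t0 <= kappa.
    by rewrite -[leRHS]mulr1 ler_pM2l//; apply: le_trans (ler_norm _) (proj2 box).
  have : 0 < 2^-1 * (pa z t0 * pa z t0) by rewrite !mulr_gt0// invr_gt0.
  by lra.
have cB : continuous (fun u => bnd - pa z u) by apply: contB; [exact: contC|exact: cpa].
have [e' e'0 he'] := cont_gt (cB t0) ab_lt.
have [e'' e''0 he''] := cont_gt (@cpa z t0) apos.
pose h := Num.min (Num.min d e) (Num.min e' e'') / 2.
have h0 : 0 < h by rewrite divr_gt0// !lt_min d0 e0 e'0.
have [k1 k2 [k3 k4]] : [/\ h < d, h < e & h < e' /\ h < e''].
  have := minl_le (Num.min d e) (Num.min e' e''); have := minr_le (Num.min d e) (Num.min e' e'').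
  have := minl_le d e; have := minr_le d e; have := minl_le e' e''; have := minr_le e' e''.
  by move: h0; rewrite /h => *; split; [lra|lra|split; lra].
have near (r : R) : h < r -> `|t0 + h - t0| < r by rewrite addrAC subrr add0r gtr0_norm.
have th : 0 <= t0 + h by rewrite addr_ge0// ltW.
exists (t0 + h) => //; split.
  have [+ _] := hd (t0 + h) (near _ k1); rewrite ltrDl => /(_ h0); rewrite fa0 mulr0.
  have box' : inbox z (t0 + h).
    split; last exact: strip.
    have := he' _ (near _ k3); have := he'' _ (near _ k4); rewrite subr_gt0 => p1 p2.
    by rewrite gtr0_norm// ltW.
  by have [-> _] := inboxE box'.
move=> u /andP[u0 ut]; case: (leP u t0) => tu; first by apply: h2; rewrite u0.
by apply: he; rewrite gtr0_norm ?subr_gt0//; lra.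
Qed.

Lemma stationary_orbit (t : R) : pa (ab, qb) t = ab /\ pq (ab, qb) t = qb.
Proof.
have [c1 c2] : clamp bnd ab = ab /\ clamp 1 qb = qb.
  split; apply: clamp_id; rewrite gtr0_norm//; first exact: ltW ab_le_bnd.
  exact: ltW.
have h : solves fat fqt (- `|t|) `|t| (fun=> ab) (fun=> qb).
  apply: solves_global => u.
  - by rewrite /fat c1 c2 fa_stat; exact: is_derive_cst.
  - by rewrite /fqt c1 c2 fq_stat; exact: is_derive_cst.
have tt : - `|t| <= t <= `|t| by rewrite -ler_norml.
have t0 : - `|t| <= 0 <= `|t| by rewrite oppr_le0 normr_ge0.
by have [<- <-] := flow_unique beta_gt0 s_gt0 kappa_gt0 (z := (ab, qb)) t0 erefl erefl h tt.
Qed.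

Definition in_wedge z : Prop := forall t : R, 0 <= t ->
  [/\ inbox z t, 0 < pa z t, 0 < sg * (pa z t - ab) & sg * fa (pa z t) (pq z t) < 0].

Lemma no_exit_in_wedge z : `|z.2| <= 1 -> 0 < z.1 -> z.1 <= bnd -> 0 < sg * (z.1 - ab) ->
  sg * fa z.1 z.2 < 0 -> ~ exits_first z -> ~ exits_second z -> in_wedge z.
Proof.
move=> z2 z10 z1b zab zfa ne1 ne2.
have fat0 : fat 0 (pa z 0) (pq z 0) = fa z.1 z.2.
  by rewrite pa0// pq0// /fat !clamp_id// gtr0_norm.
pose m (u : R) := Num.min (sg * (pa z u - ab)) (- (sg * fat u (pa z u) (pq z u))).
have cm : continuous m.
  apply: cont_min; first exact: (contM (@contC _ R sg) (contB (@cpa z) (@contC _ R ab))).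
  exact: (contN (contM (@contC _ R sg) (@cfat z))).
have m0 : 0 < m 0 by rewrite /m lt_min fat0 pa0// zab oppr_gt0.
have mpos (t : R) : 0 <= t -> 0 < m t.
  move=> t0; rewrite ltNge; apply/negP => mt.
  have [tau /andP[tau0 _] [mtau hm]] := first_hit cm t0 m0 mt.
  have before u : 0 <= u < tau -> 0 < sg * (pa z u - ab) /\ sg * fat u (pa z u) (pq z u) < 0.
    by move=> /hm; rewrite /m lt_min oppr_gt0 => /andP[].
  have tI : 0 <= tau <= tau by rewrite (ltW tau0) lexx.
  have [p1 p2 p3 p4] := wedge_box z2 z10 z1b (ltW zab) before tI.
  have [ef eq] := inboxE p2.
  have [e1|e1] := eqVneq (sg * (pa z tau - ab)) 0.
    have [e2|e2] := eqVneq (sg * fat tau (pa z tau) (pq z tau)) 0.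
      have sn : sg != 0 by case: sgP => ->; rewrite ?oppr_eq0 oner_eq0.
      move/eqP: e1; rewrite mulf_eq0 (negbTE sn) /= subr_eq0 => /eqP e1.
      move/eqP: e2; rewrite mulf_eq0 (negbTE sn) /= ef e1 => /eqP e2.
      have e3 : pq z tau = qb.
        by have := fa_stat; rewrite -e2 /fa => H; apply: (mulfI (lt0r_neq0 kappa_gt0)); lra.
      have [s1 s2] := stationary_orbit tau.
      have : z = (ab, qb) by apply: (flow_inj (t := tau) beta_gt0 s_gt0 kappa_gt0); rewrite ?s1 ?s2.
      by move=> ez; move: zab; rewrite ez subrr mulr0 ltxx.
    apply: ne2; apply: (@cross_second z tau (ltW tau0)); first by rewrite e1.
    move=> u /andP[u0 ut]; case: (ltgtP u tau) ut => // [ut|->] _.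
      by have ub : 0 <= u < tau by [rewrite u0 ut]; case: (before u ub).
    by rewrite lt_neqAle e2 /=; move: mtau; rewrite /m e1 => H;
      have := minr_le 0 (- (sg * fat tau (pa z tau) (pq z tau))); rewrite H; lra.
  apply: ne1; apply: (@cross_first z tau (ltW tau0)) => //.
    have lt1 : 0 < sg * (pa z tau - ab) by rewrite lt_neqAle eq_sym e1.
    have : sg * fat tau (pa z tau) (pq z tau) = 0.
      move: mtau; rewrite /m; case: (leP (sg * (pa z tau - ab)) (- (sg * fat tau (pa z tau) (pq z tau)))) => _; first lra.
      by move/eqP; rewrite oppr_eq0 => /eqP.
    rewrite ef => /eqP; rewrite mulf_eq0 => /orP[/eqP s0|/eqP//].
    by move: sg1; rewrite s0 mulr0 => /esym/eqP; rewrite oner_eq0.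
  move=> u /andP[u0 ut]; case: (ltgtP u tau) ut => // [ut|->] _.
    by have ub : 0 <= u < tau by [rewrite u0 ut]; case: (before u ub).
  by rewrite lt_neqAle eq_sym e1.
move=> t t0; have := mpos t t0; rewrite /m lt_min oppr_gt0 => /andP[h1 h2].
have before u : 0 <= u < t -> 0 < sg * (pa z u - ab) /\ sg * fat u (pa z u) (pq z u) < 0.
  by move=> /andP[u0 _]; have := mpos u u0; rewrite /m lt_min oppr_gt0 => /andP[].
have tI : 0 <= t <= t by rewrite t0 lexx.
have [p1 p2 p3 p4] := wedge_box z2 z10 z1b (ltW zab) before tI.
by split=> //; have [<- _] := inboxE p2.
Qed.

Lemma in_wedge_stays z : in_wedge z -> stays z.
Proof. by move=> h t /h[]. Qed.

Lemma in_wedge_fq z (t : R) : in_wedge z -> 0 <= t -> sg * fq (pa z t) (pq z t) < 0.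
Proof.
move=> h t0; have [h1 h2 h3 h4] := h t t0.
apply: wedge_fq => //; [exact: ltW|exact: ltW|].
by move=> [e _]; move: h3; rewrite e subrr mulr0 ltxx.
Qed.

Lemma in_wedge_shift z (r : R) : in_wedge z -> 0 <= r -> in_wedge (pa z r, pq z r).
Proof.
move=> h r0 t t0; rewrite /inbox; have [-> ->] := flow_shift beta_gt0 s_gt0 kappa_gt0 z r t.
by apply: h; rewrite addr_ge0.
Qed.

Lemma in_wedge_mono z (x y : R) : in_wedge z -> 0 <= x -> x < y ->
  sg * pq z y < sg * pq z x /\ sg * pa z y < sg * pa z x.
Proof.
move=> h x0 xy; rewrite -ltrN2 -(ltrN2 (sg * pa z x)).
have box (u : R) : x < u < y -> inbox z u.
  by move=> /andP[xu _]; case: (h u (le_trans x0 (ltW xu))).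
have dq (u : R) : x < u < y -> is_derive u (1:R) (fun v => - (sg * pq z v)) (- (sg * fq (pa z u) (pq z u))).
  move=> /box bu; have H := is_deriveN (is_deriveZ sg (inbox_pq beta_gt0 s_gt0 kappa_gt0 bu)).
  exact: (is_derive_eq H).
have da (u : R) : x < u < y -> is_derive u (1:R) (fun v => - (sg * pa z v)) (- (sg * fa (pa z u) (pq z u))).
  move=> /box bu; have H := is_deriveN (is_deriveZ sg (inbox_pa beta_gt0 s_gt0 kappa_gt0 bu)).
  exact: (is_derive_eq H).
have cq : {within `[x, y], continuous (fun v : R => - (sg * pq z v))}.
  by apply: continuous_subspaceT; apply: contN; apply: contM; [exact: contC|exact: cpq].
have ca : {within `[x, y], continuous (fun v : R => - (sg * pa z v))}.
  by apply: continuous_subspaceT; apply: contN; apply: contM; [exact: contC|exact: cpa].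
split.
- apply: (is_derive_incr xy dq cq) => u /andP[xu _]; rewrite oppr_gt0.
  by apply: in_wedge_fq => //; exact: le_trans (ltW xu).
- apply: (is_derive_incr xy da ca) => u /andP[xu _]; rewrite oppr_gt0.
  by case: (h u (le_trans x0 (ltW xu))).
Qed.

(** Both coordinates are monotone in the wedge and a remains away from 0, which excludes
    the other stationary points as limits. *)
Lemma in_wedge_converges z : in_wedge z ->
  pq z t @[t --> +oo] --> qb /\ pa z t @[t --> +oo] --> ab.
Proof.
move=> h; have [l [ql al hl]] := stays_converges (in_wedge_stays h).
have z10 : 0 < z.1 by have [_] := h 0 (lexx 0); rewrite pa0.
pose c := Num.min z.1 ab; have c0 : 0 < c by rewrite lt_min z10.
have ac (t : R) : 0 <= t -> c <= pa z t.
  move=> t0; have [_ _ h3 _] := h t t0.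
  have : sg * pa z t <= sg * z.1.
    have [->|ne] := eqVneq t 0; first by rewrite pa0.
    have tp : 0 < t by rewrite lt_neqAle eq_sym ne.
    by have [_ /ltW] := in_wedge_mono h (lexx 0) tp; rewrite pa0.
  move: h3; have := minl_le z.1 ab; have := minr_le z.1 ab; rewrite -/c.
  by case: sgP => ->; rewrite ?mul1r ?mulN1r => *; lra.
have al0 : 0 < a0 l.
  apply: (lt_le_trans c0); apply/ler_addgt0Pr => e e0.
  have [T hT] := (proj2 (cvgyP _ _) al) e e0.
  have := hT (Num.max 0 T); rewrite le_max lexx orbT => /(_ isT).
  have := ac (Num.max 0 T); rewrite le_max lexx => /(_ isT).
  by rewrite ler_norml => h1 /andP[_]; lra.
case: hl => e; move: ql al al0; rewrite e.
- by rewrite a0_0 ltxx.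
- by rewrite a0_qb.
- by rewrite a0N a0_qb oppr_gt0 => _ _; rewrite ltNge (ltW ab_gt0).
Qed.
Let fa_incr (x y q : R) : 0 < x -> x < y -> fa x q < fa y q.
Proof.
move=> x0 xy; have y0 := lt_trans x0 xy; rewrite /fa (gtr0_norm x0) (gtr0_norm y0).
have h1 : (beta + 2 * s) * x < (beta + 2 * s) * y by rewrite ltr_pM2l.
have h2 : x * x < y * y by rewrite ltr_pM// ltW.
lra.
Qed.

(** On the segment of height q0 in the wedge, the points leaving through one side and
    those leaving through the other form disjoint nonempty open sets, so that some point
    leaves through neither. *)
Lemma wedge_point (q0 : R) : 0 < q0 -> q0 <= 1 -> 0 < sg * (q0 - qb) ->
  exists2 z, z.2 = q0 & in_wedge z.
Proof.
move=> q00 q01 sq.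
pose rho := - (beta + 2 * s) + Num.sqrt ((beta + 2 * s) ^+ 2 + 2 * kappa * q0).
have disc : 0 <= (beta + 2 * s) ^+ 2 + 2 * kappa * q0.
  by rewrite addr_ge0 ?sqr_ge0// !mulr_ge0// ltW.
have rho0 : 0 < rho.
  rewrite /rho addrC subr_gt0 -{1}(gtr0_norm b0) -sqrtr_sqr ltr_sqrt.
    by rewrite ltrDl !mulr_gt0.
  by rewrite ltr_wpDl ?sqr_ge0// !mulr_gt0.
have fa_rho : fa rho q0 = 0.
  have e : (rho + (beta + 2 * s)) ^+ 2 = (beta + 2 * s) ^+ 2 + 2 * kappa * q0.
    by rewrite /rho addrAC addNr add0r sqr_sqrtr.
  have -> : fa rho q0 = 2^-1 * ((rho + (beta + 2 * s)) ^+ 2 - ((beta + 2 * s) ^+ 2 + 2 * kappa * q0)).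
    by rewrite /fa (gtr0_norm rho0); field.
  by rewrite e subrr mulr0.
have fa_ab : sg * fa ab q0 = - (kappa * (sg * (q0 - qb))).
  have -> : fa ab q0 = fa ab qb - kappa * (q0 - qb) by rewrite /fa; ring.
  by rewrite fa_stat; ring.
have fa_ab0 : sg * fa ab q0 < 0 by rewrite fa_ab oppr_lt0 mulr_gt0.
have rho_ab : 0 < sg * (rho - ab).
  case: sgP fa_ab0 => ->; rewrite ?mul1r ?mulN1r => h.
    rewrite subr_gt0 ltNge le_eqVlt; apply/negP => /orP[/eqP e|lt].
      by move: h; rewrite -e fa_rho ltxx.
    by have := fa_incr q0 rho0 lt; rewrite fa_rho ltNge (ltW h).
  rewrite oppr_lt0 in h.
  rewrite opprB subr_gt0 ltNge le_eqVlt; apply/negP => /orP[/eqP e|lt].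
    by move: h; rewrite e fa_rho ltxx.
  by have := fa_incr q0 ab_gt0 lt; rewrite fa_rho ltNge (ltW h).
have q0n : `|q0| <= 1 by rewrite gtr0_norm.
have rho_b : rho <= bnd.
  rewrite -(ler_pM2l b0) bndE; move: fa_rho; rewrite /fa (gtr0_norm rho0).
  have : kappa * q0 <= kappa by rewrite -[leRHS]mulr1 ler_pM2l.
  have : 0 < 2^-1 * (rho * rho) by rewrite !mulr_gt0// invr_gt0.
  by lra.
have start (c : R) : 0 < c -> c <= bnd -> fat 0 (pa (c, q0) 0) (pq (c, q0) 0) = fa c q0.
  by move=> c0 cb; rewrite pa0// pq0// /fat !clamp_id// gtr0_norm.
have E1 : exits_first (rho, q0).
  apply: (@cross_first (rho, q0) 0) => //.
  - by rewrite /inbox pa0// pq0// gtr0_norm.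
  - by rewrite pa0.
  - by rewrite pa0// pq0.
  - by move=> u /le_anti <-; rewrite pa0.
have E2 : exits_second (ab, q0).
  apply: (@cross_second (ab, q0) 0) => //.
  - by rewrite pa0// subrr mulr0.
  - by move=> u /le_anti <-; rewrite start//; exact: ltW ab_le_bnd.
have op1 (c : R) : exits_first (c, q0) -> exists2 d : R, 0 < d & forall c', `|c' - c| < d -> exits_first (c', q0).
  move=> /exits_first_open[d d0 hd]; exists d => // c' h; apply: hd => //=.
  by rewrite subrr normr0.
have op2 (c : R) : exits_second (c, q0) -> exists2 d : R, 0 < d & forall c', `|c' - c| < d -> exits_second (c', q0).
  move=> /exits_second_open[d d0 hd]; exists d => // c' h; apply: hd => //=.
  by rewrite subrr normr0.
have [c cI [n1 n2]] : exists2 c : R, (0 <= sg * (c - ab)) && (sg * c <= sg * rho) & ~ exits_first (c, q0) /\ ~ exits_second (c, q0).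
  case: sgP rho_ab => e; rewrite e ?mul1r ?mulN1r ?oppr_gt0 ?subr_gt0 ?subr_lt0 => rab.
    have [c /andP[c1 c2] h] := shooting (O1 := fun c => exits_first (c, q0)) (O2 := fun c => exits_second (c, q0))
      (ltW rab) E1 E2 (fun c _ => op1 c) (fun c _ => op2 c) (fun c => @exits_disjoint (c, q0)).
    by exists c => //; rewrite !mul1r subr_ge0 c1.
  have [c /andP[c1 c2] [h1 h2]] := shooting (O1 := fun c => exits_second (c, q0)) (O2 := fun c => exits_first (c, q0))
    (ltW rab) E2 E1 (fun c _ => op2 c) (fun c _ => op1 c) (fun c h h' => @exits_disjoint (c, q0) h' h).
  by exists c => //; rewrite !mulN1r lerN2 c1 oppr_ge0 subr_le0 c2.
case/andP: cI => c1 c2.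
have ne1 : c <> rho by move=> e; apply: n1; rewrite e.
have ne2 : c <> ab by move=> e; apply: n2; rewrite e.
have c1' : 0 < sg * (c - ab).
  rewrite lt_neqAle c1 andbT eq_sym mulf_eq0 subr_eq0 negb_or (introF eqP ne2) andbT.
  by case: sgP => ->; rewrite ?oppr_eq0 oner_eq0.
have c2' : 0 < sg * (rho - c).
  rewrite lt_neqAle mulrBr subr_ge0 c2 andbT -mulrBr eq_sym mulf_eq0 subr_eq0 negb_or.
  rewrite (eq_sym rho) (introF eqP ne1) andbT.
  by case: sgP => ->; rewrite ?oppr_eq0 oner_eq0.
have [c0 cb] : 0 < c /\ c <= bnd.
  move: c1' c2' rho0 rho_b ab_gt0 ab_le_bnd.
  by case: sgP => ->; rewrite ?mul1r ?mulN1r => *; split; lra.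
exists (c, q0) => //; apply: no_exit_in_wedge => //=.
case: sgP c2' => ->; rewrite ?mul1r ?mulN1r => h.
  by rewrite -fa_rho; apply: fa_incr => //; rewrite -subr_gt0.
by rewrite oppr_lt0 -fa_rho; apply: fa_incr => //; move: h; rewrite opprB subr_gt0.
Qed.

(** On horizontal lines in the wedge the slope da/dq of the field is monotone in a, which
    is what keeps two orbits trapped in the wedge apart. *)
Lemma slope_sign (a1 a2 q : R) : 0 < a1 -> 0 < a2 -> 0 < q -> q <= 1 ->
  0 < sg * (a1 - ab) -> 0 < sg * (a2 - a1) ->
  sg * fa a1 q < 0 -> sg * fa a2 q < 0 -> sg * fq a1 q < 0 -> sg * fq a2 q < 0 ->
  0 < sg * (q - qb) ->
  fa a2 q * fq a1 q - fa a1 q * fq a2 q <= 0.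
Proof.
move=> a10 a20 q0 q1 h1 h21 f1 f2 g1 g2 hq.
pose M (x y : R) := 2^-1 * x * y * (1 - q) - 2 * s * q * (beta + 2 * s + 2^-1 * (x + y)) + kappa * q * (1 - q).
have -> : fa a2 q * fq a1 q - fa a1 q * fq a2 q = (sg * (a2 - a1)) * (sg * M a1 a2).
  by rewrite mulrACA sg1 mul1r /fa /fq (gtr0_norm a10) (gtr0_norm a20) /M; field.
rewrite pmulr_rle0//.
(* M increases or decreases with each argument according to the sign of fq *)
have step (x y x' : R) : sg * (M x' y - M x y) = 2^-1 * (x' - x) * (sg * (y * (1 - q) - 2 * s * q)).
  by rewrite /M; field.
have e1 : fq a1 q = a1 * (1 - q) - 2 * s * q by rewrite /fq (gtr0_norm a10); ring.
have e2 : fq a2 q = a2 * (1 - q) - 2 * s * q by rewrite /fq (gtr0_norm a20); ring.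
have Msym (x y : R) : M x y = M y x by rewrite /M; ring.
case: sgP h1 h21 f1 f2 g1 g2 hq step => sgE; rewrite sgE ?mul1r ?mulN1r => h1 h21 f1 f2 g1 g2 hq step.
- have Mab : M ab ab <= 0.
    have -> : M ab ab = - ((q - qb) * (kappa * q + ab * ab / (2 * qb))).
      by rewrite /M qbE -abE; field; rewrite !gt_eqF.
    rewrite oppr_le0 mulr_ge0 ?(ltW hq)// addr_ge0//; first by rewrite mulr_ge0// ltW.
    by apply: divr_ge0; rewrite mulr_ge0// ltW.
  have gab : ab * (1 - q) - 2 * s * q <= 0.
    have -> : ab * (1 - q) - 2 * s * q = - ((ab + 2 * s) * (q - qb)) by rewrite qbE; field; rewrite gt_eqF.
    by rewrite oppr_le0 mulr_ge0// ltW.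
  have s1 := step a1 a2 ab; rewrite -e2 !mul1r in s1.
  have s2 := step a2 ab ab; rewrite !mul1r in s2.
  have p1 : 0 <= 2^-1 * (ab - a1) * fq a2 q.
    by rewrite mulr_le0 ?(ltW g2)// pmulr_rle0 ?invr_gt0//; lra.
  have p2 : 0 <= 2^-1 * (ab - a2) * (ab * (1 - q) - 2 * s * q).
    by rewrite mulr_le0// pmulr_rle0 ?invr_gt0//; lra.
  by rewrite (Msym ab a2) in s1; lra.
- rewrite oppr_le0.
  (* on the left, compare with the smaller abscissa a2 *)
  have f2' : 0 < fa a2 q by lra.
  have g2' : 0 < fq a2 q by lra.
  pose n := ((beta + 2 * s) * a2 + 2^-1 * a2 * a2) / kappa.
  have n0 : 0 < n by rewrite divr_gt0// addr_gt0 ?mulr_gt0 ?invr_gt0.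
  have nq : 0 <= n - q.
    have -> : n - q = fa a2 q / kappa.
      by rewrite /n /fa (gtr0_norm a20); field; rewrite gt_eqF.
    by rewrite divr_ge0// ltW.
  have gn : 0 <= a2 * (1 - n) - 2 * s * n.
    have e : a2 * kappa - (a2 + 2 * s) * ((beta + 2 * s) * a2 + 2^-1 * a2 * a2) =
        2^-1 * a2 * (ab - a2) * (a2 + ab + 2 * beta + 6 * s) by rewrite -abE; field.
    have -> : a2 * (1 - n) - 2 * s * n =
        (a2 * kappa - (a2 + 2 * s) * ((beta + 2 * s) * a2 + 2^-1 * a2 * a2)) / kappa.
      by rewrite /n; field; rewrite gt_eqF.
    rewrite e.
    by rewrite divr_ge0 ?(ltW kappa_gt0)// !mulr_ge0 ?invr_ge0 ?(ltW a20)//;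
      move: a20 ab_gt0 beta_gt0 s_gt0; lra.
  have Ma2 : 0 <= n * M a2 a2.
    have -> : n * M a2 a2 = (n - q) * (2^-1 * a2 * a2) + q * ((beta + 2 * s + a2) * (a2 * (1 - n) - 2 * s * n))
        + kappa * q * n * (n - q).
      by rewrite /M /n; field; rewrite gt_eqF.
    have n0' := ltW n0; have a20' := ltW a20; have q0' := ltW q0; have k0 := ltW kappa_gt0.
    have b0' : 0 <= beta + 2 * s + a2 by rewrite addr_ge0// ltW.
    have h0 : (0 : R) <= 2^-1 by rewrite invr_ge0.
    apply: addr_ge0; last by apply: mulr_ge0 => //; apply: mulr_ge0 => //; apply: mulr_ge0.
    apply: addr_ge0; first by apply: mulr_ge0 => //; apply: mulr_ge0 => //; apply: mulr_ge0.
    by apply: mulr_ge0 => //; apply: mulr_ge0.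
  have {}Ma2 : 0 <= M a2 a2 by rewrite -(pmulr_rge0 _ n0).
  have s1 := step a2 a2 a1; rewrite -e2 !mulN1r in s1.
  have p1 : 0 <= 2^-1 * (a1 - a2) * fq a2 q by rewrite !mulr_ge0 ?invr_ge0 ?(ltW g2')//; lra.
  by lra.
Qed.

Lemma in_wedge_side z (t : R) : in_wedge z -> 0 <= t -> 0 < sg * (pq z t - qb).
Proof.
move=> h t0; have [ql _] := in_wedge_converges h.
have t1 : t < t + 1 by rewrite ltrDl.
have [lt1 _] := in_wedge_mono h t0 t1.
suff : 0 <= sg * (pq z (t + 1) - qb) by rewrite !mulrBr; lra.
rewrite leNgt; apply/negP => hn; set e := - (sg * (pq z (t + 1) - qb)).
have e0 : 0 < e by rewrite oppr_gt0.
have e2 : 0 < e / 2 by rewrite divr_gt0.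
have [T hT] := (proj2 (cvgyP _ _) ql) _ e2.
pose u := Num.max T (t + 2).
have tu : t + 1 < u by rewrite lt_max; apply/orP; right; rewrite ltrD2l ltr1n.
have [lt2 _] := in_wedge_mono h (addr_ge0 t0 ler01) tu.
have := hT u; rewrite le_max lexx => /(_ isT).
rewrite -sgabs ler_norml => /andP[h1 _].
by move: lt2 h1; rewrite /e !mulrBr; lra.
Qed.

Lemma in_wedge_level z (y : R) : in_wedge z -> 0 < sg * (y - qb) -> sg * y <= sg * z.2 ->
  exists2 t : R, 0 <= t & pq z t = y.
Proof.
move=> h hy yz; have [ql _] := in_wedge_converges h.
have [T hT] := (proj2 (cvgyP _ _) ql) _ hy.
pose u := Num.max T 0; have u0 : 0 <= u by rewrite le_max lexx orbT.
have := hT u; rewrite le_max lexx => /(_ isT).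
rewrite -sgabs ler_norml => /andP[_ h1].
have hb : Num.min (sg * pq z 0) (sg * pq z u) <= sg * y <= Num.max (sg * pq z 0) (sg * pq z u).
  rewrite ge_min le_max pq0// yz andbT; apply/orP; right.
  by move: h1; rewrite !mulrBr; lra.
have c : {within `[0, u], continuous (fun t : R => sg * pq z t)}.
  by apply: continuous_subspaceT; apply: contM; [exact: contC|exact: cpq].
have [t tI e] := IVT u0 c hb.
exists t; first by move: tI; rewrite in_itv /= => /andP[].
have sn : sg != 0 by case: sgP => ->; rewrite ?oppr_eq0 oner_eq0.
exact: (mulfI sn).
Qed.

(** Parametrize both orbits by their common coordinate q, through the inverse tau of
    the coordinate q of the first: their distance in the direction a does not decrease,
    whereas both tend to the vertex. *)
Let wedge_unique_lt z1 z2 : in_wedge z1 -> in_wedge z2 -> z1.2 = z2.2 -> 0 < z1.2 ->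
  0 < sg * (z2.1 - z1.1) -> False.
Proof.
move=> w1 w2 e12 q00 hgap.
have cfq : continuous (fun t : R => fqt t (pa z1 t) (pq z1 t)).
  have h := @fq_continuous R s _ _ (clamp_comp_continuous (ltW bnd0) (@cpa z1))
    (clamp_comp_continuous ler01 (@cpq z1)).
  exact: h.
have fqt1 (t : R) : 0 <= t -> fqt t (pa z1 t) (pq z1 t) = fq (pa z1 t) (pq z1 t).
  by move=> t0; have [b _ _ _] := w1 t t0; have [_ ->] := inboxE b.
have s0 : 0 < - (sg * fqt 0 (pa z1 0) (pq z1 0)).
  by rewrite oppr_gt0 fqt1//; exact: in_wedge_fq.
have cfqN : continuous (fun t : R => - (sg * fqt t (pa z1 t) (pq z1 t))).
  exact: (contN (contM (@contC _ R sg) cfq)).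
have [e e0 he] := cont_gt (cfqN 0) s0.
have sgn (t : R) : - e < t -> 0 < - (sg * fqt t (pa z1 t) (pq z1 t)).
  move=> et; case: (leP 0 t) => t0; first by rewrite oppr_gt0 fqt1//; exact: in_wedge_fq.
  by apply: he; rewrite subr0 ltr_norml et /=; lra.
have inj (x y : R) : - e < x -> x < y -> pq z1 x <> pq z1 y.
  move=> ex xy exy.
  have d (u : R) : x < u < y -> is_derive u (1:R) (fun v => - (sg * pq z1 v)) (- (sg * fqt u (pa z1 u) (pq z1 u))).
    by move=> _; have H := is_deriveN (is_deriveZ sg (dpq z1 u)); exact: (is_derive_eq H).
  have c : {within `[x, y], continuous (fun v : R => - (sg * pq z1 v))}.
    by apply: continuous_subspaceT; apply: contN; apply: contM; [exact: contC|exact: cpq].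
  suff : - (sg * pq z1 x) < - (sg * pq z1 y) by rewrite exy ltxx.
  by apply: (is_derive_incr xy d c) => u /andP[xu _]; apply: sgn; exact: lt_trans xu.
pose tau (y : R) := xget 0 [set t : R | - e < t /\ pq z1 t = y].
have tauK (t : R) : - e < t -> tau (pq z1 t) = t.
  move=> et; have [h1 h2] : (fun t' => - e < t' /\ pq z1 t' = pq z1 t) (tau (pq z1 t)).
    by apply: (@xgetPex _ 0 [set t' : R | - e < t' /\ pq z1 t' = pq z1 t]); exists t.
  case: (ltgtP (tau (pq z1 t)) t) => // lt; exfalso.
    exact: inj h1 lt h2.
  exact: inj et lt (esym h2).
have en : - e < 0 by rewrite oppr_lt0.
have dtau (t : R) : 0 <= t -> is_derive (pq z1 t) (1:R) tau (fq (pa z1 t) (pq z1 t))^-1.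
  move=> t0; have [b _ _ _] := w1 t t0.
  apply: (is_derive_inverse (f := pq z1)).
  - near=> x; apply: tauK; near: x; apply: lt_nbhsr; exact: lt_le_trans en t0.
  - by near=> x; exact: cpq.
  - exact: inbox_pq b.
  - apply/eqP => h; have := in_wedge_fq w1 t0; by rewrite h mulr0 ltxx.
have w2le (u : R) : 0 <= u -> sg * pq z2 u <= sg * z1.2.
  move=> u0; rewrite e12; have [->|ne] := eqVneq u 0; first by rewrite pq0.
  have up : 0 < u by rewrite lt_neqAle eq_sym ne.
  by have [/ltW] := in_wedge_mono w2 (lexx 0) up; rewrite pq0.
have lev (u : R) : 0 <= u -> exists2 t : R, 0 <= t & pq z1 t = pq z2 u.
  by move=> u0; apply: in_wedge_level => //; [exact: in_wedge_side|exact: w2le].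
pose T (u : R) := tau (pq z2 u).
have TP (u : R) : 0 <= u -> 0 <= T u /\ pq z1 (T u) = pq z2 u.
  move=> u0; have [t t0 et] := lev u u0.
  by rewrite /T -et tauK ?(lt_le_trans en).
have dT (u : R) : 0 <= u -> is_derive u (1:R) T
    ((fq (pa z1 (T u)) (pq z1 (T u)))^-1 * fq (pa z2 u) (pq z2 u)).
  move=> u0; have [T0 eT] := TP u u0; have [b2 _ _ _] := w2 u u0.
  have h1 := dtau (T u) T0; rewrite {1}eT in h1.
  have h2 := inbox_pq beta_gt0 s_gt0 kappa_gt0 b2.
  exact: (@is_derive1_comp R tau (pq z2) u _ _ h1 h2).
pose D (u : R) := sg * (pa z2 u - pa z1 (T u)).
pose dD (u : R) := sg * (fa (pa z2 u) (pq z2 u) - fa (pa z1 (T u)) (pq z1 (T u)) *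
  ((fq (pa z1 (T u)) (pq z1 (T u)))^-1 * fq (pa z2 u) (pq z2 u))).
have dDP (u : R) : 0 <= u -> is_derive u (1:R) D (dD u).
  move=> u0; have [T0 eT] := TP u u0.
  have [b1 _ _ _] := w1 (T u) T0; have [b2 _ _ _] := w2 u u0.
  have h1 := inbox_pa beta_gt0 s_gt0 kappa_gt0 b1.
  have h2 := inbox_pa beta_gt0 s_gt0 kappa_gt0 b2.
  have h3 := @is_derive1_comp R (pa z1) T u _ _ h1 (dT u u0).
  have H := is_deriveZ sg (is_deriveB h2 h3); exact: (is_derive_eq H).
have cD : continuous (fun u : R => D (Num.max 0 u)).
  apply: max0_continuous; apply: continuous_in_subspaceT => u.
  rewrite inE /= in_itv /= andbT => u0; exact: is_derive_cont (dDP u u0).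
have T00 : T 0 = 0 by rewrite /T pq0// -e12 -(pq0 beta_gt0 s_gt0 kappa_gt0 z1) tauK.
have D0 : 0 < D 0 by rewrite /D T00 !pa0.
have qpos (z : R * R) (u : R) : in_wedge z -> 0 <= u -> 0 < z.2 -> 0 < pq z u /\ pq z u <= 1.
  move=> wz u0 z20; split; last first.
    by have [[_ h] _ _ _] := wz u u0; exact: le_trans (ler_norm _) h.
  have := in_wedge_side wz u0; case: sgP => sgE; rewrite sgE ?mul1r ?mulN1r.
    by rewrite subr_gt0; exact: lt_trans.
  move=> _; have [->|ne] := eqVneq u 0; first by rewrite pq0.
  have up : 0 < u by rewrite lt_neqAle eq_sym ne.
  have [+ _] := in_wedge_mono wz (lexx 0) up; rewrite sgE !mulN1r ltrN2 pq0//.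
  exact: lt_trans.
have dD0 (u : R) : 0 <= u -> 0 < D u -> 0 <= dD u.
  move=> u0 Du; have [T0 eT] := TP u u0.
  have [_ p1 p2 p3] := w1 (T u) T0; have [_ r1 r2 r3] := w2 u u0.
  have g1 := in_wedge_fq w1 T0; have g2 := in_wedge_fq w2 u0.
  have sd := in_wedge_side w2 u0.
  have [qp qp1] := qpos z2 u w2 u0 (eq_ind _ (fun x => 0 < x) q00 _ e12).
  rewrite eT in p3 g1.
  have := slope_sign p1 r1 qp qp1 p2 Du p3 r3 g1 g2 sd.
  rewrite /dD eT; set F2 := fa _ _; set F1 := fa _ _; set G1 := fq _ _; set G2 := fq _ _ => N.
  have G10 : G1 != 0 by apply/eqP => h; move: g1; rewrite -/G1 h mulr0 ltxx.
  have -> : sg * (F2 - F1 * (G1^-1 * G2)) = (- (sg * G1)) * (- (F2 * G1 - F1 * G2)) / (G1 * G1).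
    by field; rewrite G10.
  apply: divr_ge0; last by rewrite -expr2 sqr_ge0.
  by apply: mulr_ge0; rewrite oppr_ge0 // ltW.
have grow (u : R) : 0 <= u -> D 0 <= D u.
  move=> u0.
  have D0' : 0 < D (Num.max 0 0) by rewrite maxxx.
  have dD' (v : R) : 0 < v < u -> is_derive v (1:R) (fun u : R => D (Num.max 0 u)) (dD v).
    move=> /andP[v0 _]; apply: (@is_derive_ext_near R D (fun u => D (Num.max 0 u)) v _ v v0 _ (dDP v (ltW v0))).
    by move=> x; rewrite ltr_norml => /andP[h _]; rewrite max_r//; lra.
  have := barrier cD u0 D0' dD'; rewrite maxxx (max_idPr u0); apply.
  by move=> v /andP[v0 _]; rewrite (max_idPr (ltW v0)); apply: dD0; exact: ltW.
have [_ al] := in_wedge_converges w2.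
have d2 : 0 < D 0 / 2 by rewrite divr_gt0.
have [S hS] := (proj2 (cvgyP _ _) al) _ d2.
pose u := Num.max S 0; have u0 : 0 <= u by rewrite le_max lexx orbT.
have := hS u; rewrite le_max lexx => /(_ isT).
rewrite -sgabs ler_norml => /andP[_ h1].
have [T0 _] := TP u u0; have [_ _ h2 _] := w1 (T u) T0.
have eD : D u = sg * (pa z2 u - ab) - sg * (pa z1 (T u) - ab) by rewrite /D; ring.
have := grow u u0; rewrite eD; move: h1 h2 D0; lra.
Unshelve. all: by end_near. Qed.

Lemma wedge_unique z1 z2 : in_wedge z1 -> in_wedge z2 -> z1.2 = z2.2 -> 0 < z1.2 -> z1 = z2.
Proof.
move=> w1 w2 e12 q0; case: (ltgtP (sg * (z2.1 - z1.1)) 0) => h.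
- exfalso; apply: (wedge_unique_lt w2 w1) => //; first by rewrite -e12.
  by move: h; rewrite !mulrBr; lra.
- by exfalso; exact: (wedge_unique_lt w1 w2).
- have sn : sg != 0 by case: sgP => ->; rewrite ?oppr_eq0 oner_eq0.
  move/eqP: h; rewrite mulf_eq0 (negbTE sn) /= subr_eq0 => /eqP h.
  by move: e12 h; case: z1 z2 {w1 w2 q0} => [? ?] [? ?] /= -> ->.
Qed.

End Wedge.

End PhasePlane.

(** * The two branches of the stable manifold *)

Section Branches.
Context {R : realType}.
Variables (beta s kappa ab qb : R).
Hypotheses (beta_gt0 : 0 < beta) (s_gt0 : 0 < s) (kappa_gt0 : 0 < kappa).
Hypotheses (ab_gt0 : 0 < ab) (qbE : qb = ab / (ab + 2 * s)).
Hypothesis abE : 2^-1 * ab * ab + (beta + 3 * s) * ab + 2 * beta * s + 4 * s * s = kappa.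
Local Notation fa := (fa beta s kappa).
Local Notation fq := (fq s).
Local Notation bnd := (bnd beta s kappa).
Local Notation fat := (fat beta s kappa).
Local Notation fqt := (fqt beta s kappa).
Local Notation pa := (pa beta s kappa).
Local Notation pq := (pq beta s kappa).
Local Notation inbox := (inbox beta s kappa).
Local Notation stays := (stays beta s kappa).
Local Notation in_wedge := (in_wedge beta s kappa ab).
Local Notation a0 := (a0 s).
Local Notation W := (W beta s kappa).
Local Notation w := (w beta s kappa).

Let b0 : 0 < beta + 2 * s := b_gt0 beta_gt0 s_gt0.
Let qb0 : 0 < qb := qb_gt0 s_gt0 ab_gt0 qbE.
Let qb1 : qb < 1 := qb_lt1 s_gt0 ab_gt0 qbE.
Let abb : ab < bnd := ab_le_bnd beta_gt0 s_gt0 kappa_gt0 ab_gt0 qbE abE.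
Let dpa := pa_derive beta_gt0 s_gt0 kappa_gt0.
Let dpq := pq_derive beta_gt0 s_gt0 kappa_gt0.
Let pa0' := pa0 beta_gt0 s_gt0 kappa_gt0.
Let pq0' := pq0 beta_gt0 s_gt0 kappa_gt0.
Let cpa z : continuous (pa z). Proof. exact: pa_continuous. Qed.
Let cpq z : continuous (pq z). Proof. exact: pq_continuous. Qed.
Let wmono := @in_wedge_mono R beta s kappa ab qb beta_gt0 s_gt0 kappa_gt0 ab_gt0 qbE abE.
Let wfq := @in_wedge_fq R beta s kappa ab qb beta_gt0 s_gt0 kappa_gt0 ab_gt0 qbE abE.
Let wside := @in_wedge_side R beta s kappa ab qb beta_gt0 s_gt0 kappa_gt0 ab_gt0 qbE abE.
Let wlevel := @in_wedge_level R beta s kappa ab qb beta_gt0 s_gt0 kappa_gt0 ab_gt0 qbE abE.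
Let wunique := @wedge_unique R beta s kappa ab qb beta_gt0 s_gt0 kappa_gt0 ab_gt0 qbE abE.
Let wconv := @in_wedge_converges R beta s kappa ab qb beta_gt0 s_gt0 kappa_gt0 ab_gt0 qbE abE.
Let shift := flow_shift beta_gt0 s_gt0 kappa_gt0.

Let pos1 : (1 : R) = 1 \/ (1 : R) = -1. Proof. by left. Qed.
Let neg1 : (-1 : R) = 1 \/ (-1 : R) = -1. Proof. by right. Qed.

Lemma flow00 (t : R) : pa (0, 0) t = 0 /\ pq (0, 0) t = 0.
Proof.
have := flow_opp beta_gt0 s_gt0 kappa_gt0 (0, 0) t; rewrite /= !oppr0 => -[h1 h2].
by split; lra.
Qed.

Lemma flow_meet z z' (t t' : R) : pa z t = pa z' t' -> pq z t = pq z' t' ->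
  z = (pa z' (t' - t), pq z' (t' - t)).
Proof.
move=> e1 e2; apply: (flow_inj (t := t) beta_gt0 s_gt0 kappa_gt0).
  by have [-> _] := shift z' (t' - t) t; rewrite subrK.
by have [_ ->] := shift z' (t' - t) t; rewrite subrK.
Qed.

(** The orbit is eventually on one side of the line a = ab, since it crosses this line
    transversally and would then escape; on that side the a-component must point
    towards ab, since otherwise the orbit escapes as well. *)
Lemma converging_in_wedge z : stays z -> pq z t @[t --> +oo] --> qb ->
  pa z t @[t --> +oo] --> ab -> z <> (ab, qb) ->
  exists (sg T : R), [/\ sg = 1 \/ sg = -1, 0 <= T & in_wedge sg (pa z T, pq z T)].
Proof.
move=> hz qz az zne.
have [T0 hT0] := (proj2 (cvgyP _ _) az) (ab / 2) (divr_gt0 ab_gt0 (ltr0Sn R 1)).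
pose T := Num.max 0 T0; have T00 : 0 <= T by rewrite le_max lexx.
have apos (t : R) : T <= t -> 0 < pa z t.
  move=> h; have := hT0 t (le_trans _ h); rewrite le_max lexx orbT => /(_ isT).
  by rewrite ler_norml => /andP[+ _]; move: ab_gt0; lra.
have box (t : R) : T <= t -> inbox z t by move=> h; apply: hz; exact: le_trans h.
have noesc (sg t : R) : (sg = 1 \/ sg = -1) -> T <= t -> 0 < sg * (pa z t - ab) -> 0 < sg * fa (pa z t) (pq z t) -> False.
  move=> sgP Tt h1 h2.
  have H := escape beta_gt0 s_gt0 kappa_gt0 ab_gt0 qbE abE sgP hz (le_trans T00 Tt)
    (fun u hu => apos u (le_trans Tt hu)) h1 h2.
  have [S hS] := (proj2 (cvgyP _ _) az) _ (divr_gt0 h1 (ltr0Sn R 1)).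
  have := hS (Num.max t S); rewrite le_max lexx orbT => /(_ isT).
  have := H (Num.max t S); rewrite le_max lexx => /(_ isT) [_].
  set y := pa z (Num.max t S) - ab; set y0 := pa z t - ab in h1 *.
  have -> : `|y| = `|sg * y| by case: sgP => ->; rewrite ?mul1r ?mulN1r ?normrN.
  move=> h3; rewrite ger0_norm; last by apply: le_trans h3; exact: ltW.
  by move: h1 h3; lra.
have noff (sg t : R) : (sg = 1 \/ sg = -1) -> T <= t -> 0 < sg * (pa z t - ab) -> 0 <= sg * fa (pa z t) (pq z t) -> False.
  move=> sgP Tt h1; rewrite le_eqVlt => /orP[/eqP e0|]; last exact: noesc.
  have ne : (pa z t, pq z t) <> (ab, qb) by move=> [h _]; move: h1; rewrite h subrr mulr0 ltxx.
  have hfa : sg * fa (pa z t) (pq z t) <= 0 by rewrite -e0.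
  have hfq := wedge_fq beta_gt0 s_gt0 kappa_gt0 ab_gt0 qbE abE sgP (apos t Tt) (ltW h1) hfa ne.
  have [bE1 bE2] := inboxE (box t Tt).
  have fa0 : fa (pa z t) (pq z t) = 0 by case: sgP e0 => ->; rewrite ?mul1r ?mulN1r; lra.
  have d := is_deriveZ sg (fa_derive beta_gt0 s_gt0 kappa_gt0 z t).
  have l0 : 0 < sg *: ((beta + 2 * s + `|pa z t|) * fat t (pa z t) (pq z t) - kappa * fqt t (pa z t) (pq z t)).
    rewrite bE1 bE2 fa0 mulr0 sub0r /GRing.scale /= mulrN mulrCA -mulrN pmulr_rgt0//.
    by rewrite oppr_gt0.
  have [d1 d10 hd1] := deriv_gt0 d l0.
  have ca : continuous (fun u : R => sg * (pa z u - ab)).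
    by apply: contM; [exact: contC|apply: contB; [exact: cpa|exact: contC]].
  have [d2 d20 hd2] := cont_gt (ca t) h1.
  pose u := t + Num.min d1 d2 / 2.
  have m0 : 0 < Num.min d1 d2 by rewrite lt_min d10.
  have tu : t < u by rewrite ltrDl divr_gt0.
  have ut : `|u - t| < Num.min d1 d2.
    by rewrite gtr0_norm ?subr_gt0// /u; move: m0; lra.
  have ud1 : `|u - t| < d1 by apply: lt_le_trans ut (minl_le _ _).
  have ud2 : `|u - t| < d2 by apply: lt_le_trans ut (minr_le _ _).
  apply: (noesc sg u sgP) => //; first exact: le_trans (ltW tu); last first.
    by have [/(_ tu) + _] := hd1 u ud1; rewrite -[X in X < _]/(sg * fa (pa z t) (pq z t)) -e0.
  exact: hd2.
have ane (t : R) : T <= t -> pa z t <> ab.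
  move=> Tt e.
  have [bE1 bE2] := inboxE (box t Tt).
  have fne : fa (pa z t) (pq z t) <> 0.
    move=> f0; apply: zne.
    have eq : pq z t = qb.
      move: f0 (fa_stat s_gt0 ab_gt0 qbE abE); rewrite e /fa => h1 h2.
      by apply: (mulfI (lt0r_neq0 kappa_gt0)); lra.
    have [s1 s2] := stationary_orbit beta_gt0 s_gt0 kappa_gt0 ab_gt0 qbE abE t.
    by apply: (flow_inj (t := t) beta_gt0 s_gt0 kappa_gt0); rewrite ?s1 ?s2.
  have [sg sgP f0] : exists2 sg : R, sg = 1 \/ sg = -1 & 0 < sg * fa (pa z t) (pq z t).
    case: (ltgtP (fa (pa z t) (pq z t)) 0) => // h; [exists (-1)|exists 1]; rewrite ?mulN1r ?mul1r ?oppr_gt0//.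
  have d := is_deriveZ sg (inbox_pa beta_gt0 s_gt0 kappa_gt0 (box t Tt)).
  have [d1 d10 hd1] := deriv_gt0 d f0.
  have cf : continuous (fun u : R => sg * fa (pa z u) (pq z u)).
    by apply: contM; [exact: contC|exact: fa_orbit_continuous].
  have [d2 d20 hd2] := cont_gt (cf t) f0.
  pose u := t + Num.min d1 d2 / 2.
  have m0 : 0 < Num.min d1 d2 by rewrite lt_min d10.
  have tu : t < u by rewrite ltrDl divr_gt0.
  have ut : `|u - t| < Num.min d1 d2.
    by rewrite gtr0_norm ?subr_gt0// /u; move: m0; lra.
  have ud1 : `|u - t| < d1 by apply: lt_le_trans ut (minl_le _ _).
  have ud2 : `|u - t| < d2 by apply: lt_le_trans ut (minr_le _ _).
  apply: (noesc sg u sgP) => //; first exact: le_trans (ltW tu); last exact: hd2.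
  by have [/(_ tu) + _] := hd1 u ud1; rewrite /GRing.scale /= e mulrBr subr_gt0.
have [sg sgP h0] : exists2 sg : R, sg = 1 \/ sg = -1 & 0 < sg * (pa z T - ab).
  case: (ltgtP (pa z T) ab) => h; [exists (-1)|exists 1|by case: (ane T (lexx T))];
    rewrite ?mulN1r ?mul1r ?oppr_gt0 ?subr_lt0 ?subr_gt0//; by [left|right].
have side (t : R) : T <= t -> 0 < sg * (pa z t - ab).
  move=> Tt; rewrite ltNge; apply/negP => hn.
  have ca : continuous (fun u : R => sg * (pa z u - ab)).
    by apply: contM; [exact: contC|apply: contB; [exact: cpa|exact: contC]].
  have [u /andP[u1 u2] [eu _]] := first_hit ca Tt h0 hn.
  apply: (ane u (ltW u1)); move/eqP: eu; rewrite mulf_eq0 subr_eq0 => /orP[|/eqP//].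
  by case: sgP => ->; rewrite ?oppr_eq0 oner_eq0.
exists sg, T; split=> // t t0; rewrite /inbox; have [-> ->] := shift z T t.
have Tt : T <= T + t by rewrite lerDl.
split; [exact: box|exact: apos|exact: side|].
by rewrite ltNge; apply/negP => h; exact: (noff sg (T + t) sgP Tt (side _ Tt) h).
Qed.

(** Only the stationary orbit tends to the origin: W is positive near the origin and
    nondecreasing along orbits. *)
Lemma stays_cases z : stays z -> [\/ z = (0, 0),
    pq z t @[t --> +oo] --> qb /\ pa z t @[t --> +oo] --> ab |
    pq z t @[t --> +oo] --> - qb /\ pa z t @[t --> +oo] --> - ab].
Proof.
move=> hz; have [l [ql al [] hl]] := stays_converges beta_gt0 s_gt0 kappa_gt0 ab_gt0 qbE abE hz;
  rewrite {}hl in ql al.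
- constructor 1.
  have [T0 hT0] := (proj2 (cvgyP _ _) ql) _ qb0.
  pose T := Num.max 0 T0; have T00 : 0 <= T by rewrite le_max lexx.
  have bq (t : R) : 0 <= t -> `|pq z (T + t)| <= qb.
    by move=> t0; have := hT0 (T + t); rewrite subr0; apply; rewrite /T; case: (leP 0 T0) => //; lra.
  have t1 (t : R) : 0 <= t -> 0 <= T + t by move=> t0; rewrite addr_ge0.
  have ba (t : R) : 0 <= t -> `|pa z (T + t)| <= bnd by move=> /t1 /hz[].
  have ca : continuous (fun t : R => pa z (T + t)) by apply: cont_add_arg; exact: cpa.
  have cq : continuous (fun t : R => pq z (T + t)) by apply: cont_add_arg; exact: cpq.
  have da (t : R) : 0 < t -> is_derive t (1:R) (fun t => pa z (T + t)) (1 * fa (pa z (T + t)) (pq z (T + t))).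
    move=> t0; have H := is_derive_translate (inbox_pa beta_gt0 s_gt0 kappa_gt0 (hz _ (t1 t (ltW t0)))).
    by apply: (is_derive_eq H); rewrite mul1r.
  have dq (t : R) : 0 < t -> is_derive t (1:R) (fun t => pq z (T + t)) (1 * fq (pa z (T + t)) (pq z (T + t))).
    move=> t0; have H := is_derive_translate (inbox_pq beta_gt0 s_gt0 kappa_gt0 (hz _ (t1 t (ltW t0)))).
    by apply: (is_derive_eq H); rewrite mul1r.
  have [l' [_ ql' _ _ hW]] := orbit_converges beta_gt0 s_gt0 kappa_gt0 ab_gt0 qbE abE (ltW qb0) qb1 (mul1r 1)
    ca cq da dq ba bq.
  have l0 : l' = 0.
    suff h : pq z (T + t) @[t --> +oo] --> 0 by exact: cvg_unique ql' h.
    apply/cvgyP => e e0; have [S hS] := (proj2 (cvgyP _ _) ql) e e0.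
    by exists S => t St; apply: hS; rewrite -[S]add0r lerD.
  have w00 : w qb 0 = 0 := w0 beta s kappa (ltW qb0) qb1.
  rewrite l0 w00 in hW.
  have wge (t : R) : 0 <= t -> 0 <= w qb (pq z (T + t)) <= W qb (pa z (T + t)) (pq z (T + t)).
    move=> t0; have h := bq t t0; rewrite (W_ge_w _ _ s_gt0 _ _ (le_lt_trans h qb1)) andbT.
    have [->|ne] := eqVneq (pq z (T + t)) 0; first by rewrite w00.
    exact: ltW (w_gt0 beta_gt0 s_gt0 ab_gt0 qbE abE (ltW qb0) qb1 ne h h).
  have q0 (t : R) : 0 <= t -> pq z (T + t) = 0.
    move=> t0; apply/eqP; apply/negPn/negP => ne; have h := bq t t0.
    have := w_gt0 beta_gt0 s_gt0 ab_gt0 qbE abE (ltW qb0) qb1 ne h h.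
    by have := wge t t0; have := hW t t0; rewrite !mul1r => h1 /andP[_]; lra.
  have hW' (t : R) : 0 <= t -> 1 * W qb (pa z (T + t)) (pq z (T + t)) <= 1 * w qb 0.
    by move=> /hW; rewrite w00.
  have hW0 : 1 * w qb 0 <= 1 * W qb (pa z (T + 0)) (pq z (T + 0)).
    by rewrite !mul1r w00; have /andP[] := wge 0 (lexx 0); exact: le_trans.
  have := W_constant beta_gt0 s_gt0 (ltW qb0) qb1 (mul1r 1) ca cq da dq bq (lexx 0) hW' hW0.
  move=> /(_ 1 ltr01); rewrite /fq q0// mulr0 subr0 => a0E.
  have [z1 z2] := flow00 (T + 1).
  by apply: (flow_inj (t := T + 1) beta_gt0 s_gt0 kappa_gt0); rewrite ?z1 ?z2 ?q0.
- by constructor 2; split => //; rewrite -(a0_qb s_gt0 ab_gt0 qbE).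
- by constructor 3; split => //; rewrite -(a0_qb s_gt0 ab_gt0 qbE) -a0N.
Qed.

(** The two branches of the stable manifold of (ab, qb) are the orbits of a point
    zR on the boundary and of a point zL on the left. *)
Variables zL zR : R * R.
Hypotheses (wL : in_wedge (-1) zL) (eL : zL.2 = qb / 2).
Hypotheses (wR : in_wedge 1 zR) (eR : zR.2 = 1).

Let qb20 : 0 < qb / 2. Proof. by rewrite divr_gt0. Qed.

(** The orbit enters a wedge, where it meets the height of a point of the branch, and
    uniqueness in the wedge identifies both orbits. *)
Lemma branch_cases z : stays z -> pq z t @[t --> +oo] --> qb ->
  pa z t @[t --> +oo] --> ab ->
  [\/ z = (ab, qb), exists u : R, z = (pa zL u, pq zL u) |
      exists2 u : R, 0 <= u & z = (pa zR u, pq zR u)].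
Proof.
move=> hz qz az; have [->|zne] := pselect (z = (ab, qb)); first by constructor 1.
have [sg [T [sgP T0 wz]]] := converging_in_wedge hz qz az zne.
case: sgP wz => -> wz.
- have sd := wside pos1 wz (lexx 0); rewrite pq0'/= in sd.
  have le : 1 * pq z T <= 1 * zR.2.
    by rewrite !mul1r eR; have [_ h] := hz T T0; exact: le_trans (ler_norm _) h.
  have [t t0 et] := wlevel pos1 wR sd le.
  have e : (pa zR t, pq zR t) = (pa z T, pq z T).
    apply: (wunique pos1) => //=; first exact: in_wedge_shift.
    by rewrite et; move: sd; rewrite mul1r subr_gt0; exact: lt_trans.
  case: e => e1 e2.
  constructor 3; exists (t - T); last exact: flow_meet.
  rewrite leNgt; apply/negP => lt.
  have e3 := flow_meet e1 e2.
  have := strip_lt1 beta_gt0 s_gt0 kappa_gt0 (z := z) (t := T - t).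
  have -> : pq z (T - t) = zR.2 by rewrite e3.
  rewrite eR normr1 ltxx => h; apply: notF; apply: h; last by move: lt; lra.
  by have [_] := hz 0 (lexx 0); rewrite pq0'.
- suff [t [T' [t0 T'0 e1 e2]]] : exists t T' : R, [/\ 0 <= t, 0 <= T', pa z T' = pa zL t & pq z T' = pq zL t].
    by constructor 2; exists (t - T'); exact: flow_meet.
  have sd := wside neg1 wz (lexx 0); rewrite pq0'/= in sd.
  case: (leP (qb / 2) (pq z T)) => hq.
    have [|t t0 et] := wlevel neg1 wL sd; first by rewrite eL !mulN1r lerN2.
    exists t, T; have [-> ->] : (pa zL t, pq zL t) = (pa z T, pq z T) => //.
    apply: (wunique neg1) => //=; first exact: in_wedge_shift.
    by rewrite et; exact: lt_le_trans hq.
  have [||t t0 et] := wlevel (y := qb / 2) neg1 wz; first by move: qb0; lra.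
    by rewrite !mulN1r lerN2/= ltW.
  have [e1 e2] := shift z T t; rewrite e2 in et.
  exists 0, (T + t); suff [-> ->] : pa z (T + t) = pa zL 0 /\ pq z (T + t) = pq zL 0.
    by rewrite addr_ge0.
  have := wunique neg1 wL (in_wedge_shift beta_gt0 s_gt0 kappa_gt0 wz t0).
  by rewrite /= e2 e1 et eL => /(_ erefl qb20) e; rewrite pa0' pq0' e.
Qed.

Lemma left_pos (t : R) : 0 <= t -> 0 < pq zL t < qb.
Proof.
move=> t0; have := wside neg1 wL t0; rewrite mulN1r oppr_gt0 subr_lt0 => ->; rewrite andbT.
have [->|ne] := eqVneq t 0; first by rewrite pq0' eL.
have tp : 0 < t by rewrite lt_neqAle eq_sym ne.
have [+ _] := wmono neg1 wL (lexx 0) tp; rewrite !mulN1r ltrN2 pq0' eL.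
exact: lt_trans.
Qed.

Let dnb (t : R) : is_derive t (1:R) (fun u => pa zL (-1 * u)) (-1 * fat t (pa zL (-1 * t)) (pq zL (-1 * t))).
Proof. exact: is_derive_scale_arg (dpa zL (-1 * t)). Qed.
Let dqb (t : R) : is_derive t (1:R) (fun u => pq zL (-1 * u)) (-1 * fqt t (pa zL (-1 * t)) (pq zL (-1 * t))).
Proof. exact: is_derive_scale_arg (dpq zL (-1 * t)). Qed.
Let cab : continuous (fun u : R => pa zL (-1 * u)). Proof. move=> t; exact: is_derive_cont (dnb t). Qed.
Let cqb : continuous (fun u : R => pq zL (-1 * u)). Proof. move=> t; exact: is_derive_cont (dqb t). Qed.

(** W increases strictly along the left branch, up to its value at (ab, qb). *)
Let left_W : W qb zL.1 zL.2 < w qb qb.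
Proof.
have da (t : R) : 0 < t -> is_derive t (1:R) (pa zL) (1 * fa (pa zL t) (pq zL t)).
  move=> t0; rewrite mul1r; have [b _ _ _] := wL (ltW t0); exact: inbox_pa.
have dq (t : R) : 0 < t -> is_derive t (1:R) (pq zL) (1 * fq (pa zL t) (pq zL t)).
  move=> t0; rewrite mul1r; have [b _ _ _] := wL (ltW t0); exact: inbox_pq.
have ba (t : R) : 0 <= t -> `|pa zL t| <= bnd by move=> /wL[[]].
have bq (t : R) : 0 <= t -> `|pq zL t| <= qb.
  by move=> /left_pos/andP[h1 h2]; rewrite gtr0_norm// ltW.
have [l [_ ql' _ _ hW]] := orbit_converges beta_gt0 s_gt0 kappa_gt0 ab_gt0 qbE abE (ltW qb0) qb1 (mul1r 1)
    (@cpa zL) (@cpq zL) da dq ba bq.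
have [ql _] := wconv neg1 wL.
have ll : l = qb by exact: cvg_unique ql' ql.
rewrite ll in hW.
have := hW 0 (lexx 0); rewrite !mul1r pa0' pq0' lt_neqAle => ->; rewrite andbT; apply/eqP => e.
have e' : 1 * w qb qb <= 1 * W qb (pa zL 0) (pq zL 0) by rewrite !mul1r pa0' pq0' e.
have := W_constant beta_gt0 s_gt0 (ltW qb0) qb1 (mul1r 1) (@cpa zL) (@cpq zL) da dq bq (lexx 0) hW e'.
by move=> /(_ 1 ltr01) f0; have := wfq neg1 wL (ler01 : 0 <= (1:R)); rewrite f0 mulr0 ltxx.
Qed.

(** Backward in time the left branch cannot leave the region |q| < qb, since W
    decreases there below its values on the lines |q| = qb. *)
Lemma left_back (t : R) : 0 <= t -> `|pa zL (-1 * t)| < bnd /\ `|pq zL (-1 * t)| < qb.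
Proof.
move=> t0; pose f (u : R) := Num.min (bnd - `|pa zL (-1 * u)|) (qb - `|pq zL (-1 * u)|).
suff : 0 < f t by rewrite lt_min !subr_gt0 => /andP[].
have cf : continuous f.
  by apply: cont_min; apply: contB; try exact: contC; apply: cont_norm.
have [bL aL abL _] := wL (lexx 0); rewrite pa0' in aL abL.
have f0 : 0 < f 0.
  rewrite lt_min !mulr0 pa0' pq0' eL !subr_gt0 !gtr0_norm//; apply/andP; split; last by move: qb0; lra.
  by move: abL; rewrite mulN1r oppr_gt0 subr_lt0 => /lt_trans; apply.
rewrite ltNge; apply/negP => fn; have [u /andP[u0 _] [fu hu]] := first_hit cf t0 f0 fn.
have {}hu (v : R) : 0 <= v < u -> `|pa zL (-1 * v)| < bnd /\ `|pq zL (-1 * v)| < qb.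
  by move=> /hu; rewrite lt_min !subr_gt0 => /andP[].
have fu0 : 0 <= f u by rewrite fu.
have [au qu] : `|pa zL (-1 * u)| <= bnd /\ `|pq zL (-1 * u)| <= qb.
  by move: fu0; rewrite le_min !subr_ge0 => /andP[].
have qu1 : `|pq zL (-1 * u)| < 1 by exact: le_lt_trans qu _.
have Wu : W qb (pa zL (-1 * u)) (pq zL (-1 * u)) < w qb qb.
  apply: le_lt_trans left_W.
  have c1 : {within `[0, u], continuous (fun v => - W qb (pa zL (-1 * v)) (pq zL (-1 * v)))}.
    apply: continuous_subspaceT => v.
    exact: is_derive_cont (is_deriveN (W_derive beta s kappa (ltW qb0) qb1 (dnb v) (dqb v))).
  have d1 (v : R) : 0 < v < u -> is_derive v (1:R) (fun v => - W qb (pa zL (-1 * v)) (pq zL (-1 * v)))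
      (beta * (fq (pa zL (-1 * v)) (pq zL (-1 * v)) * (pa zL (-1 * v) - a0 (pq zL (-1 * v))))).
    move=> /andP[v0 vu]; have [|h1 h2] := hu v; first by rewrite ltW.
    have b : inbox zL (-1 * v) by split; [exact: ltW|apply: ltW; exact: lt_trans qb1].
    have [e1 e2] := inboxE b; have H := is_deriveN (W_derive beta s kappa (ltW qb0) qb1 (dnb v) (dqb v)).
    apply: (is_derive_eq H); rewrite -[fat v]/(fat (-1 * v)) -[fqt v]/(fqt (-1 * v)) e1 e2.
    by rewrite (a0c_id s (ltW h2)); ring.
  have := is_derive_nondecr (ltW u0) d1 c1; rewrite !mulr0 pa0' pq0' lerN2; apply.
  move=> v /andP[v0 vu]; have [|h1 h2] := hu v; first by rewrite ltW.
  have := fq_diss s_gt0 (pa zL (-1 * v)) (lt_trans h2 qb1) => hd.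
  apply: mulr_ge0; first exact: ltW; apply: le_trans hd.
  by apply: mulr_ge0; [rewrite invr_ge0|rewrite -expr2 sqr_ge0].
have qlt : `|pq zL (-1 * u)| < qb.
  rewrite lt_neqAle qu andbT; apply/eqP => e.
  have : w qb (pq zL (-1 * u)) = w qb qb.
    have : w qb `|pq zL (-1 * u)| = w qb (pq zL (-1 * u)).
      by case: (ger0P (pq zL (-1 * u))) => // _; rewrite (wN _ _ _ (ltW qb0) qb1).
    by rewrite e.
  by have := W_ge_w beta kappa s_gt0 qb (pa zL (-1 * u)) qu1; move: Wu; lra.
have ae : `|pa zL (-1 * u)| = bnd.
  move: fu; rewrite /f; case: leP => _; first by lra.
  by move: qlt; lra.
have b : inbox zL (-1 * u) by split=> //; exact: ltW.
have [e1 e2] := inboxE b.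
(* the a-component points outwards there, so it came from outside *)
have out (e : R) : (e = 1 \/ e = -1) -> e * pa zL (-1 * u) = bnd -> False.
  move=> eP ea.
  have fpos : 0 < e * fat u (pa zL (-1 * u)) (pq zL (-1 * u)).
    rewrite -[fat u]/(fat (-1 * u)) e1 /fa ae.
    have -> : e * ((beta + 2 * s) * pa zL (-1 * u) + 2^-1 * (bnd * pa zL (-1 * u)) - kappa * pq zL (-1 * u)) =
      (beta + 2 * s) * (e * pa zL (-1 * u)) + 2^-1 * (bnd * (e * pa zL (-1 * u))) - kappa * (e * pq zL (-1 * u)) by ring.
    rewrite ea bndE//.
    have h1 : e * pq zL (-1 * u) <= 1.
      apply: le_trans (ler_norm _) _.
      by rewrite normrM; case: eP => ->; rewrite ?normrN normr1 mul1r ltW.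
    have h2 : 0 < 2^-1 * (bnd * bnd) by rewrite !mulr_gt0// invr_gt0.
    by have := ler_wpM2l (ltW kappa_gt0) h1; move: h2; lra.
  have d := is_deriveN (is_deriveZ e (dnb u)).
  have l0 : 0 < - (e *: (-1 * fat u (pa zL (-1 * u)) (pq zL (-1 * u)))).
    by rewrite /GRing.scale /= mulN1r mulrN opprK.
  have [d1 d10 hd] := deriv_gt0 d l0.
  pose v := Num.max 0 (u - d1 / 2).
  have vu : v < u by rewrite gt_max u0 ltrBlDr ltrDl divr_gt0.
  have v0 : 0 <= v by rewrite le_max lexx.
  have dv : u - d1 / 2 <= v by rewrite le_max lexx orbT.
  have [|_ /(_ vu)] := hd v; first by rewrite ltr_norml; apply/andP; split; lra.
  have [|ha _] := hu v; first by rewrite v0.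
  rewrite -[X in X < _ -> _]/(- (e * pa zL (-1 * v))) -[X in _ < X -> _]/(- (e * pa zL (-1 * u))).
  rewrite ltrN2 ea ltNge => /negP; apply.
  apply: le_trans (ler_norm _) _.
  by rewrite normrM; case: eP => ->; rewrite ?normrN normr1 mul1r ltW.
move: ae; case: (ger0P (pa zL (-1 * u))) => _ ae.
  by apply: (out 1); [left|rewrite mul1r].
by apply: (out (-1)); [right|rewrite (mulN1r (pa zL _))].
Qed.

Lemma left_inbox (t : R) : inbox zL t /\ `|pq zL t| < qb.
Proof.
case: (leP 0 t) => t0.
  have [b _ _ _] := wL t0; split => //.
  by have /andP[h1 h2] := left_pos t0; rewrite gtr0_norm.
have [|h1 h2] := @left_back (- t); first by rewrite oppr_ge0 ltW.
rewrite mulN1r opprK in h1 h2; split => //.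
by split; apply: ltW => //; exact: lt_trans qb1.
Qed.

Lemma left_stays (t : R) : stays (pa zL t, pq zL t).
Proof.
move=> u u0; have [e1 e2] := shift zL t u; rewrite /inbox e1 e2.
by have [[h1 h2] _] := left_inbox (t + u).
Qed.

(** Backwards in time the orbit is bounded, so that it converges to a stationary point, and
    W is too small for this to be one of the self-organized ones. *)
Lemma left_limit0 : pa zL (-1 * t) @[t --> +oo] --> 0 /\ pq zL (-1 * t) @[t --> +oo] --> 0.
Proof.
have da (t : R) : 0 < t -> is_derive t (1:R) (fun t => pa zL (-1 * t)) (-1 * fa (pa zL (-1 * t)) (pq zL (-1 * t))).
  move=> t0; have [b _] := left_inbox (-1 * t); have [e1 _] := inboxE b.
  by apply: (is_derive_eq (dnb t)); rewrite -[fat t]/(fat (-1 * t)) e1.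
have dq (t : R) : 0 < t -> is_derive t (1:R) (fun t => pq zL (-1 * t)) (-1 * fq (pa zL (-1 * t)) (pq zL (-1 * t))).
  move=> t0; have [b _] := left_inbox (-1 * t); have [_ e1] := inboxE b.
  by apply: (is_derive_eq (dqb t)); rewrite -[fqt t]/(fqt (-1 * t)) e1.
have ba (t : R) : 0 <= t -> `|pa zL (-1 * t)| <= bnd by move=> _; have [[]] := left_inbox (-1 * t).
have bq (t : R) : 0 <= t -> `|pq zL (-1 * t)| <= qb by move=> _; have [_ /ltW] := left_inbox (-1 * t).
have sg1 : -1 * -1 = 1 :> R by rewrite mulrNN mulr1.
have [l [_ ql al hl hW]] := orbit_converges beta_gt0 s_gt0 kappa_gt0 ab_gt0 qbE abE (ltW qb0) qb1 sg1
    cab cqb da dq ba bq.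
have := hW 0 (lexx 0); rewrite mulr0 pa0' pq0' !mulN1r lerN2 => hl'.
suff l0 : l = 0 by split; [move: al; rewrite l0 a0_0|move: ql; rewrite l0].
case: hl => // e; exfalso; move: hl'; rewrite e ?(wN _ _ _ (ltW qb0) qb1) => h; by have := left_W; rewrite ltNge h.
Qed.

Lemma left_converges (t : R) : pq (pa zL t, pq zL t) u @[u --> +oo] --> qb /\
  pa (pa zL t, pq zL t) u @[u --> +oo] --> ab.
Proof.
have [ql al] := wconv neg1 wL.
split; apply/cvgyP => e e0.
  have [S hS] := (proj2 (cvgyP _ _) ql) e e0; exists (S - t) => u hu.
  by have [_ ->] := shift zL t u; apply: hS; move: hu; lra.
have [S hS] := (proj2 (cvgyP _ _) al) e e0; exists (S - t) => u hu.
by have [-> _] := shift zL t u; apply: hS; move: hu; lra.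
Qed.

Lemma left_inj (t1 t2 : R) : pa zL t1 = pa zL t2 -> pq zL t1 = pq zL t2 -> t1 = t2.
Proof.
suff H (t t' : R) : t < t' -> pa zL t = pa zL t' -> pq zL t = pq zL t' -> False.
  by move=> e1 e2; case: (ltgtP t1 t2) => // h; exfalso; [exact: H h e1 e2|exact: H h (esym e1) (esym e2)].
move=> lt e1 e2; have e := flow_meet e1 e2.
have d : 0 < t' - t by rewrite subr_gt0.
have [+ _] := wmono neg1 wL (lexx 0) d.
by rewrite pq0' [in X in _ < X]e /= ltxx.
Qed.

Lemma right_gt (t : R) : 0 <= t -> qb < pq zR t.
Proof. by move=> t0; have := wside pos1 wR t0; rewrite mul1r subr_gt0. Qed.

Lemma right_inj (t1 t2 : R) : 0 <= t1 -> 0 <= t2 -> pq zR t1 = pq zR t2 -> t1 = t2.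
Proof.
move=> h1 h2 e; case: (ltgtP t1 t2) => // lt.
  by have [+ _] := wmono pos1 wR h1 lt; rewrite e ltxx.
by have [+ _] := wmono pos1 wR h2 lt; rewrite e ltxx.
Qed.

Lemma right_stays (t : R) : 0 <= t -> stays (pa zR t, pq zR t).
Proof. by move=> t0; apply: stays_shift => //; exact: in_wedge_stays wR. Qed.

Lemma right_converges (t : R) : pq (pa zR t, pq zR t) u @[u --> +oo] --> qb /\
  pa (pa zR t, pq zR t) u @[u --> +oo] --> ab.
Proof.
have [ql al] := wconv pos1 wR.
split; apply/cvgyP => e e0.
  have [S hS] := (proj2 (cvgyP _ _) ql) e e0; exists (S - t) => u hu.
  by have [_ ->] := shift zR t u; apply: hS; move: hu; lra.
have [S hS] := (proj2 (cvgyP _ _) al) e e0; exists (S - t) => u hu.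
by have [-> _] := shift zR t u; apply: hS; move: hu; lra.
Qed.

End Branches.

(** * The curve of bounded orbits *)

Section Glue.
Context {R : realType}.
Implicit Types (f g h : R -> R) (p t : R).

Lemma contP f t : {for t, continuous f} <->
  forall e : R, 0 < e -> exists2 d : R, 0 < d & forall u, `|u - t| < d -> `|f u - f t| <= e.
Proof.
split=> [cf e e0|h].
  have /cvgrPdist_le /(_ e e0)/nbhs_ballP[d /= d0 hd] := cf.
  by exists d => // u ut; rewrite distrC; apply: hd; rewrite /ball /= distrC.
apply/cvgrPdist_le => e e0; have [d d0 hd] := h e e0; apply/nbhs_ballP.
by exists d => //= u; rewrite /ball /= distrC => /hd; rewrite distrC.
Qed.

Lemma cont_ext_near f g t (d : R) : 0 < d -> (forall u, `|u - t| < d -> f u = g u) ->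
  {for t, continuous f} -> {for t, continuous g}.
Proof.
move=> d0 e /contP cf; apply/contP => r r0; have [d' d'0 hd] := cf r r0.
exists (Num.min d d'); first by rewrite lt_min d0.
by move=> u; rewrite lt_min => /andP[h1 h2]; rewrite -!e ?subrr ?normr0//; exact: hd.
Qed.

(** The time along the left branch covers the line as t covers ]0, 1/2[; the time along
    the right branch goes back from +oo to 0 as t covers ]1/2, 1]. *)
Definition left_time t : R := -1 * ln ((1 - 2 * t) / (2 * t)).
Definition right_time t : R := -1 * ln (2 * t - 1).

(** Time +oo is sent to 0 by v = exp (- t), where the limit p is the value. *)
Definition after_log f p (v : R) : R := if 0 < v then f (-1 * ln v) else p.

Lemma after_log_continuous f p : continuous f -> f t @[t --> +oo] --> p ->
  continuous (after_log f p).
Proof.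
move=> cf fp v; case: (ltP 0 v) => v0.
  apply: (@cont_ext_near (fun v => f (-1 * ln v)) _ v v v0) => [u|].
    by rewrite ltr_norml => /andP[h _]; rewrite /after_log ifT//; lra.
  apply: (@continuous_comp _ _ _ (fun v : R => -1 * ln v) f); last exact: cf.
  by apply: cvgM; [exact: cvg_cst|exact: continuous_ln].
apply/contP => e e0; have [T hT] := (proj2 (cvgyP _ _) fp) e e0.
exists (expR (- T)); first exact: expR_gt0.
move=> u hu; rewrite [X in `|_ - X|]/after_log ltNge v0 /= /after_log; case: (ltP 0 u) => u0; last first.
  by rewrite subrr normr0 ltW.
apply: hT; rewrite mulN1r lerNr -ler_expR lnK ?posrE//.
by move: hu; rewrite ltr_norml => /andP[_]; lra.
Qed.

(** One of the first two terms is always the constant p, by the convention in after_log: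
    this glues the two branches without a case distinction. *)
Definition half_curve f g p t : R :=
  after_log f p ((1 - 2 * t) / (2 * t)) + after_log g p (2 * t - 1) - p.

Lemma half_left f g p t : 0 < t -> t < 2^-1 -> half_curve f g p t = f (left_time t).
Proof.
move=> t0 t1; rewrite /half_curve /after_log ifT; last by rewrite divr_gt0 ?mulr_gt0//; lra.
by rewrite ifF; [rewrite addrK|apply/negbTE; rewrite -leNgt; lra].
Qed.

Lemma half_mid f g p : half_curve f g p 2^-1 = p.
Proof.
rewrite /half_curve mulfV ?pnatr_eq0// subrr mul0r /after_log ltxx.
by rewrite addrK.
Qed.

Lemma half_right f g p t : 2^-1 < t -> half_curve f g p t = g (right_time t).
Proof.
move=> t1; rewrite /half_curve /after_log ifF; last first.
  apply/negbTE; rewrite -leNgt pmulr_lle0; first by lra.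
  by rewrite invr_gt0; lra.
by rewrite ifT; [rewrite addrAC subrr add0r|lra].
Qed.

Lemma half_continuous f g p t : continuous f -> continuous g ->
  f t @[t --> +oo] --> p -> g t @[t --> +oo] --> p -> 0 < t ->
  {for t, continuous (half_curve f g p)}.
Proof.
move=> cf cg fp gp t0; apply: cvgB; last exact: cvg_cst.
apply: cvgD.
  apply: (@continuous_comp _ _ _ (fun t : R => (1 - 2 * t) / (2 * t)) (after_log f p));
    last exact: after_log_continuous.
  apply: cvgM.
    by apply: cvgB; [exact: cvg_cst|apply: cvgM; [exact: cvg_cst|exact: cvg_id]].
  apply: cvgV; first by rewrite gt_eqF// mulr_gt0.
  by apply: cvgM; [exact: cvg_cst|exact: cvg_id].
apply: (@continuous_comp _ _ _ (fun t : R => 2 * t - 1) (after_log g p));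
  last exact: after_log_continuous.
by apply: cvgB; [apply: cvgM; [exact: cvg_cst|exact: cvg_id]|exact: cvg_cst].
Qed.

(** The two halves of the curve are opposite to each other and meet at the origin. *)
Definition odd_ext h t : R := if 0 < t then h t else if t < 0 then - h (- t) else 0.

Lemma odd_extN h t : odd_ext h (- t) = - odd_ext h t.
Proof.
rewrite /odd_ext oppr_gt0 oppr_lt0; case: (ltgtP t 0) => _; rewrite ?opprK ?oppr0//.
Qed.

Lemma left_time_surj (u : R) : exists2 t, 0 < t < 2^-1 & left_time t = u.
Proof.
have E0 := expR_gt0 u; set E := expR u in E0 *.
have d0 : 0 < 2 * (1 + E) by rewrite mulr_gt0// addr_gt0.
exists (E / (2 * (1 + E))).
  apply/andP; split; first by rewrite divr_gt0.
  by rewrite ltr_pdivrMr// mulrA mulVf ?pnatr_eq0// mul1r ltrDr.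
have -> : left_time (E / (2 * (1 + E))) = -1 * ln (E^-1).
  by rewrite /left_time; congr (-1 * ln _); field; rewrite !gt_eqF// addr_gt0.
by rewrite /E -expRN expRK mulN1r opprK.
Qed.

Lemma left_time_inj t t' : 0 < t < 2^-1 -> 0 < t' < 2^-1 -> left_time t = left_time t' -> t = t'.
Proof.
move=> /andP[t0 t1] /andP[t'0 t'1]; rewrite /left_time !mulN1r => /oppr_inj.
have h (x : R) : 0 < x -> x < 2^-1 -> (1 - 2 * x) / (2 * x) \is Num.pos.
  by move=> x0 x1; rewrite posrE divr_gt0 ?mulr_gt0//; lra.
move=> /(ln_inj (h _ t0 t1) (h _ t'0 t'1)) e.
have : (2 * t) * (2 * t') * ((1 - 2 * t) / (2 * t)) = (2 * t) * (2 * t') * ((1 - 2 * t') / (2 * t')).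
  by rewrite e.
have -> : (2 * t) * (2 * t') * ((1 - 2 * t) / (2 * t)) = 2 * t' * (1 - 2 * t).
  by field; rewrite gt_eqF.
have -> : (2 * t) * (2 * t') * ((1 - 2 * t') / (2 * t')) = 2 * t * (1 - 2 * t').
  by field; rewrite gt_eqF.
by lra.
Qed.

Lemma right_time_surj (u : R) : 0 <= u -> exists2 t, 2^-1 < t <= 1 & right_time t = u.
Proof.
move=> u0; have E0 := expR_gt0 (- u); exists ((1 + expR (- u)) / 2).
  apply/andP; split; first by move: E0; lra.
  have : expR (- u) <= 1 by rewrite -expR0 ler_expR oppr_le0.
  by lra.
rewrite /right_time (_ : 2 * _ - 1 = expR (- u)); first by rewrite expRK mulN1r opprK.
by field.
Qed.

Lemma right_time_inj t t' : 2^-1 < t -> 2^-1 < t' -> right_time t = right_time t' -> t = t'.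
Proof.
move=> h h'; rewrite /right_time !mulN1r => /oppr_inj.
have hp (x : R) : 2^-1 < x -> 2 * x - 1 \is Num.pos by move=> ?; rewrite posrE; lra.
by move=> /(ln_inj (hp _ h) (hp _ h')); lra.
Qed.

Lemma right_time_ge0 t : 2^-1 < t <= 1 -> 0 <= right_time t.
Proof.
move=> /andP[h1 h2]; rewrite /right_time mulN1r oppr_ge0.
by rewrite -ln1 ler_ln ?posrE//; lra.
Qed.

Lemma right_time1 : right_time 1 = 0.
Proof. by rewrite /right_time (_ : 2 * 1 - 1 = 1); [rewrite ln1 mulr0|ring]. Qed.

Lemma odd_ext_continuous f g p : continuous f -> continuous g ->
  f t @[t --> +oo] --> p -> g t @[t --> +oo] --> p -> f (-1 * t) @[t --> +oo] --> 0 ->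
  continuous (odd_ext (half_curve f g p)).
Proof.
move=> cf cg fp gp f0.
have pos t : 0 < t -> {for t, continuous (odd_ext (half_curve f g p))}.
  move=> t0; apply: (@cont_ext_near (half_curve f g p) _ t t t0); last exact: half_continuous.
  by move=> u; rewrite ltr_norml => /andP[h _]; rewrite /odd_ext ifT//; lra.
move=> t; case: (ltgtP t 0) => [t0|t0|->]; last first.
- apply/contP => e e0; have [T hT] := (proj2 (cvgyP _ _) f0) e e0.
  have ET := expR_gt0 T.
  pose d := (2 * (1 + expR T))^-1; have d0 : 0 < d by rewrite invr_gt0 mulr_gt0// addr_gt0.
  have d1 : d <= 2^-1.
    rewrite /d lef_pV2 ?posrE ?mulr_gt0 ?addr_gt0//.
    by move: ET; lra.
  have small u : 0 < u -> u < d -> `|half_curve f g p u| <= e.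
    move=> u0 ud; rewrite half_left//; last exact: lt_le_trans ud d1.
    have := hT (-1 * left_time u); rewrite subr0 !mulN1r opprK; apply.
    rewrite /left_time mulN1r opprK -ler_expR lnK ?posrE; last first.
      by rewrite divr_gt0 ?mulr_gt0//; move: ud d1; lra.
    rewrite ler_pdivlMr ?mulr_gt0//.
    have : u * (2 * (1 + expR T)) < 1.
      by rewrite -ltr_pdivlMr ?mulr_gt0 ?addr_gt0// mul1r.
    by lra.
  exists d => // u; rewrite subr0 [odd_ext _ 0]/odd_ext ltxx subr0 /odd_ext.
  rewrite ltr_norml => /andP[h1 h2]; case: (ltgtP u 0) => u0; last by rewrite normr0 ltW.
    by rewrite normrN; apply: small; lra.
  exact: small.
- exact: pos.
- have t0' : 0 < - t by rewrite oppr_gt0.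
  have e : odd_ext (half_curve f g p) = fun u => - odd_ext (half_curve f g p) (- u).
    by apply/funext => u; rewrite odd_extN opprK.
  rewrite e; apply: cvgN.
  apply: (@continuous_comp _ _ _ (fun u : R => - u) (odd_ext (half_curve f g p))); last exact: pos.
  by apply: cvgN; exact: cvg_id.
Qed.

End Glue.

Section Curve.
Context {R : realType}.
Variables (beta s kappa ab qb : R).
Hypotheses (beta_gt0 : 0 < beta) (s_gt0 : 0 < s) (kappa_gt0 : 0 < kappa).
Hypotheses (ab_gt0 : 0 < ab) (qbE : qb = ab / (ab + 2 * s)).
Hypothesis abE : 2^-1 * ab * ab + (beta + 3 * s) * ab + 2 * beta * s + 4 * s * s = kappa.
Local Notation pa := (pa beta s kappa).
Local Notation pq := (pq beta s kappa).
Local Notation stays := (stays beta s kappa).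
Local Notation in_wedge := (in_wedge beta s kappa ab).
Variables zL zR : R * R.
Hypotheses (wL : in_wedge (-1) zL) (eL : zL.2 = qb / 2).
Hypotheses (wR : in_wedge 1 zR) (eR : zR.2 = 1).

Let qb0 : 0 < qb := qb_gt0 s_gt0 ab_gt0 qbE.
Let qb1 : qb < 1 := qb_lt1 s_gt0 ab_gt0 qbE.
Let abb : ab < bnd beta s kappa := ab_le_bnd beta_gt0 s_gt0 kappa_gt0 ab_gt0 qbE abE.
Let pq0' := pq0 beta_gt0 s_gt0 kappa_gt0.
Let wconv := @in_wedge_converges R beta s kappa ab qb beta_gt0 s_gt0 kappa_gt0 ab_gt0 qbE abE.
Let sgp : (1 : R) = 1 \/ (1 : R) = -1. Proof. by left. Qed.
Let sgn : (-1 : R) = 1 \/ (-1 : R) = -1. Proof. by right. Qed.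

Definition curve_a := odd_ext (half_curve (pa zL) (pa zR) ab).
Definition curve_q := odd_ext (half_curve (pq zL) (pq zR) qb).
Definition curve (t : R) : R * R := (curve_a t, curve_q t).

(** The sign e = 1 or e = -1 selects one of the two self-organized points. *)
Definition attracted (e : R) (z : R * R) : Prop :=
  [/\ stays z, pq z t @[t --> +oo] --> e * qb & pa z t @[t --> +oo] --> e * ab].

Lemma curveN (t : R) : curve (- t) = (- (curve t).1, - (curve t).2).
Proof. by rewrite /curve /curve_a /curve_q !odd_extN. Qed.

Lemma curve0 : curve 0 = (0, 0).
Proof. by rewrite /curve /curve_a /curve_q /odd_ext ltxx. Qed.

Lemma curve_left (t : R) : 0 < t -> t < 2^-1 ->
  curve t = (pa zL (left_time t), pq zL (left_time t)).
Proof. by move=> t0 t1; rewrite /curve /curve_a /curve_q /odd_ext t0 !half_left. Qed.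

Lemma curve_mid : curve 2^-1 = (ab, qb).
Proof. by rewrite /curve /curve_a /curve_q /odd_ext invr_gt0 ltr0n !half_mid. Qed.

Lemma curve_right (t : R) : 2^-1 < t -> curve t = (pa zR (right_time t), pq zR (right_time t)).
Proof.
move=> t1; have t0 : 0 < t by apply: lt_trans t1; rewrite invr_gt0.
by rewrite /curve /curve_a /curve_q /odd_ext t0 !half_right.
Qed.

Lemma curve_continuous : continuous curve_a /\ continuous curve_q.
Proof.
have [ql al] := wconv sgn wL; have [qr ar] := wconv sgp wR.
have [a0l q0l] := left_limit0 beta_gt0 s_gt0 kappa_gt0 ab_gt0 qbE abE wL eL.
split; apply: odd_ext_continuous => //; try exact: pa_continuous; exact: pq_continuous.
Qed.

Lemma attractedN (e : R) z : attracted e z -> attracted (- e) (- z.1, - z.2).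
Proof.
move=> [hs hq ha]; split; first exact: stays_opp.
- apply/cvgyP => r r0; have [T hT] := (proj2 (cvgyP _ _) hq) r r0; exists T => t Tt.
  have [_ ->] := flow_opp beta_gt0 s_gt0 kappa_gt0 z t.
  by rewrite mulNr -opprD normrN; exact: hT.
- apply/cvgyP => r r0; have [T hT] := (proj2 (cvgyP _ _) ha) r r0; exists T => t Tt.
  have [-> _] := flow_opp beta_gt0 s_gt0 kappa_gt0 z t.
  by rewrite mulNr -opprD normrN; exact: hT.
Qed.

Lemma attracted_mid : attracted 1 (ab, qb).
Proof.
have st := stationary_orbit beta_gt0 s_gt0 kappa_gt0 ab_gt0 qbE abE.
rewrite /attracted !mul1r; split.
- by move=> t _; rewrite /inbox; have [-> ->] := st t; rewrite !gtr0_norm// !ltW.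
- by apply/cvgyP => r r0; exists 0 => t _; have [_ ->] := st t; rewrite subrr normr0 ltW.
- by apply/cvgyP => r r0; exists 0 => t _; have [-> _] := st t; rewrite subrr normr0 ltW.
Qed.

Lemma curve_attracted (t : R) : 0 < t <= 1 -> attracted 1 (curve t).
Proof.
move=> /andP[t0 t1]; case: (ltgtP t 2^-1) => ht.
- rewrite curve_left// /attracted !mul1r; split.
    by apply: (left_stays beta_gt0 s_gt0 kappa_gt0 ab_gt0 qbE abE wL eL).
  by have [] := left_converges beta_gt0 s_gt0 kappa_gt0 ab_gt0 qbE abE wL (left_time t).
  by have [] := left_converges beta_gt0 s_gt0 kappa_gt0 ab_gt0 qbE abE wL (left_time t).
- rewrite curve_right// /attracted !mul1r; split.
    by apply: (right_stays beta_gt0 s_gt0 kappa_gt0 wR); apply: right_time_ge0; rewrite ht.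
  by have [] := right_converges beta_gt0 s_gt0 kappa_gt0 ab_gt0 qbE abE wR (right_time t).
  by have [] := right_converges beta_gt0 s_gt0 kappa_gt0 ab_gt0 qbE abE wR (right_time t).
- by rewrite ht curve_mid; exact: attracted_mid.
Qed.

Lemma attracted_curve z : attracted 1 z -> exists2 t : R, 0 < t <= 1 & curve t = z.
Proof.
rewrite /attracted !mul1r => -[hs hq ha].
have [->|[u ->]|[u u0 ->]] := branch_cases beta_gt0 s_gt0 kappa_gt0 ab_gt0 qbE abE wL eL wR eR hs hq ha.
- by exists 2^-1; [rewrite invr_gt0 ltr0n /= invf_le1// ler1n|exact: curve_mid].
- have [t /andP[t0 t1] <-] := left_time_surj u; exists t; last exact: curve_left.
  by rewrite t0 (le_trans (ltW t1))// invf_le1// ler1n.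
- have [t /andP[t0 t1] <-] := right_time_surj u0; exists t; last exact: curve_right.
  by rewrite t1 (lt_trans _ t0)// invr_gt0.
Qed.

Lemma attractedP z : (attracted 1 z <-> exists2 t : R, 0 < t <= 1 & curve t = z) /\
  (attracted (-1) z <-> exists2 t : R, -1 <= t < 0 & curve t = z).
Proof.
have zNN : (- - z.1, - - z.2) = z by rewrite !opprK; case: z.
split; split.
- exact: attracted_curve.
- by move=> [t t01 <-]; exact: curve_attracted.
- move=> /attractedN; rewrite opprK => /attracted_curve[t /andP[t0 t1] e].
  exists (- t); first by rewrite lerN2 t1 oppr_lt0.
  by rewrite curveN e /= zNN.
- move=> [t /andP[t0 t1] <-]; rewrite -[t]opprK curveN; apply: attractedN.
  by apply: curve_attracted; rewrite oppr_gt0 t1 lerNl.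
Qed.

Lemma attracted_disjoint z : attracted 1 z -> attracted (-1) z -> False.
Proof.
rewrite /attracted !mul1r !mulN1r => -[_ h1 _] [_ h2 _].
have e : qb = - qb by exact: cvg_unique h1 h2.
by move: qb0; lra.
Qed.

Lemma attracted_neq0 (e : R) : e * e = 1 -> ~ attracted e (0, 0).
Proof.
move=> e1 [_ h1 _].
have h2 : pq (0, 0) t @[t --> +oo] --> 0.
  apply/cvgyP => r r0; exists 0 => t _.
  by have [_ ->] := flow00 beta_gt0 s_gt0 kappa_gt0 t; rewrite subrr normr0 ltW.
have h : e * qb = 0 by exact: cvg_unique h1 h2.
have : qb = 0 by rewrite -[qb]mul1r -e1 -mulrA h mulr0.
by move=> h'; move: qb0; rewrite h' ltxx.
Qed.

Lemma stays00 : stays (0, 0).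
Proof.
move=> t _; rewrite /inbox; have [-> ->] := flow00 beta_gt0 s_gt0 kappa_gt0 t.
by rewrite normr0 ler01 (ltW (bnd_gt0 beta_gt0 s_gt0 kappa_gt0)).
Qed.

(** A bounded orbit that is not the stationary one at the origin converges to one of the
    self-organized points. *)
Lemma stays_attracted z : stays z <-> [\/ z = (0, 0), attracted 1 z | attracted (-1) z].
Proof.
split; last by case=> [->|[]|[]] //; exact: stays00.
move=> hz; have [->|[h1 h2]|[h1 h2]] := stays_cases beta_gt0 s_gt0 kappa_gt0 ab_gt0 qbE abE hz.
- by constructor 1.
- by constructor 2; split; rewrite ?mul1r.
- by constructor 3; split; rewrite ?mulN1r.
Qed.

(** By convergence of the bounded orbits, what remains is the classification of the
    orbits attracted by each of the self-organized points. *)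
Lemma curve_stays z : (exists2 t : R, -1 <= t <= 1 & curve t = z) <-> stays z.
Proof.
have [[p1 p2] [n1 n2]] := attractedP z; split.
- move=> [t /andP[t0 t1] e]; apply/stays_attracted; case: (ltgtP t 0) => h.
  + by constructor 3; apply: n2; exists t => //; rewrite t0 h.
  + by constructor 2; apply: p2; exists t => //; rewrite t1 h.
  + by constructor 1; rewrite -e h curve0.
- move=> /stays_attracted[->|/p1[t /andP[t0 t1] e]|/n1[t /andP[t0 t1] e]].
  + by exists 0; rewrite ?curve0// lerN10 ler01.
  + by exists t => //; rewrite t1 (le_trans _ (ltW t0))// lerN10.
  + by exists t => //; rewrite t0 (le_trans (ltW t1)).
Qed.

Let curve_inj_pos (t t' : R) : 0 < t <= 1 -> 0 < t' <= 1 -> curve t = curve t' -> t = t'.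
Proof.
have lq (x : R) : 0 < x -> x < 2^-1 -> (curve x).2 < qb.
  move=> x0 x1; rewrite curve_left//=.
  have [_] := left_inbox beta_gt0 s_gt0 kappa_gt0 ab_gt0 qbE abE wL eL (left_time x).
  exact: le_lt_trans (ler_norm _).
have rq (x : R) : 2^-1 < x -> x <= 1 -> qb < (curve x).2.
  move=> x0 x1; rewrite curve_right//=.
  by apply: (right_gt beta_gt0 s_gt0 kappa_gt0 ab_gt0 qbE abE wR); apply: right_time_ge0; rewrite x0.
move=> /andP[t0 t1] /andP[t'0 t'1] e.
case: (ltgtP t 2^-1) => h; case: (ltgtP t' 2^-1) => h'; try by rewrite h h'.
- apply: left_time_inj; rewrite ?t0 ?t'0//.
  move: e; rewrite !curve_left// => -[e1 e2].
  exact: (left_inj beta_gt0 s_gt0 kappa_gt0 ab_gt0 qbE abE wL e1 e2).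
- by have := rq t' h' t'1; have := lq t t0 h; rewrite e => h1 h2; have := lt_trans h1 h2; rewrite ltxx.
- by have := lq t t0 h; rewrite e h' curve_mid ltxx.
- by have := rq t h t1; have := lq t' t'0 h'; rewrite e => h1 h2; have := lt_trans h1 h2; rewrite ltxx.
- apply: right_time_inj => //; move: e; rewrite !curve_right// => -[_ e2].
  have i1 : 0 <= right_time t by apply: right_time_ge0; rewrite h.
  have i2 : 0 <= right_time t' by apply: right_time_ge0; rewrite h'.
  exact: (right_inj beta_gt0 s_gt0 kappa_gt0 ab_gt0 qbE abE wR i1 i2 e2).
- by have := rq t h t1; rewrite e h' curve_mid ltxx.
- by have := lq t' t'0 h'; rewrite -e h curve_mid ltxx.
- by have := rq t' h' t'1; rewrite -e h curve_mid ltxx.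
Qed.

(** The left branch is below the height qb and the right one above; each is injective
    in time, and the two halves are attracted by different points. *)
Lemma curve_inj (t t' : R) : -1 <= t <= 1 -> -1 <= t' <= 1 -> curve t = curve t' -> t = t'.
Proof.
move=> /andP[t0 t1] /andP[t'0 t'1] e.
have pos (x : R) : 0 < x -> x <= 1 -> attracted 1 (curve x).
  by move=> x0 x1; apply: curve_attracted; rewrite x0.
have neg (x : R) : -1 <= x -> x < 0 -> attracted (-1) (curve x).
  by move=> x0 x1; have [_ [_]] := attractedP (curve x); apply; exists x; rewrite ?x0.
have z1 := @attracted_neq0 1 (mul1r 1).
have sg1 : -1 * -1 = 1 :> R by rewrite mulrNN mulr1.
have z2 := @attracted_neq0 (-1) sg1.
case: (ltgtP t 0) => h; case: (ltgtP t' 0) => h'; try by rewrite h h'.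
- apply: oppr_inj; apply: curve_inj_pos; rewrite ?oppr_gt0 ?h ?h' /= 1?lerNl//.
  by rewrite !curveN e.
- by exfalso; apply: (attracted_disjoint (pos t' h' t'1)); rewrite -e; exact: neg.
- by exfalso; apply: z2; rewrite -curve0 -h' -e; exact: neg.
- by exfalso; apply: (attracted_disjoint (pos t h t1)); rewrite e; exact: neg.
- by apply: curve_inj_pos; rewrite ?h ?h'.
- by exfalso; apply: z1; rewrite -curve0 -h' -e; exact: pos.
- by exfalso; apply: z2; rewrite -curve0 -h e; exact: neg.
- by exfalso; apply: z1; rewrite -curve0 -h e; exact: pos.
Qed.

Lemma curve1 : (curve 1).2 = 1.
Proof. by rewrite curve_right ?right_time1 ?pq0'// invf_lt1// ltr1n. Qed.

(** Intermediate values, as the height goes from -1 to 1 along the curve. *)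
Lemma curve_height (q0 : R) : -1 <= q0 <= 1 -> exists2 t : R, -1 <= t <= 1 & (curve t).2 = q0.
Proof.
move=> q01; have [_ cq] := curve_continuous.
have c : {within `[-1, 1], continuous curve_q} by exact: continuous_subspaceT.
have e1 : curve_q 1 = 1 := curve1.
have e2 : curve_q (-1) = -1 by rewrite /curve_q odd_extN -/curve_q e1.
have N11 : -1 <= (1 : R) by rewrite (le_trans (lerN10 R)) ?ler01.
have [|t tI e] := IVT N11 c (v := q0).
  by rewrite e1 e2 (min_idPl N11) (max_idPr N11).
by exists t => //; move: tI; rewrite in_itv.
Qed.

End Curve.

(** * Weak interaction: the curve is monotone *)

Section Backward.
Context {R : realType}.
Implicit Types f : R -> R.

(** The time reversal of first_hit. *)
Lemma last_zero f (t T : R) : continuous f -> t <= T -> 0 < f T -> f t <= 0 ->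
  exists2 t0, t <= t0 < T & f t0 = 0 /\ forall u, t0 < u <= T -> 0 < f u.
Proof.
move=> cf tT fT ft; have cg : continuous (fun u => f (T - u)) by exact: cont_sub_arg.
have T0 : 0 <= T - t by rewrite subr_ge0.
have [||u /andP[u0 u1] [fu hu]] := first_hit (c := 0) cg T0; rewrite ?subr0// ?subKr//.
exists (T - u); first by apply/andP; split; lra.
split=> // v /andP[v0 v1]; have := hu (T - v); rewrite subKr; apply.
by apply/andP; split; lra.
Qed.

Lemma derive_after_zero f (t T l : R) : t < T -> f t = 0 -> (forall u, t < u <= T -> 0 < f u) ->
  is_derive t (1:R) f l -> 0 <= l.
Proof.
move=> tT ft hf d; rewrite leNgt; apply/negP; rewrite -oppr_gt0 => l0.
have [e e0 he] := deriv_gt0 (is_deriveN d) l0.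
have m0 : 0 < Num.min (T - t) (e / 2) by rewrite lt_min subr_gt0 tT divr_gt0.
have m1 := minl_le (T - t) (e / 2); have m2 := minr_le (T - t) (e / 2).
have tl : t < t + Num.min (T - t) (e / 2) by rewrite ltrDl.
have [|h _] := he (t + Num.min (T - t) (e / 2)).
  by rewrite addrAC subrr add0r gtr0_norm//; lra.
move: (h tl); rewrite -[X in X < _]/(- f t) -[X in _ < X]/(- f _) ltrN2 ft.
by rewrite ltNge le_eqVlt hf ?orbT// tl /=; lra.
Qed.

Lemma left_time_lt (t t' : R) : 0 < t -> t < t' -> t' < 2^-1 -> left_time t < left_time t'.
Proof.
move=> t0 tt t1; rewrite /left_time !mulN1r ltrN2.
have p (u : R) : 0 < u -> u < 2^-1 -> 0 < (1 - 2 * u) / (2 * u).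
  by move=> u0 u1; rewrite divr_gt0 ?mulr_gt0//; lra.
rewrite ltr_ln ?posrE ?p//; try lra.
rewrite ltr_pdivrMr; last lra.
by rewrite mulrAC ltr_pdivlMr; lra.
Qed.

Lemma right_time_lt (t t' : R) : 2^-1 < t -> t < t' -> right_time t' < right_time t.
Proof.
by move=> t0 tt; rewrite /right_time !mulN1r ltrN2 ltr_ln ?posrE; lra.
Qed.

End Backward.

Section WeakInteraction.
Context {R : realType}.
Variables (beta s kappa ab qb : R).
Hypotheses (beta_gt0 : 0 < beta) (s_gt0 : 0 < s) (kappa_gt0 : 0 < kappa).
Hypotheses (ab_gt0 : 0 < ab) (qbE : qb = ab / (ab + 2 * s)).
Hypothesis abE : 2^-1 * ab * ab + (beta + 3 * s) * ab + 2 * beta * s + 4 * s * s = kappa.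
Local Notation fa := (fa beta s kappa).
Local Notation fq := (fq s).
Local Notation pa := (pa beta s kappa).
Local Notation pq := (pq beta s kappa).
Local Notation in_wedge := (in_wedge beta s kappa ab).
Variables zL zR : R * R.
Hypotheses (wL : in_wedge (-1) zL) (eL : zL.2 = qb / 2).
Hypotheses (wR : in_wedge 1 zR) (eR : zR.2 = 1).
Local Notation curve := (curve beta s kappa ab qb zL zR).

Let qb0 : 0 < qb := qb_gt0 s_gt0 ab_gt0 qbE.
Let cpa z : continuous (pa z). Proof. exact: pa_continuous. Qed.
Let cpq z : continuous (pq z). Proof. exact: pq_continuous. Qed.
Let linbox := left_inbox beta_gt0 s_gt0 kappa_gt0 ab_gt0 qbE abE wL eL.
Let dpa t := inbox_pa beta_gt0 s_gt0 kappa_gt0 (proj1 (linbox t)).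
Let dpq t := inbox_pq beta_gt0 s_gt0 kappa_gt0 (proj1 (linbox t)).
Let sgp : (1 : R) = 1 \/ (1 : R) = -1. Proof. by left. Qed.
Let sgn : (-1 : R) = 1 \/ (-1 : R) = -1. Proof. by right. Qed.
Let wconv := @in_wedge_converges R beta s kappa ab qb beta_gt0 s_gt0 kappa_gt0 ab_gt0 qbE abE.

Lemma left_origin (t : R) : (pa zL t, pq zL t) <> (0, 0).
Proof.
move=> [e1 e2]; have [z1 z2] := flow00 beta_gt0 s_gt0 kappa_gt0 t.
have : zL = (0, 0) by apply: (flow_inj (t := t) beta_gt0 s_gt0 kappa_gt0); rewrite ?z1 ?z2.
by move=> e; move: eL qb0; rewrite e /=; lra.
Qed.

Hypothesis weak : 4 * kappa < (beta + 4 * s) * (beta + 4 * s).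

(* the slope for which the linear part of the field crosses the ray fastest *)
Let m : R := (beta + 4 * s) / (2 * kappa).
Let B0 : 0 < beta + 4 * s. Proof. by rewrite addr_gt0// mulr_gt0. Qed.
Let m0 : 0 < m. Proof. by rewrite divr_gt0// mulr_gt0. Qed.
Let mE : 2 * kappa * m = beta + 4 * s.
Proof. by rewrite /m; field; rewrite gt_eqF. Qed.

Let m_steep : m * ab < qb.
Proof.
rewrite qbE ltr_pdivlMr; last by rewrite addr_gt0// mulr_gt0.
rewrite mulrAC gtr_pMl// -(ltr_pM2l (_ : 0 < 2 * kappa)) ?mulr_gt0// mulr1 mulrA mE -abE.
have h1 := mulr_gt0 ab_gt0 ab_gt0; have h2 := mulr_gt0 beta_gt0 ab_gt0.
have h3 := mulr_gt0 s_gt0 ab_gt0; have h4 := mulr_gt0 beta_gt0 s_gt0.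
by lra.
Qed.

(* the field crosses the ray q = m a downwards *)
Let line_cross (a : R) : 0 < a -> fq a (m * a) - m * fa a (m * a) < 0.
Proof.
move=> a0; have -> : fq a (m * a) - m * fa a (m * a) =
   a * (1 - (beta + 4 * s) * m + 2^-1 * (2 * kappa * m) * m) - 3 / 2 * m * a * a.
  by rewrite /fq /fa (gtr0_norm a0); field.
rewrite mE; have h : 0 < 3 / 2 * m * a * a by do !apply: mulr_gt0 => //; rewrite ?invr_gt0.
have k : 1 < 2^-1 * (beta + 4 * s) * m.
  rewrite /m mulrA ltr_pdivlMr ?mulr_gt0// mul1r.
  have wk := weak; set B := beta + 4 * s in wk *; have -> : 2^-1 * B * B = 2^-1 * (B * B) by ring.
  by move: wk; set BB := B * B; lra.
have := mulr_gt0 a0 (_ : 0 < 2^-1 * (beta + 4 * s) * m - 1).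
by rewrite subr_gt0 => /(_ k); move: h; lra.
Qed.

(** The field crosses the ray q = m a of the half plane a > 0 downwards, and near (ab, qb)
    the branch is above that ray. Followed backwards it can neither reach the ray nor,
    above the ray, the axis a = 0, which is crossed towards a < 0. *)
Lemma left_above (t : R) : 0 < pa zL t /\ 0 < pq zL t.
Proof.
have [ql al] := wconv sgn wL.
have yl : pq zL u - m * pa zL u @[u --> +oo] --> qb - m * ab.
  by apply: cvgB => //; apply: cvgM => //; exact: cvg_cst.
have g0 : 0 < qb - m * ab by rewrite subr_gt0.
have [T0 hT0] := (proj2 (cvgyP _ _) yl) _ (divr_gt0 g0 (ltr0Sn R 1)).
pose T := Num.max t (Num.max 0 T0).
have tT : t <= T by rewrite le_max lexx.
have T00 : 0 <= T by rewrite !le_max lexx orbT.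
have := hT0 T; rewrite !le_max lexx !orbT => /(_ isT); rewrite ler_norml => /andP[yT _].
have [_ aT _ _] := wL T00.
pose f u := Num.min (pa zL u) (pq zL u - m * pa zL u).
have cy : continuous (fun u => pq zL u - m * pa zL u).
  by apply: contB => //; apply: contM => //; exact: contC.
have cf : continuous f by exact: cont_min.
suff : 0 < f t.
  rewrite lt_min subr_gt0 => /andP[h1 h2]; split => //.
  by apply: lt_trans h2; exact: mulr_gt0.
rewrite ltNge; apply/negP => ft.
have fT : 0 < f T by rewrite lt_min aT /=; move: yT; rewrite -/T; lra.
have [t0 /andP[_ t0T] [f0 hf]] := last_zero cf tT fT ft.
have apos u : t0 < u <= T -> 0 < pa zL u by move=> /hf; rewrite lt_min => /andP[].
have ypos u : t0 < u <= T -> 0 < pq zL u - m * pa zL u by move=> /hf; rewrite lt_min => /andP[].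
have : 0 <= f t0 by rewrite f0.
rewrite le_min => /andP[a0 y0].
have [ez|ne] := eqVneq (pa zL t0) 0.
  have := derive_after_zero t0T ez apos (dpa t0); rewrite ez /fa normr0 !(mulr0, mul0r) !add0r oppr_ge0 => h.
  apply: (@left_origin t0); congr (_, _) => //; apply/eqP; rewrite eq_le; apply/andP; split.
    by rewrite -(ler_pM2l kappa_gt0) mulr0.
  by move: y0; rewrite ez mulr0 subr0.
have a0' : 0 < pa zL t0 by rewrite lt_neqAle eq_sym ne.
have y00 : pq zL t0 - m * pa zL t0 = 0.
  by move: f0; rewrite /f /Num.min; case: ifP => // _ e; move: ne; rewrite e eqxx.
have d := is_deriveB (dpq t0) (is_deriveZ m (dpa t0)).
have := derive_after_zero t0T y00 ypos d; rewrite /GRing.scale /=.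
have -> : pq zL t0 = m * pa zL t0 by move: y00; lra.
by have := line_cross a0'; lra.
Qed.

(** Going backwards with a > 0, the branch does not leave its wedge: there a decreases,
    and the nullcline of a is crossed in the opposite direction. *)
Lemma left_rising (t : R) : [/\ pa zL t < ab, 0 < fa (pa zL t) (pq zL t) & 0 < fq (pa zL t) (pq zL t)].
Proof.
have ne (u : R) : (pa zL u, pq zL u) <> (ab, qb).
  by move=> [_ e]; have [_] := linbox u; rewrite e gtr0_norm// ltxx.
have wfq u : pa zL u <= ab -> 0 <= fa (pa zL u) (pq zL u) -> 0 < fq (pa zL u) (pq zL u).
  move=> h1 h2; have := wedge_fq beta_gt0 s_gt0 kappa_gt0 ab_gt0 qbE abE sgn (proj1 (left_above u)) _ _ (@ne u).
  by rewrite !mulN1r oppr_ge0 subr_le0 !oppr_le0 oppr_lt0; apply.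
pose f u := Num.min (ab - pa zL u) (fa (pa zL u) (pq zL u)).
suff : 0 < f t.
  by rewrite lt_min subr_gt0 => /andP[h1 h2]; split=> //; apply: wfq; exact: ltW.
rewrite ltNge; apply/negP => ft.
have cf : continuous f.
  by apply: cont_min; [apply: contB => //; exact: contC|exact: fa_orbit_continuous].
pose T := Num.max t 0.
have tT : t <= T by rewrite le_max lexx.
have T0 : 0 <= T by rewrite le_max lexx orbT.
have [_ _ h1 h2] := wL T0; rewrite mulN1r oppr_gt0 in h1; rewrite mulN1r oppr_lt0 in h2.
have fT : 0 < f T by rewrite lt_min h2 andbT subr_gt0; move: h1; rewrite subr_lt0.
have [t0 /andP[_ t0T] [f0 hf]] := last_zero cf tT fT ft.
have apos u : t0 < u <= T -> 0 < ab - pa zL u by move=> /hf; rewrite lt_min => /andP[].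
have fpos u : t0 < u <= T -> 0 < fa (pa zL u) (pq zL u) by move=> /hf; rewrite lt_min => /andP[].
have : 0 <= f t0 by rewrite f0.
rewrite le_min => /andP[a0 y0].
have fa0 : fa (pa zL t0) (pq zL t0) = 0.
  move: f0; rewrite /f /Num.min; case: ifP => // _ e.
  have d := is_deriveB (is_derive_cst ab t0 (1:R)) (dpa t0).
  have := derive_after_zero t0T e apos d.
  by rewrite sub0r oppr_ge0 => h; apply/eqP; rewrite eq_le h.
have := wfq t0; rewrite -subr_ge0 => /(_ a0 y0) q0.
have := derive_after_zero t0T fa0 fpos (fa_derive beta_gt0 s_gt0 kappa_gt0 zL t0).
have [-> ->] := inboxE (proj1 (linbox t0)).
rewrite fa0 mulr0 sub0r oppr_ge0 leNgt => /negP; apply.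
exact: mulr_gt0.
Qed.

Lemma left_incr (t t' : R) : t < t' -> pa zL t < pa zL t' /\ pq zL t < pq zL t'.
Proof.
move=> tt; split; [apply: (is_derive_incr tt (fun u _ => dpa u))|
  apply: (is_derive_incr tt (fun u _ => dpq u))]; try exact: continuous_subspaceT.
- by move=> u _; have [] := left_rising u.
- by move=> u _; have [] := left_rising u.
Qed.

Lemma curve_rise (t : R) : 0 < t <= 1 -> 0 < (curve t).1 /\ 0 < (curve t).2.
Proof.
move=> /andP[t0 t1]; case: (ltgtP t 2^-1) => h.
- by rewrite curve_left//=; exact: left_above.
- rewrite curve_right//=; have u0 : 0 <= right_time t by apply: right_time_ge0; rewrite h.
  have [_ h1 _ _] := wR u0; split => //.
  exact: lt_trans qb0 (right_gt beta_gt0 s_gt0 kappa_gt0 ab_gt0 qbE abE wR u0).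
- by rewrite h curve_mid.
Qed.

Let left_below (t : R) : pa zL t < ab /\ pq zL t < qb.
Proof.
have [h _ _] := left_rising t; split => //.
have [_] := linbox t; exact: le_lt_trans (ler_norm _).
Qed.

Let right_above (t : R) : 0 <= t -> ab < pa zR t /\ qb < pq zR t.
Proof.
move=> t0; have [_ _ h _] := wR t0; split; first by rewrite mul1r subr_gt0 in h.
exact: (right_gt beta_gt0 s_gt0 kappa_gt0 ab_gt0 qbE abE wR t0).
Qed.

Let curve_mono_pos (t t' : R) : 0 < t -> t < t' -> t' <= 1 ->
  (curve t).1 < (curve t').1 /\ (curve t).2 < (curve t').2.
Proof.
move=> t0 tt t1; have t'0 := lt_trans t0 tt.
case: (ltgtP t 2^-1) => h; case: (ltgtP t' 2^-1) => h'; try by exfalso; lra.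
- by rewrite !curve_left//=; apply: left_incr; exact: left_time_lt.
- rewrite curve_left// curve_right//=.
  have u0 : 0 <= right_time t' by apply: right_time_ge0; rewrite h'.
  have [h1 h2] := left_below (left_time t); have [h3 h4] := right_above u0.
  by split; [exact: lt_trans h3|exact: lt_trans h4].
- by rewrite curve_left// h' curve_mid /=; exact: left_below.
- rewrite !curve_right//=.
  have u0 : 0 <= right_time t' by apply: right_time_ge0; rewrite h'.
  have := in_wedge_mono beta_gt0 s_gt0 kappa_gt0 ab_gt0 qbE abE sgp wR u0 (right_time_lt h tt).
  by rewrite !mul1r => -[].
- rewrite h curve_mid curve_right//=; apply: right_above.
  by apply: right_time_ge0; rewrite h'.
Qed.

(** On the left branch this is the absence of turning, on the right one a property of
    the wedge. *)
Lemma curve_mono (t t' : R) : -1 <= t -> t < t' -> t' <= 1 ->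
  (curve t).1 < (curve t').1 /\ (curve t).2 < (curve t').2.
Proof.
move=> t0 tt t1.
have neg (u : R) : -1 <= u -> u < 0 -> (curve u).1 < 0 /\ (curve u).2 < 0.
  move=> u1 u0; have -> : u = - - u by rewrite opprK.
  by rewrite curveN /= !oppr_lt0; apply: curve_rise; rewrite oppr_gt0 u0 lerNl.
case: (ltgtP t 0) => h; case: (ltgtP t' 0) => h'; try by exfalso; lra.
- have -> : t = - - t by rewrite opprK.
  have -> : t' = - - t' by rewrite opprK.
  rewrite curveN (curveN beta s kappa ab qb zL zR (- t')) /= !ltrN2.
  by apply: curve_mono_pos; rewrite ?oppr_gt0 ?ltrN2// lerNl.
- have [h1 h2] := neg t t0 h; have [|h3 h4] := @curve_rise t'; first by rewrite h'.
  by split; [exact: lt_trans h3|exact: lt_trans h4].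
- by rewrite h' curve0; exact: neg.
- exact: curve_mono_pos.
- by rewrite h curve0; apply: curve_rise; rewrite t1 andbT -h.
Qed.

End WeakInteraction.

(** * Strong interaction: the curve spirals *)

Section PolarAngle.
Context {R : realType}.

Definition radius (x y : R) : R := Num.sqrt (x * x + y * y).

(** th is an angle of the vector (x, y), defined up to multiples of 2 pi. *)
Definition angle_of (x y th : R) : Prop := x = radius x y * cos th /\ y = radius x y * sin th.

Lemma sqnorm_gt0 (x y : R) : (x, y) <> (0, 0) -> 0 < x * x + y * y.
Proof.
move=> ne; rewrite lt_neqAle eq_sym addr_ge0 -?expr2 ?sqr_ge0// andbT.
by rewrite paddr_eq0 ?sqr_ge0// !sqrf_eq0; apply/andP => -[/eqP hx /eqP hy]; apply: ne; rewrite hx hy.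
Qed.

Lemma angle_atan (x y : R) : 0 < x -> angle_of x y (atan (y / x)).
Proof.
move=> x0; have c0 : 0 < cos (atan (y / x)).
  by rewrite cos_atan invr_gt0 sqrtr_gt0 ltr_pwDl// sqr_ge0.
have e : sin (atan (y / x)) = y / x * cos (atan (y / x)).
  by rewrite -{2}[y / x]atanK /tan divfK// gt_eqF.
have hr : radius x y * cos (atan (y / x)) = x.
  have n0 : 0 < 1 + (y / x) ^+ 2 by rewrite ltr_pwDl// sqr_ge0.
  rewrite cos_atan /radius; have -> : x * x + y * y = x ^+ 2 * (1 + (y / x) ^+ 2).
    by field; rewrite gt_eqF.
  rewrite sqrtrM ?sqr_ge0// sqrtr_sqr gtr0_norm// mulfK// gt_eqF// sqrtr_gt0//.
by split; rewrite ?e ?[radius x y * (_ * _)]mulrCA hr// divfK// gt_eqF.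
Qed.

Lemma angle_opp (x y th : R) : angle_of x y th -> angle_of (- x) (- y) (th + pi).
Proof.
move=> [e1 e2]; rewrite /angle_of sinDpi cosDpi /radius !mulrNN !mulrN.
by split; congr (- _).
Qed.

Lemma continuous_ne0_gt0 (f : R -> R) : continuous f -> (forall t, f t <> 0) -> 0 < f 0 ->
  forall t, 0 < f t.
Proof.
move=> cf ne f0 t; rewrite ltNge; apply/negP => ft.
case: (leP 0 t) => t0.
  by have [u _ [e _]] := first_hit cf t0 f0 ft; exact: (ne u).
by have [u _ [e _]] := last_zero cf (ltW t0) f0 ft; exact: (ne u).
Qed.

(** The angle is the primitive of the angular velocity: the component of (x, y)
    orthogonal to the direction th has a constant ratio to the radius, so it remains zero. *)
Lemma angle_exists (x y dx dy : R -> R) (th0 : R) :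
  (forall t, is_derive t (1:R) x (dx t)) -> (forall t, is_derive t (1:R) y (dy t)) ->
  continuous dx -> continuous dy -> (forall t, (x t, y t) <> (0, 0)) -> angle_of (x 0) (y 0) th0 ->
  exists th : R -> R, [/\ th 0 = th0, forall t, angle_of (x t) (y t) (th t) &
    forall t, is_derive t (1:R) th ((x t * dy t - y t * dx t) / (x t * x t + y t * y t))].
Proof.
move=> ddx ddy cdx cdy ne [ex ey]; have n0 t := sqnorm_gt0 (@ne t).
have cx : continuous x by move=> t; exact: is_derive_cont (ddx t).
have cy : continuous y by move=> t; exact: is_derive_cont (ddy t).
pose g t := (x t * dy t - y t * dx t) / (x t * x t + y t * y t).
have cg : continuous g.
  move=> t; apply: cvgM.
    exact: ((contB (contM cx cdy) (contM cy cdx)) t).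
  apply: cvgV; first by rewrite gt_eqF.
  exact: ((contD (contM cx cx) (contM cy cy)) t).
pose th t := th0 + prim g t.
have thE0 : th 0 = th0 by rewrite /th prim0// addr0.
have dth t : is_derive t (1:R) th (g t).
  have H := is_deriveD (is_derive_cst th0 t (1:R)) (is_derive_prim t cg).
  by apply: (is_derive_eq H); rewrite add0r.
have dc t : is_derive t (1:R) (fun t => cos (th t)) (- sin (th t) * g t) := is_derive1_comp (is_derive_cos (th t)) (dth t).
have ds t : is_derive t (1:R) (fun t => sin (th t)) (cos (th t) * g t) := is_derive1_comp (is_derive_sin (th t)) (dth t).
have cc : continuous (fun t => cos (th t)) by move=> t; exact: is_derive_cont (dc t).
have cs : continuous (fun t => sin (th t)) by move=> t; exact: is_derive_cont (ds t).
have cs1 t : cos (th t) * cos (th t) + sin (th t) * sin (th t) = 1 by rewrite -!expr2 cos2Dsin2.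
pose n t := x t * x t + y t * y t.
have dn t : is_derive t (1:R) n (2 * (x t * dx t + y t * dy t)).
  have H := is_deriveD (is_deriveM (ddx t) (ddx t)) (is_deriveM (ddy t) (ddy t)).
  by apply: (is_derive_eq H); rewrite /GRing.scale /=; ring.
pose v t := y t * cos (th t) - x t * sin (th t).
have dv t : is_derive t (1:R) v (dy t * cos (th t) - y t * (sin (th t) * g t) - dx t * sin (th t) - x t * (cos (th t) * g t)).
  have H := is_deriveB (is_deriveM (ddy t) (dc t)) (is_deriveM (ddx t) (ds t)).
  by apply: (is_derive_eq H); rewrite /GRing.scale /=; ring.
pose F t := v t * v t * (n t)^-1.
have dF t : is_derive t (1:R) F 0.
  have nn : n t != 0 by exact: lt0r_neq0 (n0 t).
  have H := is_deriveM (is_deriveM (dv t) (dv t)) (@is_deriveV R n t _ 1 nn (dn t)).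
  apply: (is_derive_eq H); rewrite /GRing.scale /= /g -/(n t) -[(v * v) t]/(v t * v t).
  have nE : n t = x t * x t + y t * y t by [].
  apply: (mulfI (expf_neq0 3 nn)); rewrite mulr0.
  have -> : n t ^+ 3 = n t * (n t * n t) by rewrite exprS expr2.
  transitivity (2 * n t * v t * (v t * - (x t * dx t + y t * dy t) +
     ((dy t * cos (th t) - dx t * sin (th t)) * n t - (y t * sin (th t) + x t * cos (th t)) * (x t * dy t - y t * dx t)))).
    by field.
  by rewrite /v nE; ring.
have v0 : v 0 = 0 by rewrite /v thE0 [X in X * cos _]ey [X in _ - X * _]ex; ring.
have vz t : v t = 0.
  have := derive_bound_lipschitz (M := 0) dF _ t 0; rewrite normr0 mul0r => /(_ (fun _ => lexx 0)).
  rewrite normr_le0 /F v0 !mul0r subr0 mulf_eq0 invr_eq0 (gt_eqF (n0 t)) orbF -expr2 sqrf_eq0.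
  by move/eqP.
pose u t := x t * cos (th t) + y t * sin (th t).
have uu t : u t ^+ 2 = n t.
  have : u t ^+ 2 + v t ^+ 2 = n t * (cos (th t) * cos (th t) + sin (th t) * sin (th t)).
    by rewrite /u /v /n; ring.
  by rewrite vz expr0n addr0 cs1 mulr1.
have u0 t : 0 < u t.
  apply: continuous_ne0_gt0 t => [|t e|].
  - by apply: contD; apply: contM.
  - by have := n0 t; rewrite -/(n t) -uu e expr0n ltxx.
  - have -> : u 0 = radius (x 0) (y 0) * (cos (th 0) * cos (th 0) + sin (th 0) * sin (th 0)).
      by rewrite /u thE0 [X in X * cos _ + _]ex [X in _ + X * sin _ = _]ey; ring.
    by rewrite cs1 mulr1 sqrtr_gt0.
have ru t : radius (x t) (y t) = u t by rewrite /radius -/(n t) -uu sqrtr_sqr gtr0_norm.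
exists th; split=> // t; rewrite /angle_of ru; split.
  have : u t * cos (th t) - v t * sin (th t) = x t * (cos (th t) * cos (th t) + sin (th t) * sin (th t)).
    by rewrite /u /v; ring.
  by rewrite vz cs1 mul0r subr0 mulr1.
have : u t * sin (th t) + v t * cos (th t) = y t * (cos (th t) * cos (th t) + sin (th t) * sin (th t)).
  by rewrite /u /v; ring.
by rewrite vz cs1 mul0r addr0 mulr1.
Qed.

Lemma left_time_small (X : R) : exists2 d : R, 0 < d & d <= 4^-1 /\
  forall t : R, 0 < t < d -> left_time t <= - X.
Proof.
have EX := expR_gt0 X.
exists (Num.min 4^-1 (2 * (1 + expR X))^-1).
  by rewrite lt_min !invr_gt0 mulr_gt0 ?addr_gt0.
split; first exact: minl_le.
move=> t /andP[t0]; rewrite lt_min => /andP[t4 tX].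
rewrite /left_time mulN1r lerN2 -ler_expR lnK ?posrE; last first.
  by rewrite divr_gt0 ?mulr_gt0//; lra.
rewrite ler_pdivlMr ?mulr_gt0//.
have : t * (2 * (1 + expR X)) < 1.
  by rewrite -ltr_pdivlMr ?mulr_gt0 ?addr_gt0// mul1r.
by lra.
Qed.

Lemma left_time_quarter : left_time (4^-1 : R) = 0.
Proof.
rewrite /left_time (_ : (1 - 2 * 4^-1) / (2 * 4^-1) = 1 :> R) ?ln1 ?mulr0//.
by field.
Qed.

Lemma left_time_ge0 (t : R) : 4^-1 <= t -> t < 2^-1 -> 0 <= left_time t.
Proof.
move=> h1 h2; rewrite /left_time mulN1r oppr_ge0 -ln1 ler_ln ?posrE//.
  by rewrite ler_pdivrMr; lra.
by rewrite divr_gt0; lra.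
Qed.

Lemma left_time_continuous (t : R) : 0 < t -> t < 2^-1 -> {for t, continuous (@left_time R)}.
Proof.
move=> t0 t1; apply: cvgM; first exact: cvg_cst.
apply: (@continuous_comp _ _ _ (fun t : R => (1 - 2 * t) / (2 * t)) (@ln R)).
  apply: cvgM.
    by apply: cvgB; [exact: cvg_cst|apply: cvgM; [exact: cvg_cst|exact: cvg_id]].
  apply: cvgV; first by rewrite gt_eqF// mulr_gt0.
  by apply: cvgM; [exact: cvg_cst|exact: cvg_id].
by apply: continuous_ln; rewrite divr_gt0 ?mulr_gt0//; lra.
Qed.

End PolarAngle.

Section StrongInteraction.
Context {R : realType}.
Variables (beta s kappa ab qb : R).
Hypotheses (beta_gt0 : 0 < beta) (s_gt0 : 0 < s) (kappa_gt0 : 0 < kappa).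
Hypotheses (ab_gt0 : 0 < ab) (qbE : qb = ab / (ab + 2 * s)).
Hypothesis abE : 2^-1 * ab * ab + (beta + 3 * s) * ab + 2 * beta * s + 4 * s * s = kappa.
Local Notation fa := (fa beta s kappa).
Local Notation fq := (fq s).
Local Notation pa := (pa beta s kappa).
Local Notation pq := (pq beta s kappa).
Local Notation in_wedge := (in_wedge beta s kappa ab).
Variables zL zR : R * R.
Hypotheses (wL : in_wedge (-1) zL) (eL : zL.2 = qb / 2).
Hypotheses (wR : in_wedge 1 zR) (eR : zR.2 = 1).
Local Notation curve := (curve beta s kappa ab qb zL zR).

Let cpa z : continuous (pa z). Proof. exact: pa_continuous. Qed.
Let cpq z : continuous (pq z). Proof. exact: pq_continuous. Qed.
Let linbox := left_inbox beta_gt0 s_gt0 kappa_gt0 ab_gt0 qbE abE wL eL.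
Let dpa t := inbox_pa beta_gt0 s_gt0 kappa_gt0 (proj1 (linbox t)).
Let dpq t := inbox_pq beta_gt0 s_gt0 kappa_gt0 (proj1 (linbox t)).

Hypothesis strong : (beta + 4 * s) * (beta + 4 * s) < 4 * kappa.

Let B := beta + 4 * s.
Let c : R := (kappa - B * B / 4) / (1 + kappa).
Let k0 : 0 < 1 + kappa. Proof. exact: addr_gt0. Qed.
Let c0 : 0 < c.
Proof. by rewrite divr_gt0// subr_gt0; move: strong; rewrite -/B; set BB := B * B; lra. Qed.
Let cE : 4 * c * (1 + kappa) = 4 * kappa - B * B.
Proof. by rewrite /c; field; rewrite gt_eqF. Qed.

(* c is less than the smallest eigenvalue of the linearized angular form *)
Let form_ge (a q : R) : c * (a * a + q * q) <= a * a - B * (a * q) + kappa * (q * q).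
Proof.
have h1 : 0 < 1 - c.
  rewrite -(pmulr_lgt0 _ k0); have -> : (1 - c) * (1 + kappa) = 1 + 4^-1 * (B * B).
    have -> : (1 - c) * (1 + kappa) = 1 + kappa - 4^-1 * (4 * c * (1 + kappa)) by field.
    by rewrite cE; field.
  by rewrite ltr_pwDl// mulr_ge0 ?invr_ge0// -expr2 sqr_ge0.
rewrite -subr_ge0 -(pmulr_rge0 _ (_ : 0 < 4 * (1 - c))) ?mulr_gt0//.
have -> : 4 * (1 - c) * (a * a - B * (a * q) + kappa * (q * q) - c * (a * a + q * q)) =
  (2 * (1 - c) * a - B * q) ^+ 2 + ((4 * kappa - B * B) - 4 * c * (1 + kappa) + 4 * (c * c)) * q ^+ 2 by ring.
rewrite cE subrr add0r; apply: addr_ge0; first exact: sqr_ge0.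
apply: mulr_ge0; last exact: sqr_ge0.
by apply: mulr_ge0 => //; apply: mulr_ge0; exact: ltW.
Qed.

Let speed_ge (a q : R) : `|a| <= 2 / 3 * c -> 2^-1 * c * (a * a + q * q) <= a * fq a q - q * fa a q.
Proof.
move=> ha; have -> : a * fq a q - q * fa a q = a * a - B * (a * q) + kappa * (q * q) - 3 / 2 * `|a| * (a * q).
  by rewrite /fq /fa /B; field.
have h1 : a * q <= 2^-1 * (a * a + q * q).
  by rewrite -subr_ge0; have -> : 2^-1 * (a * a + q * q) - a * q = 2^-1 * (a - q) ^+ 2; [field|rewrite mulr_ge0 ?sqr_ge0// invr_ge0].
have h2 : 3 / 2 * `|a| * (a * q) <= c * (2^-1 * (a * a + q * q)).
  have p : 0 <= 2^-1 * (a * a + q * q) by rewrite mulr_ge0 ?invr_ge0// addr_ge0// -expr2 sqr_ge0.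
  have n0 : 0 <= 3 / 2 * `|a| by rewrite mulr_ge0// divr_ge0.
  apply: (le_trans (ler_wpM2l n0 h1)); apply: ler_wpM2r => //; lra.
by have := form_ge a q; lra.
Qed.

(** Near the origin the angular velocity is, up to terms of the order of |a|, a positive
    definite quadratic form divided by the square of the radius. *)
Lemma left_angle : exists th : R -> R, exists T k : R,
  [/\ continuous th, th 0 = atan (pq zL 0 / pa zL 0),
      forall t, angle_of (pa zL t) (pq zL t) (th t), 0 < k /\ 0 <= T &
      forall t t' : R, t <= t' -> t' <= - T -> k * (t' - t) <= th t' - th t].
Proof.
have ne t : (pa zL t, pq zL t) <> (0, 0).
  exact: (left_origin beta_gt0 s_gt0 kappa_gt0 ab_gt0 qbE eL).
have [_ a0 _ _] := wL (lexx 0).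
have cfq : continuous (fun t => fq (pa zL t) (pq zL t)) by exact: fq_continuous.
have [th [th0 ang dth]] := angle_exists dpa dpq (@fa_orbit_continuous R beta s kappa beta_gt0 s_gt0 kappa_gt0 zL) cfq ne (angle_atan (pq zL 0) a0).
have [al _] := left_limit0 beta_gt0 s_gt0 kappa_gt0 ab_gt0 qbE abE wL eL.
have c23 : 0 < 2 / 3 * c by rewrite mulr_gt0// divr_gt0.
have [T0 hT0] := (proj2 (cvgyP _ _) al) _ c23.
exists th, (Num.max 0 T0), (2^-1 * c); split=> //.
- by move=> t; exact: is_derive_cont (dth t).
- by split; [rewrite mulr_gt0// invr_gt0|rewrite le_max lexx].
move=> t t' tt t'T.
have d (u : R) : t < u < t' -> is_derive u (1:R) (fun u => th u - 2^-1 * c * u)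
   ((pa zL u * fq (pa zL u) (pq zL u) - pq zL u * fa (pa zL u) (pq zL u)) /
    (pa zL u * pa zL u + pq zL u * pq zL u) - 2^-1 * c).
  by move=> _; have H := is_deriveB (dth u) (is_derive_cmul (2^-1 * c) u); exact: (is_derive_eq H).
have w : {within `[t, t'], continuous (fun u => th u - 2^-1 * c * u)}.
  apply: continuous_subspaceT; apply: contB; first by move=> u; exact: is_derive_cont (dth u).
  by move=> u; exact: is_derive_cont (is_derive_cmul (2^-1 * c) u).
have := is_derive_nondecr tt d w => h.
suff : th t - 2^-1 * c * t <= th t' - 2^-1 * c * t' by lra.
apply: h => u /andP[u0 u1]; rewrite subr_ge0 ler_pdivlMr ?sqnorm_gt0//.
apply: speed_ge; have := hT0 (- u); rewrite subr0 mulrNN mul1r; apply.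
have : u <= - Num.max 0 T0 by apply: le_trans t'T; exact: ltW.
by rewrite lerNr ge_max => /andP[].
Qed.

Let curve_a_gt0 (t : R) : 4^-1 <= t -> t <= 1 -> 0 < (curve t).1.
Proof.
move=> t0 t1; case: (ltgtP t 2^-1) => h.
- by rewrite curve_left//=; [have [] := wL (left_time_ge0 t0 h)|lra].
- rewrite curve_right//=; have u0 : 0 <= right_time t by apply: right_time_ge0; rewrite h.
  by have [] := wR u0.
- by rewrite h curve_mid.
Qed.

Let cc := curve_continuous beta_gt0 s_gt0 kappa_gt0 ab_gt0 qbE abE wL eL wR.

(** The angle of the left branch, continued by that of the rest of the curve,
    which remains in the half plane a > 0. *)
Lemma curve_angle : exists th : R -> R,
  [/\ forall t : R, 0 < t <= 1 -> {for t, continuous th},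
      forall t : R, 0 < t <= 1 -> angle_of (curve t).1 (curve t).2 (th t) &
      forall A : R, exists2 d : R, 0 < d & forall t : R, 0 < t < d -> th t <= - A].
Proof.
have [th [T [k [cth th0 ang [k_gt0 T0] hk]]]] := left_angle.
have q4 : (4^-1 : R) < 2^-1 by lra.
have q0 : (0 : R) < 4^-1 by lra.
have c4 : curve 4^-1 = (pa zL 0, pq zL 0) by rewrite curve_left// left_time_quarter.
pose Phi t := atan ((curve t).2 / (curve t).1).
have PhiE : Phi 4^-1 = th 0 by rewrite /Phi c4 th0.
pose psi t := th (left_time (Num.min t 4^-1)) + Phi (Num.max t 4^-1) - Phi 4^-1.
have psi_small t : t <= 4^-1 -> psi t = th (left_time t).
  by move=> h; rewrite /psi (min_idPl h) (max_idPr h) addrK.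
have psi_large t : 4^-1 <= t -> psi t = Phi t.
  by move=> h; rewrite /psi (min_idPr h) (max_idPl h) left_time_quarter -PhiE addrAC subrr add0r.
exists psi; split.
- move=> t /andP[t0 t1].
  apply: cvgB; last exact: cvg_cst.
  apply: cvgD.
    apply: (@continuous_comp _ _ _ (fun t : R => Num.min t 4^-1) (fun u => th (left_time u))).
      by apply: continuous_min; [exact: cvg_id|exact: cvg_cst].
    apply: (@continuous_comp _ _ _ (@left_time R) th); last exact: cth.
    apply: left_time_continuous; first by rewrite lt_min t0.
    by apply: le_lt_trans q4; exact: minr_le.
  apply: (@continuous_comp _ _ _ (fun t : R => Num.max t 4^-1) Phi).
    by apply: continuous_max; [exact: cvg_id|exact: cvg_cst].
  have h1 : 4^-1 <= Num.max t 4^-1 by rewrite le_max lexx orbT.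
  have h2 : Num.max t 4^-1 <= 1 by rewrite ge_max t1; lra.
  have [ca cq] := cc.
  apply: (@continuous_comp _ _ _ (fun u => (curve u).2 / (curve u).1) (@atan R)).
    apply: cvgM; first exact: cq.
    by apply: cvgV; [rewrite gt_eqF// curve_a_gt0|exact: ca].
  exact: continuous_atan.
- move=> t /andP[t0 t1]; case: (leP t 4^-1) => h.
    by rewrite psi_small// curve_left//=; exact: le_lt_trans q4.
  by rewrite psi_large ?ltW//; apply: angle_atan; apply: curve_a_gt0 => //; exact: ltW.
- move=> A; pose X := T + `|A + th (- T)| / k.
  have XT : T <= X by rewrite lerDl divr_ge0// ltW.
  have [d d0 [d4 hd]] := left_time_small X; exists d => // t tI.
  have /andP[t0 td] := tI.
  rewrite psi_small; last by apply: ltW; exact: lt_le_trans d4.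
  have h := hd t tI; have h' : left_time t <= - T by apply: le_trans h _; rewrite lerN2.
  have := hk _ _ h' (lexx _).
  have : k * (X - T) <= k * (- T - left_time t) by apply: ler_wpM2l; [exact: ltW|lra].
  have -> : k * (X - T) = `|A + th (- T)| by rewrite /X; field; rewrite gt_eqF.
  by have := ler_norm (A + th (- T)); lra.
Qed.

Let curve_sq_gt0 (t : R) : 0 < t <= 1 -> 0 < (curve t).1 * (curve t).1 + (curve t).2 * (curve t).2.
Proof.
move=> t01; apply: sqnorm_gt0 => e.
have h := curve_attracted beta_gt0 s_gt0 kappa_gt0 ab_gt0 qbE abE wL eL wR t01.
apply: (@attracted_neq0 R beta s kappa ab qb beta_gt0 s_gt0 kappa_gt0 ab_gt0 qbE 1 (mul1r 1)).
by rewrite -e -surjective_pairing.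
Qed.

(** The negative half is opposite to the positive one, which adds pi to the angle. *)
Lemma curve_spirals : spirals curve.
Proof.
have [th [cth ang lim]] := curve_angle; have [ca cq] := cc.
have crad : continuous (fun t => radius (curve t).1 (curve t).2).
  move=> t; apply: (@continuous_comp _ _ _ (fun t => (curve t).1 * (curve t).1 + (curve t).2 * (curve t).2)
    (@Num.sqrt R)); last exact: sqrt_continuous.
  exact: (contD (contM ca ca) (contM cq cq)) t.
have rneg (t : R) : radius (curve (- t)).1 (curve (- t)).2 = radius (curve t).1 (curve t).2.
  by rewrite curveN /radius /= !mulrNN.
split.
  exists (fun t => radius (curve t).1 (curve t).2), th; split.
    split; first exact: continuous_subspaceT.
    - apply: continuous_in_subspaceT => t; rewrite inE /= in_itv /=; exact: cth.
    - move=> t; rewrite /= in_itv /= => tI; have [e1 e2] := ang t tI; split => //.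
      by rewrite sqrtr_gt0 curve_sq_gt0.
  apply/cvgryPge => A; have [d d0 hd] := lim A.
  near=> t; have tI : 0 < t < d by apply/andP; split; near: t; [exact: nbhs_right_gt|exact: nbhs_right_lt].
  by have := hd t tI; have := ler_norm (- th t); rewrite normrN; lra.
exists (fun t => radius (curve t).1 (curve t).2), (fun t => th (- t) + pi); split.
  split; first exact: continuous_subspaceT.
  - apply: continuous_in_subspaceT => t; rewrite inE /= in_itv /= => /andP[t0 t1].
    apply: cvgD; last exact: cvg_cst.
    apply: (@continuous_comp _ _ _ (fun t : R => - t) th); first by apply: cvgN; exact: cvg_id.
    by apply: cth; rewrite oppr_gt0 t1 lerNl.
  - move=> t; rewrite /= in_itv /= => /andP[t0 t1].
    have tI : 0 < - t <= 1 by rewrite oppr_gt0 t1 lerNl.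
    have [e1 e2] := angle_opp (ang _ tI); rewrite -rneg sqrtr_gt0 curve_sq_gt0//; split => //.
      by move: e1; rewrite -rneg curveN /= !opprK.
    by move: e2; rewrite -rneg curveN /= !opprK.
apply/cvgryPge => A; have [d d0 hd] := lim (A + pi).
near=> t.
have tI : 0 < - t < d.
  by rewrite oppr_gt0 ltrNl; apply/andP; split; near: t; [exact: nbhs_left_lt|apply: nbhs_left_gt; rewrite oppr_lt0].
by have := hd _ tI; have := ler_norm (- (th (- t) + pi)); rewrite normrN; lra.
Unshelve. all: by end_near. Qed.

(** Between two successive crossings of the vertical axis the left branch meets
    every line q = q0 close to the origin, at times that differ from turn to turn. *)
Lemma left_meets (n : nat) : exists2 delta : R, 0 < delta & forall q0 : R, `|q0| < delta ->
  exists ts : 'I_n -> R, (forall i j, i != j -> ts i <> ts j) /\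
    forall i, pq zL (ts i) = q0 /\ winds_around n (pa (pa zL (ts i), pq zL (ts i))) (pq (pa zL (ts i), pq zL (ts i))).
Proof.
have [th [T [k [cth th0 ang [k_gt0 T0] hk]]]] := left_angle.
have pi0 : 0 < pi :> R by exact: pi_gt0.
have rad0 t : 0 < radius (pa zL t) (pq zL t).
  rewrite sqrtr_gt0; apply: sqnorm_gt0.
  exact: (left_origin beta_gt0 s_gt0 kappa_gt0 ab_gt0 qbE eL).
have reach (v : R) : v <= th (- T) -> exists2 t, t <= - T & th t = v.
  move=> hv; pose t := - T - (th (- T) - v) / k.
  have tT : t <= - T by rewrite gerBl divr_ge0 ?subr_ge0// ltW.
  have := hk t (- T) tT (lexx _).
  have -> : k * (- T - t) = th (- T) - v by rewrite /t; field; rewrite gt_eqF.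
  move=> h; have ht : th t <= v by lra.
  have [|u] := IVT tT (continuous_subspaceT cth) (v := v).
    by rewrite (min_idPl _) ?(max_idPr _) ?ht ?hv//; exact: le_trans hv.
  by rewrite in_itv /= => /andP[_ uT] e; exists u.
have mono t t' : t <= - T -> t' <= - T -> th t < th t' -> t <= t'.
  move=> h h' lt; rewrite leNgt; apply/negP => tt; have := hk t' t (ltW tt) h.
  have : 0 <= k * (t - t') by rewrite mulr_ge0 ?ltW ?subr_gt0.
  by lra.
have ndec t t' : t <= t' -> t' <= - T -> th t <= th t'.
  move=> tt h; have := hk t t' tt h.
  have : 0 <= k * (t' - t) by apply: mulr_ge0; [exact: ltW|rewrite subr_ge0].
  by move=> h1 h2; rewrite -subr_ge0; exact: le_trans h2.
(* the first turn taken into account *)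
pose Y := `|th (- T)| + `|th 0| + n%:R * (2 * pi) + pi.
have Y0 : 0 <= Y.
  have np : 0 <= n%:R * (2 * pi) :> R by rewrite mulr_ge0// mulr_ge0// ltW.
  have := normr_ge0 (th (- T)); have := normr_ge0 (th 0).
  by rewrite /Y; move: np pi0; lra.
pose K := Num.truncn Y.
pose c_ (i : nat) : R := - (K.+1 + i)%:R * (2 * pi).
have cY i : c_ i + pi <= - Y + pi.
  rewrite lerD2r /c_ mulNr lerN2.
  have h1 : Y < K.+1%:R by have /andP[] := truncn_itv Y0.
  have h2 : K.+1%:R <= (K.+1 + i)%:R :> R by rewrite ler_nat leq_addr.
  have h3 : (K.+1 + i)%:R * 1 <= (K.+1 + i)%:R * (2 * pi) :> R.
    by rewrite ler_wpM2l//; have := pi_ge2 R; lra.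
  by move: h1 h2 h3; rewrite mulr1; lra.
have cs i : cos (c_ i) = 1 /\ sin (c_ i) = 0.
  rewrite /c_ mulNr cosN sinN; elim: (K.+1 + i)%N => [|m [h1 h2]]; first by rewrite mul0r cos0 sin0 oppr0.
  have -> : m.+1%:R * (2 * pi) = m%:R * (2 * pi) + pi + pi :> R by rewrite -natr1; ring.
  by rewrite cosDpi sinDpi cosDpi sinDpi !opprK.
have band i : exists2 d : R, 0 < d & forall q0 : R, `|q0| < d ->
    exists2 t, t <= - T & pq zL t = q0 /\ c_ i - pi / 2 <= th t <= c_ i + pi / 2.
  have hT : c_ i + pi / 2 <= th (- T).
    have := cY i; have := ler_norm (- th (- T)); rewrite normrN /Y.
    have h1 : 0 <= `|th 0| by []. have h2 : 0 <= n%:R * (2 * pi) :> R by rewrite mulr_ge0// mulr_ge0// ltW.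
    by move: h1 h2 pi0; lra.
  have [t1 h1 e1] : exists2 t, t <= - T & th t = c_ i - pi / 2 by apply: reach; move: pi0 hT; lra.
  have [t2 h2 e2] := reach _ hT.
  have tt : t1 <= t2 by apply: mono => //; rewrite e1 e2; move: pi0; lra.
  have [ci si] := cs i.
  have p1 : pq zL t1 = - radius (pa zL t1) (pq zL t1).
    have [_ {1}->] := ang t1; rewrite e1 sinD cosN sinN ci si sin_pihalf cos_pihalf; ring.
  have p2 : pq zL t2 = radius (pa zL t2) (pq zL t2).
    have [_ {1}->] := ang t2; rewrite e2 sinD ci si sin_pihalf cos_pihalf; ring.
  exists (Num.min (radius (pa zL t1) (pq zL t1)) (radius (pa zL t2) (pq zL t2))); first by rewrite lt_min !rad0.
  move=> q0; rewrite lt_min -p2 => /andP[]; rewrite !ltr_norml => /andP[g1 _] /andP[_ g2].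
  have g1' : pq zL t1 < q0 by rewrite p1.
  have [|u] := IVT tt (continuous_subspaceT (@cpq zL)) (v := q0).
    by rewrite (min_idPl _) ?(max_idPr _) ?(ltW g1') ?(ltW g2)//; apply: ltW; exact: lt_trans g2.
  rewrite in_itv /= => /andP[u1 u2] e; exists u; first exact: le_trans h2.
  split => //; rewrite -e1 -e2; apply/andP; split; apply: ndec => //; exact: le_trans h2.
have bands (m : nat) : exists2 d : R, 0 < d & forall q0 : R, `|q0| < d -> forall i : nat, (i < m)%N ->
    exists2 t, t <= - T & pq zL t = q0 /\ c_ i - pi / 2 <= th t <= c_ i + pi / 2.
  elim: m => [|m [d d0 hd]]; first by exists 1.
  have [d' d'0 hd'] := band m; exists (Num.min d d'); first by rewrite lt_min d0.
  move=> q0; rewrite lt_min => /andP[q1 q2] i; rewrite ltnS leq_eqVlt => /orP[/eqP->|im]; first exact: hd'.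
  exact: hd.
have [d d0 hd] := bands n; exists d => // q0 hq.
pose ts (i : 'I_n) := projT1 (cid2 (hd q0 hq i (ltn_ord i))).
have tsT i : ts i <= - T by rewrite /ts; case: cid2.
have tsP i : pq zL (ts i) = q0 /\ c_ i - pi / 2 <= th (ts i) <= c_ i + pi / 2 by rewrite /ts; case: cid2.
exists ts; split.
  suff H (i j : 'I_n) : (i < j)%N -> ts i <> ts j.
    move=> i j; rewrite -(inj_eq val_inj) /= neq_ltn => /orP[/H//|/H h e]; exact: h.
  move=> ij e; have [_ /andP[h1 _]] := tsP i; have [_ /andP[_ h2]] := tsP j; rewrite -e in h2.
  have := le_trans h1 h2; rewrite /c_.
  have : (K.+1 + i)%:R + 1 <= (K.+1 + j)%:R :> R by rewrite natr1 ler_nat ltn_add2l.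
  have p2 : 0 < 2 * pi :> R by rewrite mulr_gt0.
  by rewrite -(ler_pM2r p2) mulrDl mul1r; move: pi0; lra.
move=> i; have [e /andP[_ h2]] := tsP i; split => //.
exists (fun t => radius (pa zL (ts i + t)) (pq zL (ts i + t))), (fun t => th (ts i + t)); split.
  split.
  - apply: continuous_subspaceT; apply: (@cont_add_arg R (fun t => radius (pa zL t) (pq zL t))) => t.
    apply: (@continuous_comp _ _ _ (fun t => pa zL t * pa zL t + pq zL t * pq zL t)
      (@Num.sqrt R)); last exact: sqrt_continuous.
    exact: (contD (contM (@cpa zL) (@cpa zL)) (contM (@cpq zL) (@cpq zL))) t.
  - by apply: continuous_subspaceT; exact: cont_add_arg.
  - move=> t _; have [-> ->] := flow_shift beta_gt0 s_gt0 kappa_gt0 zL (ts i) t.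
    by have [e1 e2] := ang (ts i + t).
exists (- ts i); first by rewrite oppr_ge0; apply: le_trans (tsT i) _; rewrite oppr_le0.
rewrite subrr addr0; apply: le_trans (ler_norm _).
have := cY i; rewrite /Y; have := ler_norm (- th 0); rewrite normrN.
have h1 : 0 <= `|th (- T)| by [].
by move: h1 pi0; lra.
Qed.

End StrongInteraction.

(** * Binary processes on the unit interval *)

Section UnitInterval.
Context {R : realType}.
Local Notation leb := (@lebesgue_measure R).

Let mI : measurable (`[0, 1[%classic : set R). Proof. exact: measurable_itv. Qed.

Definition unif : set (measurableTypeR R) -> \bar R := mrestr leb mI.

HB.instance Definition _ := Measure.on unif.

Let unif_setT : unif setT = 1%E.
Proof. by rewrite /unif /mrestr setTI lebesgue_measure_itv/= lte_fin ltr01 sube0. Qed.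

HB.instance Definition _ := Measure_isProbability.Build _ _ R unif unif_setT.

End UnitInterval.

Section BinaryProcess.
Context {R : realType}.
(* mu w is the prescribed probability of the word w, whose head is the last letter *)
Variable mu : seq bool -> R.
Hypothesis mu_ge0 : forall w, 0 <= mu w.
Hypothesis mu_nil : mu [::] = 1.
Hypothesis mu_cons : forall w, mu (false :: w) + mu (true :: w) = mu w.

Fixpoint cell_left (w : seq bool) : R :=
  if w is b :: w' then cell_left w' + (if b then mu (false :: w') else 0) else 0.

Fixpoint word (n : nat) (x : R) : seq bool :=
  if n is n'.+1 then (cell_left (word n' x) + mu (false :: word n' x) <= x) :: word n' x else [::].

Definition letter (i : nat) (x : R) : bool := head false (word i.+1 x).

Lemma word_letters n x : word n x = rev (mkseq (letter ^~ x) n).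
Proof. by elim: n => // n IH; rewrite mkseqS rev_rcons -IH. Qed.

Lemma cell_bounds w : 0 <= cell_left w /\ cell_left w + mu w <= 1.
Proof.
elim: w => [|b w [h1 h2]] /=; first by rewrite mu_nil add0r.
have := mu_cons w; have := mu_ge0 (false :: w); have := mu_ge0 (true :: w).
by case: b; lra.
Qed.

(** The words form nested partitions of [0, 1[ into intervals of length mu w, by the
    additivity of mu; the left end of such an interval is cell_left w. *)
Lemma word_cell w x : 0 <= x < 1 ->
  (word (size w) x == w) = (cell_left w <= x < cell_left w + mu w).
Proof.
move=> x01; elim: w => [|b w IH] /=; first by rewrite mu_nil add0r x01.
rewrite eqseq_cons; have := mu_cons w; have := mu_ge0 (false :: w); have := mu_ge0 (true :: w) => h1 h2 h3.
have [e|ne] := eqVneq (word (size w) x) w.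
  move: IH; rewrite e eqxx => /esym/andP[i1 i2]; rewrite andbT.
  case: b; first by rewrite eqb_id (_ : x < _ = true) ?andbT//; lra.
  by rewrite addr0 i1 eqbF_neg -ltNge.
rewrite andbF; move: IH; rewrite (negbTE ne) => /esym/negbT; rewrite negb_and -ltNge -leNgt => /orP i.
apply/esym/negbTE; rewrite negb_and -ltNge -leNgt; apply/orP.
by case: b; case: i => i; (left; lra) || (right; lra).
Qed.

Let measurable_word (w : seq bool) (n : nat) :
  measurable [set x : measurableTypeR R | word n x = w].
Proof.
elim: n w => [|n IH] w.
  case: w => [|b w]; first by rewrite (_ : mkset _ = setT)//; apply/seteqP; split.
  by rewrite (_ : mkset _ = set0)//; apply/seteqP; split.
case: w => [|b w]; first by rewrite (_ : mkset _ = set0)//; apply/seteqP; split.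
have mle (c : R) : measurable [set x : measurableTypeR R | c <= x].
  have : measurable (`[c, +oo[%classic : set R) by exact: measurable_itv.
  by rewrite set_itvE.
pose c := cell_left w + mu (false :: w).
have -> : [set x : measurableTypeR R | word n.+1 x = b :: w] =
    [set x | word n x = w] `&` (if b then [set x : measurableTypeR R | c <= x] else ~` [set x : measurableTypeR R | c <= x]).
  apply/seteqP; split => x /=.
    by move=> [hb hw]; split => //; case: b hb; rewrite hw -/c => h; rewrite ?h//= h.
  by move=> [-> hb]; congr cons; case: b hb => /= h; rewrite -/c ?h//; apply/negP.
by apply: measurableI => //; case: b => //; exact: measurableC.
Qed.

(** Such an event is a finite union of cells. *)
Lemma measurable_letters (n : nat) (Q : pred (seq bool)) :
  measurable [set x : measurableTypeR R | Q (word n x)].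
Proof.
pose w k : seq bool := odflt [::] (unpickle k).
rewrite (_ : mkset _ = \bigcup_k (if Q (w k) then [set x | word n x = w k] else set0)); last first.
  apply/seteqP; split => x /= => [qx|[k _]]; last by case: ifP => // qk /= ->.
  by exists (pickle (word n x)) => //; rewrite /w pickleK /= qx.
by apply: bigcupT_measurable => k; case: ifP => _; [exact: measurable_word|exact: measurable0].
Qed.

Lemma measurable_letter i : measurable_fun setT (letter i : measurableTypeR R -> bool).
Proof.
apply: (@measurable_fun_bool _ _ _ _ true).
have := measurable_letters i.+1 (head false).
by rewrite setTI; congr measurable; apply/seteqP; split.
Qed.

Lemma prob_word w : unif [set x | word (size w) x = w] = (mu w)%:E.
Proof.
rewrite /unif /mrestr (_ : _ `&` _ = `[cell_left w, cell_left w + mu w[%classic).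
  rewrite lebesgue_measure_itv/= lte_fin ltrDl; case: ltP => h; first by rewrite -EFinD; congr EFin; ring.
  by congr EFin; apply/le_anti; rewrite h mu_ge0.
have [h1 h2] := cell_bounds w.
apply/seteqP; split => x /=.
  by move=> [/eqP e x01]; move: x01 e; rewrite !in_itv/= => x01; rewrite word_cell.
rewrite !in_itv/= => /andP[x1 x2].
have x01 : 0 <= x < 1 by rewrite (le_trans h1 x1) (lt_le_trans x2 h2).
by split=> //; apply/eqP; rewrite word_cell// x1.
Qed.

End BinaryProcess.

(** * Markov chains on countably many times *)

Section ChainWeights.
Context {R : realType}.
Variables (tr : R -> R -> bool -> bool -> R) (T : nat -> R).
Hypothesis tr_ge0 : forall s t x y, 0 <= s -> s <= t -> 0 <= tr s t x y.
Hypothesis tr_sum : forall s t x, 0 <= s -> s <= t -> tr s t x false + tr s t x true = 1.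
Hypothesis tr_comp : forall s t u x z, 0 <= s -> s <= t -> t <= u ->
  tr s t x false * tr t u false z + tr s t x true * tr t u true z = tr s u x z.
Hypothesis tr_id : forall s x y, 0 <= s -> tr s s x y = (x == y)%:R.
Hypothesis T_inj : injective T.
Hypothesis T_ge0 : forall i, 0 <= T i.
Implicit Types (f g h : nat -> bool -> R) (l : seq nat).

(** The expectation of the product of the f i (X_{T i}), i in l, for a chain X
    started from x at time s, when the times T i are listed in increasing order. *)
Fixpoint chain_mean f (s : R) (x : bool) l : R :=
  if l is i :: l' then
    tr s (T i) x false * (f i false * chain_mean f (T i) false l') +
    tr s (T i) x true * (f i true * chain_mean f (T i) true l')
  else 1.

Definition earlier : rel nat := fun i j => T i <= T j.

Let earlier_total : total earlier. Proof. by move=> i j; exact: le_total. Qed.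
Let earlier_trans : transitive earlier. Proof. by move=> i j k; exact: le_trans. Qed.
Let earlier_anti : antisymmetric earlier.
Proof. by move=> i j /le_anti /T_inj. Qed.

Lemma chain_mean_ext f g s x l : (forall i y, i \in l -> f i y = g i y) ->
  chain_mean f s x l = chain_mean g s x l.
Proof.
elim: l s x => //= i l IH s x fg.
by rewrite !fg ?mem_head// !IH// => j y jl; apply: fg; rewrite inE jl orbT.
Qed.

Lemma chain_mean_ge0 f s x l : (forall i y, 0 <= f i y) -> 0 <= s ->
  all (fun i => s <= T i) l -> sorted earlier l -> 0 <= chain_mean f s x l.
Proof.
move=> f0; elim: l s x => //= i l IH s x s0 /andP[si al] pl.
have il : all (fun j => T i <= T j) l by apply: (order_path_min earlier_trans pl).
have H y : 0 <= chain_mean f (T i) y l by apply: IH => //; exact: path_sorted pl.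
by rewrite addr_ge0// mulr_ge0// ?tr_ge0// mulr_ge0.
Qed.

Lemma chain_mean_skip f s t x l : 0 <= s -> s <= t -> all (fun i => t <= T i) l ->
  tr s t x false * chain_mean f t false l + tr s t x true * chain_mean f t true l =
  chain_mean f s x l.
Proof.
move=> s0 st; case: l => [|i l] /=; first by rewrite !mulr1 tr_sum.
move=> /andP[ti _]; rewrite -!(tr_comp _ _ s0 st ti); ring.
Qed.

(** The Chapman-Kolmogorov equation drops the times with trivial factors. *)
Lemma chain_mean_filter f (p : pred nat) s x l : 0 <= s -> sorted earlier l ->
  all (fun i => s <= T i) l -> (forall i y, ~~ p i -> f i y = 1) ->
  chain_mean f s x l = chain_mean f s x (seq.filter p l).
Proof.
move=> s0 + + fp; elim: l s s0 x => //= i l IH s s0 x pl /andP[si al].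
have il : all (fun j => T i <= T j) l by apply: (order_path_min earlier_trans pl).
have sl := path_sorted pl.
have e y := IH (T i) (T_ge0 i) y sl il.
case: ifP => pi /=; first by rewrite !e.
rewrite !fp ?pi// !mul1r !e chain_mean_skip//.
by rewrite all_filter; apply/allP => j jl; apply/implyP => _; exact: (allP il).
Qed.

Lemma chain_mean_add f g h (k : nat) s x l : uniq l -> k \in l ->
  (forall i y, i != k -> f i y = g i y /\ f i y = h i y) ->
  (forall y, f k y = g k y + h k y) ->
  chain_mean f s x l = chain_mean g s x l + chain_mean h s x l.
Proof.
move=> + + fgh fk; elim: l s x => //= i l IH s x /andP[il ul].
rewrite inE; case: (eqVneq k i) => [e|ki] /= kl.
  subst i.
  have e y : chain_mean f (T k) y l = chain_mean g (T k) y l /\ chain_mean f (T k) y l = chain_mean h (T k) y l.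
    have ne j : j \in l -> j != k by move=> jl; apply: contraNneq il => <-.
    by split; apply: chain_mean_ext => j z /ne jk; case: (fgh j z jk).
  have [e1 e2] := e false; have [e3 e4] := e true.
  by rewrite !fk -e1 -e2 -e3 -e4; ring.
have ik : i != k by rewrite eq_sym.
have [f1 f2] := fgh i false ik; have [f3 f4] := fgh i true ik.
by rewrite !IH// -f1 -f2 -f3 -f4; ring.
Qed.

(** The Markov property: the state at time T i being x0, the factor of a later
    time T j separates from those of the past. *)
Lemma chain_mean_last f (c : R) (x0 : bool) i j s x l : (forall z, f i z = if z == x0 then c else 0) ->
  chain_mean f s x (l ++ [:: i; j]) = chain_mean f s x (rcons l i) *
  (tr (T i) (T j) x0 false * f j false + tr (T i) (T j) x0 true * f j true).
Proof.
move=> fi; elim: l s x => [|k l IH] s x /=; last by rewrite !IH; ring.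
by rewrite !fi; case: x0 {fi} => /=; ring.
Qed.

Variable m : bool -> R.
Hypothesis m_ge0 : forall x, 0 <= m x.
Hypothesis m_sum : m false + m true = 1.

Definition law_mean f l : R := m false * chain_mean f 0 false l + m true * chain_mean f 0 true l.

Definition timeline (n : nat) : seq nat := sort earlier (iota 0 n).

Let timeline_sorted n : sorted earlier (timeline n).
Proof. exact: sort_sorted. Qed.

Let timeline_ge0 l : all (fun i => 0 <= T i) l.
Proof. by apply/allP. Qed.

Let timeline_uniq n : uniq (timeline n).
Proof. by rewrite sort_uniq iota_uniq. Qed.

Let mem_timeline n k : (k \in timeline n) = (k < n)%N.
Proof. by rewrite mem_sort mem_iota add0n leq0n. Qed.

Definition spell (w : seq bool) (i : nat) (y : bool) : R := (nth false (rev w) i == y)%:R.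

(** The times T 0, T 1, and so on are dense and not ordered, whereas a chain is
    described in the order of time: hence the sorting of the first ones. *)
Definition word_weight (w : seq bool) : R := law_mean (spell w) (timeline (size w)).

Lemma word_weight_ge0 w : 0 <= word_weight w.
Proof. by rewrite addr_ge0// mulr_ge0// chain_mean_ge0//; move=> i y; rewrite /spell ler0n. Qed.

Lemma word_weight_nil : word_weight [::] = 1.
Proof. by rewrite /word_weight /law_mean /timeline /= !mulr1. Qed.

(** Forgetting the last letter amounts to dropping a time. *)
Lemma word_weight_cons w : word_weight (false :: w) + word_weight (true :: w) = word_weight w.
Proof.
pose n := size w; pose f i y : R := if i == n then 1 else spell w i y.
have sp b i : i != n -> forall y, spell (b :: w) i y = f i y.
  move=> ne y; rewrite /spell /f (negbTE ne) rev_cons nth_rcons size_rev -/n (negbTE ne).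
  by case: ltnP => // ni; rewrite /spell nth_default ?size_rev.
have spn b y : spell (b :: w) n y = (b == y)%:R.
  by rewrite /spell rev_cons nth_rcons size_rev -/n ltnn eqxx.
have mn : n \in timeline n.+1 by rewrite mem_timeline.
have key x : chain_mean (spell (false :: w)) 0 x (timeline n.+1) + chain_mean (spell (true :: w)) 0 x (timeline n.+1) =
    chain_mean (spell w) 0 x (timeline n).
  rewrite -(@chain_mean_add f (spell (false :: w)) (spell (true :: w)) n)//.
  - have -> : timeline n = seq.filter (fun i => i != n) (timeline n.+1).
      rewrite /timeline filter_sort//; congr sort; rewrite -addn1 iotaD filter_cat /= eqxx /= cats0.
      by apply/esym/all_filterP/allP => i; rewrite mem_iota add0n => /andP[_]; rewrite ltn_neqAle => /andP[].
    rewrite (@chain_mean_filter f (fun i => i != n))//; last by move=> i y; rewrite negbK /f => ->.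
    by apply: chain_mean_ext => i y; rewrite mem_filter /f => /andP[/negbTE ->].
  - by move=> i y ne; rewrite !sp.
  - by move=> y; rewrite !spn /f eqxx; case: y; rewrite ?addr0 ?add0r.
rewrite /word_weight /law_mean /= -/n -!key; ring.
Qed.

Local Notation Y := (letter word_weight).

Lemma measurable_Y i : measurable_fun setT (Y i : measurableTypeR R -> bool).
Proof. exact: measurable_letter. Qed.

Local Notation ev n F := [set w : measurableTypeR R | all (fun i => F i (Y i w)) (iota 0 n)].

Let ev_measurable n (F : nat -> bool -> bool) : measurable (ev n F).
Proof.
have := measurable_letters word_weight n (fun w => all (fun i => F i (nth false (rev w) i)) (iota 0 n)).
congr measurable; apply/seteqP; split => x /= h; apply/allP => i ii; move/allP: h => /(_ i ii);
  rewrite (word_letters word_weight) revK nth_mkseq//; by move: ii; rewrite mem_iota.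
Qed.

(** Additivity reduces events of product form to single words, one letter at a time. *)
Lemma prob_finite n (F : nat -> bool -> bool) :
  unif (ev n F) = (law_mean (fun i y => (F i y)%:R) (timeline n))%:E.
Proof.
suff H k : (k <= n)%N -> forall F, (forall i, (k <= i < n)%N -> exists b, forall y, F i y = (b == y)) ->
    unif (ev n F) = (law_mean (fun i y => (F i y)%:R) (timeline n))%:E.
  by apply: (H n) => // i /andP[/leq_ltn_trans h /h]; rewrite ltnn.
elim: k => [|k IH] kn {}F hF.
  pose w := rev (mkseq (fun i => F i true) n).
  have sw : size w = n by rewrite size_rev size_mkseq.
  have Fw i y : (i < n)%N -> F i y = (nth false (rev w) i == y).
    move=> ii; rewrite /w revK nth_mkseq//; have [b hb] := hF i ii.
    by rewrite !hb; case: b y {hb} => [] [].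
  have -> : ev n F = [set x | word word_weight (size w) x = w].
    apply/seteqP; split => x /=; rewrite sw (word_letters word_weight).
      move=> /allP h; apply: (can_inj revK); rewrite !revK.
      apply: (@eq_from_nth _ false); rewrite !size_mkseq// => i ii; rewrite !nth_mkseq//.
      have := h i; rewrite mem_iota => /(_ ii); rewrite Fw// => /eqP <-.
      by rewrite /w revK nth_mkseq.
    move=> e; apply/allP => i; rewrite mem_iota => ii; rewrite Fw// -e revK nth_mkseq//.
  rewrite (prob_word word_weight_ge0 word_weight_nil word_weight_cons); congr EFin.
  rewrite /word_weight /law_mean sw; congr (_ * _ + _ * _); apply: chain_mean_ext => i y;
    by rewrite mem_timeline => ii; rewrite Fw.
pose G (b : bool) (i : nat) (y : bool) := if i == k then F k y && (b == y) else F i y.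
have kt : k \in timeline n by rewrite mem_timeline.
have split_law : law_mean (fun i y => (F i y)%:R) (timeline n) =
    law_mean (fun i y => (G false i y)%:R) (timeline n) + law_mean (fun i y => (G true i y)%:R) (timeline n).
  have e x : chain_mean (fun i y => (F i y)%:R) 0 x (timeline n) =
      chain_mean (fun i y => (G false i y)%:R) 0 x (timeline n) + chain_mean (fun i y => (G true i y)%:R) 0 x (timeline n).
    apply: (@chain_mean_add _ _ _ k) => //.
      by move=> i y /negbTE ne; rewrite /G ne.
    by move=> y; rewrite /G eqxx; case: y; rewrite !(andbT, andbF) ?addr0 ?add0r.
  by rewrite /law_mean !e; ring.
have split_ev : ev n F = ev n (G false) `|` ev n (G true).
  apply/seteqP; split => x /=.
    move=> /allP h; suff : all (fun i => G (Y k x) i (Y i x)) (iota 0 n) by case: (Y k x) => ?; [right|left].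
    by apply/allP => i /h; rewrite /G; case: eqP => // -> ->; rewrite eqxx.
  by case=> /allP h; apply/allP => i /h; rewrite /G; case: eqP => // -> /andP[].
have disj : ev n (G false) `&` ev n (G true) = set0.
  apply/seteqP; split => x //= [/allP h1 /allP h2].
  have ki : k \in iota 0 n by rewrite mem_iota add0n.
  by have := h1 k ki; have := h2 k ki; rewrite /G eqxx => /andP[_ /eqP <-] /andP[].
have part b : unif (ev n (G b)) = (law_mean (fun i y => (G b i y)%:R) (timeline n))%:E.
  have [Fkb|Fkb] := boolP (F k b).
    apply: IH (ltnW kn) _ _ => i /andP[ki ii]; rewrite /G.
    case: (eqVneq i k) => [_|ne]; first by exists b => y; case: eqVneq => [<-|]; rewrite ?Fkb ?andbF.
    by apply: hF; rewrite ii andbT ltn_neqAle eq_sym ne.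
  have G0 y : G b k y = false.
    by rewrite /G eqxx; case: eqVneq => [<-|]; rewrite ?andbF// (negbTE Fkb).
  rewrite (_ : ev n (G b) = set0); last first.
    by apply/seteqP; split => x //= /allP /(_ k); rewrite mem_iota add0n kn G0 => /(_ isT).
  rewrite measure0; congr EFin.
  have e x : chain_mean (fun i y => (G b i y)%:R) 0 x (timeline n) = 0.
    have : chain_mean (fun i y => (G b i y)%:R) 0 x (timeline n) =
        chain_mean (fun i y => (G b i y)%:R) 0 x (timeline n) + chain_mean (fun i y => (G b i y)%:R) 0 x (timeline n).
      by apply: (@chain_mean_add _ _ _ k) => // y; rewrite G0 addr0.
    by set z := chain_mean _ _ _ _; lra.
  by rewrite /law_mean !e !mulr0 addr0.
have eU : unif (ev n (G false) `|` ev n (G true)) = (unif (ev n (G false)) + unif (ev n (G true)))%E.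
  exact: measureU.
by rewrite split_ev eU !part split_law.
Qed.

Lemma letter_law i : T i = 0 -> unif [set w | Y i w] = (m true)%:E.
Proof.
move=> i0; pose F (k : nat) (z : bool) := (k == i) ==> z.
have [n ni] : exists n, (i < n)%N by exists i.+1.
have -> : [set w : measurableTypeR R | Y i w] = ev n F.
  apply/seteqP; split => w /= h.
    by apply/allP => k _; apply/implyP => /eqP ->.
  by move/allP: h => /(_ i); rewrite mem_iota add0n ni /F eqxx => /(_ isT).
rewrite prob_finite; congr EFin.
have e x : chain_mean (fun k z => (F k z)%:R) 0 x (timeline n) = x%:R.
  rewrite (@chain_mean_filter _ (pred1 i))//; last by move=> k z /= /negbTE ki; rewrite /F ki.
  rewrite filter_pred1_uniq// ?mem_timeline//= i0 /F eqxx !tr_id// !mulr1 /=.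
  by case: x; rewrite /= !(mulr0, mulr1, mul0r, mul1r, addr0, add0r).
by rewrite /law_mean !e mulr0 add0r mulr1.
Qed.

(** Sort the times: those after T j do not matter, and the others split at T i, the state
    at this time being given. *)
Lemma letters_markov (H : seq (nat * bool)) (i j : nat) (x y : bool) :
  all (fun e => T e.1 <= T i) H -> T i <= T j ->
  unif [set w | [&& all (fun e => Y e.1 w == e.2) H, Y i w == x & Y j w == y]] =
  (unif [set w | all (fun e => Y e.1 w == e.2) H && (Y i w == x)] * (tr (T i) (T j) x y)%:E)%E.
Proof.
move=> hH; rewrite le_eqVlt => /orP[/eqP/T_inj <-|ij].
  rewrite tr_id//; case: (eqVneq x y) => [<-|ne].
    by rewrite mule1; congr unif; apply/seteqP; split => w /=; rewrite andbb.
  rewrite mule0 (_ : mkset _ = set0) ?measure0//; apply/seteqP; split => w //=.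
  by move=> /and3P[_ /eqP -> /eqP e]; move: ne; rewrite e eqxx.
have nij : i != j by apply: contraTneq ij => ->; rewrite ltxx.
pose n := (\max_(e <- H) e.1 + i + j).+1.
have Hn e : e \in H -> (e.1 < n)%N.
  move=> eH; rewrite /n ltnS -addnA; apply: (leq_trans _ (leq_addr _ _)).
  by rewrite (big_rem e)//= leq_maxl.
have iN : (i < n)%N by rewrite /n ltnS addnAC leq_addl.
have jN : (j < n)%N by rewrite /n ltnS leq_addl.
clearbody n.
pose F0 (k : nat) (z : bool) := all (fun e => (k == e.1) ==> (z == e.2)) H && ((k == i) ==> (z == x)).
pose F (k : nat) (z : bool) := F0 k z && ((k == j) ==> (z == y)).
have H0 w : all (fun k => F0 k (Y k w)) (iota 0 n) = all (fun e => Y e.1 w == e.2) H && (Y i w == x).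
  apply/allP/andP => [h|[/allP h1 h2] k _].
    split; last by have := h i; rewrite mem_iota add0n iN => /(_ isT)/andP[_]; rewrite eqxx.
    apply/allP => e eH; have := h e.1; rewrite mem_iota add0n Hn// => /(_ isT)/andP[/allP /(_ e eH)].
    by rewrite eqxx.
  apply/andP; split; last by apply/implyP => /eqP ->.
  by apply/allP => e /h1 e1; apply/implyP => /eqP ->.
have H1 w : all (fun k => F k (Y k w)) (iota 0 n) = [&& all (fun e => Y e.1 w == e.2) H, Y i w == x & Y j w == y].
  rewrite andbA -H0; apply/idP/andP => [/allP h|[/allP h1 h2]].
    split; first by apply/allP => k /h /andP[].
    by have := h j; rewrite mem_iota add0n jN => /(_ isT)/andP[_]; rewrite eqxx.
  by apply/allP => k /h1 k1; rewrite /F k1; apply/implyP => /eqP ->.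
have -> : [set w | [&& all (fun e => Y e.1 w == e.2) H, Y i w == x & Y j w == y]] = ev n F.
  by apply/seteqP; split => w /=; rewrite H1.
have -> : [set w | all (fun e => Y e.1 w == e.2) H && (Y i w == x)] = ev n F0.
  by apply/seteqP; split => w /=; rewrite H0.
rewrite !prob_finite -EFinM; congr EFin.
pose p k := earlier k i || (k == j).
pose L := seq.filter (fun k => T k < T i) (timeline n).
have Lp : seq.filter p (timeline n) = L ++ [:: i; j].
  have uL : uniq (L ++ [:: i; j]).
    rewrite cat_uniq filter_uniq//= inE nij /= andbT orbF negb_or !mem_filter ltxx /=.
    by rewrite ltNge (ltW ij).
  apply: (sorted_eq earlier_trans earlier_anti).
  - by apply: sorted_filter.
  - rewrite sorted_pairwise// pairwise_cat -sorted_pairwise// sorted_filter//= /earlier (ltW ij) !andbT.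
    apply/allrelP => k k' /=; rewrite mem_filter !inE => /andP[ki _] /orP[] /eqP ->; first exact: ltW.
    exact: ltW (lt_trans ki ij).
  - apply: uniq_perm => //; first exact: filter_uniq.
    move=> k; rewrite mem_cat !mem_filter mem_timeline !inE /p /earlier.
    apply/andP/or3P => [[/orP[ki|/eqP->] kn]|].
    + move: ki; rewrite le_eqVlt => /orP[/eqP/T_inj ->|h]; first by constructor 2.
      by constructor 1; rewrite h.
    + by constructor 3.
    + by case=> [/andP[/ltW -> ->]|/eqP ->|/eqP ->]; rewrite ?lexx ?eqxx ?orbT ?iN ?jN.
have F0p k z : ~~ p k -> F0 k z.
  rewrite negb_or => /andP[ki kj]; apply/andP; split.
    apply/allP => e eH; apply/implyP => /eqP ek; move: ki; rewrite /earlier ek.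
    by move/allP: hH => /(_ e eH) ->.
  by apply/implyP => /eqP ek; move: ki; rewrite ek /earlier lexx.
have Fp k z : ~~ p k -> F k z.
  move=> pk; rewrite /F F0p//=; move: pk; rewrite negb_or => /andP[_ /negbTE ->]//.
pose c : R := (F0 i x)%:R.
have Fi z : (F i z)%:R = (if z == x then c else 0) :> R.
  rewrite /F (negbTE nij) andbT /F0 eqxx /=; case: eqVneq => [->|_]; last by rewrite andbF.
  by rewrite /c /F0 !eqxx.
have F0i z : (F0 i z)%:R = (if z == x then c else 0) :> R.
  by rewrite -Fi /F (negbTE nij) andbT.
have F0j z : F0 j z = true.
  apply/andP; split; last by rewrite eq_sym (negbTE nij).
  apply/allP => e eH; apply/implyP => /eqP ek; move/allP: hH => /(_ e eH); rewrite -ek.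
  by rewrite leNgt ij.
have Fj z : (F j z)%:R = (z == y)%:R :> R by rewrite /F F0j eqxx.
have e0 z : chain_mean (fun k z => (F0 k z)%:R) 0 z (timeline n) =
    chain_mean (fun k z => (F0 k z)%:R) 0 z (rcons L i).
  rewrite (@chain_mean_filter _ p)//; last by move=> k z' /F0p ->.
  by rewrite Lp (chain_mean_last _ _ _ _ F0i) !F0j !mulr1 tr_sum ?mulr1// ltW.
have e1 z : chain_mean (fun k z => (F k z)%:R) 0 z (timeline n) =
    chain_mean (fun k z => (F0 k z)%:R) 0 z (rcons L i) * tr (T i) (T j) x y.
  rewrite (@chain_mean_filter _ p)//; last by move=> k z' /Fp ->.
  rewrite Lp (chain_mean_last _ _ _ _ Fi) !Fj; congr (_ * _).
    apply: chain_mean_ext => k z'; rewrite mem_rcons inE mem_filter => kL.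
    have kj : k != j.
      case/orP: kL => [/eqP ->//|/andP[ki _]].
      by apply: contraTneq ki => ->; rewrite -leNgt ltW.
    by rewrite /F (negbTE kj) andbT.
  by case: y {Fj F Fi Fp H1 F0j}; rewrite /= !(mulr1, mulr0) ?addr0 ?add0r.
by rewrite /law_mean !e0 !e1; ring.
Qed.

End ChainWeights.

(** * The transition function of a chain with two states *)

Section TransitionFunction.
Context {R : realType}.
Local Notation leb := (@lebesgue_measure R).

Lemma ftc (f F : R -> R) (a b : R) : a <= b -> continuous f -> continuous F ->
  (forall t : R, a < t < b -> is_derive t (1:R) F (f t)) ->
  (\int[leb]_(u in `[a, b]) (f u)%:E = (F b - F a)%:E)%E.
Proof.
move=> ab cf cF dF; move: ab dF; rewrite le_eqVlt => /orP[/eqP <-|ab] dF.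
  by rewrite set_itv1 integral_set1 subrr.
rewrite (continuous_FTC2 (F := F) ab) ?EFinB//.
- exact: continuous_subspaceT.
- split; first by move=> t; rewrite in_itv /= => /dF dt; exact: (@ex_derive _ _ _ _ _ _ _ dt).
  + by apply: cvg_at_right_filter; exact: cF.
  + by apply: cvg_at_left_filter; exact: cF.
- by move=> t; rewrite in_itv /= => /dF dt; rewrite derive1E; exact: (@derive_val _ _ _ _ _ _ _ dt).
Qed.

Variables (rate : R -> bool -> R) (Lam : R).
Hypothesis rate_cont : forall x, continuous (rate^~ x).
Hypothesis rate_ge0 : forall t x, 0 <= rate t x.
Hypothesis rate_le : forall t x, rate t x <= Lam.

Let total_rate (t : R) : R := rate t false + rate t true.
Let total_cont : continuous total_rate. Proof. by apply: contD; exact: rate_cont. Qed.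

Let E (t : R) : R := expR (prim total_rate t).
Let E_gt0 t : 0 < E t. Proof. exact: expR_gt0. Qed.
Let E_neq0 t : E t != 0. Proof. by rewrite gt_eqF. Qed.
Let dE (t : R) : is_derive t (1:R) E (total_rate t * E t).
Proof.
have H := @is_derive1_comp R expR (prim total_rate) t _ _ (is_derive_expR _) (is_derive_prim t total_cont).
by apply: (is_derive_eq H); rewrite mulrC.
Qed.
Let cE : continuous E. Proof. by move=> t; exact: is_derive_cont (dE t). Qed.

Let in_cont : continuous (fun t => rate t false * E t).
Proof. by apply: contM; [exact: rate_cont|exact: cE]. Qed.
Let N : R -> R := prim (fun t => rate t false * E t).
Let dN (t : R) : is_derive t (1:R) N (rate t false * E t).
Proof. exact: (is_derive_prim t in_cont). Qed.
Let cN : continuous N. Proof. by move=> t; exact: is_derive_cont (dN t). Qed.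

(** Variation of constants for the linear equation of the probability of being
    in the state true. *)
Definition trans (s t : R) (x y : bool) : R :=
  let p := (x%:R * E s + N t - N s) / E t in if y then p else 1 - p.

Let trans_derive (s t : R) (x : bool) : is_derive t (1:R) (fun t => trans s t x true)
  (rate t false * trans s t x false - rate t true * trans s t x true).
Proof.
have dV : is_derive t (1:R) (fun t => (E t)^-1) (- (E t) ^- 2 *: (total_rate t * E t)).
  by apply: is_deriveV => //; exact: dE.
have dS := is_deriveB (is_deriveD (is_derive_cst (x%:R * E s) t (1:R)) (dN t)) (is_derive_cst (N s) t (1:R)).
have H := is_deriveM dS dV; apply: (is_derive_eq H).
rewrite -[X in X *: _]/(x%:R * E s + N t - N s) /trans /GRing.scale /= /total_rate.
by field; rewrite E_neq0.
Qed.

Lemma trans_id s x y : trans s s x y = (x == y)%:R.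
Proof.
by rewrite /trans addrK mulfK//; case: x y => [] [] /=; rewrite ?subr0 ?subrr.
Qed.

Let N_ndecr s t : s <= t -> 0 <= N t - N s <= E t - E s.
Proof.
move=> st; apply/andP; split.
  rewrite subr_ge0; apply: (is_derive_nondecr st (fun u _ => dN u)).
    exact: continuous_subspaceT.
  by move=> u _; rewrite mulr_ge0// ltW.
suff : E s - N s <= E t - N t by lra.
apply: (is_derive_nondecr st (fun u _ => is_deriveB (dE u) (dN u))).
  by apply: continuous_subspaceT; apply: contB.
move=> u _; rewrite /total_rate mulrDl addrAC subrr add0r.
by rewrite mulr_ge0// ltW.
Qed.

Lemma trans_ge0 s t x y : s <= t -> 0 <= trans s t x y.
Proof.
move=> /N_ndecr/andP[h1 h2]; have Es := E_gt0 s.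
rewrite /trans; case: y; first by rewrite divr_ge0 ?(ltW (E_gt0 t))//; case: x => /=; lra.
by rewrite subr_ge0 ler_pdivrMr// mul1r; case: x => /=; lra.
Qed.

Lemma trans_sum s t x : trans s t x false + trans s t x true = 1.
Proof. by rewrite /trans subrK. Qed.

Lemma trans_comp s t u x z :
  trans s t x false * trans t u false z + trans s t x true * trans t u true z = trans s u x z.
Proof. by rewrite /trans; case: z => /=; field; rewrite !E_neq0. Qed.

Let trans_derive_y (s t : R) (x y : bool) : is_derive t (1:R) (fun t => trans s t x y)
  (rate t (~~ y) * trans s t x (~~ y) - rate t y * trans s t x y).
Proof.
case: y => /=; first exact: trans_derive.
have H := is_deriveB (is_derive_cst (1:R) t (1:R)) (trans_derive s t x).
by apply: (is_derive_eq H); rewrite sub0r opprB.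
Qed.

Let trans_cont s x y : continuous (fun t => trans s t x y).
Proof. by move=> t; exact: is_derive_cont (trans_derive_y s t x y). Qed.

Lemma trans_transition : transition_function rate trans.
Proof.
move=> s x s0; split.
- by move=> t y; exact: trans_ge0.
- by move=> t _; exact: trans_sum.
- by move=> y; exact: continuous_subspaceT.
- move=> t y st.
  have c : continuous (fun u : R => rate u (~~ y) * trans s u x (~~ y) - rate u y * trans s u x y).
    by apply: contB; apply: contM; (exact: rate_cont || exact: trans_cont).
  have I := ftc st c (@trans_cont s x y) (fun u _ => trans_derive_y s u x y).
  by rewrite /Rintegral I /= trans_id addrC subrK.
Qed.

(** The probability of a jump in a short time is at most its length times the bound on
    the rates. *)
Lemma trans_jump s t x : s <= t -> trans s t x (~~ x) <= Lam * (t - s).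
Proof.
move=> st.
have H := lipschitz_of_derive (@trans_cont s x (~~ x)) st (fun u _ => trans_derive_y s u x (~~ x)).
have e : trans s s x (~~ x) = 0 by rewrite trans_id; case: x {H}.
have {}H := H Lam; rewrite e subr0 in H; apply: (le_trans (ler_norm _)); apply: H.
move=> u /andP[/ltW su _]; set y := ~~ x.
have h1 := trans_ge0 x (~~ y) su; have h2 := trans_ge0 x y su.
have h3 : trans s u x (~~ y) + trans s u x y = 1 by rewrite -(trans_sum s u x); case: (y) => //=; rewrite addrC.
have := mulr_ge0 (rate_ge0 u (~~ y)) h1; have := mulr_ge0 (rate_ge0 u y) h2.
have := ler_wpM2r h1 (rate_le u (~~ y)); have := ler_wpM2r h2 (rate_le u y).
have L0 : 0 <= Lam by apply: le_trans (rate_ge0 u y) (rate_le u y).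
have := mulr_ge0 L0 h1; have := mulr_ge0 L0 h2.
have e2 : Lam = Lam * trans s u x (~~ y) + Lam * trans s u x y by rewrite -mulrDr h3 mulr1.
by rewrite ler_norml => *; apply/andP; split; lra.
Qed.

Lemma trans_cvg (u v : nat -> R) (s t : R) x y : u n @[n --> \oo] --> s -> v n @[n --> \oo] --> t ->
  trans (u n) (v n) x y @[n --> \oo] --> trans s t x y.
Proof.
move=> us vt.
have Eu : E (u n) @[n --> \oo] --> E s by apply: (cvg_comp _ E us); exact: cE.
have Ev : E (v n) @[n --> \oo] --> E t by apply: (cvg_comp _ E vt); exact: cE.
have Nu : N (u n) @[n --> \oo] --> N s by apply: (cvg_comp _ N us); exact: cN.
have Nv : N (v n) @[n --> \oo] --> N t by apply: (cvg_comp _ N vt); exact: cN.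
have H : (x%:R * E (u n) + N (v n) - N (u n)) / E (v n) @[n --> \oo] --> (x%:R * E s + N t - N s) / E t.
  apply: cvgM; last by apply: cvgV.
  by apply: cvgB => //; apply: cvgD => //; apply: cvgM => //; exact: cvg_cst.
by rewrite /trans; case: y => //; apply: cvgB => //; exact: cvg_cst.
Qed.

End TransitionFunction.

(** * Limits from the right along dyadic points *)

Section RightLimits.
Context {R : realType}.

Definition dyadic (n k : nat) : R := k%:R / 2 ^+ n.

Let pow_gt0 n : 0 < (2 : R) ^+ n. Proof. by rewrite exprn_gt0. Qed.

Lemma dyadic_ge0 n k : 0 <= dyadic n k.
Proof. by rewrite divr_ge0// ltW. Qed.

Lemma dyadic_double n k : dyadic n.+1 k.*2 = dyadic n k.
Proof.
rewrite /dyadic -muln2 natrM exprS; field.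
by rewrite lt0r_neq0.
Qed.

Lemma dyadic_scale n p k : dyadic (p + n) (k * 2 ^ p) = dyadic n k.
Proof.
elim: p => [|p IH]; first by rewrite muln1.
by rewrite addSn expnS mulnCA mul2n dyadic_double IH.
Qed.

Lemma dyadic_lt n k l : (dyadic n k < dyadic n l) = (k < l)%N.
Proof. by rewrite /dyadic ltr_pM2r ?invr_gt0// ltr_nat. Qed.

(** The point is strictly after t, as required for limits from the right. *)
Definition next_index (n : nat) (t : R) : nat := (Num.truncn (2 ^+ n * t)).+1.

Lemma next_bounds n t : 0 <= t ->
  t < dyadic n (next_index n t) <= t + (2 ^+ n)^-1.
Proof.
move=> t0; have /andP[h1 h2] := truncn_itv (mulr_ge0 (ltW (pow_gt0 n)) t0).
rewrite /dyadic /next_index; apply/andP; split.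
  by rewrite ltr_pdivlMr// mulrC.
rewrite ler_pdivrMr// mulrDl mulVf ?lt0r_neq0// -addn1 natrD lerD2r.
by rewrite (mulrC t).
Qed.

Lemma next_mono n s t : s <= t -> dyadic n (next_index n s) <= dyadic n (next_index n t).
Proof.
move=> st; rewrite /dyadic ler_pM2r ?invr_gt0// ler_nat ltnS.
by apply: le_truncn; rewrite ler_wpM2l// ltW.
Qed.

Lemma mesh_small (e : R) : 0 < e -> exists n0 : nat, forall n, (n0 <= n)%N -> (2 ^+ n)^-1 < e.
Proof.
move=> e0; exists (Num.truncn e^-1).+1 => n hn.
rewrite invf_plt ?posrE//.
have ei : 0 <= e^-1 by rewrite invr_ge0 ltW.
have /andP[_ h] := truncn_itv ei.
apply: (lt_le_trans h); rewrite -natrX ler_nat.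
exact: leq_trans hn (ltnW (ltn_expl _ _)).
Qed.

Variable y : nat -> nat -> bool.
Hypothesis y_double : forall n k, y n.+1 k.*2 = y n k.

Let y_scale n p k : y (p + n) (k * 2 ^ p) = y n k.
Proof.
elim: p => [|p IH]; first by rewrite muln1.
by rewrite addSn expnS mulnCA mul2n y_double IH.
Qed.

Definition jumps (n a b : nat) : nat := \sum_(a <= j < b) (y n j != y n j.+1).

Lemma jumps_cat n a b c : (a <= b)%N -> (b <= c)%N -> jumps n a c = (jumps n a b + jumps n b c)%N.
Proof. by move=> ab bc; rewrite /jumps (big_cat_nat (n := b)). Qed.

Lemma jumps_neq n a b : (a <= b)%N -> y n a != y n b -> (0 < jumps n a b)%N.
Proof.
elim: b => [|b IH]; first by rewrite leqn0 => /eqP ->; rewrite eqxx.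
rewrite leq_eqVlt => /orP[/eqP ->|]; first by rewrite eqxx.
rewrite ltnS => ab ne; rewrite /jumps big_nat_recr//= -/(jumps n a b).
case: (eqVneq (y n a) (y n b)) => [e|/(IH ab) h]; last by rewrite ltn_addr.
by rewrite -e ne addn1.
Qed.

(** A finer grid sees at least as many jumps. *)
Lemma jumps_refine n a b : (a <= b)%N -> (jumps n a b <= jumps n.+1 a.*2 b.*2)%N.
Proof.
elim: b => [|b IH].
  by rewrite leqn0 => /eqP ->; rewrite /jumps big_geq.
rewrite leq_eqVlt => /orP[/eqP ->|]; first by rewrite /jumps big_geq.
rewrite ltnS => ab; rewrite doubleS /jumps !big_nat_recr//=; last 2 first.
- by rewrite leq_double.
- by rewrite leqW// leq_double.
rewrite -addnA; apply: leq_add; first exact: IH.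
rewrite -(y_double n b) -(y_double n b.+1) doubleS.
by case: (y _ b.*2); case: (y _ b.*2.+1); case: (y _ b.*2.+2).
Qed.

Lemma jumps_scale n p a b : (a <= b)%N -> (jumps n a b <= jumps (p + n) (a * 2 ^ p) (b * 2 ^ p))%N.
Proof.
move=> ab; elim: p => [|p IH]; first by rewrite !muln1.
apply: (leq_trans IH); rewrite addSn expnS !(mulnCA _ 2) !mul2n.
by apply: jumps_refine; rewrite leq_mul2r ab orbT.
Qed.

Definition right_limit (t : R) (b : bool) : Prop :=
  exists2 d : R, 0 < d & forall n k, t < dyadic n k < t + d -> y n k = b.

Lemma right_limit_unique t b b' : 0 <= t -> right_limit t b -> right_limit t b' -> b = b'.
Proof.
move=> t0 [d d0 hd] [d' d'0 hd'].
have m0 : 0 < Num.min d d' by rewrite lt_min d0.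
have [n0 /(_ n0 (leqnn _)) hn] := mesh_small m0; move: hn; rewrite lt_min => /andP[h1 h2].
have /andP[t1 t2] := next_bounds n0 t0.
rewrite -(hd n0 (next_index n0 t)); last by rewrite t1 (le_lt_trans t2)// ltrD2l.
by rewrite -(hd' n0 (next_index n0 t))// t1 (le_lt_trans t2)// ltrD2l.
Qed.

(** Otherwise one finds alternating values at arbitrarily many dyadic points
    decreasing to t, hence arbitrarily many jumps on a fine grid. *)
Lemma right_limit_exists (M : nat) (t : R) (B : nat) : 0 <= t -> t + 1 <= M%:R ->
  (forall n, (jumps n 0 (M * 2 ^ n) <= B)%N) -> exists b, right_limit t b.
Proof.
move=> t0 tM hB; apply: contrapT => hn.
have alt (d : R) b : 0 < d -> exists n k, t < dyadic n k < t + d /\ y n k = b.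
  move=> d0; apply: contrapT => h; apply: hn; exists (~~ b); exists d => // n k hk.
  case: (eqVneq (y n k) b) => e; first by exfalso; apply: h; exists n, k.
  by move: e; case: (y n k); case: (b).
have many m : exists n k, [/\ t < dyadic n k, dyadic n k < t + 1 & (m <= jumps n k (M * 2 ^ n))%N].
  elim: m => [|m [n [k [h1 h2 h3]]]].
    by have [n [k [/andP[h1 h2] _]]] := alt 1 true ltr01; exists n, k.
  have d0 : 0 < dyadic n k - t by rewrite subr_gt0.
  have [n' [k' [/andP[h4 h5] e]]] := alt _ (~~ y n k) d0; rewrite subrKC in h5.
  exists (n' + n)%N, (k' * 2 ^ n)%N.
  have e1 : dyadic (n' + n) (k' * 2 ^ n) = dyadic n' k' by rewrite addnC dyadic_scale.
  have e2 : dyadic (n' + n) (k * 2 ^ n') = dyadic n k by rewrite dyadic_scale.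
  have e3 : y (n' + n) (k' * 2 ^ n) = y n' k' by rewrite addnC y_scale.
  have e4 : y (n' + n) (k * 2 ^ n') = y n k by rewrite y_scale.
  have lt : (k' * 2 ^ n < k * 2 ^ n')%N by rewrite -(dyadic_lt (n' + n)) e1 e2.
  have kM : (k <= M * 2 ^ n)%N.
    rewrite -(ler_nat R) natrM natrX -ler_pdivrMr//.
    by apply: le_trans tM; rewrite -/(dyadic n k) ltW.
  rewrite e1; split=> //; first exact: lt_trans h2.
  have kM' : (k * 2 ^ n' <= M * 2 ^ (n' + n))%N by rewrite addnC expnD mulnA leq_mul2r kM orbT.
  rewrite (jumps_cat _ (ltnW lt) kM') -add1n; apply: leq_add.
    by apply: jumps_neq (ltnW lt) _; rewrite e3 e4 e; case: (y n k).
  apply: (leq_trans h3); apply: (leq_trans (jumps_scale n n' kM)).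
  by rewrite -mulnA -expnD addnC.
have [n [k [h1 h2 h3]]] := many B.+1.
have kM : (k <= M * 2 ^ n)%N.
  rewrite -(ler_nat R) natrM natrX -ler_pdivrMr//.
  by apply: le_trans tM; rewrite -/(dyadic n k) ltW.
have := hB n; rewrite (jumps_cat _ (leq0n k) kM) leqNgt => /negP; apply.
exact: leq_trans h3 (leq_addl _ _).
Qed.

Lemma right_limit_right t b : right_limit t b -> exists2 d : R, 0 < d &
  forall u, t <= u < t + d -> right_limit u b.
Proof.
move=> [d d0 hd]; exists d => // u /andP[tu ud].
exists (t + d - u); first by rewrite subr_gt0.
by move=> n k /andP[h1 h2]; apply: hd; rewrite (le_lt_trans tu h1)/=; move: h2; rewrite subrKC.
Qed.

Lemma right_limit_next t b : 0 <= t -> right_limit t b ->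
  exists n0 : nat, forall n, (n0 <= n)%N -> y n (next_index n t) = b.
Proof.
move=> t0 [d d0 hd]; have [n0 hn0] := mesh_small d0; exists n0 => n hn.
have /andP[t1 t2] := next_bounds n t0.
by apply: hd; rewrite t1 (le_lt_trans t2)// ltrD2l hn0.
Qed.

End RightLimits.

(** * Existence of the controlled chain *)

Section ChainExistence.
Context {R : realType}.

Lemma enumerate_dyadic : exists T : nat -> R,
  [/\ injective T, forall i, 0 <= T i & forall n k, exists i, T i = dyadic n k].
Proof.
pose D : set R := [set x | exists n k, x = dyadic n k].
have cD : countable D.
  have sD : D `<=` (fun p : nat * nat => dyadic p.1 p.2) @` setT.
    by move=> x [n [k ->]]; exists (n, k).
  exact: (card_le_trans (subset_card_le sD) (card_le_trans (card_image_le _ _) (countableP _))).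
have iD : infinite_set D.
  have inj : {in setT &, injective (dyadic 0 : nat -> R)}.
    by move=> i j _ _; rewrite /dyadic !expr0 !divr1 => /eqP; rewrite eqr_nat => /eqP.
  apply/infiniteP; rewrite -(card_le_eql (inj_card_eq inj)).
  by apply: subset_card_le => x [k _ <-]; exists 0%N, k.
have := eq_card_nat cD iD; rewrite card_eq_sym => /card_set_bijP[T [h1 h2 h3]].
exists T; split.
- by move=> i j; apply: h2; rewrite inE.
- by move=> i; have [n [k ->]] := h1 i I; exact: dyadic_ge0.
- by move=> n k; have [|i _ e] := h3 (dyadic n k); [exists n, k|exists i].
Qed.

Variables (rate : R -> bool -> R) (Lam m0 : R).
Hypothesis rate_cont : forall x, continuous (rate^~ x).
Hypothesis rate_ge0 : forall t x, 0 <= rate t x.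
Hypothesis rate_le : forall t x, rate t x <= Lam.
Hypothesis m0_bounds : 0 <= m0 <= 1.
Variables (T : nat -> R) (idx : nat -> nat -> nat).
Hypotheses (T_inj : injective T) (T_ge0 : forall i, 0 <= T i).
Hypothesis T_idx : forall n k, T (idx n k) = dyadic n k.

Local Notation Omega := (measurableTypeR R).
Let tr := trans rate.
Let m (x : bool) : R := if x then m0 else 1 - m0.

Let m_ge0 x : 0 <= m x.
Proof. by case/andP: m0_bounds => h1 h2; case: x; rewrite /m// subr_ge0. Qed.
Let m_sum : m false + m true = 1. Proof. by rewrite /m subrK. Qed.
Let Lam_ge0 : 0 <= Lam. Proof. exact: le_trans (rate_ge0 0 true) (rate_le 0 true). Qed.

Let tr_ge0 (s t : R) x y : 0 <= s -> s <= t -> 0 <= tr s t x y.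
Proof. by move=> _; exact: trans_ge0. Qed.
Let tr_sum (s t : R) x : 0 <= s -> s <= t -> tr s t x false + tr s t x true = 1.
Proof. by move=> _ _; exact: trans_sum. Qed.
Let tr_comp (s t u : R) x z : 0 <= s -> s <= t -> t <= u ->
  tr s t x false * tr t u false z + tr s t x true * tr t u true z = tr s u x z.
Proof. by move=> _ _ _; exact: trans_comp. Qed.
Let tr_id (s : R) x y : 0 <= s -> tr s s x y = (x == y)%:R.
Proof. by move=> _; exact: trans_id. Qed.

Let Y := letter (word_weight tr T m).
Let markovY := @letters_markov R tr T tr_ge0 tr_sum tr_comp tr_id T_inj T_ge0 m m_ge0 m_sum.
Let y (w : Omega) (n k : nat) : bool := Y (idx n k) w.

Let y_double w n k : y w n.+1 k.*2 = y w n k.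
Proof. by rewrite /y; congr (Y _ w); apply: T_inj; rewrite !T_idx dyadic_double. Qed.

Let mY i b : measurable [set w : Omega | Y i w = b].
Proof.
have := @measurable_Y R tr T m i measurableT [set b] I; rewrite setTI; congr measurable.
Qed.

Let mYeq i b : measurable [set w : Omega | Y i w == b].
Proof. by have := mY i b; congr measurable; apply/seteqP; split => w /= /eqP. Qed.

Let ym n k b : measurable [set w : Omega | y w n k = b]. Proof. exact: mY. Qed.

Let mall (h : seq (nat * bool)) : measurable [set w : Omega | all (fun e => Y e.1 w == e.2) h].
Proof.
elim: h => [|e h IH]; first by rewrite (_ : mkset _ = setT)//; apply/seteqP; split.
rewrite (_ : mkset _ = [set w | Y e.1 w == e.2] `&` [set w | all (fun e => Y e.1 w == e.2) h]).
  exact: measurableI.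
by apply/seteqP; split => w /= /andP.
Qed.

Let jump_event n k := [set w : Omega | y w n k != y w n k.+1].

Let jump_eventE n k : jump_event n k =
  [set w | y w n k = false] `&` [set w | y w n k.+1 = true] `|`
  [set w | y w n k = true] `&` [set w | y w n k.+1 = false].
Proof.
apply/seteqP; split => w; rewrite /jump_event /=.
  by case: (y w n k); case: (y w n k.+1) => // _; [right|left].
by case=> -[-> ->].
Qed.

Let jump_event_measurable n k : measurable (jump_event n k).
Proof. by rewrite jump_eventE; apply: measurableU; apply: measurableI. Qed.

Let prob_jump n k : (unif (jump_event n k) <= (2 * Lam / 2 ^+ n)%:E)%E.
Proof.
have one b : (unif ([set w | y w n k = b] `&` [set w | y w n k.+1 = ~~ b]) <= (Lam / 2 ^+ n)%:E)%E.
  have lt : T (idx n k) <= T (idx n k.+1) by rewrite !T_idx ltW// dyadic_lt.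
  have := markovY (H := [::]) b (~~ b) isT lt; rewrite /= => H.
  have -> : [set w | y w n k = b] `&` [set w | y w n k.+1 = ~~ b] =
      [set w | (letter (word_weight tr T m) (idx n k) w == b) && (letter (word_weight tr T m) (idx n k.+1) w == ~~ b)].
    by apply/seteqP; split => w /=; [move=> [/eqP -> /eqP ->]|move=> /andP[/eqP h1 /eqP h2]].
  rewrite H -[leRHS]mul1e; apply: lee_pmul.
  - exact: measure_ge0.
  - by rewrite lee_fin; apply: tr_ge0.
  - by apply: probability_le1; exact: mYeq.
  - rewrite lee_fin; apply: le_trans (trans_jump rate_cont rate_ge0 rate_le _ lt) _.
    by rewrite !T_idx /dyadic -mulrBl -natrB// subSnn mul1r.
have eA (A B : set Omega) (a b : R) : measurable A -> measurable B -> (unif A <= a%:E)%E -> (unif B <= b%:E)%E ->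
    (unif (A `|` B) <= (a + b)%:E)%E.
  move=> mA mB hA hB; apply: le_trans (_ : unif A + unif B <= _)%E; first exact: measureU2.
  by rewrite EFinD; exact: leeD.
rewrite jump_eventE (_ : 2 * Lam / 2 ^+ n = Lam / 2 ^+ n + Lam / 2 ^+ n); last by rewrite -mulrA mulrDl mul1r.
by apply: eA; [exact: measurableI|exact: measurableI|exact: one false|exact: one true].
Qed.

Let many_jumps (M r n : nat) := [set w : Omega | (r < jumps (y w) n 0 (M * 2 ^ n))%N].

Let jumpsE w n b : ((jumps (y w) n 0 b)%:R)%:E = (\sum_(0 <= j < b) (\1_(jump_event n j) w)%:E)%E :> \bar R.
Proof.
rewrite /jumps natr_sum -sumEFin; apply: eq_bigr => j _; congr EFin.
by rewrite indicE; congr (_%:R); congr nat_of_bool; apply/idP/idP => [h|]; rewrite inE.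
Qed.

Let many_jumps_measurable M r n : measurable (many_jumps M r n).
Proof.
pose g : Omega -> \bar R := fun w => (\sum_(0 <= j < M * 2 ^ n) (\1_(jump_event n j) w)%:E)%E.
have mf : measurable_fun setT g.
  by apply: emeasurable_sum => j; apply/measurable_EFinP; exact: measurable_indic.
have := emeasurable_fun_o_infty measurableT mf r%:R%:E.
rewrite setTI; congr measurable; apply/seteqP; split => w;
  by rewrite /many_jumps /= /g -jumpsE lte_fin ltr_nat.
Qed.

(** Markov's inequality: the mean number of jumps on a grid is bounded by the number of
    steps times the probability of a jump in one of them, uniformly in the mesh. *)
Let many_jumps_prob M r n : (unif (many_jumps M r n) <= (2 * Lam * M%:R / r.+1%:R)%:E)%E.
Proof.
pose g (w : Omega) : \bar R := (\sum_(0 <= j < M * 2 ^ n) (\1_(jump_event n j) w)%:E)%E.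
have mi j : measurable_fun setT ((fun w => (\1_(jump_event n j) w)%:E) : Omega -> \bar R).
  by apply/measurable_EFinP; exact: measurable_indic.
have mg : measurable_fun setT g by apply: emeasurable_sum => j; exact: mi.
have r0 : (0 : R) < r.+1%:R by rewrite ltr0n.
have := le_integral_abse unif measurableT mg r0.
have g0 w : (0 <= g w)%E by apply: sume_ge0 => j _; rewrite lee_fin.
have -> : (\int[unif]_x `|g x|)%E = (\sum_(0 <= j < M * 2 ^ n) unif (jump_event n j))%E.
  under eq_integral => w _ do rewrite (gee0_abs (g0 w)).
  rewrite ge0_integral_sum//.
  by apply: eq_bigr => j _; rewrite integral_indic// setIT.
have -> : setT `&` [set x | (r.+1%:R%:E <= `|g x|)%E] = many_jumps M r n.
  rewrite setTI; apply/seteqP; split => w; rewrite /many_jumps /= gee0_abs// /g -jumpsE lee_fin ler_nat//.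
move=> h; have hs : (\sum_(0 <= j < M * 2 ^ n) unif (jump_event n j) <= (2 * Lam * M%:R)%:E)%E.
  apply: le_trans (lee_sum _ (fun j _ => prob_jump n j)) _.
  rewrite sumEFin lee_fin sumr_const_nat subn0 -[leLHS]mulr_natr natrM natrX.
  have p0 : (2 : R) ^+ n != 0 by rewrite lt0r_neq0// exprn_gt0.
  by rewrite (_ : _ * (_ * _) = 2 * Lam * M%:R)//; field.
rewrite -(@lee_pmul2l _ r.+1%:R%:E)// -EFinM (mulrC r.+1%:R) divfK ?lt0r_neq0//.
exact: le_trans hs.
Qed.

Let many_jumps_incr M r : {homo many_jumps M r : n p / (n <= p)%N >-> (n <= p)%O}.
Proof.
move=> n p np; rewrite -(subnK np); elim: (p - n)%N => [|d IH]; first by rewrite add0n.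
apply: (le_trans IH); rewrite subsetEset => w; rewrite /many_jumps /= => h; apply: (leq_trans h).
have := jumps_refine (y_double w) (d + n) (leq0n (M * 2 ^ (d + n))).
by rewrite addSn expnS mulnCA mul2n double0.
Qed.

(** The event that the jumps accumulate somewhere. *)
Let bad := \bigcup_M \bigcap_r \bigcup_n many_jumps M r n.

Let bad_measurable : measurable bad.
Proof.
apply: bigcupT_measurable => M; apply: bigcapT_measurable => r.
by apply: bigcupT_measurable => n; exact: many_jumps_measurable.
Qed.

Let bad_null : unif bad = 0%E.
Proof.
have mU M r : measurable (\bigcup_n many_jumps M r n) by apply: bigcupT_measurable => n; exact: many_jumps_measurable.
have mB M : measurable (\bigcap_r \bigcup_n many_jumps M r n) by apply: bigcapT_measurable.
have bound M r : (unif (\bigcap_r \bigcup_n many_jumps M r n) <= (2 * Lam * M%:R / r.+1%:R)%:E)%E.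
  apply: (@le_trans _ _ (unif (\bigcup_n many_jumps M r n))).
    by apply: le_measure; rewrite ?inE//; exact: bigcap_inf.
  have cv := nondecreasing_cvg_mu (mu := unif) (many_jumps_measurable M r) (mU M r) (@many_jumps_incr M r).
  rewrite -(cvg_lim _ cv)//; apply: lime_le; first by apply/cvg_ex; eexists; exact: cv.
  by near=> n; exact: many_jumps_prob.
have null M : unif (\bigcap_r \bigcup_n many_jumps M r n) = 0%E.
  apply/eqP; rewrite eq_le measure_ge0 andbT; apply/lee_addgt0Pr => e e0; rewrite add0e.
  pose c := 2 * Lam * M%:R; have c0 : 0 <= c by rewrite !mulr_ge0.
  have ce : 0 <= c / e by rewrite divr_ge0// ltW.
  have /andP[_ h] := truncn_itv ce.
  apply: le_trans (bound M (Num.truncn (c / e))) _; rewrite lee_fin ler_pdivrMr ?ltr0n//.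
  by rewrite (mulrC e) -ler_pdivrMr// ltW.
apply/eqP; rewrite eq_le measure_ge0 andbT.
apply: le_trans (generalized_Boole_inequality unif mB bad_measurable) _.
by rewrite eseries0// => M _ _; rewrite /= null.
Unshelve. all: by end_near. Qed.

Let not_bad w : ~ bad w -> forall M, exists B, forall n, (jumps (y w) n 0 (M * 2 ^ n) <= B)%N.
Proof.
move=> hb M; apply: contrapT => h; apply: hb; exists M => // r _.
apply: contrapT => h'; apply: h; exists r => n; rewrite leqNgt; apply/negP => lt.
by apply: h'; exists n.
Qed.

Let X (t : R) (w : Omega) : bool := `[< ~ bad w /\ right_limit (y w) t true >].

Let X_limit w t : ~ bad w -> 0 <= t -> right_limit (y w) t (X t w).
Proof.
move=> hw t0; have [B hB] := not_bad hw (Num.truncn (t + 1)).+1.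
have tM : t + 1 <= (Num.truncn (t + 1)).+1%:R.
  by have /andP[_ /ltW] := truncn_itv (addr_ge0 t0 ler01).
have [b hb] := right_limit_exists (y_double w) t0 tM hB.
rewrite /X; case: (asboolP (~ bad w /\ right_limit (y w) t true)) => [[] //|h].
by case: b hb => // hb; exfalso; apply: h.
Qed.

Let X_next w t : ~ bad w -> 0 <= t ->
  exists n0 : nat, forall n, (n0 <= n)%N -> Y (idx n (next_index n t)) w = X t w.
Proof. by move=> hw t0; exact: right_limit_next t0 (X_limit hw t0). Qed.

Let X_measurable t : 0 <= t -> measurable_fun setT (X t).
Proof.
move=> t0; apply: (@measurable_fun_bool _ _ _ _ true); rewrite setTI.
have -> : X t @^-1` [set true] = ~` bad `&` \bigcup_N \bigcap_n [set w | Y (idx (N + n) (next_index (N + n) t)) w = true].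
  apply/seteqP; split => w /=.
    move=> Xw; have hw : ~ bad w by move/asboolP: Xw => [].
    split => //; have [n0 hn] := X_next hw t0; exists n0 => // n _ /=.
    by rewrite hn ?leq_addr.
  move=> [hw [N _ hN]]; have [n0 hn] := X_next hw t0.
  rewrite -(hn (N + n0)%N) ?leq_addl//; exact: (hN n0 I).
apply: measurableI; first exact: measurableC.
by apply: bigcupT_measurable => N; apply: bigcapT_measurable => n; exact: mY.
Qed.

Let X_right w t : 0 <= t -> \forall s \near t^'+, X s w = X t w.
Proof.
move=> t0; have [hb|hw] := pselect (bad w).
  by near=> s; rewrite /X !asboolF//; case.
have [d d0 hd] := right_limit_right (X_limit hw t0).
near=> s.
have ts : t < s by near: s; exact: nbhs_right_gt.
have sd : s < t + d by near: s; apply: nbhs_right_lt; rewrite ltrDl.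
apply: (right_limit_unique (le_trans t0 (ltW ts)) (X_limit hw (le_trans t0 (ltW ts)))).
by apply: hd; rewrite (ltW ts).
Unshelve. all: by end_near. Qed.

(** Probabilities pass to the limit along events that stabilize off the null set. *)
Let prob_limit (A : nat -> set Omega) (B : set Omega) : (forall n, measurable (A n)) -> measurable B ->
  (forall w, ~ bad w -> exists n0 : nat, forall n, (n0 <= n)%N -> A n w <-> B w) ->
  unif (A n) @[n --> \oo] --> unif B.
Proof.
move=> mA mB h.
have mi (C : set Omega) : measurable C -> measurable_fun setT ((fun w => (\1_C w)%:E) : Omega -> \bar R).
  by move=> mC; apply/measurable_EFinP; exact: measurable_indic.
have cv : \forall w \ae unif, setT w -> (\1_(A n) w)%:E @[n --> \oo] --> ((\1_B w)%:E : \bar R).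
  exists bad; split => // w; apply: contra_notP => hw _.
  have [n0 hn] := h w hw; apply: cvg_near_cst; exists n0 => // n /= /hn en.
  by congr EFin; rewrite !indicE; congr (_%:R); congr nat_of_bool; apply/idP/idP; rewrite !inE => /en.
have dom : \forall w \ae unif, forall n, setT w -> (`|(\1_(A n) w)%:E| <= cst (1%E : \bar R) w)%E.
  by apply: aeW => w n _; rewrite gee0_abs ?lee_fin// indicE lern1 leq_b1.
have [_ _] := dominated_convergence (measurableT) (fun n => mi _ (mA n)) (mi _ mB) cv
  (finite_measure_integrable_cst unif 1 measurableT) dom.
have e (C : set Omega) : measurable C -> (\int[unif]_(x in setT) (\1_C x)%:E)%E = unif C.
  by move=> mC; rewrite integral_indic// setIT.
by rewrite e//; under eq_fun => n do rewrite e//.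
Qed.

Let next_cvg (t : R) : 0 <= t -> dyadic n (next_index n t) @[n --> \oo] --> t.
Proof.
move=> t0; apply/cvgrPdist_le => e e0; have [n0 hn] := mesh_small e0; exists n0 => // n /= /hn h.
have /andP[h1 h2] := next_bounds n t0.
by rewrite distrC ger0_norm ?subr_ge0 ?(ltW h1)// lerBlDl; apply: le_trans h2 _; rewrite lerD2l ltW.
Qed.

Let X_event_measurable (h : seq (R * bool)) : all (fun e => 0 <= e.1) h ->
  measurable [set w : Omega | all (fun e => X e.1 w == e.2) h].
Proof.
elim: h => [|e h IH] /=; first by rewrite (_ : mkset _ = setT)//; apply/seteqP; split.
move=> /andP[e0 /IH mh].
rewrite (_ : mkset _ = [set w | X e.1 w == e.2] `&` [set w | all (fun e => X e.1 w == e.2) h]).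
  apply: measurableI => //; have := X_measurable e0 measurableT (Y := [set e.2]) I.
  by rewrite setTI; congr measurable; apply/seteqP; split => w /= /eqP.
by apply/seteqP; split => w /= /andP.
Qed.

Let approx (n : nat) (h : seq (R * bool)) := [seq (idx n (next_index n e.1), e.2) | e <- h].

(** X has at a finite number of times the same values as the letters at the next points of
    a fine grid. *)
Let event_limit (h : seq (R * bool)) : all (fun e => 0 <= e.1) h ->
  unif [set w : Omega | all (fun e => Y e.1 w == e.2) (approx n h)] @[n --> \oo] -->
  unif [set w : Omega | all (fun e => X e.1 w == e.2) h].
Proof.
move=> hh; apply: prob_limit; [by move=> n; exact: mall|exact: X_event_measurable|].
move=> w hw; elim: h hh => [|e h IH] /=; first by exists 0%N.
move=> /andP[e0 /IH[n1 h1]]; have [n2 h2] := X_next hw e0.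
exists (maxn n1 n2) => n; rewrite geq_max => /andP[/h1 i1 /h2 ->].
by split=> /andP[-> /i1 ->].
Qed.

Let X0_law : unif [set w | X 0 w] = m0%:E.
Proof.
pose i := idx 0 0; have Ti : T i = 0 by rewrite T_idx /dyadic mul0r.
have Y0 : unif [set w : Omega | Y i w == true] = m0%:E.
  have := letter_law tr_ge0 tr_sum tr_comp tr_id T_ge0 m_ge0 m_sum Ti; rewrite -/Y => <-.
  by congr unif; apply/seteqP; split => w /=; [move=> /eqP|move=> ->].
have Y1 : unif [set w : Omega | Y i w == false] = (1 - m0)%:E.
  rewrite (_ : mkset _ = ~` [set w : Omega | Y i w == true]).
    by rewrite [LHS](probability_setC unif (mYeq i true)) EFinB -Y0.
  by apply/seteqP; split => w /=; case: (Y i w).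
have step n : unif [set w : Omega | Y (idx n (next_index n (0 : R))) w == true] =
    ((1 - m0) * tr 0 (dyadic n (next_index n (0 : R))) false true + m0 * tr 0 (dyadic n (next_index n (0 : R))) true true)%:E.
  pose j := idx n (next_index n (0 : R)); rewrite -/j; have ij : T i <= T j by rewrite Ti.
  have mk x := markovY (H := [::]) (j := j) x true isT ij.
  rewrite (_ : mkset _ = [set w : Omega | (Y i w == false) && (Y j w == true)] `|`
     [set w : Omega | (Y i w == true) && (Y j w == true)]); last first.
    by apply/seteqP; split => w /=; [case: (Y i w) => h; [right|left]|case=> /andP[]].
  have mI x : measurable [set w : Omega | (Y i w == x) && (Y j w == true)].
    have := measurableI _ _ (mYeq i x) (mYeq j true).
    by congr measurable; apply/seteqP; split => w /= /andP.
  have E x : unif [set w : Omega | (Y i w == x) && (Y j w == true)] =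
      (unif [set w : Omega | Y i w == x] * (tr (T i) (T j) x true)%:E)%E := mk x.
  have disj : [set w : Omega | (Y i w == false) && (Y j w == true)] `&`
      [set w : Omega | (Y i w == true) && (Y j w == true)] = set0.
    by apply/seteqP; split => w //= [/andP[/eqP -> _]].
  apply: (etrans (measureU unif (mI false) (mI true) disj)).
  transitivity (unif [set w : Omega | Y i w == false] * (tr (T i) (T j) false true)%:E +
    unif [set w : Omega | Y i w == true] * (tr (T i) (T j) true true)%:E)%E.
    by congr (_ + _)%E; exact: E.
  have Tj : T j = dyadic n (next_index n (0 : R)) by exact: T_idx.
  by rewrite Y0 Y1 Ti Tj.
have h0 : all (fun e : R * bool => 0 <= e.1) [:: (0, true)] by rewrite /= lexx.
have L1 := event_limit h0.
have L2 : ((1 - m0) * tr 0 (dyadic n (next_index n (0 : R))) false true + m0 * tr 0 (dyadic n (next_index n (0 : R))) true true)%:E @[n --> \oo] --> m0%:E.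
  apply: cvg_EFin; first by near=> n.
  rewrite [X in _ --> X](_ : m0 = (1 - m0) * tr 0 0 false true + m0 * tr 0 0 true true).
    apply: cvgD; apply: cvgM; try exact: cvg_cst; apply: (trans_cvg rate_cont); try exact: cvg_cst;
      exact: next_cvg.
  by rewrite !tr_id//= mulr0 add0r mulr1.
have -> : [set w | X 0 w] = [set w : Omega | all (fun e => X e.1 w == e.2) [:: (0, true)]].
  by apply/seteqP; split => w /=; [move=> ->|rewrite andbT => /eqP].
apply: (cvg_unique (@ereal_hausdorff R) L1).
apply: cvg_trans L2; apply: near_eq_cvg; near=> n.
by rewrite -step; congr unif; apply/seteqP; split => w /=; rewrite andbT.
Unshelve. all: by end_near. Qed.

Lemma chain_exists_aux : markov_chain rate m0 unif X.
Proof.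
split.
- exact: X_measurable.
- by move=> w t; exact: X_right.
- exact: X0_law.
exists tr; first exact: trans_transition.
move=> h s t x z s0 st hh.
have hh0 : all (fun e : R * bool => 0 <= e.1) h by apply: sub_all hh => e /andP[].
have t0 : 0 <= t by exact: le_trans st.
pose h1 := rcons h (s, x); pose h2 := rcons h1 (t, z).
have a1 : all (fun e : R * bool => 0 <= e.1) h1 by rewrite all_rcons /= s0.
have a2 : all (fun e : R * bool => 0 <= e.1) h2 by rewrite all_rcons /= t0.
have L1 := event_limit a1; have L2 := event_limit a2.
have e1 : [set w | all (fun e => X e.1 w == e.2) h && (X s w == x)] = [set w | all (fun e => X e.1 w == e.2) h1].
  by apply/seteqP; split => w /=; rewrite all_rcons andbC.
have e2 : [set w | [&& all (fun e => X e.1 w == e.2) h, X s w == x & X t w == z]] = [set w | all (fun e => X e.1 w == e.2) h2].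
  by apply/seteqP; split => w /=; rewrite !all_rcons /= => /and3P[-> -> ->].
rewrite e1 e2.
have step n : unif [set w : Omega | all (fun e => Y e.1 w == e.2) (approx n h2)] =
   (unif [set w : Omega | all (fun e => Y e.1 w == e.2) (approx n h1)] *
    (tr (dyadic n (next_index n s)) (dyadic n (next_index n t)) x z)%:E)%E.
  have hn : all (fun e => T e.1 <= T (idx n (next_index n s))) (approx n h).
    rewrite all_map; apply: sub_all hh => e /= /andP[_ es]; rewrite !T_idx; exact: next_mono.
  have hst : T (idx n (next_index n s)) <= T (idx n (next_index n t)) by rewrite !T_idx next_mono.
  have := markovY x z hn hst; rewrite !T_idx -/Y.
  rewrite /approx /h2 /h1 !map_rcons /=.
  have -> : [set w : Omega | all (fun e => Y e.1 w == e.2) (rcons [seq (idx n (next_index n e.1), e.2) | e <- h] (idx n (next_index n s), x))] =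
    [set w | all (fun e => Y e.1 w == e.2) [seq (idx n (next_index n e.1), e.2) | e <- h] && (Y (idx n (next_index n s)) w == x)].
    by apply/seteqP; split => w /=; rewrite all_rcons andbC.
  by move=> <-; congr unif; apply/seteqP; split => w /=; rewrite !all_rcons /= => /and3P[-> -> ->].
apply: (cvg_unique (@ereal_hausdorff R) L2).
suff : (unif [set w : Omega | all (fun e => Y e.1 w == e.2) (approx n h1)] *
    (tr (dyadic n (next_index n s)) (dyadic n (next_index n t)) x z)%:E)%E @[n --> \oo] -->
    (unif [set w : Omega | all (fun e => X e.1 w == e.2) h1] * (tr s t x z)%:E)%E.
  by rewrite -(eq_cvg _ _ step).
apply: cvgeM => //.
  by apply: mule_def_fin => //; apply: fin_num_measure; exact: X_event_measurable.
apply: cvg_EFin; first by near=> n.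
by apply: (trans_cvg rate_cont); exact: next_cvg.
Unshelve. all: by end_near. Qed.

End ChainExistence.

(** The letters give the values at dyadic times, limits from the right those at other
    times, and the Markov property passes to the limit from the former to the latter. *)
Theorem chain_exists {R : realType} (rate : R -> bool -> R) (Lam m0 : R) :
  (forall x, continuous (rate^~ x)) -> (forall t x, 0 <= rate t x <= Lam) -> 0 <= m0 <= 1 ->
  exists X : R -> measurableTypeR R -> bool, markov_chain rate m0 unif X.
Proof.
move=> rc rb m01; have [T [T_inj T_ge0 hT]] := @enumerate_dyadic R.
pose idx n k := projT1 (cid (hT n k)).
have T_idx n k : T (idx n k) = dyadic n k by rewrite /idx; case: cid.
have r0 t x : 0 <= rate t x by case/andP: (rb t x).
have rL t x : rate t x <= Lam by case/andP: (rb t x).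
by eexists; exact: (chain_exists_aux rc r0 rL m01 T_inj T_ge0 T_idx).
Qed.

(** * Integral equations and integration by parts *)

Section IntegralTools.
Context {R : realType}.
Local Notation leb := (@lebesgue_measure R).
Implicit Types (f g m mu b : R -> R) (s t T : R).

Definition integrable_on (s t : R) f : Prop := leb.-integrable `[s, t] (fun u => (f u)%:E).

Lemma cont_integrable f s t : {within `[s, t], continuous f} -> integrable_on s t f.
Proof. by move=> cf; apply: continuous_compact_integrable => //; exact: segment_compact. Qed.

Lemma within_bounded f s t : {within `[s, t], continuous f} ->
  exists M : R, forall u, s <= u <= t -> `|f u| <= M.
Proof.
move=> cf; case: (leP s t) => st; last first.
  by exists 0 => u /andP[h1 h2]; have := le_trans h1 h2; rewrite leNgt st.
have c : {within `[s, t], continuous (fun u => `|f u|)}.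
  exact: (@cont_norm (subspace `[s, t]) R f cf).
have [v _ hv] := EVT_max st c; exists `|f v| => u hu; apply: hv.
by rewrite in_itv.
Qed.

Lemma integrable_onM f g s t : integrable_on s t f -> {within `[s, t], continuous g} ->
  integrable_on s t (fun u => f u * g u).
Proof.
move=> fi cg; have [M hM] := within_bounded cg.
have H := @integrableMl _ _ R leb `[s, t] (measurable_itv _) (fun u => (f u)%:E) g fi
  (subspace_continuous_measurable_fun (measurable_itv _) cg) _.
apply: H; exists M; split; first exact: num_real.
by move=> M' MM' u /=; rewrite in_itv /= => /hM h; exact: le_trans h (ltW MM').
Qed.

Lemma integrable_onD f g s t : integrable_on s t f -> integrable_on s t g ->
  integrable_on s t (fun u => f u + g u).
Proof. move=> fi gi; have mI : measurable (`[s, t]%classic : set (measurableTypeR R)) by exact: measurable_itv.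
have := integrableD mI fi gi; congr integrable; by apply/funext => u; rewrite /= EFinD. Qed.

Lemma integrable_onN f s t : integrable_on s t f -> integrable_on s t (fun u => - f u).
Proof. by move=> fi; have := integrableN fi; congr integrable; apply/funext => u; rewrite /= EFinN. Qed.

Lemma integrable_on_norm f s t : integrable_on s t f -> integrable_on s t (fun u => `|f u|).
Proof.
move=> fi; have := integrable_norm fi; congr integrable.
Qed.

Lemma integrable_on_sub f s t s' t' : integrable_on s t f -> s <= s' -> t' <= t -> integrable_on s' t' f.
Proof.
move=> fi ss tt; apply: integrableS fi => //.
by move=> u /=; rewrite !in_itv /= => /andP[h1 h2]; rewrite (le_trans ss h1) (le_trans h2 tt).
Qed.

Definition integral_on (s t : R) f : R := \int[leb]_(u in `[s, t]) f u.

Lemma integral_onE s t f : integrable_on s t f ->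
  (\int[leb]_(u in `[s, t]) (f u)%:E)%E = (integral_on s t f)%:E.
Proof. by move=> fi; rewrite /integral_on /Rintegral fineK//; exact: integrable_fin_num fi. Qed.

Lemma integral_on_split f s t : 0 <= s -> s <= t -> integrable_on 0 t f ->
  integral_on 0 t f - integral_on 0 s f = integral_on s t f.
Proof.
move=> s0 st fi.
have H := @Rintegral_itvB R f (BLeft 0) (BRight t) s fi.
rewrite /integral_on H ?bnd_simp//.
apply: Rintegral_itv_obnd_cbnd.
have fs : integrable_on s t f by exact: integrable_on_sub fi s0 (lexx t).
apply: integrableS fs => //.
by move=> u /=; rewrite !in_itv /= => /andP[/ltW -> ->].
Qed.

Lemma integral_on_cst s t (c : R) : s <= t -> integral_on s t (fun=> c) = c * (t - s).
Proof.
move=> st; have e : leb `[s, t]%classic = (t - s)%:E.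
  rewrite lebesgue_measure_itv /= lte_fin; case: ltP => [_|ts]; first by rewrite EFinB.
  by rewrite (le_anti (introT andP (conj st ts))) subrr.
by rewrite /integral_on Rintegral_cst// [X in _ * fine X](_ : _ = (t - s)%:E).
Qed.

Lemma integral_onD f g s t : integrable_on s t f -> integrable_on s t g ->
  integral_on s t (fun u => f u + g u) = integral_on s t f + integral_on s t g.
Proof. by move=> fi gi; exact: RintegralD. Qed.

Lemma integral_onZr f s t (c : R) : integrable_on s t f ->
  integral_on s t (fun u => f u * c) = integral_on s t f * c.
Proof. by move=> fi; exact: RintegralZr. Qed.

Lemma integral_on_le f g s t : integrable_on s t f -> integrable_on s t g ->
  (forall u, s <= u <= t -> f u <= g u) -> integral_on s t f <= integral_on s t g.
Proof. by move=> fi gi h; apply: le_Rintegral => // u /=; rewrite in_itv; exact: h. Qed.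

Lemma integral_on_norm_le f g s t : integrable_on s t f -> integrable_on s t g ->
  (forall u, s <= u <= t -> `|f u| <= g u) -> `|integral_on s t f| <= integral_on s t g.
Proof.
move=> fi gi h; apply: (le_trans (le_normr_Rintegral _ fi)) => //.
by apply: integral_on_le => //; exact: integrable_on_norm.
Qed.

Lemma integral_on_eq f g s t : (forall u, s <= u <= t -> f u = g u) -> integral_on s t f = integral_on s t g.
Proof. by move=> h; apply: eq_Rintegral => u; rewrite inE /= in_itv; exact: h. Qed.

(** Over a partition of mesh h the increments add up to at most c h times the total
    increment of N. *)
Lemma constant_of_small (F N : R -> R) (c T : R) : 0 <= T -> 0 <= c ->
  (forall s t, 0 <= s -> s <= t -> t <= T -> `|F t - F s| <= c * (t - s) * (N t - N s)) ->
  F T = F 0.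
Proof.
move=> T0 c0 h; apply/eqP; rewrite -subr_eq0 -normr_eq0 eq_le normr_ge0 andbT.
have step (n : nat) : `|F T - F 0| <= c * (T / n.+1%:R) * (N T - N 0).
  have n0 : (0 : R) < n.+1%:R by rewrite ltr0n.
  pose x (i : nat) : R := i%:R * (T / n.+1%:R).
  have H (i : nat) : (i <= n.+1)%N -> `|F (x i) - F 0| <= c * (T / n.+1%:R) * (N (x i) - N 0).
    elim: i => [|i IH] hi; first by rewrite /x mul0r !subrr normr0 mulr0.
    have xS : x i.+1 - x i = T / n.+1%:R by rewrite /x -mulrBl -natrB// subSnn mul1r.
    have d0 : 0 <= T / n.+1%:R by rewrite divr_ge0// ltW.
    have := h (x i) (x i.+1); rewrite xS => hh.
    have xi0 : 0 <= x i by rewrite mulr_ge0.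
    have xi1 : x i <= x i.+1 by rewrite -subr_ge0 xS.
    have xT : x i.+1 <= T.
      by rewrite /x mulrA ler_pdivrMr// mulrC ler_wpM2l// ler_nat.
    have := ler_normD (F (x i.+1) - F (x i)) (F (x i) - F 0).
    have -> : F (x i.+1) - F (x i) + (F (x i) - F 0) = F (x i.+1) - F 0 by ring.
    have := hh xi0 xi1 xT; have := IH (ltnW hi); set A := c * _; rewrite !mulrBr; lra.
  have := H n.+1 (leqnn _); rewrite /x mulrCA divff ?mulr1//.
pose K := c * T * (N T - N 0).
have stepK n : `|F T - F 0| * n.+1%:R <= K.
  have := step n; rewrite mulrA -[_ / _ * _]mulrAC ler_pdivlMr ?ltr0n//.
rewrite leNgt; apply/negP => pos.
have K0 : 0 <= K / `|F T - F 0|.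
  rewrite divr_ge0 ?normr_ge0//; apply: le_trans (stepK 0%N); rewrite mulr1; exact: normr_ge0.
have /andP[_] := truncn_itv K0; rewrite ltr_pdivrMr// mulrC => hK.
by have := lt_le_trans hK (stepK _); rewrite ltxx.
Qed.

Section ProductRule.
Variables (m mu b b' : R -> R) (T : R).
Hypotheses (T0 : 0 <= T) (mui : integrable_on 0 T mu).
Hypothesis mE : forall t, 0 <= t <= T -> m t = m 0 + integral_on 0 t mu.
Hypotheses (cb : continuous b) (cb' : continuous b').
Hypothesis db : forall t, 0 < t -> is_derive t (1:R) b (b' t).
Hypothesis cm : {within `[0, T], continuous m}.

Let sub_cont (f : R -> R) s t : continuous f -> {within `[s, t], continuous f}.
Proof. exact: continuous_subspaceT. Qed.

Let m_sub s t : 0 <= s -> s <= t -> t <= T -> m t - m s = integral_on s t mu.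
Proof.
move=> s0 st tT; have t0T : 0 <= t <= T by rewrite tT (le_trans s0).
have s0T : 0 <= s <= T by rewrite s0 (le_trans st).
rewrite (mE t0T) (mE s0T).
rewrite -(integral_on_split s0 st); last by exact: integrable_on_sub mui (lexx 0) tT.
by ring.
Qed.

Let b_sub s t : 0 <= s -> s <= t -> b t - b s = integral_on s t b'.
Proof.
move=> s0 st; have := ftc st cb' cb (fun u hu => db (le_lt_trans s0 (proj1 (andP hu)))).
rewrite integral_onE; first by case.
by apply: cont_integrable; exact: sub_cont.
Qed.

(** The rates are only integrable, so m has no derivative; but the two sides differ by a
    function whose increments are of second order. *)
Lemma product_rule : m T * b T - m 0 * b 0 = integral_on 0 T (fun u => mu u * b u + m u * b' u).
Proof.
have inti s t : 0 <= s -> t <= T -> integrable_on s t (fun u => mu u * b u + m u * b' u).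
  move=> s0 tT; apply: integrable_on_sub s0 tT; apply: integrable_onD.
    by apply: integrable_onM => //; exact: sub_cont.
  by apply: integrable_onM; [exact: cont_integrable|exact: sub_cont].
have [B0 hB0] := within_bounded (@sub_cont b' 0 T cb').
pose B := Num.max 0 B0; have Bp : 0 <= B by rewrite le_max lexx.
have hB u : 0 <= u <= T -> `|b' u| <= B by move=> /hB0 h; rewrite le_max h orbT.
pose N t := integral_on 0 t (fun u => `|mu u|).
have N_sub s t : 0 <= s -> s <= t -> t <= T -> N t - N s = integral_on s t (fun u => `|mu u|).
  move=> s0 st tT; apply: integral_on_split => //.
  by apply: integrable_on_norm; exact: integrable_on_sub mui (lexx 0) tT.
have N_nd s t : 0 <= s -> s <= t -> t <= T -> 0 <= N t - N s.
  by move=> s0 st tT; rewrite N_sub//; apply: Rintegral_ge0 => u _.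
have m_N s t : 0 <= s -> s <= t -> t <= T -> `|m t - m s| <= N t - N s.
  move=> s0 st tT; rewrite m_sub// N_sub//.
  have i : integrable_on s t mu by exact: integrable_on_sub mui s0 tT.
  by apply: integral_on_norm_le => //; exact: integrable_on_norm.
pose F t := m t * b t - integral_on 0 t (fun u => mu u * b u + m u * b' u).
have key : F T = F 0.
  apply: (@constant_of_small F N (2 * B) T T0) => [|s t s0 st tT]; first exact: mulr_ge0.
  have i1 : integrable_on s t mu by exact: integrable_on_sub mui s0 tT.
  have i2 : integrable_on s t b' by apply: cont_integrable; exact: sub_cont.
  have i0 := inti s t s0 tT.
  have -> : F t - F s = - integral_on s t (fun u => mu u * (b u - b t) + (m u - m s) * b' u).
    have -> : F t - F s = m t * b t - m s * b s -
        (integral_on 0 t (fun u => mu u * b u + m u * b' u) - integral_on 0 s (fun u => mu u * b u + m u * b' u)).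
      by rewrite /F; ring.
    rewrite integral_on_split//; last by exact: inti.
    have -> : m t * b t - m s * b s = integral_on s t mu * b t + integral_on s t b' * m s.
      by rewrite -m_sub// -b_sub//; ring.
    rewrite -!integral_onZr// -integral_onD; last 2 first.
    - by apply: integrable_onM => //; exact: sub_cont (@contC _ R _).
    - by apply: integrable_onM => //; exact: sub_cont (@contC _ R _).
    have ->  : integral_on s t (fun u => mu u * b u + m u * b' u) =
      integral_on s t (fun u => mu u * b t + b' u * m s) + integral_on s t (fun u => mu u * (b u - b t) + (m u - m s) * b' u).
      rewrite -integral_onD; first by apply: integral_on_eq => u _; ring.
      + apply: integrable_onD; first by apply: integrable_onM => //; exact: sub_cont (@contC _ R _).
        by apply: integrable_onM => //; exact: sub_cont (@contC _ R _).
      + have -> : (fun u => mu u * (b u - b t) + (m u - m s) * b' u) =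
          (fun u => (mu u * b u + m u * b' u) + (- (mu u * b t) + - (b' u * m s))).
          by apply/funext => u; ring.
        apply: integrable_onD => //; apply: integrable_onD; apply: integrable_onN;
          by apply: integrable_onM => //; exact: sub_cont (@contC _ R _).
    by ring.
  rewrite normrN.
  have bl u : s <= u <= t -> `|b u - b t| <= B * (t - s).
    move=> /andP[su ut]; have u0 := le_trans s0 su.
    rewrite distrC b_sub//; apply: le_trans (_ : integral_on u t (fun=> B) <= _).
      apply: integral_on_norm_le; [by apply: cont_integrable; exact: sub_cont|
        by apply: cont_integrable; exact: sub_cont (@contC _ R _)|].
      by move=> v /andP[uv vt]; apply: hB; rewrite (le_trans u0 uv) (le_trans vt tT).
    by rewrite integral_on_cst// ler_wpM2l// lerD2l lerN2.
  have i3 : integrable_on s t (fun u => mu u * (b u - b t) + (m u - m s) * b' u).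
    have -> : (fun u => mu u * (b u - b t) + (m u - m s) * b' u) =
        (fun u => (mu u * b u + m u * b' u) + (- (mu u * b t) + - (b' u * m s))).
      by apply/funext => u; ring.
    apply: integrable_onD => //; apply: integrable_onD; apply: integrable_onN;
      by apply: integrable_onM => //; exact: sub_cont (@contC _ R _).
  have cc (c : R) : integrable_on s t (fun=> c) by apply: cont_integrable; exact: sub_cont (@contC _ R _).
  have i4 : integrable_on s t (fun u => `|mu u| * (B * (t - s))).
    by apply: integrable_onM; [exact: integrable_on_norm|exact: sub_cont (@contC _ R _)].
  apply: le_trans (_ : integral_on s t (fun u => `|mu u| * (B * (t - s)) + (N t - N s) * B) <= _).
    apply: integral_on_norm_le => //; first exact: integrable_onD.
    move=> u hu; have /andP[su ut] := hu; apply: le_trans (ler_normD _ _) _; apply: lerD.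
      by rewrite normrM ler_wpM2l// bl.
    rewrite normrM; apply: ler_pM => //; last by apply: hB; rewrite (le_trans s0 su) (le_trans ut tT).
    apply: le_trans (m_N _ _ s0 su (le_trans ut tT)) _.
    by have := N_nd u t (le_trans s0 su) ut tT; lra.
  rewrite (integral_onD i4 (cc _)) (integral_onZr _ (integrable_on_norm i1)).
  by rewrite integral_on_cst// -N_sub// le_eqVlt; apply/orP; left; apply/eqP; ring.
have e0 : integral_on 0 0 (fun u => mu u * b u + m u * b' u) = 0.
  by rewrite /integral_on set_itv1 Rintegral_set1.
by move: key; rewrite /F e0 subr0 => <-; ring.
Qed.

End ProductRule.

End IntegralTools.

(** * The law and the cost of a chain *)

Section ChainLaw.
Context {R : realType}.
Local Notation leb := (@lebesgue_measure R).
Variables (rate : R -> bool -> R) (m0 : R) (d : measure_display) (Omega : measurableType d).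
Variables (P : probability Omega R) (X : R -> Omega -> bool).
Hypothesis mc : markov_chain rate m0 P X.
Hypothesis rate_int : forall x T, 0 <= T -> integrable_on 0 T (rate^~ x).

Let mX (t : R) b : 0 <= t -> measurable [set w | X t w == b].
Proof.
move=> t0; have [mX _ _ _] := mc; have := mX t t0 measurableT [set b] I.
by rewrite setTI; congr measurable; apply/seteqP; split => w /= /eqP.
Qed.

Let mXt (t : R) : 0 <= t -> measurable [set w | X t w].
Proof. by move=> t0; have := mX true t0; congr measurable; apply/seteqP; split => w /= /eqP. Qed.

Let initial x : P [set w | X 0 w == x] = (if x then m0 else 1 - m0)%:E.
Proof.
have [_ _ P0 _] := mc.
have Pt : P [set w | X 0 w == true] = m0%:E by rewrite -P0; congr (P _); apply/seteqP; split => w /= /eqP.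
case: x => //; rewrite EFinB -Pt.
have <- := probability_setC P (mX true (lexx 0)).
by congr (P _); apply/seteqP; split => w /=; case: (X 0 w).
Qed.

(** The forward equation is that of the transition function, averaged over the initial
    law. *)
Lemma chain_law : exists m : R -> R,
  [/\ forall t, 0 <= t -> P [set w | X t w] = (m t)%:E, forall t, 0 <= t -> 0 <= m t <= 1,
      m 0 = m0, {within `[0, +oo[, continuous m} &
      forall t, 0 <= t -> m t = m 0 +
        integral_on 0 t (fun u => rate u false * (1 - m u) - rate u true * m u)].
Proof.
have [_ _ P0 [tr htr markov]] := mc.
pose m (t : R) := (1 - m0) * tr 0 t false true + m0 * tr 0 t true true.
have [ge0f sumf contf intf] := htr 0 false (lexx 0).
have [ge0t sumt contt intt] := htr 0 true (lexx 0).
have Pm t : 0 <= t -> P [set w | X t w] = (m t)%:E.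
  move=> t0.
  have E x : P [set w | (X 0 w == x) && (X t w == true)] = (P [set w | X 0 w == x] * (tr 0 t x true)%:E)%E :=
    markov [::] 0 t x true (lexx 0) t0 isT.
  have mI x : measurable [set w | (X 0 w == x) && (X t w == true)].
    have := measurableI _ _ (mX x (lexx 0)) (mX true t0).
    by congr measurable; apply/seteqP; split => w /= /andP.
  have disj : [set w | (X 0 w == false) && (X t w == true)] `&` [set w | (X 0 w == true) && (X t w == true)] = set0.
    by apply/seteqP; split => w //= [/andP[/eqP -> _]].
  have -> : [set w | X t w] = [set w | (X 0 w == false) && (X t w == true)] `|` [set w | (X 0 w == true) && (X t w == true)].
    by apply/seteqP; split => w /=; [case: (X 0 w) => ->; [right|left]|case=> /andP[_ /eqP]].
  apply: (etrans (measureU P (mI false) (mI true) disj)).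
  transitivity (P [set w | X 0 w == false] * (tr 0 t false true)%:E + P [set w | X 0 w == true] * (tr 0 t true true)%:E)%E.
    by congr (_ + _)%E; exact: E.
  by rewrite !initial.
exists m; split=> //.
- move=> t t0; have h1 : (0 <= (m t)%:E)%E by rewrite -(Pm t t0) measure_ge0.
  have h2 : ((m t)%:E <= 1)%E by rewrite -(Pm t t0); exact: probability_le1 (mXt t0).
  by rewrite !lee_fin in h1 h2; rewrite h1.
- have := Pm 0 (lexx 0); rewrite P0 => -[e].
  by rewrite -e.
- by apply: wcontD; apply: wcontM => //; apply: continuous_subspaceT; exact: contC.
have sub t : `[0, t]%classic `<=` (`[0, +oo[%classic : set R).
  by move=> u /=; rewrite !in_itv /= => /andP[->].
have wtr t x y : {within `[0, t], continuous (fun u => tr 0 u x y)}.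
  by apply: (continuous_subspaceW (@sub t)); case: x.
have m00 : m 0 = m0.
  have := Pm 0 (lexx 0); rewrite P0 => -[e]; by rewrite -e.
move=> t t0; rewrite m00.
have iI x : integrable_on 0 t (fun u => rate u false * tr 0 u x false - rate u true * tr 0 u x true).
  apply: integrable_onD; last apply: integrable_onN; apply: integrable_onM; try exact: rate_int; exact: wtr.
have sum0 u x : 0 <= u -> tr 0 u x false = 1 - tr 0 u x true.
  by move=> u0; case: x; [rewrite -(sumt u u0)|rewrite -(sumf u u0)]; rewrite addrK.
have -> : integral_on 0 t (fun u => rate u false * (1 - m u) - rate u true * m u) =
  integral_on 0 t (fun u => (rate u false * tr 0 u false false - rate u true * tr 0 u false true) * (1 - m0)) +
  integral_on 0 t (fun u => (rate u false * tr 0 u true false - rate u true * tr 0 u true true) * m0).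
  have cst (c : R) : {within `[0, t], continuous (fun _ : R => c)}.
    by apply: continuous_subspaceT; exact: contC.
  rewrite -integral_onD; first by apply: integral_on_eq => u /andP[u0 _]; rewrite !sum0// /m; ring.
  - by apply: integrable_onM; [exact: iI|exact: cst].
  - by apply: integrable_onM; [exact: iI|exact: cst].
rewrite !integral_onZr//.
have := intf t true t0; have := intt t true t0; rewrite /= => e1 e2.
by rewrite /m e1 e2 /integral_on /=; ring.
Qed.

Let cell n k : set R := `[dyadic n k, dyadic n k.+1[%classic.

Let joint_set : measurable [set z : Omega * measurableTypeR R | (0 <= z.2) && X z.2 z.1].
Proof.
have [_ rc _ _] := mc.
rewrite (_ : mkset _ = (setT `*` `[0, +oo[%classic) `&`
   \bigcup_N \bigcap_n \bigcup_k ([set w | X (dyadic (N + n) k.+1) w] `*` cell (N + n) k)); last first.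
  apply/seteqP; split => -[w t] /=.
  - move=> /andP[t0 Xt]; split; first by rewrite in_itv /= t0.
    have [e /= e0 he] := rc w t t0.
    have [n0 hn] := mesh_small e0; exists n0 => // n _.
    exists (Num.truncn (2 ^+ (n0 + n) * t)) => //=.
    have /andP[h1 h2] := next_bounds (n0 + n) t0.
    split.
      rewrite he//= distrC ger0_norm ?subr_ge0 ?(ltW h1)//.
      by rewrite ltrBlDl; apply: le_lt_trans h2 _; rewrite ltrD2l hn// leq_addr.
    rewrite /cell /= in_itv /= h1 andbT /dyadic ler_pdivrMr ?exprn_gt0// mulrC.
    by have /andP[] := truncn_itv (mulr_ge0 t0 (exprn_ge0 (n0 + n) (ler0n R 2))).
  - move=> [[_]]; rewrite in_itv /= andbT => t0 [N _ h]; rewrite t0 /=.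
    have [e /= e0 he] := rc w t t0.
    have [n0 hn] := mesh_small e0.
    have [k _ [/= Xk]] := h n0 I; rewrite /cell /= in_itv /= => /andP[k1 k2].
    rewrite -(he (dyadic (N + n0) k.+1))//= distrC ger0_norm ?subr_ge0 ?(ltW k2)//.
    have := hn (N + n0)%N (leq_addl _ _).
    have : dyadic (N + n0) k.+1 = dyadic (N + n0) k + ((2 : R) ^+ (N + n0))^-1.
      by rewrite /dyadic -addn1 natrD mulrDl mul1r.
    by move: k1; lra.
apply: measurableI; first by apply: measurableX => //; exact: measurable_itv.
apply: bigcupT_measurable => N; apply: bigcapT_measurable => n; apply: bigcupT_measurable => k.
by apply: measurableX; [exact: mXt (dyadic_ge0 _ _)|exact: measurable_itv].
Qed.

(** By Tonelli's theorem the expected cost depends only on the law; joint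
    measurability comes from continuity from the right. *)
Lemma expected_cost (m : R -> R) (c : bool -> R -> R) :
  (forall t, 0 <= t -> P [set w | X t w] = (m t)%:E) ->
  (forall x, measurable_fun (`[0, +oo[%classic : set (measurableTypeR R)) (c x)) ->
  (forall x t, 0 <= t -> 0 <= c x t) ->
  (\int[P]_w \int[leb]_(t in `[0%R, +oo[) (c (X t w) t)%:E)%E =
  (\int[leb]_(t in `[0%R, +oo[) ((1 - m t) * c false t + m t * c true t)%:E)%E.
Proof.
move=> Pm mcost c0.
pose J : set (measurableTypeR R) := `[0, +oo[%classic.
have mJ : measurable J by exact: measurable_itv.
have JE t : J t = (0 <= t) by rewrite /J /= in_itv /= andbT.
pose C x : measurableTypeR R -> R := (c x) \_ J.
have mC x : measurable_fun setT (C x) by apply/(measurable_restrictT _ mJ).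
have C0 x t : 0 <= C x t.
  rewrite /C /patch; case: ifPn => // /set_mem; rewrite JE; exact: c0.
pose g (z : Omega * measurableTypeR R) := (0 <= z.2) && X z.2 z.1.
have mg : measurable_fun setT g.
  by apply: (@measurable_fun_bool _ _ _ _ true); rewrite setTI; exact: joint_set.
pose f (z : Omega * measurableTypeR R) : R := if g z then C true z.2 else C false z.2.
have mf : measurable_fun setT f.
  by apply: measurable_fun_ifT => //; apply: measurableT_comp.
have f0 z : (0 <= (f z)%:E)%E by rewrite lee_fin /f; case: ifP.
have mfE : measurable_fun setT (fun z => (f z)%:E) by apply/measurable_EFinP.
have FT := @fubini_tonelli _ _ Omega (measurableTypeR R) R P leb (fun z => (f z)%:E) mfE f0.
have lhs : (\int[P]_w \int[leb]_(t in `[0%R, +oo[) (c (X t w) t)%:E)%E = (\int[P]_w \int[leb]_t (f (w, t))%:E)%E.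
  apply: eq_integral => w _; rewrite integral_mkcond; apply: eq_integral => t _.
  rewrite /patch; case: ifPn => [/set_mem|/negP h].
    rewrite -/J JE => t0; rewrite /f /g /= t0 /= /C /patch.
    have tJ : t \in J by apply/mem_set; rewrite JE.
    by rewrite !tJ; case: (X t w).
  rewrite /f /C /patch; have tJ : (t \in J) = false by apply/negP.
  by rewrite !tJ; case: ifP.
have rhs : (\int[leb]_(t in `[0%R, +oo[) ((1 - m t) * c false t + m t * c true t)%:E)%E = (\int[leb]_t \int[P]_w (f (w, t))%:E)%E.
  rewrite integral_mkcond; apply: eq_integral => t _.
  rewrite /patch; case: ifPn => [/set_mem|/negP h]; last first.
    have tJ : (t \in J) = false by apply/negP.
    under eq_integral => w _ do rewrite /f /C /patch !tJ if_same.
    by rewrite integral0.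
  rewrite -/J JE => t0; have tJ : t \in J by apply/mem_set; rewrite JE.
  have mXf : measurable [set w | X t w == false] by exact: mX.
  have PXf : P [set w | X t w == false] = (1 - m t)%:E.
    rewrite EFinB -Pm// -(probability_setC P (mXt t0)).
    by congr (P _); apply/seteqP; split => w /=; case: (X t w).
  have uE : setT = [set w | X t w == false] `|` [set w | X t w].
    by apply/seteqP; split => w //= _; case: (X t w); [right|left].
  rewrite [in RHS]uE ge0_integral_setU//; last 3 first.
  - exact: mXt.
  - by rewrite -uE; exact: (measurableT_comp mfE (pair2_measurable t)).
  - by apply/disj_setPS => w /= [/eqP ->].
  have -> : (\int[P]_(w in [set w | X t w == false]) (f (w, t))%:E)%E = ((c false t)%:E * (1 - m t)%:E)%E.
    rewrite -PXf -integral_cst//; apply: eq_integral => w /set_mem /= /eqP Xw.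
    by rewrite /f /g /= Xw andbF /C /patch tJ.
  have -> : (\int[P]_(w in [set w | X t w]) (f (w, t))%:E)%E = ((c true t)%:E * (m t)%:E)%E.
    rewrite -Pm// -integral_cst//; last exact: mXt.
    apply: eq_integral => w /set_mem /= Xw.
    by rewrite /f /g /= Xw t0 /= /C /patch tJ.
  by rewrite -!EFinM -EFinD; congr EFin; ring.
by rewrite lhs rhs FT.
Qed.

End ChainLaw.

(** * The cost as a constant plus an excess *)

Section ExtendedIntegrals.
Context {R : realType}.
Local Notation leb := (@lebesgue_measure R).
Local Notation halfline := (`[0, +oo[%classic : set (measurableTypeR R)).

(** Infinite integrals are allowed, hence the detour through positive and negative parts
    of h. *)
Lemma integral_shift (C D h : R -> R) (T : R) : integrable_on 0 T h ->
  measurable_fun (`[0, T]%classic : set (measurableTypeR R)) C ->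
  measurable_fun (`[0, T]%classic : set (measurableTypeR R)) D ->
  (forall u, 0 <= u <= T -> 0 <= C u) -> (forall u, 0 <= u <= T -> 0 <= D u) ->
  (forall u, 0 <= u <= T -> C u = D u + h u) ->
  (\int[leb]_(u in `[0%R, T]) (C u)%:E = (integral_on 0 T h)%:E + \int[leb]_(u in `[0%R, T]) (D u)%:E)%E.
Proof.
move=> hi mC mD C0 D0 e.
have mI : measurable (`[0, T]%classic : set (measurableTypeR R)) by exact: measurable_itv.
pose hp u := 2^-1 * (`|h u| + h u); pose hn u := 2^-1 * (`|h u| - h u).
have ni : integrable_on 0 T (fun u => `|h u|) by exact: integrable_on_norm.
have cst (c : R) : {within `[0, T], continuous (fun=> c)} by apply: continuous_subspaceT; exact: contC.
have hpi : integrable_on 0 T hp.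
  have := integrable_onM (integrable_onD ni hi) (cst 2^-1); congr (integrable_on _ _ _).
  by apply/funext => u; rewrite /hp mulrC.
have hni : integrable_on 0 T hn.
  have := integrable_onM (integrable_onD ni (integrable_onN hi)) (cst 2^-1); congr (integrable_on _ _ _).
  by apply/funext => u; rewrite /hn mulrC.
have hp0 u : 0 <= hp u by rewrite /hp mulr_ge0 ?invr_ge0//; have := ler_norm (- h u); rewrite normrN; lra.
have hn0 u : 0 <= hn u by rewrite /hn mulr_ge0 ?invr_ge0//; have := ler_norm (h u); lra.
have mE (f : R -> R) : measurable_fun (`[0, T]%classic : set (measurableTypeR R)) f ->
    measurable_fun (`[0, T]%classic : set (measurableTypeR R)) (fun u => (f u)%:E) by move=> ?; apply/measurable_EFinP.
have mi (f : R -> R) : integrable_on 0 T f -> measurable_fun (`[0, T]%classic : set (measurableTypeR R)) (fun u => (f u)%:E).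
  by move=> /integrableP[].
have inI u : (`[0, T]%classic : set R) u -> 0 <= u <= T by rewrite /= in_itv.
have nng (f : R -> R) : (forall u, 0 <= u <= T -> 0 <= f u) ->
    forall u : R, (`[0, T]%classic : set R) u -> (0 <= (f u)%:E)%E.
  by move=> f0 u /inI /f0; rewrite lee_fin.
have L1 : (\int[leb]_(u in `[0%R, T]) ((C u)%:E + (hn u)%:E) =
    \int[leb]_(u in `[0%R, T]) (C u)%:E + (integral_on 0 T hn)%:E)%E.
  by rewrite (ge0_integralD leb mI (nng _ C0) (mE _ mC) (nng _ (fun u _ => hn0 u)) (mi _ hni)) (integral_onE hni).
have L2 : (\int[leb]_(u in `[0%R, T]) ((D u)%:E + (hp u)%:E) =
    \int[leb]_(u in `[0%R, T]) (D u)%:E + (integral_on 0 T hp)%:E)%E.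
  by rewrite (ge0_integralD leb mI (nng _ D0) (mE _ mD) (nng _ (fun u _ => hp0 u)) (mi _ hpi)) (integral_onE hpi).
have L3 : (\int[leb]_(u in `[0%R, T]) ((C u)%:E + (hn u)%:E) = \int[leb]_(u in `[0%R, T]) ((D u)%:E + (hp u)%:E))%E.
  apply: eq_integral => u /set_mem /inI hu; rewrite -!EFinD e//; congr EFin.
  by rewrite /hn /hp; field.
have -> : integral_on 0 T h = integral_on 0 T hp - integral_on 0 T hn.
  have -> : integral_on 0 T hp = integral_on 0 T (fun u => h u + hn u).
    by apply: integral_on_eq => u _; rewrite /hp /hn; field.
  by rewrite integral_onD//; ring.
have := L1; rewrite L3 L2 => /(congr1 (fun x => x - (integral_on 0 T hn)%:E)%E).
by rewrite addeK// => <-; rewrite -addeA -EFinB addeC.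
Qed.

Lemma halflineE : halfline = \bigcup_n `[0, n%:R]%classic.
Proof.
apply/seteqP; split => u /=; rewrite ?in_itv /= ?andbT.
  move=> u0; exists (Num.truncn u).+1 => //=; rewrite in_itv /= u0 /=.
  by have /andP[_ /ltW] := truncn_itv u0.
by move=> [n _] /=; rewrite in_itv => /andP[].
Qed.

Let seg_incr : {homo (fun n : nat => `[0, n%:R]%classic : set (measurableTypeR R)) : n k / (n <= k)%N >-> (n <= k)%O}.
Proof.
move=> n k nk; rewrite subsetEset => u /=; rewrite !in_itv /= => /andP[-> h] /=.
by apply: le_trans h _; rewrite ler_nat.
Qed.

Lemma integral_halfline_cvg (f : R -> R) : measurable_fun halfline f -> (forall u, 0 <= u -> 0 <= f u) ->
  (\int[leb]_(u in `[0%R, n%:R]) (f u)%:E)%E @[n --> \oo] --> (\int[leb]_(u in `[0%R, +oo[) (f u)%:E)%E.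
Proof.
move=> mf f0; rewrite [X in _ --> (\int[leb]_(u in X) _)%E]halflineE.
apply: ge0_nondecreasing_set_cvg_integral; first exact: seg_incr.
- by move=> n; exact: measurable_itv.
- move=> n; apply/measurable_EFinP; apply: measurable_funS mf; first exact: measurable_itv.
  by move=> u /=; rewrite !in_itv /= => /andP[->].
- by move=> n u /=; rewrite in_itv /= lee_fin => /andP[/f0].
Qed.

Lemma measurable_halfline (f : R -> R) : (forall T, 0 <= T -> integrable_on 0 T f) -> measurable_fun halfline f.
Proof.
move=> h; rewrite halflineE; apply/measurable_fun_bigcup; first by move=> n; exact: measurable_itv.
by move=> n; apply/measurable_EFinP; have /integrableP[] := h n%:R (ler0n _ _).
Qed.

Lemma exp_small (beta c e : R) : 0 < beta -> 0 <= c -> 0 < e ->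
  exists2 T : R, 0 <= T & forall t, T <= t -> c * expR (- beta * t) <= e.
Proof.
move=> b0 c0 e0; exists (c / e / beta); first by rewrite !divr_ge0// ltW.
move=> t Tt; have h1 : beta * t <= expR (beta * t) by apply: ltW; apply: lt_le_trans (expR_ge1Dx _); rewrite ltrDr.
have h2 : c <= e * (beta * t).
  have : c / e / beta * (e * beta) <= t * (e * beta) by rewrite ler_wpM2r// ltW// mulr_gt0.
  have -> : c / e / beta * (e * beta) = c by field; rewrite !gt_eqF.
  by move=> h; apply: le_trans h _; rewrite mulrCA (mulrC t) lexx.
apply: le_trans (_ : e * (beta * t) * expR (- beta * t) <= _); first by rewrite ler_wpM2r// expR_ge0.
rewrite -mulrA ger_pMr//; apply: le_trans (_ : expR (beta * t) * expR (- beta * t) <= _).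
  by rewrite ler_wpM2r// expR_ge0.
by rewrite -expRD mulNr addrN expR0.
Qed.

(** Corrected by the primitive of its bound, prim f is monotone and bounded. *)
Lemma discounted_limit (f : R -> R) (beta c : R) : 0 < beta -> continuous f ->
  (forall t, 0 <= t -> `|f t| <= c * expR (- beta * t)) ->
  exists l : R, prim f t @[t --> +oo] --> l.
Proof.
move=> b0 cf hf.
have c0 : 0 <= c.
  have := hf 0 (lexx 0); rewrite mulr0 expR0 mulr1; exact: le_trans.
pose E (t : R) := c * expR (- beta * t).
pose H (t : R) := prim f t + - (c / beta) * expR (- beta * t).
have dH (t : R) : is_derive t (1:R) H (f t + E t).
  have H1 := is_deriveD (is_derive_prim t cf) (is_deriveZ (- (c / beta)) (is_derive_expRM (- beta) t)).
  apply: (is_derive_eq H1); rewrite /GRing.scale /= /E; field.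
  by rewrite gt_eqF.
have cH : continuous H by move=> t; exact: is_derive_cont (dH t).
have nd x y : 0 <= x -> x <= y -> H x <= H y.
  move=> x0 xy; apply: (is_derive_nondecr xy (fun u _ => dH u)); first exact: continuous_subspaceT.
  move=> u /andP[xu _]; have := hf u (le_trans x0 (ltW xu)); rewrite ler_norml => /andP[h _].
  by rewrite /E; lra.
pose H2 (t : R) := prim f t + (c / beta) * expR (- beta * t).
have dH2 (t : R) : is_derive t (1:R) H2 (f t - E t).
  have H1 := is_deriveD (is_derive_prim t cf) (is_deriveZ (c / beta) (is_derive_expRM (- beta) t)).
  apply: (is_derive_eq H1); rewrite /GRing.scale /= /E; field.
  by rewrite gt_eqF.
have cH2 : continuous H2 by move=> t; exact: is_derive_cont (dH2 t).
have bd t : 0 <= t -> H t <= c / beta.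
  move=> t0; have h : - H2 0 <= - H2 t.
    apply: (is_derive_nondecr t0 (fun u _ => is_deriveN (dH2 u))).
      by apply: continuous_subspaceT; exact: contN.
    move=> u /andP[u0 _]; have := hf u (ltW u0); rewrite ler_norml => /andP[_ h].
    by rewrite /E; lra.
  move: h; rewrite {1}/H2 (prim0 cf) mulr0 expR0 mulr1 add0r lerN2 => h.
  apply: le_trans h; rewrite /H /H2 lerD2l mulNr -subr_ge0 opprK.
  by rewrite addr_ge0// mulr_ge0 ?expR_ge0// divr_ge0// ltW.
have [l [l1 l2]] := ndecr_bounded_limit nd bd.
exists l; apply/cvgyP => e e0; have e2 : 0 < e / 2 by rewrite divr_gt0.
have [T T0 hT] := l2 _ e2.
have cb0 : 0 <= c / beta by rewrite divr_ge0// ltW.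
have [T1 T10 hT1] := exp_small b0 cb0 e2.
exists (Num.max T T1) => t; rewrite ge_max => /andP[Tt T1t].
have t0 : 0 <= t by exact: le_trans Tt.
have small := hT1 t T1t.
have Et0 : 0 <= (c / beta) * expR (- beta * t) by rewrite mulr_ge0 ?expR_ge0.
have := l1 t t0; have := hT t Tt; rewrite /H mulNr => h1 h2.
by rewrite ler_norml; apply/andP; split; lra.
Qed.

End ExtendedIntegrals.

Section CostIdentity.
Context {R : realType}.
Local Notation leb := (@lebesgue_measure R).
Local Notation halfline := (`[0, +oo[%classic : set (measurableTypeR R)).
Variables (beta sigma kappa : R) (p a : R -> R) (A : R).
Hypotheses (beta_gt0 : 0 < beta) (kappa_gt0 : 0 < kappa).
Hypotheses (cp : continuous p) (p01 : forall t, 0 <= t -> 0 <= p t <= 1).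
Hypotheses (ca : continuous a) (ba : forall t, `|a t| <= A).
Hypothesis da : forall t : R, 0 < t ->
  is_derive t (1:R) a (fa beta (sigma ^+ 2) kappa (a t) (2 * p t - 1)).
Local Notation s := (sigma ^+ 2).

Let A0 : 0 <= A. Proof. exact: le_trans (ba 0). Qed.

Definition pos_part (x : R) : R := Num.max 0 x.

Lemma pos_part_cases (x : R) : (0 <= x /\ pos_part x = x /\ pos_part (- x) = 0) \/
  (x <= 0 /\ pos_part x = 0 /\ pos_part (- x) = - x).
Proof.
rewrite /pos_part; case: (leP 0 x) => h; [left|right]; split=> //.
- by split=> //; apply/max_idPl; rewrite oppr_le0.
- exact: ltW.
- by split=> //; apply/max_idPr; rewrite oppr_ge0 ltW.
Qed.

Lemma pos_part_ge0 (x : R) : 0 <= pos_part x. Proof. by rewrite le_max lexx. Qed.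

Lemma pos_part_continuous (f : R -> R) : continuous f -> continuous (fun t => pos_part (f t)).
Proof. by move=> cf u; exact: (@continuous_max R R (fun=> 0) f u (@contC _ R 0 u) (cf u)). Qed.

(** The feedback adds the rates a^+ in state 0 and a^- in state 1; the squares compare
    with them, and the linear terms penalize jumps against the sign of a. *)
Definition excess (alpha : R -> bool -> R) (m : R -> R) (u : R) : R := expR (- beta * u) *
  ((1 - m u) * (2^-1 * (alpha u false - pos_part (a u)) ^+ 2 + pos_part (- a u) * alpha u false) +
   m u * (2^-1 * (alpha u true - pos_part (- a u)) ^+ 2 + pos_part (a u) * alpha u true)).

Let g (u : R) : R := expR (- beta * u) *
  (kappa * (1 - p u) + s * a u - 2^-1 * pos_part (- a u) ^+ 2).

Let cexp : continuous (fun u : R => expR (- beta * u)).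
Proof. by move=> u; exact: is_derive_cont (is_derive_expRM (- beta) u). Qed.

Let cg : continuous g.
Proof.
apply: contM => //; apply: contB.
  apply: contD; apply: contM; try exact: contC; last exact: ca.
  by apply: contB => //; exact: contC.
apply: contM; first exact: contC.
have cN : continuous (fun u => pos_part (- a u)) by apply: pos_part_continuous; exact: contN.
have -> : (fun u => pos_part (- a u) ^+ 2) = (fun u => pos_part (- a u) * pos_part (- a u)).
  by apply/funext => u; rewrite expr2.
exact: contM.
Qed.

Let g_bound (t : R) : 0 <= t -> `|g t| <= (kappa + s * A + 2^-1 * A ^+ 2) * expR (- beta * t).
Proof.
move=> t0; rewrite /g normrM (ger0_norm (expR_ge0 _)) mulrC ler_wpM2r ?expR_ge0//.
have s0 : 0 <= s by rewrite sqr_ge0.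
have /andP[p0 p1] := p01 t0; have := ba t; rewrite ler_norml => /andP[a1 a2].
have k1 : 0 <= kappa * (1 - p t) by rewrite mulr_ge0 ?(ltW kappa_gt0)// subr_ge0.
have k2 : 0 <= kappa * p t by rewrite mulr_ge0 ?(ltW kappa_gt0).
have s1 : s * a t <= s * A by rewrite ler_wpM2l.
have s2 : - (s * A) <= s * a t by rewrite -mulrN ler_wpM2l.
have q1 : 0 <= pos_part (- a t) by exact: pos_part_ge0.
have q2 : pos_part (- a t) <= A by case: (pos_part_cases (a t)) => [[_ [_ ->]]|[_ [_ ->]]] //; lra.
have q3 : pos_part (- a t) ^+ 2 <= A ^+ 2 by rewrite lerXn2r ?nnegrE.
have q4 : 0 <= pos_part (- a t) ^+ 2 by rewrite sqr_ge0.
by rewrite ler_norml; apply/andP; split; lra.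
Qed.

Let b (u : R) : R := expR (- beta * u) * a u.
Let b' (u : R) : R := expR (- beta * u) * (fa beta s kappa (a u) (2 * p u - 1) - beta * a u).

Let cb : continuous b. Proof. exact: contM. Qed.

Let cb' : continuous b'.
Proof.
apply: contM => //; apply: contB; last by apply: contM => //; exact: contC.
apply: fa_continuous => //; apply: contB; last exact: contC.
by apply: contM => //; exact: contC.
Qed.

Let db (t : R) : 0 < t -> is_derive t (1:R) b (b' t).
Proof.
move=> t0; have H := is_deriveM (is_derive_expRM (- beta) t) (da t0).
by apply: (is_derive_eq H); rewrite /GRing.scale /= /b'; ring.
Qed.

(** Add the derivative of exp (- beta t) (1 - m) a along the flow of laws m to the running
    cost: the equation of a makes all terms with m disappear except the excess. *)
Lemma cost_identity : exists K : R, forall (alpha : R -> bool -> R), admissible alpha ->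
  forall (d : measure_display) (Omega : measurableType d) (P : probability Omega R)
    (X : R -> Omega -> bool), markov_chain (jump_rate sigma alpha) (p 0) P X ->
  exists m : R -> R,
  [/\ forall t, 0 <= t -> P [set w | X t w] = (m t)%:E, forall t, 0 <= t -> 0 <= m t <= 1,
      m 0 = p 0 /\ {within `[0, +oo[, continuous m},
      forall t, 0 <= t -> m t = m 0 +
        integral_on 0 t (fun u => jump_rate sigma alpha u false * (1 - m u) - jump_rate sigma alpha u true * m u) &
      measurable_fun halfline (excess alpha m) /\
      cost beta kappa p alpha P X = (K%:E + \int[leb]_(u in `[0%R, +oo[) (excess alpha m u)%:E)%E].
Proof.
have [l hl] := discounted_limit beta_gt0 cg g_bound.
exists (l + (1 - p 0) * a 0) => alpha adm d Omega P X mc.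
have ai x T : 0 <= T -> integrable_on 0 T (alpha^~ x) by move=> T0; have [_] := adm x; exact.
have a_ge0 x t : 0 <= t -> 0 <= alpha t x by have [h _] := adm x; exact: h.
have cst (c T : R) : {within `[0, T], continuous (fun=> c)} by apply: continuous_subspaceT; exact: contC.
have ri x T : 0 <= T -> integrable_on 0 T (jump_rate sigma alpha ^~ x).
  by move=> T0; apply: integrable_onD; [apply: cont_integrable; exact: cst|exact: ai].
have [m [Pm m01 m0 cm mE]] := chain_law mc ri.
exists m; split=> //.
have mI : measurable halfline by exact: measurable_itv.
have mm : measurable_fun halfline m by exact: subspace_continuous_measurable_fun.
have mcont (f : R -> R) : continuous f -> measurable_fun halfline f.
  by move=> cf; apply: measurable_funTS; exact: continuous_measurable_fun.
have mal x : measurable_fun halfline (alpha^~ x) by apply: measurable_halfline => T T0; exact: ai.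
have cpp : continuous (fun u => pos_part (a u)) by exact: pos_part_continuous.
have cpn : continuous (fun u => pos_part (- a u)) by apply: pos_part_continuous; exact: contN.
have mexp : measurable_fun halfline (fun u : R => expR (- beta * u)) by exact: mcont.
have mc1 (c : R) : measurable_fun halfline (fun=> c) by exact: mcont (@contC _ R c).
have m1m : measurable_fun halfline (fun u => 1 - m u) by exact: measurable_funB.
have mex : measurable_fun halfline (excess alpha m).
  have part x (f h : R -> R) : continuous f -> continuous h -> measurable_fun halfline
      (fun u => 2^-1 * (alpha u x - f u) ^+ 2 + h u * alpha u x).
    move=> cf ch; apply: measurable_funD; last by apply: measurable_funM => //; exact: mcont.
    apply: measurable_funM => //; apply: measurable_funX; apply: measurable_funB => //; exact: mcont.
  apply: measurable_funM => //; apply: measurable_funD; apply: measurable_funM => //; exact: part.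
pose c x (u : R) := expR (- beta * u) * (2^-1 * alpha u x ^+ 2 + kappa * running_cost x (p u)).
have mcx x : measurable_fun halfline (c x).
  apply: measurable_funM => //; apply: measurable_funD.
    by apply: measurable_funM => //; exact: measurable_funX.
  apply: measurable_funM => //; case: x => /=; last exact: mcont.
  by apply: mcont; apply: contB => //; exact: contC.
have rc0 x u : 0 <= u -> 0 <= running_cost x (p u).
  by move=> /p01/andP[h1 h2]; case: x => //=; rewrite subr_ge0.
have c0 x u : 0 <= u -> 0 <= c x u.
  move=> u0; rewrite mulr_ge0 ?expR_ge0// addr_ge0// mulr_ge0 ?invr_ge0 ?sqr_ge0//; first exact: ltW.
  exact: rc0.
split => //; rewrite /cost (expected_cost mc Pm mcx c0).
pose C (u : R) := (1 - m u) * c false u + m u * c true u.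
have mC : measurable_fun halfline C by apply: measurable_funD; exact: measurable_funM.
have C0 u : 0 <= u -> 0 <= C u.
  by move=> u0; have /andP[h1 h2] := m01 u u0; rewrite addr_ge0// mulr_ge0 ?c0// subr_ge0.
have ex0 u : 0 <= u -> 0 <= excess alpha m u.
  move=> u0; have /andP[h1 h2] := m01 u u0; rewrite mulr_ge0 ?expR_ge0//.
  have h3 : 0 <= 1 - m u by rewrite subr_ge0.
  have PP x y z : 0 <= y -> 0 <= 2^-1 * x ^+ 2 + y * alpha u z.
    by move=> y0; rewrite addr_ge0// mulr_ge0 ?invr_ge0 ?sqr_ge0// a_ge0.
  by rewrite addr_ge0// mulr_ge0//; apply: PP; exact: pos_part_ge0.
pose nu u := - (jump_rate sigma alpha u false * (1 - m u) - jump_rate sigma alpha u true * m u).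
pose n u := 1 - m u.
pose h u := g u - (nu u * b u + n u * b' u).
have sub T : (`[0, T]%classic : set R) `<=` `[0, +oo[%classic.
  by move=> u /=; rewrite !in_itv /= => /andP[->].
have wm T : {within `[0, T], continuous m} by exact: continuous_subspaceW cm.
have wn T : {within `[0, T], continuous n} by apply: wcontB => //; exact: cst.
have nui T : 0 <= T -> integrable_on 0 T nu.
  move=> T0; apply: integrable_onN; apply: integrable_onD; last apply: integrable_onN; apply: integrable_onM => //; exact: ri.
have wcont (f : R -> R) T : continuous f -> {within `[0, T], continuous f} by exact: continuous_subspaceT.
have bi T : 0 <= T -> integrable_on 0 T (fun u => nu u * b u + n u * b' u).
  move=> T0; apply: integrable_onD; first by apply: integrable_onM; [exact: nui|exact: wcont].
  by apply: integrable_onM; [exact: cont_integrable|exact: wcont].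
have gi T : integrable_on 0 T g by apply: cont_integrable; exact: wcont.
have hi T : 0 <= T -> integrable_on 0 T h.
  by move=> T0; apply: integrable_onD; [exact: gi|apply: integrable_onN; exact: bi].
have alg u : 0 <= u -> C u = excess alpha m u + h u.
  move=> u0; rewrite /C /c /excess /h /g /nu /n /b /b' /jump_rate /fa /=.
  by have [[x0 [-> ->]]|[x0 [-> ->]]] := pos_part_cases (a u); rewrite ?(ger0_norm x0) ?(ler0_norm x0); field.
have nE t T : 0 <= t <= T -> n t = n 0 + integral_on 0 t nu.
  move=> /andP[t0 _]; rewrite /n mE// /nu.
  have i1 : integrable_on 0 t (fun u => jump_rate sigma alpha u false * (1 - m u) - jump_rate sigma alpha u true * m u).
    have := integrable_onN (nui t t0); congr (integrable_on _ _ _); apply/funext => u; by rewrite /nu opprK.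
  have -> : (fun u => - (jump_rate sigma alpha u false * (1 - m u) - jump_rate sigma alpha u true * m u)) =
     (fun u => (jump_rate sigma alpha u false * (1 - m u) - jump_rate sigma alpha u true * m u) * -1).
    by apply/funext => u; rewrite mulrN1.
  by rewrite integral_onZr//; ring.
have hint T : 0 <= T -> integral_on 0 T h = prim g T - n T * b T + n 0 * b 0.
  move=> T0; have PR := product_rule T0 (nui T T0) (fun t => @nE t T) cb cb' db (wn T).
  have -> : integral_on 0 T h = integral_on 0 T g + integral_on 0 T (fun u => - (nu u * b u + n u * b' u)).
    by rewrite -integral_onD//; apply: integrable_onN; exact: bi.
  have -> : integral_on 0 T (fun u => - (nu u * b u + n u * b' u)) = integral_on 0 T (fun u => (nu u * b u + n u * b' u) * -1).
    by apply: integral_on_eq => u _; rewrite mulrN1.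
  rewrite integral_onZr; last exact: bi.
  rewrite -PR; have -> : integral_on 0 T g = prim g T.
    have cprim : continuous (prim g) by move=> u; exact: is_derive_cont (is_derive_prim u cg).
    have := ftc T0 cg cprim (fun t _ => is_derive_prim t cg).
    by rewrite integral_onE// prim0// subr0 => -[].
  ring.
have finite N : (\int[leb]_(u in `[0%R, N%:R]) (C u)%:E =
    (integral_on 0 N%:R h)%:E + \int[leb]_(u in `[0%R, N%:R]) (excess alpha m u)%:E)%E.
  apply: integral_shift; first exact: hi.
  - by apply: measurable_funS mC => //; exact: sub.
  - by apply: measurable_funS mex => //; exact: sub.
  - by move=> u /andP[/C0].
  - by move=> u /andP[/ex0].
  - by move=> u /andP[/alg].
have bB t : 0 <= t -> `|n t * b t| <= A * expR (- beta * t).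
  move=> t0; rewrite /b normrM normrM (ger0_norm (expR_ge0 _)) mulrCA mulrC ler_wpM2r ?expR_ge0//.
  have /andP[h1 h2] := m01 t t0.
  have n1 : 0 <= n t <= 1 by rewrite /n; apply/andP; split; lra.
  case/andP: n1 => n1 n2; rewrite (ger0_norm n1).
  by have := ler_wpM2r (normr_ge0 (a t)) n2; rewrite mul1r => /le_trans; apply.
have lim_h : (integral_on 0 N%:R h)%:E @[N --> \oo] --> (l + (1 - p 0) * a 0)%:E.
  apply: cvg_EFin; first by near=> N.
  apply/cvgrPdist_le => e e0; have e2 : 0 < e / 2 by rewrite divr_gt0.
  have [T1 hT1] := (proj2 (cvgyP _ _) hl) _ e2.
  have [T2 T20 hT2] := exp_small beta_gt0 A0 e2.
  near=> N.
  have N1 : T1 <= N%:R by near: N; exact: nbhs_infty_ger.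
  have N2 : T2 <= N%:R by near: N; exact: nbhs_infty_ger.
  have N0 : (0 : R) <= N%:R by exact: ler0n.
  rewrite /= (hint _ N0); have := hT1 _ N1; have := le_trans (bB _ N0) (hT2 _ N2).
  have -> : n 0 * b 0 = (1 - p 0) * a 0 by rewrite /n /b m0 mulr0 expR0 mul1r.
  rewrite !ler_norml => /andP[h1 h2] /andP[h3 h4]; apply/andP; split; lra.
apply: (cvg_unique (@ereal_hausdorff R) (integral_halfline_cvg mC C0)).
rewrite /= (eq_cvg _ _ finite); apply: cvgeD lim_h (integral_halfline_cvg mex ex0).
by rewrite fin_num_adde_defr.
Unshelve. all: by end_near. Qed.

End CostIdentity.

(** * Nash equilibria and bounded trajectories *)

Section ScalarShooting.
Context {R : realType}.
Variables (beta s kappa : R) (q : R -> R).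
Hypotheses (beta_gt0 : 0 < beta) (s_gt0 : 0 < s) (kappa_gt0 : 0 < kappa).
Hypotheses (cq : continuous q) (q1 : forall t, `|q t| <= 1).
Local Notation fa := (fa beta s kappa).
Local Notation bnd := (bnd beta s kappa).
Local Notation fat := (fat beta s kappa).
Local Notation lipc := (lipc beta s kappa).

Let bnd0 : 0 < bnd := bnd_gt0 beta_gt0 s_gt0 kappa_gt0.
Let lip0 : 0 < lipc := lipc_gt0 beta_gt0 s_gt0 kappa_gt0.

Let f (t x y : R) : R := fat t x (q t).
Let z (t x y : R) : R := 0.

Let lf t x y x' y' : `|f t x y - f t x' y'| <= lipc * (`|x - x'| + `|y - y'|).
Proof.
apply: le_trans (fat_lip beta_gt0 s_gt0 kappa_gt0 _ _ _ _ _) _.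
by rewrite subrr normr0 addr0 ler_wpM2l ?(ltW lip0)// lerDl.
Qed.
Let lz t x y x' y' : `|z t x y - z t x' y'| <= lipc * (`|x - x'| + `|y - y'|).
Proof. by rewrite /z subrr normr0 mulr_ge0 ?(ltW lip0)// addr_ge0. Qed.

Let solution c : exists x y : R -> R,
  [/\ x 0 = c, y 0 = 0, forall t, is_derive t (1:R) x (f t (x t) (y t)) &
      forall t, is_derive t (1:R) y (z t (x t) (y t))].
Proof.
apply: (@picard R f z lipc (lipc * (bnd + 1))) => //.
- by move=> t x y; exact: fat_bound.
- by move=> t x y; rewrite /z normr0 mulr_ge0 ?(ltW lip0)// addr_ge0// ltW.
- move=> x y cx cy.
  have h := @fa_continuous R beta s kappa _ _ (clamp_comp_continuous (ltW bnd0) cx) (clamp_comp_continuous ler01 cq).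
  exact: h.
- by move=> x y _ _; exact: contC.
Qed.

Let traj c : R -> R := projT1 (cid (solution c)).
Let aux c : R -> R := projT1 (cid (projT2 (cid (solution c)))).
Let trajP c : [/\ traj c 0 = c, aux c 0 = 0, forall t, is_derive t (1:R) (traj c) (f t (traj c t) (aux c t)) &
      forall t, is_derive t (1:R) (aux c) (z t (traj c t) (aux c t))].
Proof. exact: (projT2 (cid (projT2 (cid (solution c))))). Qed.

Let ct c : continuous (traj c).
Proof. by have [_ _ d _] := trajP c; move=> t; exact: is_derive_cont (d t). Qed.

Let close c (t d : R) : 0 <= t -> 0 < d ->
  exists2 r : R, 0 < r & forall c', `|c' - c| < r -> `|traj c' t - traj c t| < d.
Proof.
move=> t0 d0; have E0 := expR_gt0 (2 * lipc * t).
exists (d / expR (2 * lipc * t)); first by rewrite divr_gt0.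
move=> c' hc; have [a1 b1 d1 e1] := trajP c; have [a2 b2 d2 e2] := trajP c'.
have [+ _] := dist_growth (ltW lip0) lf lz t0 (solves_global 0 t d2 e2) (solves_global 0 t d1 e1).
rewrite /sqdist a1 a2 b1 b2 subrr mulr0 addr0 subr0 => h.
have h2 : (traj c' t - traj c t) ^+ 2 <= (c' - c) ^+ 2 * expR (4 * lipc * t).
  by rewrite !expr2; apply: le_trans h; rewrite lerDl -expr2 sqr_ge0.
have h3 : (c' - c) ^+ 2 * expR (4 * lipc * t) < d ^+ 2.
  have -> : 4 * lipc * t = 2 * lipc * t + 2 * lipc * t by ring.
  rewrite expRD -expr2 -exprMn -[X in X < _]real_normK ?num_real// normrM (gtr0_norm E0).
  by rewrite ltrXn2r ?nnegrE ?mulr_ge0 ?(ltW E0) ?(ltW d0)// -ltr_pdivlMr.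
rewrite ltNge; apply/negP => hd; have := le_lt_trans h2 h3.
by rewrite ltNge -[X in _ <= X]real_normK ?num_real// !expr2 ler_pM ?(ltW d0).
Qed.

Let f_above t x y : bnd < x -> 0 <= f t x y.
Proof.
move=> h; rewrite /f /fat /fa (clamp_id (q1 t)).
have -> : clamp bnd x = bnd.
  by case: (clamp_cases x (ltW bnd0)) => -[h1 h2] //; move: bnd0; lra.
rewrite (gtr0_norm bnd0) bndE//; have := ler_norm (q t); have := q1 t => h1 h2.
have h3 : kappa * q t <= kappa * 1 by rewrite ler_wpM2l// ?(ltW kappa_gt0)// (le_trans h2).
have h4 : 0 <= 2^-1 * (bnd * bnd) by rewrite mulr_ge0 ?invr_ge0// mulr_ge0// ltW.
by lra.
Qed.

Let f_below t x y : x < - bnd -> f t x y <= 0.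
Proof.
move=> h; rewrite /f /fat /fa (clamp_id (q1 t)).
have -> : clamp bnd x = - bnd.
  by case: (clamp_cases x (ltW bnd0)) => -[h1 h2] //; move: bnd0; lra.
rewrite normrN (gtr0_norm bnd0) mulrN bndE//; have := ler_norm (- q t); have := q1 t; rewrite normrN => h1 h2.
have h3 : kappa * - q t <= kappa * 1 by rewrite ler_wpM2l// ?(ltW kappa_gt0)// (le_trans h2).
have h4 : 0 <= 2^-1 * (bnd * bnd) by rewrite mulr_ge0 ?invr_ge0// mulr_ge0// ltW.
by lra.
Qed.

Let stays_above c (t t' : R) : t <= t' -> bnd < traj c t -> bnd < traj c t'.
Proof.
move=> tt h; have [_ _ d _] := trajP c.
by apply: (lt_le_trans h); apply: (barrier (@ct c) tt h (fun u _ => d u)) => u _; exact: f_above.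
Qed.

Let stays_below c (t t' : R) : t <= t' -> traj c t < - bnd -> traj c t' < - bnd.
Proof.
move=> tt; rewrite -ltrNr => h; have [_ _ d _] := trajP c.
rewrite -ltrNr; apply: (lt_le_trans h).
apply: (barrier (contN (@ct c)) tt h (fun u _ => is_deriveN (d u))) => u _.
by rewrite ltrNr oppr_ge0 => /f_below; apply.
Qed.

(** Initial values that are too large blow up to +oo, those that are too small to -oo, and
    both sets are open. *)
Lemma bounded_value_difference : exists a : R -> R, [/\ continuous a, forall t, 0 <= t -> `|a t| <= bnd &
  forall t : R, 0 <= t -> is_derive t (1:R) a (fa (a t) (q t))].
Proof.
pose O1 c := exists2 t, 0 <= t & bnd < traj c t.
pose O2 c := exists2 t, 0 <= t & traj c t < - bnd.
have lh : - (bnd + 1) <= bnd + 1 by have := ltW bnd0; lra.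
have E1 : O1 (bnd + 1) by exists 0 => //; have [-> _ _ _] := trajP (bnd + 1); rewrite ltrDl.
have E2 : O2 (- (bnd + 1)).
  by exists 0 => //; have [-> _ _ _] := trajP (- (bnd + 1)); rewrite ltrN2 ltrDl.
have op1 c : O1 c -> exists2 d : R, 0 < d & forall c', `|c' - c| < d -> O1 c'.
  move=> [t t0 h]; have d0 : 0 < traj c t - bnd by rewrite subr_gt0.
  have [r r0 hr] := @close c t _ t0 d0; exists r => // c' /hr h'; exists t => //.
  by move: h'; rewrite ltr_norml => /andP[h1 _]; lra.
have op2 c : O2 c -> exists2 d : R, 0 < d & forall c', `|c' - c| < d -> O2 c'.
  move=> [t t0 h]; have d0 : 0 < - bnd - traj c t by rewrite subr_gt0.
  have [r r0 hr] := @close c t _ t0 d0; exists r => // c' /hr h'; exists t => //.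
  by move: h'; rewrite ltr_norml => /andP[_ h1]; lra.
have dis c : O1 c -> O2 c -> False.
  move=> [t t0 h] [t' t'0 h']; case: (leP t t') => tt.
    by have := stays_above tt h; move: h' bnd0; lra.
  by have := stays_below (ltW tt) h'; move: h bnd0; lra.
have [c _ [n1 n2]] := shooting lh E1 E2 (fun c _ => op1 c) (fun c _ => op2 c) dis.
have bd t : 0 <= t -> `|traj c t| <= bnd.
  move=> t0; rewrite ler_norml; apply/andP; split; rewrite leNgt; apply/negP => h.
    by apply: n2; exists t.
  by apply: n1; exists t.
exists (traj c); split => // t t0; have [_ _ d _] := trajP c.
by have := d t; rewrite /f /fat !clamp_id// bd.
Qed.

End ScalarShooting.

Section Equilibrium.
Context {R : realType}.
Local Notation leb := (@lebesgue_measure R).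
Local Notation halfline := (`[0, +oo[%classic : set (measurableTypeR R)).

(** Data on the half line are extended to the line by their value at 0. *)
Definition hold (f : R -> R) (t : R) : R := f (Num.max 0 t).

Lemma hold_id (f : R -> R) (t : R) : 0 <= t -> hold f t = f t.
Proof. by move=> t0; rewrite /hold (max_idPr t0). Qed.

Lemma hold_continuous (f : R -> R) : {within `[0, +oo[, continuous f} -> continuous (hold f).
Proof. exact: max0_continuous. Qed.

Lemma hold_derive (f : R -> R) (t l : R) : 0 < t -> is_derive t (1:R) f l -> is_derive t (1:R) (hold f) l.
Proof.
move=> t0; apply: (@is_derive_ext_near R f (hold f) t l t t0) => u.
by rewrite ltr_norml => /andP[h _]; rewrite hold_id//; lra.
Qed.

Variables (beta sigma kappa : R).
Hypotheses (beta_gt0 : 0 < beta) (s_gt0 : 0 < sigma ^+ 2) (kappa_gt0 : 0 < kappa).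
Local Notation s := (sigma ^+ 2).
Local Notation fa := (fa beta s kappa).
Local Notation bnd := (bnd beta s kappa).

Lemma cost_hold p alpha d (Omega : measurableType d) (P : probability Omega R) X :
  cost beta kappa (hold p) alpha P X = cost beta kappa p alpha P X.
Proof.
rewrite /cost; apply: eq_integral => w _; apply: eq_integral => t /set_mem /=.
by rewrite in_itv /= andbT => t0; rewrite hold_id.
Qed.

(** The optimal control when the difference of the values in the two states is a. *)
Definition feedback (a : R -> R) (t : R) (x : bool) : R := if x then pos_part (- a t) else pos_part (a t).

Lemma feedback_continuous (a : R -> R) x : continuous a -> continuous (feedback a ^~ x).
Proof. by move=> ca; case: x; apply: pos_part_continuous => //; exact: contN. Qed.

Lemma feedback_bounds (a : R -> R) (A t : R) x : (forall t, `|a t| <= A) -> 0 <= feedback a t x <= A.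
Proof.
move=> ba; have := ba t; rewrite ler_norml => /andP[h1 h2].
have A0 : 0 <= A by exact: le_trans (ba 0).
by case: x; rewrite /feedback pos_part_ge0 /=; case: (pos_part_cases (a t)) => [[_ [e1 e2]]|[_ [e1 e2]]]; rewrite ?e1 ?e2; lra.
Qed.

Lemma feedback_admissible (a : R -> R) (A : R) : continuous a -> (forall t, `|a t| <= A) -> admissible (feedback a).
Proof.
move=> ca ba x; split; first by move=> t _; have /andP[] := @feedback_bounds a A t x ba.
move=> T T0; apply: cont_integrable; apply: continuous_subspaceT; exact: feedback_continuous.
Qed.

Lemma feedback_excess (a m : R -> R) (u : R) : excess beta a (feedback a) m u = 0.
Proof.
rewrite /excess /feedback !subrr expr0n /= mulr0.
by case: (pos_part_cases (a u)) => [[_ [-> ->]]|[_ [-> ->]]]; ring.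
Qed.

Lemma feedback_chain (a : R -> R) (A m0 : R) : continuous a -> (forall t, `|a t| <= A) -> 0 <= m0 <= 1 ->
  exists X : R -> measurableTypeR R -> bool, markov_chain (jump_rate sigma (feedback a)) m0 unif X.
Proof.
move=> ca ba m01; apply: (@chain_exists R _ (s + A)) => // [x|t x].
  by apply: contD; [exact: contC|exact: feedback_continuous].
have /andP[h1 h2] := @feedback_bounds a A t x ba.
by rewrite /jump_rate addr_ge0 ?(ltW s_gt0)//= lerD2l.
Qed.

(** With continuous coefficients the forward equation in integral form is an ordinary
    differential equation. *)
Lemma forward_derive (m F : R -> R) : continuous F ->
  (forall t : R, 0 <= t -> m t = m 0 + integral_on 0 t F) ->
  forall t : R, 0 < t -> is_derive t (1:R) m (F t).
Proof.
move=> cF mE t t0.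
have d : is_derive t (1:R) (fun u => m 0 + prim F u) (F t).
  have H := is_deriveD (is_derive_cst (m 0) t (1:R)) (is_derive_prim t cF).
  by apply: (is_derive_eq H); rewrite add0r.
apply: (@is_derive_ext_near R _ m t _ t t0) d => u; rewrite ltr_norml => /andP[h _].
have u0 : 0 <= u by lra.
rewrite [RHS]mE//; congr (_ + _).
have cprim : continuous (prim F) by move=> v; exact: is_derive_cont (is_derive_prim v cF).
have := ftc u0 cF cprim (fun v _ => is_derive_prim v cF).
by rewrite (prim0 cF) subr0 => H; rewrite /integral_on /Rintegral H.
Qed.

(** The feedback is admissible and its excess is zero, so the excess of an optimal control
    is zero almost everywhere; wherever the state has positive probability the control is
    the feedback, and the forward equation becomes the equation for q. *)
Theorem nash_trajectory q : nash beta sigma kappa q -> exists a, bounded_trajectory beta sigma kappa a q.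
Proof.
case=> p01 [alpha] [adm] [disp] [Om] [P] [X] [mc Pp opt].
pose p (t : R) := (q t + 1) / 2; rewrite -/p in mc Pp opt p01.
have ri x T : 0 <= T -> integrable_on 0 T (jump_rate sigma alpha ^~ x).
  move=> T0; apply: integrable_onD; last by have [_] := adm x; exact.
  by apply: cont_integrable; apply: continuous_subspaceT; exact: contC.
have wp : {within `[0, +oo[, continuous p}.
  have [m [Pm _ _ cm _]] := chain_law mc ri.
  apply: (subspace_eq_continuous _ cm) => t; rewrite inE /= in_itv /= andbT => t0.
  by have := Pm t t0; rewrite Pp// => -[].
pose pe := hold p; have cpe : continuous pe := hold_continuous wp.
have pe01 t : 0 <= t -> 0 <= pe t <= 1 by move=> t0; rewrite /pe hold_id// p01.
have pe01' t : 0 <= pe t <= 1 by rewrite /pe /hold p01// le_max lexx.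
pose qe t := 2 * pe t - 1.
have cqe : continuous qe by apply: contB; [apply: contM => //|]; exact: contC.
have qe1 t : `|qe t| <= 1.
  by have /andP[h1 h2] := pe01' t; rewrite /qe ler_norml; apply/andP; split; lra.
have [a [ca ba da]] := bounded_value_difference beta_gt0 s_gt0 kappa_gt0 cqe qe1.
pose ae := hold a.
have cae : continuous ae by apply: hold_continuous; exact: continuous_subspaceT.
have bae t : `|ae t| <= bnd by rewrite /ae /hold ba// le_max lexx.
have dae (t : R) : 0 < t -> is_derive t (1:R) ae (fa (ae t) (2 * pe t - 1)).
  by move=> t0; rewrite {2}/ae hold_id ?ltW//; apply: hold_derive => //; apply: da; exact: ltW.
have [K HK] := cost_identity beta_gt0 kappa_gt0 cpe pe01 cae bae dae.
have pe0 : pe 0 = p 0 by rewrite /pe hold_id.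
have [X' mc'] := @feedback_chain ae bnd (pe 0) cae bae (pe01' 0).
have adm' := feedback_admissible cae bae.
have mcE : markov_chain (jump_rate sigma alpha) (pe 0) P X by rewrite pe0.
have [m [Pm m01 [m0 cm] mE [mex costE]]] := HK _ adm _ _ _ _ mcE.
have [m' [_ _ _ _ [_ costE']]] := HK _ adm' _ _ _ _ mc'.
have mp t : 0 <= t -> m t = pe t.
  by move=> t0; have := Pm t t0; rewrite Pp// /pe hold_id// => -[].
have opt' : (cost beta kappa pe alpha P X <= cost beta kappa pe (feedback ae) unif X')%E.
  by rewrite !cost_hold; apply: (opt _ adm'); move: mc'; rewrite pe0.
rewrite costE costE' in opt'.
have z0 : (\int[leb]_(u in `[0%R, +oo[) (excess beta ae (feedback ae) m' u)%:E)%E = 0%E.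
  by under eq_integral => u _ do rewrite feedback_excess; rewrite integral0.
rewrite z0 adde0 in opt'.
have al0 x t : 0 <= t -> 0 <= alpha t x by have [h _] := adm x; exact: h.
have ex0 u : 0 <= u -> 0 <= excess beta ae alpha m u.
  move=> u0; have /andP[h1 h2] := m01 u u0; rewrite mulr_ge0 ?expR_ge0//.
  have h3 : 0 <= 1 - m u by rewrite subr_ge0.
  have PP x y z : 0 <= y -> 0 <= 2^-1 * x ^+ 2 + y * alpha u z.
    by move=> y0; rewrite addr_ge0// mulr_ge0 ?invr_ge0 ?sqr_ge0// al0.
  by rewrite addr_ge0// mulr_ge0//; apply: PP; exact: pos_part_ge0.
have mH : measurable halfline by exact: measurable_itv.
have int0 : (\int[leb]_(u in `[0%R, +oo[) `|(excess beta ae alpha m u)%:E|)%E = 0%E.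
  have -> : (\int[leb]_(u in `[0%R, +oo[) `|(excess beta ae alpha m u)%:E|)%E = (\int[leb]_(u in `[0%R, +oo[) (excess beta ae alpha m u)%:E)%E.
    apply: eq_integral => u /set_mem /=; rewrite in_itv /= andbT => u0.
    by rewrite ger0_norm// ex0.
  apply/eqP; rewrite eq_le; apply/andP; split; last first.
    by apply: integral_ge0 => u /=; rewrite in_itv /= andbT lee_fin; exact: ex0.
  by move: opt'; rewrite -[leRHS]adde0 leeD2lE.
have /ae_eq_integral_abs ae0 := int0.
have {}ae0 := ae0 mH (proj2 (measurable_EFinP _ _) mex).
pose F (u : R) := (s + pos_part (ae u)) * (1 - pe u) - (s + pos_part (- ae u)) * pe u.
have cpos : continuous (fun u => pos_part (ae u)) by exact: pos_part_continuous.
have cneg : continuous (fun u => pos_part (- ae u)) by apply: pos_part_continuous; exact: contN.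
have cF : continuous F.
  apply: contB; apply: contM => //; try (apply: contD => //; exact: contC).
  by apply: contB => //; exact: contC.
have pE t : 0 <= t -> pe t = pe 0 + integral_on 0 t F.
  move=> t0; rewrite -mp// mE// mp//; congr (_ + _).
  have sub : (`[0, t]%classic : set R) `<=` `[0, +oo[%classic by move=> u /=; rewrite !in_itv /= => /andP[->].
  have wm : {within `[0, t], continuous m} by exact: continuous_subspaceW cm.
  have cst (c : R) : {within `[0, t], continuous (fun=> c)} by apply: continuous_subspaceT; exact: contC.
  have i1 : integrable_on 0 t (fun u => jump_rate sigma alpha u false * (1 - m u) - jump_rate sigma alpha u true * m u).
    apply: integrable_onD; last apply: integrable_onN; apply: integrable_onM => //; try exact: ri.
    exact: wcontB (cst 1) wm.
  have i2 : integrable_on 0 t F by apply: cont_integrable; exact: continuous_subspaceT.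
  rewrite /integral_on /Rintegral; congr fine.
  have mI : measurable (`[0, t]%classic : set (measurableTypeR R)) by exact: measurable_itv.
  have [mi1 _] := integrableP _ _ _ i1; have [mi2 _] := integrableP _ _ _ i2.
  apply: (ae_eq_integral _ _ mI mi1 mi2).
  case: ae0 => N [mN N0 hN]; exists N; split => // u /= hu; apply: hN => /= h; apply: hu => ut.
  have u0 : 0 <= u by move: ut; rewrite /= in_itv /= => /andP[].
  have := h (sub u ut) => -[e].
  have {}e : (1 - m u) * (2^-1 * (alpha u false - pos_part (ae u)) ^+ 2 + pos_part (- ae u) * alpha u false) +
     m u * (2^-1 * (alpha u true - pos_part (- ae u)) ^+ 2 + pos_part (ae u) * alpha u true) = 0.
    by move/eqP: e; rewrite mulf_eq0 gt_eqF ?expR_gt0//= => /eqP.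
  have /andP[h1 h2] := m01 u u0; have h3 : 0 <= 1 - m u by rewrite subr_ge0.
  have k1 : 0 <= (1 - m u) * (pos_part (- ae u) * alpha u false) by rewrite !mulr_ge0 ?pos_part_ge0 ?al0.
  have k2 : 0 <= m u * (pos_part (ae u) * alpha u true) by rewrite !mulr_ge0 ?pos_part_ge0 ?al0.
  have k3 : 0 <= (1 - m u) * (alpha u false - pos_part (ae u)) ^+ 2 by rewrite mulr_ge0 ?sqr_ge0.
  have k4 : 0 <= m u * (alpha u true - pos_part (- ae u)) ^+ 2 by rewrite mulr_ge0 ?sqr_ge0.
  have z1 : (1 - m u) * (alpha u false - pos_part (ae u)) ^+ 2 = 0 by lra.
  have z2 : m u * (alpha u true - pos_part (- ae u)) ^+ 2 = 0 by lra.
  have y1 : (1 - m u) * (alpha u false - pos_part (ae u)) = 0.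
    by move/eqP: z1; rewrite mulf_eq0 sqrf_eq0 -mulf_eq0 => /eqP.
  have y2 : m u * (alpha u true - pos_part (- ae u)) = 0.
    by move/eqP: z2; rewrite mulf_eq0 sqrf_eq0 -mulf_eq0 => /eqP.
  congr EFin; rewrite /F /jump_rate -mp//; lra.
have dpe := forward_derive cF pE.
have qE t : 0 <= t -> q t = qe t.
  by move=> t0; rewrite /qe /pe hold_id// /p; field.
exists a; split; last by exists bnd.
split.
- exact: continuous_subspaceT.
- apply: (subspace_eq_continuous _ (continuous_subspaceT cqe)) => t; rewrite inE /= in_itv /= andbT => t0.
  exact: esym (qE t t0).
- by move=> t t0; rewrite field_aE qE ?ltW//; apply: da; exact: ltW.
- move=> t t0; rewrite field_qE qE ?ltW//.
  have H : is_derive t (1:R) qe (2 * F t - 0).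
    have H1 := is_deriveB (is_deriveZ 2 (dpe t t0)) (is_derive_cst (1:R) t (1:R)); exact: (is_derive_eq H1).
  apply: (@is_derive_ext_near R qe q t _ t t0).
    by move=> u; rewrite ltr_norml => /andP[h _]; rewrite qE//; lra.
  apply: (is_derive_eq H); rewrite /fq /F /qe /ae hold_id ?ltW//.
  by have [[x0 [-> ->]]|[x0 [-> ->]]] := pos_part_cases (a t); rewrite ?(ger0_norm x0) ?(ler0_norm x0); ring.
- by move=> t t0; rewrite /phase_space /= qE// -ler_norml.
Qed.

(** The law of the chain controlled by the feedback solves the same linear equation as
    q, and every other control has a nonnegative excess. *)
Theorem trajectory_nash a q : bounded_trajectory beta sigma kappa a q -> nash beta sigma kappa q.
Proof.
move=> [[ca cq da dq ph] [M hM]].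
pose p (t : R) := (q t + 1) / 2.
have p01 t : 0 <= t -> 0 <= p t <= 1.
  by move=> /ph; rewrite /phase_space /p /= => /andP[h1 h2]; apply/andP; split; lra.
pose pe := hold p; pose ae := hold a; pose qe := hold q.
have cae : continuous ae := hold_continuous ca.
have cqe : continuous qe := hold_continuous cq.
have peE t : pe t = (qe t + 1) / 2 by [].
have cpe : continuous pe.
  by apply: contM; [apply: contD => //|]; exact: contC.
have pe01 t : 0 <= t -> 0 <= pe t <= 1 by move=> t0; rewrite /pe hold_id// p01.
have bae t : `|ae t| <= M by rewrite /ae /hold hM// le_max lexx.
have qpe t : 2 * pe t - 1 = qe t by rewrite peE; field.
have dae (t : R) : 0 < t -> is_derive t (1:R) ae (fa (ae t) (2 * pe t - 1)).
  move=> t0; rewrite qpe; have := hold_derive t0 (da t t0).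
  by rewrite field_aE /ae /qe !hold_id ?ltW.
have dqe (t : R) : 0 < t -> is_derive t (1:R) qe (fq s (ae t) (qe t)).
  by move=> t0; have := hold_derive t0 (dq t t0); rewrite field_qE /ae /qe !hold_id ?ltW.
have [K HK] := cost_identity beta_gt0 kappa_gt0 cpe pe01 cae bae dae.
have adm := feedback_admissible cae bae.
have [X mc] := @feedback_chain ae M (pe 0) cae bae (pe01 0 (lexx 0)).
have [m [Pm m01 [m0 cm] mE [_ costE]]] := HK _ adm _ _ _ _ mc.
(* the law of the chain and p solve the same linear equation *)
pose me := hold m; have cme : continuous me := hold_continuous cm.
pose F (u : R) := (s + pos_part (ae u)) * (1 - me u) - (s + pos_part (- ae u)) * me u.
have cpos : continuous (fun u => pos_part (ae u)) by exact: pos_part_continuous.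
have cneg : continuous (fun u => pos_part (- ae u)) by apply: pos_part_continuous; exact: contN.
have cF : continuous F.
  apply: contB; apply: contM => //; try (apply: contD => //; exact: contC).
  by apply: contB => //; exact: contC.
have dm : forall t : R, 0 < t -> is_derive t (1:R) m (F t).
  apply: forward_derive => // t t0; rewrite {1}mE//; congr (_ + _).
  by apply: integral_on_eq => u /andP[u0 _]; rewrite /F /me hold_id.
have mp t : 0 <= t -> m t = pe t.
  move=> t0; pose D u := (m u - pe u) * (m u - pe u).
  have dD (u : R) : 0 < u < t -> is_derive u (1:R) D (- (2 * (2 * s + `|ae u|)) * D u).
    move=> /andP[u0 _].
    have dp : is_derive u (1:R) pe (2^-1 * fq s (ae u) (qe u)).
      have H := is_deriveM (is_deriveD (dqe u u0) (is_derive_cst (1:R) u (1:R))) (is_derive_cst (2^-1:R) u (1:R)).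
      by apply: (is_derive_eq H); rewrite /GRing.scale /= mulr0 add0r addr0.
    have d := is_deriveB (dm u u0) dp; have H := is_deriveM d d.
    apply: (is_derive_eq H); rewrite /GRing.scale /= -[(m - pe) u]/(m u - pe u) /D /F /fq -qpe /me hold_id ?ltW//.
    by have [[x0 [-> ->]]|[x0 [-> ->]]] := pos_part_cases (ae u); rewrite ?(ger0_norm x0) ?(ler0_norm x0); field.
  have wD : {within `[0, t], continuous D}.
    have sub : (`[0, t]%classic : set R) `<=` `[0, +oo[%classic by move=> u /=; rewrite !in_itv /= => /andP[->].
    have c1 : {within `[0, t], continuous (fun u => m u - pe u)}.
      by apply: wcontB; [exact: continuous_subspaceW cm|exact: continuous_subspaceT].
    exact: wcontM.
  have := gronwall_upper (c := 0) t0 dD wD.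
  have -> : D 0 = 0 by rewrite /D m0 subrr mulr0.
  rewrite mul0r => h; have : D t <= 0.
    apply: h => u _; rewrite mul0r mulNr oppr_le0 mulr_ge0//; last by rewrite /D -expr2 sqr_ge0.
    by rewrite mulr_ge0// addr_ge0// mulr_ge0// ltW.
  rewrite /D -expr2 => h'; apply/eqP; rewrite -subr_eq0 -sqrf_eq0 eq_le h' sqr_ge0//.
have pe0 : pe 0 = (q 0 + 1) / 2 by rewrite /pe hold_id.
split; first exact: p01.
exists (feedback ae); split => //; exists _, (measurableTypeR R), unif, X; split.
- by rewrite -pe0.
- by move=> t t0; rewrite Pm// mp// /pe hold_id.
move=> alpha' adm' d' Omega' P' X'; rewrite -pe0 => mc'.
have [m' [_ m01' _ _ [_ costE']]] := HK _ adm' _ _ _ _ mc'.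
rewrite -(cost_hold p (feedback ae)) -(cost_hold p alpha') costE costE'.
apply: leeD2l.
have -> : (\int[leb]_(u in `[0%R, +oo[) (excess beta ae (feedback ae) m u)%:E)%E = 0%E.
  by under eq_integral => u _ do rewrite feedback_excess; rewrite integral0.
apply: integral_ge0 => u /=; rewrite in_itv /= andbT lee_fin => u0.
have al0 x t : 0 <= t -> 0 <= alpha' t x by have [h _] := adm' x; exact: h.
have /andP[h1 h2] := m01' u u0; rewrite mulr_ge0 ?expR_ge0//.
have h3 : 0 <= 1 - m' u by rewrite subr_ge0.
have PP x y z : 0 <= y -> 0 <= 2^-1 * x ^+ 2 + y * alpha' u z.
  by move=> y0; rewrite addr_ge0// mulr_ge0 ?invr_ge0 ?sqr_ge0// al0.
by rewrite addr_ge0// mulr_ge0//; apply: PP; exact: pos_part_ge0.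
Qed.

End Equilibrium.

(** * Stationary points and equilibria on the curve *)

Section SelfOrganized.
Context {R : realType}.
Variables (beta sigma kappa : R).
Hypotheses (beta_gt0 : 0 < beta) (s_gt0 : 0 < sigma ^+ 2) (kappa_gtc : kappa_c beta sigma < kappa).
Local Notation s := (sigma ^+ 2).
Local Notation ab := (abar beta sigma kappa).
Local Notation qb := (qbar beta sigma kappa).

Let B0 : 0 < beta + 3 * s. Proof. by rewrite addr_gt0// mulr_gt0. Qed.

Lemma kappa_cE : kappa_c beta sigma = 2 * beta * s + 4 * s * s.
Proof. by rewrite /kappa_c; ring. Qed.

Let disc0 : 0 < (beta + 3 * s) ^+ 2 + 2 * (kappa - kappa_c beta sigma).
Proof. by rewrite addr_gt0 ?exprn_gt0// mulr_gt0// subr_gt0. Qed.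

Lemma abar_gt0 : 0 < ab.
Proof.
rewrite /abar addrC subr_gt0 -{1}(gtr0_norm B0) -sqrtr_sqr ltr_sqrt//.
by rewrite ltrDl mulr_gt0// subr_gt0.
Qed.

Lemma abar_root : 2^-1 * ab * ab + (beta + 3 * s) * ab + 2 * beta * s + 4 * s * s = kappa.
Proof.
have := sqr_sqrtr (ltW disc0); rewrite kappa_cE /abar kappa_cE.
set D := Num.sqrt _ => h.
have -> : 2^-1 * (- (beta + 3 * s) + D) * (- (beta + 3 * s) + D) + (beta + 3 * s) * (- (beta + 3 * s) + D) + 2 * beta * s + 4 * s * s =
  2^-1 * (D ^+ 2 - (beta + 3 * s) ^+ 2) + 2 * beta * s + 4 * s * s by field.
by rewrite h; field.
Qed.

Lemma qbar_ratio : qb = ab / (ab + 2 * s). Proof. by []. Qed.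

Hypothesis kappa_gt0 : 0 < kappa.

(** The q-component vanishes only on a = a0 q, and there the a-component vanishes at
    three heights only. *)
Lemma stationary_points z : phase_space z ->
  (stationary_point beta sigma kappa z <-> [\/ z = (- ab, - qb), z = (0, 0) | z = (ab, qb)]).
Proof.
case: z => a q; rewrite /phase_space /stationary_point /= -ler_norml field_aE field_qE => q1.
have st := fa_stat s_gt0 abar_gt0 qbar_ratio abar_root.
have sq := fq_stat s_gt0 abar_gt0 qbar_ratio.
split; last first.
  case=> -[-> ->]; rewrite ?fa_odd ?fq_odd ?st ?sq ?oppr0//.
  by rewrite /fa /fq normr0; split; ring.
move=> [fa0 fq0].
have ql : `|q| < 1.
  rewrite lt_neqAle q1 andbT; apply/eqP => e.
  have h : a = (2 * s + `|a|) * q by move: fq0; rewrite /fq => /eqP; rewrite subr_eq0 => /eqP.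
  have p : 0 <= 2 * s + `|a| by rewrite addr_ge0// mulr_ge0// ltW.
  have := congr1 Num.norm h; rewrite normrM e mulr1 (ger0_norm p).
  by move: s_gt0; lra.
have ea : a = a0 s q.
  have := fq_ge s_gt0 a ql; rewrite fq0 normr0 pmulr_rle0 ?subr_gt0// normr_le0 subr_eq0.
  by move/eqP.
have aq := a0_qb s_gt0 abar_gt0 qbar_ratio.
have fa0' : fa beta s kappa (a0 s q) q = 0 by rewrite -ea.
case: (a0_zero beta_gt0 s_gt0 abar_gt0 qbar_ratio abar_root ql fa0') => e.
- by constructor 2; rewrite ea e a0_0.
- by constructor 3; rewrite ea e aq.
- by constructor 1; rewrite ea e a0N aq.
Qed.

End SelfOrganized.

Section Equilibria.
Context {R : realType}.
Variables (beta sigma kappa : R).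
Hypotheses (beta_gt0 : 0 < beta) (s_gt0 : 0 < sigma ^+ 2) (kappa_gt0 : 0 < kappa).
Local Notation s := (sigma ^+ 2).
Local Notation pa := (pa beta s kappa).
Local Notation pq := (pq beta s kappa).
Local Notation stays := (stays beta s kappa).

Lemma nash_flow q : nash beta sigma kappa q -> exists a : R -> R,
  [/\ bounded_trajectory beta sigma kappa a q, stays (a 0, q 0) &
      forall t, 0 <= t -> a t = pa (a 0, q 0) t /\ q t = pq (a 0, q 0) t].
Proof.
move=> /(nash_trajectory beta_gt0 s_gt0 kappa_gt0)[a h]; exists a.
by have [h1 h2] := bounded_trajectory_flow beta_gt0 s_gt0 kappa_gt0 h.
Qed.

Lemma flow_nash z : stays z -> nash_from beta sigma kappa z.2 (pq z).
Proof.
move=> h; split; last exact: pq0.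
apply: (trajectory_nash beta_gt0 s_gt0 kappa_gt0).
exact: (flow_bounded_trajectory beta_gt0 s_gt0 kappa_gt0 h).
Qed.

(** A Nash equilibrium is determined by the initial point of its trajectory. *)
Lemma unique_nash (q0 : R) z : stays z -> z.2 = q0 ->
  (forall z', stays z' -> z'.2 = q0 -> z' = z) -> unique_nash_from beta sigma kappa q0.
Proof.
move=> hz e u; split; first by exists (pq z); rewrite -e; exact: flow_nash.
move=> q1 q2 [/nash_flow[a1 [_ s1 f1]] e1] [/nash_flow[a2 [_ s2 f2]] e2] t t0.
have [_ ->] := f1 t t0; have [_ ->] := f2 t t0.
by rewrite (u _ s1 e1) (u _ s2 e2).
Qed.

Lemma cvg_ge0 (f g : R -> R) (l : R) : (forall t, 0 <= t -> f t = g t) ->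
  f t @[t --> +oo] --> l -> g t @[t --> +oo] --> l.
Proof.
move=> e /cvgyP h; apply/cvgyP => r /h[T hT]; exists (Num.max 0 T) => t.
by rewrite ge_max => /andP[t0 tT]; rewrite -e//; exact: hT.
Qed.

Variables (ab qb : R).
Hypotheses (ab_gt0 : 0 < ab) (qbE : qb = ab / (ab + 2 * s)).
Hypothesis abE : 2^-1 * ab * ab + (beta + 3 * s) * ab + 2 * beta * s + 4 * s * s = kappa.
Local Notation in_wedge := (in_wedge beta s kappa ab).
Variables zL zR : R * R.
Hypotheses (wL : in_wedge (-1) zL) (eL : zL.2 = qb / 2).
Hypotheses (wR : in_wedge 1 zR) (eR : zR.2 = 1).
Local Notation attracted := (attracted beta s kappa ab qb).

Let qb0 : 0 < qb := qb_gt0 s_gt0 ab_gt0 qbE.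

Lemma stable_manifold_attracted (e : R) z :
  stable_manifold beta sigma kappa (e * ab, e * qb) z <-> attracted e z.
Proof.
split.
  move=> [a [q [tr <- ha hq]]].
  have bt := convergent_bounded tr ha.
  have [h1 h2] := bounded_trajectory_flow beta_gt0 s_gt0 kappa_gt0 bt.
  split => //.
    by apply: (cvg_ge0 _ hq) => t /h2[].
  by apply: (cvg_ge0 _ ha) => t /h2[].
move=> [hs hq ha]; have [tr _] := flow_bounded_trajectory beta_gt0 s_gt0 kappa_gt0 hs.
by exists (pa z), (pq z); split=> //; rewrite pa0 ?pq0//; case: z {tr hs hq ha}.
Qed.

(** The left branches lie in |q| < qb. *)
Lemma stays_above_right z : stays z -> qb < z.2 -> exists2 u : R, 0 <= u & z = (pa zR u, pq zR u).
Proof.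
have br z' : attracted 1 z' -> [\/ z' = (ab, qb), exists u : R, z' = (pa zL u, pq zL u) |
      exists2 u : R, 0 <= u & z' = (pa zR u, pq zR u)].
  move=> [h1 h2 h3]; rewrite !mul1r in h2 h3.
  exact: (branch_cases beta_gt0 s_gt0 kappa_gt0 ab_gt0 qbE abE wL eL wR eR h1 h2 h3).
have lb u : `|pq zL u| < qb.
  by have [] := left_inbox beta_gt0 s_gt0 kappa_gt0 ab_gt0 qbE abE wL eL u.
move=> hz hq; case: ((proj1 (stays_attracted beta_gt0 s_gt0 kappa_gt0 ab_gt0 qbE abE z)) hz) => [e|h|h].
- by move: hq qb0; rewrite e /=; lra.
- case: (br _ h) => [e|[u e]|//]; first by move: hq; rewrite e ltxx.
  by have := lb u; have := ler_norm (pq zL u); move: hq; rewrite e /=; lra.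
- have {}h : attracted 1 (- z.1, - z.2) by rewrite -[1]opprK; exact: attractedN.
  case: (br _ h) => [[_ e]|[u [_ e]]|[u u0 [_ e]]].
  + by move: hq qb0; rewrite -e; lra.
  + by have := lb u; have := ler_norm (- pq zL u); rewrite normrN; move: hq; lra.
  + have := right_gt beta_gt0 s_gt0 kappa_gt0 ab_gt0 qbE abE wR u0.
    by move: hq qb0; rewrite -e; lra.
Qed.

Lemma stays_above_unique z z' : stays z -> stays z' -> qb < `|z.2| -> z'.2 = z.2 -> z' = z.
Proof.
have pos x x' : stays x -> stays x' -> qb < x.2 -> x'.2 = x.2 -> x' = x.
  move=> hx hx' h e; have [u u0 ex] := stays_above_right hx h.
  rewrite -e in h; have [u' u'0 ex'] := stays_above_right hx' h.
  have eu : u' = u.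
    apply: (right_inj beta_gt0 s_gt0 kappa_gt0 ab_gt0 qbE abE wR u'0 u0).
    by move: e; rewrite ex ex'.
  by rewrite ex ex' eu.
move=> hz hz' h e; case: (ger0P z.2) h => z0 h; first exact: pos.
have /(_ h) := pos _ _ (stays_opp beta_gt0 s_gt0 kappa_gt0 hz) (stays_opp beta_gt0 s_gt0 kappa_gt0 hz').
rewrite /= e => /(_ erefl)[e1]; case: z {hz hz' h z0} e e1 => z1 z2; case: z' => z1' z2' /= -> /oppr_inj->//.
Qed.

(** If the two flows coincide then so do their derivatives, and for given q in ]-1, 1[
    the derivative of q determines a; but the left branch does not return to a point. *)
Lemma left_separated (t1 t2 : R) : t1 <> t2 -> exists2 t : R, 0 <= t &
  pq (pa zL t1, pq zL t1) t != pq (pa zL t2, pq zL t2) t.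
Proof.
move=> ne; apply: contrapT => H.
have lb := left_inbox beta_gt0 s_gt0 kappa_gt0 ab_gt0 qbE abE wL eL.
have e (t : R) : 0 <= t -> pq zL (t1 + t) = pq zL (t2 + t).
  move=> t0; have [_ <-] := flow_shift beta_gt0 s_gt0 kappa_gt0 zL t1 t.
  have [_ <-] := flow_shift beta_gt0 s_gt0 kappa_gt0 zL t2 t.
  by apply/eqP/negPn/negP => h; apply: H; exists t.
have d (r : R) : is_derive (1:R) (1:R) (fun t => pq zL (r + t)) (fq s (pa zL (r + 1)) (pq zL (r + 1))).
  exact: is_derive_translate (inbox_pq beta_gt0 s_gt0 kappa_gt0 (proj1 (lb (r + 1)))).
have d2 : is_derive (1:R) (1:R) (fun t => pq zL (t1 + t)) (fq s (pa zL (t2 + 1)) (pq zL (t2 + 1))).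
  apply: (@is_derive_ext_near R (fun t => pq zL (t2 + t)) _ 1 _ 1 ltr01) (d t2) => u.
  by rewrite ltr_norml => /andP[h _]; rewrite e//; lra.
have fe : fq s (pa zL (t1 + 1)) (pq zL (t1 + 1)) = fq s (pa zL (t2 + 1)) (pq zL (t2 + 1)).
  by have [_ <-] := d t1; have [_ <-] := d2.
apply: ne; apply: (addIr 1).
apply: (left_inj beta_gt0 s_gt0 kappa_gt0 ab_gt0 qbE abE wL _ (e 1 ler01)).
move: fe; rewrite -(e 1 ler01) /fq; set x := pa zL (t1 + 1); set y := pa zL (t2 + 1); set q := pq zL _ => fe.
have q1 : `|q| < 1 by apply: lt_trans (qb_lt1 s_gt0 ab_gt0 qbE); have [] := lb (t1 + 1).
have h : x - y = (`|x| - `|y|) * q by move: fe; lra.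
have := congr1 Num.norm h; rewrite normrM => h2.
have h3 : `|x - y| * (1 - `|q|) <= 0.
  rewrite mulrBr mulr1 subr_le0 {1}h2; apply: ler_wpM2r => //; exact: ler_dist_dist.
move: h3; rewrite pmulr_lle0 ?subr_gt0// normr_le0 subr_eq0 => /eqP//.
Qed.

End Equilibria.

Theorem theorem6p3 (R : realType) (beta sigma kappa : R)
    (beta_gt0 : 0 < beta) (sigma2_gt0 : 0 < sigma ^+ 2) (kappa_gt0 : 0 < kappa)
    (kappa_gtc : kappa_c beta sigma < kappa) :
  let ab := abar beta sigma kappa in
  let qb := qbar beta sigma kappa in
  let NE := nash beta sigma kappa in
  let NE_from := nash_from beta sigma kappa in
  (forall z : R * R, phase_space z ->
     (stationary_point beta sigma kappa z <->
      [\/ z = (- ab, - qb), z = (0, 0) | z = (ab, qb)])) /\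
  exists (C : set (R * R)) (gamma : R -> R * R),
    (* the curve C, parametrized by gamma on [-1, 1] *)
    (C `<=` phase_space /\
     {within `[-1, 1], continuous gamma} /\
     {in `[-1, 1] &, injective gamma} /\
     C = gamma @` `[-1, 1] /\
     [/\ C (- ab, - qb), C (0, 0) & C (ab, qb)] /\
     (gamma (-1)).2 = -1 /\ gamma 0 = (0, 0) /\ (gamma 1).2 = 1 /\
     stable_manifold beta sigma kappa (ab, qb) = gamma @` `]0, 1] /\
     stable_manifold beta sigma kappa (- ab, - qb) = gamma @` `[-1, 0[) /\
    (* Nash equilibria lie on C *)
    (forall q : R -> R, NE q ->
       exists a : R -> R, bounded_trajectory beta sigma kappa a q /\
         forall t, 0 <= t -> C (a t, q t)) /\
    (forall q0 : R, -1 <= q0 <= 1 -> exists q : R -> R, NE_from q0 q) /\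
    (* (A) *)
    (kappa < kappa_c beta sigma + beta ^+ 2 / 4 ->
       strictly_monotone C /\
       (forall q0 : R, -1 <= q0 <= 1 ->
          unique_nash_from beta sigma kappa q0) /\
       (forall (q0 : R) (q : R -> R), q0 != 0 -> NE_from q0 q ->
          q t @[t --> +oo] --> Num.sg q0 * qb)) /\
    (* (B) *)
    (kappa_c beta sigma + beta ^+ 2 / 4 < kappa ->
       spirals gamma /\
       (forall n : nat, exists2 delta : R, 0 < delta &
          forall q0 : R, `|q0| < delta ->
          exists qs : 'I_n -> R -> R,
            (forall i j : 'I_n, i != j ->
               exists2 t, 0 <= t & qs i t != qs j t) /\
            (forall i : 'I_n, NE_from q0 (qs i) /\
               (exists a : R -> R,
                  bounded_trajectory beta sigma kappa a (qs i) /\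
                  winds_around n a (qs i)) /\
               ((qs i) t @[t --> +oo] --> qb \/
                (qs i) t @[t --> +oo] --> - qb))) /\
       (exists2 rho : R, 0 <= rho < 1 &
          forall q0 : R, rho < `|q0| -> `|q0| <= 1 ->
            unique_nash_from beta sigma kappa q0)).
Proof.
move=> ab qb NE NE_from; rewrite /NE /NE_from => {NE NE_from}.
set s := sigma ^+ 2 in sigma2_gt0 *.
have ab_gt0 : 0 < ab := abar_gt0 beta_gt0 sigma2_gt0 kappa_gtc.
have qbE : qb = ab / (ab + 2 * s) by [].
have abE : 2^-1 * ab * ab + (beta + 3 * s) * ab + 2 * beta * s + 4 * s * s = kappa :=
  abar_root beta_gt0 sigma2_gt0 kappa_gtc.
have qb_gt0 := qb_gt0 sigma2_gt0 ab_gt0 qbE.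
have qb_lt1 := qb_lt1 sigma2_gt0 ab_gt0 qbE.
split; first by move=> z; exact: (stationary_points beta_gt0 sigma2_gt0 kappa_gtc).
(* any height below qb serves to generate the left branch *)
have [||zL eL wL] := wedge_point beta_gt0 sigma2_gt0 kappa_gt0 ab_gt0 qbE abE (or_intror (erefl (-1 : R))) (divr_gt0 qb_gt0 (ltr0Sn R 1)).
- by lra.
- by rewrite mulN1r oppr_gt0; lra.
have [||zR eR wR] := wedge_point beta_gt0 sigma2_gt0 kappa_gt0 ab_gt0 qbE abE (or_introl (erefl (1 : R))) (ltr01 : 0 < (1 : R)).
- by [].
- by rewrite mul1r subr_gt0.
(* the flow identifies equilibria with the points of bounded forward orbits *)
pose g := curve beta s kappa ab qb zL zR.
have [ca cq] := curve_continuous beta_gt0 sigma2_gt0 kappa_gt0 ab_gt0 qbE abE wL eL wR.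
have st z := curve_stays beta_gt0 sigma2_gt0 kappa_gt0 ab_gt0 qbE abE wL eL wR eR z.
have att z := attractedP beta_gt0 sigma2_gt0 kappa_gt0 ab_gt0 qbE abE wL eL wR eR z.
have inC (t : R) : -1 <= t <= 1 -> (g @` `[-1, 1]) (g t) by move=> tI; exists t => //=; rewrite in_itv.
have CP z : (g @` `[-1, 1]) z <-> stays beta s kappa z.
  rewrite -(st z); split => [[t tI e]|[t tI e]]; exists t => //; move: tI; by rewrite /= in_itv.
have phase z : stays beta s kappa z -> phase_space z.
  by move=> /(_ 0 (lexx 0))[_]; rewrite pq0// /phase_space /= ler_norml.
have flowC q : nash beta sigma kappa q -> exists a : R -> R, bounded_trajectory beta sigma kappa a q /\
    forall t, 0 <= t -> (g @` `[-1, 1]) (a t, q t).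
  move=> /(nash_flow beta_gt0 sigma2_gt0 kappa_gt0)[a [bt hs f]]; exists a; split => // t t0.
  by have [-> ->] := f t t0; apply/CP; exact: stays_shift.
have ex (q0 : R) : -1 <= q0 <= 1 -> exists2 z, stays beta s kappa z & z.2 = q0.
  move=> /(curve_height beta_gt0 sigma2_gt0 kappa_gt0 ab_gt0 qbE abE wL eL wR eR)[t tI e].
  by exists (g t) => //; apply/CP; exact: inC.
have half : (2^-1 : R) < 1 by rewrite invf_lt1 ?ltr1n.
have half0 : 0 < (2^-1 : R) by rewrite invr_gt0.
have g2 : g 2^-1 = (ab, qb) := curve_mid beta s kappa ab qb zL zR.
have c1 : (g 1).2 = 1 by exact: curve1.
exists (g @` `[-1, 1]), g; split; [|split; [exact: flowC|split; [|split]]].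
- split; [|split; [|split; [|split; [|split; [|split; [|split; [|split; [|split]]]]]]]].
  + by move=> z /CP; exact: phase.
  + by apply: continuous_subspaceT => t; exact: (cvg_pair (ca t) (cq t)).
  + move=> t t'; rewrite !in_itv /=.
    exact: (curve_inj beta_gt0 sigma2_gt0 kappa_gt0 ab_gt0 qbE abE wL eL wR eR).
  + by [].
  + split.
    * rewrite (_ : (- ab, - qb) = g (- 2^-1)); last by rewrite /g curveN -/g g2.
      by apply: inC; apply/andP; split; lra.
    * by rewrite -(curve0 beta s kappa ab qb zL zR); apply: inC; rewrite lerN10 ler01.
    * by rewrite -g2; apply: inC; apply/andP; split; lra.
  + by transitivity (- (g 1).2); [rewrite /g curveN|rewrite c1].
  + exact: curve0.
  + by [].
  + have sm := stable_manifold_attracted beta_gt0 sigma2_gt0 kappa_gt0 ab qb 1.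
    rewrite !mul1r in sm; apply/seteqP; split => z.
      by move=> /sm /(proj1 (proj1 (att z)))[t tI e]; exists t => //=; rewrite in_itv.
    move=> [t tI e]; apply/sm; apply: (proj2 (proj1 (att z))); exists t => //.
  + have sm := stable_manifold_attracted beta_gt0 sigma2_gt0 kappa_gt0 ab qb (-1).
    rewrite !mulN1r in sm; apply/seteqP; split => z.
      by move=> /sm /(proj1 (proj2 (att z)))[t tI e]; exists t => //=; rewrite in_itv.
    move=> [t tI e]; apply/sm; apply: (proj2 (proj2 (att z))); exists t => //.
- move=> q0 /ex[z hz e]; exists (pq beta s kappa z); rewrite -e.
  exact: (flow_nash beta_gt0 sigma2_gt0 kappa_gt0 hz).
- rewrite kappa_cE => kA.
  have weak : 4 * kappa < (beta + 4 * s) * (beta + 4 * s).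
    have -> : (beta + 4 * s) * (beta + 4 * s) = 4 * (2 * beta * s + 4 * s * s + beta ^+ 2 / 4) by field.
    by rewrite ltr_pM2l.
  have mono := curve_mono beta_gt0 sigma2_gt0 kappa_gt0 ab_gt0 qbE abE wL eL wR weak.
  have rise := curve_rise beta_gt0 sigma2_gt0 kappa_gt0 ab_gt0 qbE abE wL eL wR weak.
  have sm : strictly_monotone (g @` `[-1, 1]).
    move=> _ _ [t tI <-] [t' t'I <-]; move: tI t'I; rewrite /= !in_itv /= => /andP[t0 t1] /andP[t'0 t'1].
    case: (ltgtP t t') => h.
    + by have [h1 h2] := mono t t' t0 h t'1; rewrite h1 h2.
    + have [h1 h2] := mono t' t t'0 h t1.
      by split => h3; have := lt_trans h3 (_ : _ < _); [move=> /(_ _ h1)|move=> /(_ _ h2)]; rewrite ltxx.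
    + by rewrite h !ltxx.
  split => //; split.
    move=> q0 /ex[z hz e]; apply: (unique_nash beta_gt0 sigma2_gt0 kappa_gt0 hz e) => z' hz' e'.
    have [h1 h2] := sm z z' (proj2 (CP z) hz) (proj2 (CP z') hz').
    have [h3 h4] := sm z' z (proj2 (CP z') hz') (proj2 (CP z) hz).
    have e2 : z'.2 = z.2 by rewrite e e'.
    have e1 : z'.1 = z.1.
      case: (ltgtP z'.1 z.1) => // h; [have := h3 h|have := h1 h]; by rewrite e2 ltxx.
    by rewrite [LHS]surjective_pairing e1 e2 -surjective_pairing.
  move=> q0 q q0N [/(nash_flow beta_gt0 sigma2_gt0 kappa_gt0)[a [_ hs f]] e0].
  have conv (e : R) : Num.sg q0 = e -> attracted beta s kappa ab qb e (a 0, q 0) ->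
      q t @[t --> +oo] --> Num.sg q0 * qb.
    move=> -> [_ hq _]; apply: (cvg_ge0 _ hq) => t /f[_ ->] //.
  case: ((proj1 (stays_attracted beta_gt0 sigma2_gt0 kappa_gt0 ab_gt0 qbE abE _)) hs) => [[_ e]|h|h].
  + by move: q0N; rewrite -e0 e eqxx.
  + apply: conv (h); apply: gtr0_sg; have [t tI e] := proj1 (proj1 (att _)) h.
    by have [_] := rise t tI; rewrite e /= e0.
  + apply: conv (h); apply: ltr0_sg; have [t /andP[t0 t1] e] := proj1 (proj2 (att _)) h.
    have tI : 0 < - t <= 1 by rewrite oppr_gt0 t1 lerNl.
    by have [_] := rise (- t) tI; rewrite curveN e /= e0 oppr_gt0.
- rewrite kappa_cE => kB.
  have strong : (beta + 4 * s) * (beta + 4 * s) < 4 * kappa.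
    have -> : (beta + 4 * s) * (beta + 4 * s) = 4 * (2 * beta * s + 4 * s * s + beta ^+ 2 / 4) by field.
    by rewrite ltr_pM2l.
  split; first exact: (curve_spirals beta_gt0 sigma2_gt0 kappa_gt0 ab_gt0 qbE abE wL eL wR strong).
  split.
    move=> n; have [d d0 hd] := left_meets beta_gt0 sigma2_gt0 kappa_gt0 ab_gt0 qbE abE wL eL strong n.
    exists d => // q0 /hd[ts [inj hts]].
    pose z i := (pa beta s kappa zL (ts i), pq beta s kappa zL (ts i)).
    exists (fun i => pq beta s kappa (z i)); split.
      move=> i j /inj h.
      exact: (left_separated beta_gt0 sigma2_gt0 kappa_gt0 ab_gt0 qbE abE wL eL h).
    move=> i; have [e w] := hts i.
    have hz := left_stays beta_gt0 sigma2_gt0 kappa_gt0 ab_gt0 qbE abE wL eL (ts i).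
    split; [|split].
    + by rewrite -e; exact: (flow_nash beta_gt0 sigma2_gt0 kappa_gt0 hz).
    + exists (pa beta s kappa (z i)); split => //.
      exact: (flow_bounded_trajectory beta_gt0 sigma2_gt0 kappa_gt0 hz).
    + left.
      by have [] := left_converges beta_gt0 sigma2_gt0 kappa_gt0 ab_gt0 qbE abE wL (ts i).
  (* beyond the height qb only the two right branches are met *)
  exists qb; first by rewrite ltW.
  move=> q0 hq; rewrite ler_norml => /ex[z hz e].
  apply: (unique_nash beta_gt0 sigma2_gt0 kappa_gt0 hz e) => z' hz' e'.
  by apply: (stays_above_unique beta_gt0 sigma2_gt0 kappa_gt0 ab_gt0 qbE abE wL eL wR eR hz hz'); rewrite ?e ?e'.
Qed.
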